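(* Let $B$ be a finite-dimensional Euclidean space with norm $\|\cdot\|$ and inner product $\langle\cdot,\cdot\rangle$, let $K\subset B$ be a proper cone, and let $\mathbf{S}^K_{\|\cdot\|}=\{x\in K:\|x\|=1\}$. Fix any Borel-measurable function $\beta:\mathbf{S}^K_{\|\cdot\|}\to\mathbb{R}_+$ that is bounded away from zero. For a finite measure $\alpha$ on $\mathcal{B}(\mathbf{S}^K_{\|\cdot\|})$ let $N=N_{\alpha,\beta}$ be the Poisson random measure of the jumps of the $K$-valued Gamma Lévy process with parameters $\alpha,\beta$, and for $h\in L(\Gamma_K(\alpha,\beta))$ put $$Y^h=\int_0^\infty\int_K h\left(s,\frac{x}{\|x\|}\right)x\,N(\mathrm{d}s,\mathrm{d}x).$$ Then the set of distributions of the random variables $Y^h$, where $\alpha$ ranges over all finite measures on $\mathcal{B}(\mathbf{S}^K_{\|\cdot\|})$ and $h$ ranges over $L(\Gamma_K(\alpha,\beta))$, equals $GGC_0(K)$, the class of all generalised Gamma convolutions on $K$ without drift.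
   Context: $\mathbb{R}_+=[0,\infty)$. A cone is a nonempty convex set $K\subset B$ with $\lambda x\in K$ for all $\lambda\ge 0$, $x\in K$; it is proper if $x,-x\in K$ implies $x=0$. Its dual cone is $K'=\{y:\langle y,s\rangle\ge 0\ \forall s\in K\}$. Infinitely divisible laws on $K$: a distribution $\mu$ on $K$ is infinitely divisible if for each integer $p\ge1$ it is the law of a sum of $p$ i.i.d. $K$-valued random elements. Such $\mu$ is taken to have Laplace transform given by the regular Lévy–Khintchine representation $\int_K e^{-\langle\Theta,x\rangle}\mu(\mathrm{d}x)=\exp\{-\langle\Theta,\Psi_0\rangle-\int_K(1-e^{-\langle\Theta,x\rangle})\nu_\mu(\mathrm{d}x)\}$, $\Theta\in K'$, with drift $\Psi_0\in K$ and Lévy measure $\nu_\mu$ with $\nu_\mu(K^c)=0$ and $\int_K(\|x\|\wedge1)\nu_\mu(\mathrm{d}x)<\infty$. ''Without drift'' means $\Psi_0=0$. $K$-Gamma distribution and process: $\Gamma_K(\alpha,\beta)$ is the infinitely divisible law on $K$ without drift and with Lévy measure $\nu_{\alpha,\beta}(E)=\int_{\mathbf{S}^K_{\|\cdot\|}}\int_0^\infty 1_E(rU)\frac{e^{-\beta(U)r}}{r}\,\mathrm{d}r\,\alpha(\mathrm{d}U)$, $E\in\mathcal{B}(K)$ (the condition that $\beta$ is bounded away from zero ensures its existence for every finite $\alpha$). The $K$-valued Gamma process is the Lévy process $\gamma$ with $\gamma_1\sim\Gamma_K(\alpha,\beta)$; the random measure $N$ of its jumps is a Poisson random measure on $\mathbb{R}_+\times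 K$ with intensity $\mathrm{d}s\,\nu_{\alpha,\beta}(\mathrm{d}x)$. $L(\Gamma_K(\alpha,\beta))$ is the set of measurable functions $h:\mathbb{R}_+\times\mathbf{S}^K_{\|\cdot\|}\to\mathbb{R}_+$ with $\int_{\mathbf{S}^K_{\|\cdot\|}}\int_0^\infty\ln\left(1+\frac{h(s,U)}{\beta(U)}\right)\mathrm{d}s\,\alpha(\mathrm{d}U)<\infty$. The integral $Y^h$ is taken in the sense of Rajput and Rosinski: set $\Lambda(A)=\int_{\mathbb{R}_+\times K}1_A(s,x/\|x\|)\,x\,N(\mathrm{d}s,\mathrm{d}x)$ for Borel $A\subset[0,T]\times\mathbf{S}^K_{\|\cdot\|}$, $T<\infty$; for a simple function $f=\sum_j a_j1_{A_j}$ and Borel $A\subset\mathbb{R}_+\times\mathbf{S}^K_{\|\cdot\|}$ put $\int_A f\,\mathrm{d}\Lambda=\sum_j a_j\Lambda(A\cap A_j)$; $h$ is integrable if there are simple $f_n\to h$ ($\mathrm{d}s\otimes\alpha$)-a.e. such that $\int_A f_n\,\mathrm{d}\Lambda$ converges in probability for every Borel $A$, and then $Y^h$ is the limit for $A=\mathbb{R}_+\times\mathbf{S}^K_{\|\cdot\|}$. $GGC(K)$ is the collection of all infinitely divisible distributions $\mu$ on $K$ whose Lévy measure has a polar decomposition $\nu_\mu(E)=\int_{\mathbf{S}^K_{\|\cdot\|}}\int_0^\infty1_E(rU)\frac{k_U(r)}{r}\,\mathrm{d}r\,\alpha(\mathrm{d}U)$, $E\in\mathcal{B}(K)$, for some finite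 measure $\alpha$ on $\mathbf{S}^K_{\|\cdot\|}$, where $k_U(r)$ is measurable in $U$ and completely monotone in $r$ for $\alpha$-a.e. $U$. *)

(* Defs.v *)
From HB Require Import structures.
From mathcomp Require Import all_boot all_order all_algebra.
From mathcomp Require Import all_classical all_reals all_analysis.
From mathcomp Require Import measurable_realfun.

Set Implicit Arguments.
Unset Strict Implicit.
Unset Printing Implicit Defensive.
Import Order.TTheory GRing.Theory Num.Theory.
Import numFieldNormedType.Exports.
Local Open Scope classical_set_scope.
Local Open Scope ring_scope.

(* Finite-dimensional Euclidean spaces: the norm (hence the topology) is the
   one of the library structure, and [ip] is the inner product inducing it. *)
Record euclidean (R : realType) (B : normedModType R) (ip : B -> B -> R) :
    Prop := Euclidean {
  ip_sym : forall x y, ip x y = ip y x ;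
  ip_linear : forall a x y z, ip (a *: x + y) z = a * ip x z + ip y z ;
  ip_norm : forall x, ip x x = `|x| ^+ 2 ;
  ip_fin_dim : exists (n : nat) (e : 'I_n -> B),
    forall x, exists c : 'I_n -> R, x = \sum_i c i *: e i }.

(* B with its Borel sigma-algebra. *)
Definition borel (R : realType) (B : normedModType R) :=
  g_sigma_algebraType (@open B).

(* Stands for [0, +oo[ x B: negative times carry no mass and no condition. *)
Notation timespace R B := (measurableTypeR R * borel B)%type.

Section cones.
Context (R : realType) (B : normedModType R).
Implicit Types K : set B.

Definition is_cone K := [/\ K !=set0,
  (forall x y (t : R), K x -> K y -> 0 <= t <= 1 -> K (t *: x + (1 - t) *: y)) &
  (forall (l : R) x, 0 <= l -> K x -> K (l *: x))].

Definition proper_cone K := is_cone K /\ forall x, K x -> K (- x) -> x = 0.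

Definition dual_cone (ip : B -> B -> R) K : set B :=
  [set y | forall s, K s -> 0 <= ip y s].

Definition unit_sphere K : set B := [set x | K x /\ `|x| = 1].

(* mu(D^c) = 0; D itself is not required to be Borel. *)
Definition carried_by (D : set B) (mu : set (borel B) -> \bar R) :=
  mu.-negligible (~` D).

End cones.

Section random_variables.
Context d (Omega : measurableType d) (R : realType) (P : probability Omega R).
Local Open Scope ereal_scope.

Definition independent_family (I : choiceType) d' (T : sigmaRingType d')
    (X : I -> Omega -> T) :=
  forall (s : seq I) (E : I -> set T), uniq s -> (forall i, measurable (E i)) ->
    P (\bigcap_(i in [set` s]) (X i @^-1` E i)) =
    \prod_(i <- s) P (X i @^-1` E i).

Definition has_law d' (T : measurableType d') (X : Omega -> T)
    (mu : set T -> \bar R) :=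
  measurable_fun setT X /\ forall E, measurable E -> P (X @^-1` E) = mu E.

Definition cvg_in_probability (B : normedModType R) (Z : nat -> Omega -> B)
    (Y : Omega -> B) :=
  forall e : R, (0 < e)%R ->
    P [set w | (e <= `|Z n w - Y w|)%R] @[n --> \oo] --> 0.

(* Poisson random measure with intensity [lambda]. *)
Definition poisson_random_measure d' (T : measurableType d')
    (N : R.-ker Omega ~> T) (lambda : set T -> \bar R) :=
  [/\ (forall E, measurable E -> lambda E < +oo -> forall n : nat,
        P [set w | N w E = n%:R%:E] =
        (fine (lambda E) ^+ n / n`!%:R * expR (- fine (lambda E)))%:E),
      (forall E, measurable E -> lambda E = +oo ->
        {ae P, forall w, N w E = +oo}) &
      (forall (n : nat) (E : 'I_n -> set T), (forall i, measurable (E i)) ->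
        trivIset setT E ->
        independent_family (T := \bar R) (fun i w => N w (E i)))].

End random_variables.

Section infinitely_divisible.
Context (R : realType) (B : normedModType R) (ip : B -> B -> R) (K : set B).
Local Open Scope ereal_scope.

Definition infinitely_divisible_on (mu : probability (borel B) R) :=
  carried_by K mu /\
  forall p : nat, (0 < p)%N ->
    exists (d : measure_display) (Omega : measurableType d)
           (P : probability Omega R) (mu_p : probability (borel B) R)
           (X : 'I_p -> Omega -> borel B),
      [/\ (forall i w, K (X i w)),
          (forall i, has_law P (X i) mu_p),
          independent_family P X &
          has_law P ((fun w => (\sum_i (X i w : B))%R) : Omega -> borel B) mu].

Definition is_levy_measure_on (nu : {measure set (borel B) -> \bar R}) :=
  carried_by K nu /\
  \int[nu]_x (Num.min `|x : B| 1)%R%:E < +oo.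

(* Regular Levy-Khintchine representation with drift psi and Levy measure nu.
   The third and fourth clauses are the real and imaginary parts of
     E exp(i<z,x>) = exp(i<z,psi> + \int (exp(i<z,x>) - 1) nu(dx)).
   When K is closed they follow from the Laplace transform formula.  In general
   K' can be too small for the Laplace transform to determine mu (for
   K = {x > 0} U {x = 0, y >= 0} in the plane, K' is a ray), and these clauses
   make psi and nu the drift and the Levy measure of mu. *)
Definition regular_LK (mu : probability (borel B) R) (psi : B)
    (nu : {measure set (borel B) -> \bar R}) :=
  [/\ K psi /\ is_levy_measure_on nu,
      (forall theta, dual_cone ip K theta ->
        \int[mu]_x (expR (- ip theta x))%:E =
        (expR (- ip theta psi
               - \int[nu]_x (1 - expR (- ip theta x))))%:E),
      (forall z : B,
        (\int[mu]_x cos (ip z x) =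
         expR (\int[nu]_x (cos (ip z x) - 1)) *
         cos (ip z psi + \int[nu]_x sin (ip z x)))%R) &
      (forall z : B,
        (\int[mu]_x sin (ip z x) =
         expR (\int[nu]_x (cos (ip z x) - 1)) *
         sin (ip z psi + \int[nu]_x sin (ip z x)))%R)].

(* \int_S \int_0^oo 1_E(r U) k_U(r) / r dr alpha(dU); here and below alpha is
   a measure on B carried by the unit sphere S of K. *)
Definition polar (alpha : set (borel B) -> \bar R) (k : borel B -> R -> R)
    (E : set (borel B)) : \bar R :=
  \int[alpha]_U \int[@lebesgue_measure R]_(r in `]0%R, +oo[)
    (\1_E ((r *: (U : B))%R : borel B) * (k U r / r))%:E.

Definition completely_monotone (f : R -> R) :=
  forall (n : nat) (r : R), (0 < r)%R ->
    derivable (derive1n n f) r 1%R /\ (0 <= (-1) ^+ n * derive1n n f r)%R.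

Definition GGC_levy_measure (nu : {measure set (borel B) -> \bar R}) :=
  exists (alpha : {finite_measure set (borel B) -> \bar R})
         (k : borel B -> R -> R),
    [/\ carried_by (unit_sphere K) alpha,
        (forall r, (0 < r)%R -> measurable_fun setT (k ^~ r)),
        {ae alpha, forall U, completely_monotone (k U)} &
        forall E, measurable E -> nu E = polar alpha k E].

Definition GGC_with_drift (psi : B) : set (probability (borel B) R) :=
  [set mu | infinitely_divisible_on mu /\
    exists2 nu, regular_LK mu psi nu & GGC_levy_measure nu].

Definition GGC : set (probability (borel B) R) :=
  [set mu | exists psi, GGC_with_drift psi mu].

Definition GGC0 : set (probability (borel B) R) := GGC_with_drift 0%R.

End infinitely_divisible.

Section levy_processes.
Context (R : realType) (B : normedModType R).
Context d (Omega : measurableType d) (P : probability Omega R).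
Implicit Type X : R -> Omega -> borel B.

(* K-valued Levy process (X_t)_{t >= 0}; values at t < 0 play no role. *)
Record levy_process (K : set B) X : Prop := LevyProcess {
  levy_measurable : forall t, 0 <= t -> measurable_fun setT (X t) ;
  levy_valued : forall t w, 0 <= t -> K (X t w) ;
  levy0 : {ae P, forall w, X 0 w = 0 :> B} ;
  levy_indep : forall (n : nat) (t : nat -> R), 0 <= t 0%N ->
    (forall i, t i <= t i.+1) ->
    independent_family P
      (fun (i : 'I_n) w => ((X (t i.+1) w : B) - X (t i) w : borel B)) ;
  levy_stationary : forall s t, 0 <= s -> 0 <= t ->
    forall E : set (borel B), measurable E ->
      P [set w | E ((X (s + t) w : B) - X s w)] = P (X t @^-1` E) ;
  levy_cadlag : {ae P, forall w,
    (forall s, 0 <= s -> (X t w : B) @[t --> s^'+] --> (X s w : B)) /\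
    (forall s, 0 < s -> cvg ((X t w : B) @[t --> s^'-]))} }.

Definition jump X (w : Omega) (s : R) : B :=
  (X s w : B) - lim ((X t w : B) @[t --> s^'-]).

Definition jump_count X (w : Omega) (E : set (timespace R B)) : \bar R :=
  counting [set s : R | [/\ 0 < s, jump X w s != 0 & E (s, jump X w s)]].

End levy_processes.

Section gamma.
Context (R : realType) (B : normedModType R) (ip : B -> B -> R) (K : set B).
Variable beta : borel B -> R.
Implicit Type alpha : {finite_measure set (borel B) -> \bar R}.
Local Open Scope ereal_scope.

Definition gamma_levy alpha : set (borel B) -> \bar R :=
  polar alpha (fun U r => expR (- (beta U * r))).

Definition is_gamma_law alpha (mu : probability (borel B) R) :=
  infinitely_divisible_on K mu /\
  exists2 nu : {measure set (borel B) -> \bar R}, regular_LK ip K mu 0%R nu &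
    forall E, measurable E -> nu E = gamma_levy alpha E.

(* ds nu_{alpha,beta}(dx) on [0, +oo[ x B. *)
Definition gamma_intensity alpha (E : set (timespace R B)) : \bar R :=
  \int[@lebesgue_measure R]_(s in `[0%R, +oo[) gamma_levy alpha (xsection E s).

(* N is the random measure of the jumps of a K-valued Gamma process X; by the
   Levy-Ito theorem it is a Poisson random measure. *)
Definition gamma_jump_measure alpha d (Omega : measurableType d)
    (P : probability Omega R) (N : R.-ker Omega ~> timespace R B) :=
  (exists X : R -> Omega -> borel B,
    [/\ levy_process P K X,
        (exists2 mu, is_gamma_law alpha mu & has_law P (X 1%R) mu) &
        {ae P, forall w, forall E, measurable E -> N w E = jump_count X w E}])
  /\ poisson_random_measure P N (gamma_intensity alpha).

(* The class L(Gamma_K(alpha, beta)).  A measurable function on the sphere is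
   represented by a Borel function on B, whose values off the sphere are
   irrelevant. *)
Definition gamma_integrand alpha (h : timespace R B -> R) :=
  [/\ measurable_fun [set z : timespace R B | (0 <= z.1)%R] h,
      (forall s U, (0 <= s)%R -> unit_sphere K U -> (0 <= h (s, U))%R) &
      \int[alpha]_U \int[@lebesgue_measure R]_(s in `[0%R, +oo[)
        (ln (1 + h (s, U) / beta U))%:E < +oo].

End gamma.

Section stochastic_integral.
Context (R : realType) (B : normedModType R) (ip : B -> B -> R) (K : set B).
Local Open Scope ereal_scope.

(* Integral of a B-valued function, characterized by its inner products with
   the vectors of B; 0 when f is not integrable. *)
Definition vintegral d (T : measurableType d)
    (m : {measure set T -> \bar R}) (f : T -> B) : B :=
  xget 0%R [set v | forall y,
    m.-integrable setT (fun x => (ip y (f x))%:E) /\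
    \int[m]_x (ip y (f x))%:E = (ip y v)%:E].

Context d (Omega : measurableType d) (P : probability Omega R).
Context (N : R.-ker Omega ~> timespace R B).

(* At x = 0 the direction x / ||x|| is 0, but the integrand vanishes. *)
Definition Lambda (A : set (timespace R B)) (w : Omega) : B :=
  vintegral (N w) (fun sx : timespace R B => let x : B := sx.2 in
    (\1_A (sx.1, `|x|^-1 *: x : borel B) *: x)%R).

Record step_function := StepFunction {
  step_num : nat ;
  step_coef : 'I_step_num -> R ;
  step_set : 'I_step_num -> set (timespace R B) ;
  step_measurable : forall j, measurable (step_set j) ;
  step_bounded : forall j, exists T : R,
    step_set j `<=` `[0%R, T] `*` unit_sphere K }.

Arguments step_coef : clear implicits.
Arguments step_set : clear implicits.

Definition step_eval (f : step_function) (z : timespace R B) : R :=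
  (\sum_j step_coef f j * \1_(step_set f j) z)%R.

Definition step_integral (f : step_function) (A : set (timespace R B))
    (w : Omega) : B :=
  (\sum_j step_coef f j *: Lambda (A `&` step_set f j) w)%R.

(* Y is (a version of) Y^h, the Rajput-Rosinski integral of h.  As the step
   sets lie in [0, +oo[ x S, taking A = setT is taking A = [0, +oo[ x S. *)
Definition stochastic_integral
    (alpha : {finite_measure set (borel B) -> \bar R})
    (h : timespace R B -> R) (Y : Omega -> borel B) :=
  exists f : nat -> step_function,
    [/\ {ae (@lebesgue_measure R \x alpha), forall z : timespace R B,
          (0 <= z.1)%R -> step_eval (f n) z @[n --> \oo] --> h z},
        (forall A, measurable A ->
          exists2 Z : Omega -> borel B, measurable_fun setT Z &
            cvg_in_probability P (fun n => step_integral (f n) A) (Z : _ -> B)),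
        measurable_fun setT Y &
        cvg_in_probability P (fun n => step_integral (f n) setT) (Y : _ -> B)].

End stochastic_integral.

(* Main.v *)
(* [Y^h] is a Poisson integral of [h(s, x / |x|) x], so its Levy measure is the
   image of the intensity under that map.  In polar coordinates the change of
   variable [r / h] shows that this image is
     alpha(dU) k_U(r) / r dr,  k_U(r) = \int_0^oo exp(- beta(U) r / h(s, U)) ds,
   and [k_U] is completely monotone as a Laplace transform.  By Frullani's
   integral, the condition [\int\int ln(1 + h / beta) < oo] says that the image
   integrates [min(|x|, 1)].  Conversely, by Bernstein's theorem
   [k_U(r) = \int_0^oo v(s, U)^r ds] for a decreasing [v(., U)] with values in
   [0, 1], which is jointly measurable because its level sets can be read off
   from [k_U]; moreover [v < 1], for otherwise the Levy measure would be infinite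
   at infinity, and [h = beta / (- ln v)] gives back [k_U].
   As [K] need not be closed, laws are compared through characteristic functions,
   and [Y^h] lies in [K] because the jumps in any given set of directions are
   a.s. absent or infinitely many.  For the infinite divisibility of [Y^h],
   replacing [alpha] by [alpha / p] divides the characteristic exponent by [p]. *)
Require Import Defs.
From HB Require Import structures.
From mathcomp Require Import all_boot all_order all_algebra.
From mathcomp Require Import all_classical all_reals all_analysis.
From mathcomp Require Import measurable_realfun.
From mathcomp Require Import ring lra.

Set Implicit Arguments.
Unset Strict Implicit.
Unset Printing Implicit Defensive.
Import Order.TTheory GRing.Theory Num.Theory.
Import numFieldNormedType.Exports.
Local Open Scope classical_set_scope.
Local Open Scope ring_scope.

(** * Euclidean spaces and cones *)

(** The Rajput-Rosinski definition gives simple functions that converge almost everywhere and whose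
    integrals over each Borel set converge in probability, with no domination. Identifying the limit
    with the Poisson integral therefore rests on having convergence over every set: a gliding hump
    turns it into convergence of the full integrals. The cone [K], like its unit sphere, may be
    neither closed nor Borel. Borel subsets of full measure replace the sphere, and [K] is replaced
    by a subcone generated by countably many directions, sigma-compact and hence Borel, in which the
    integral is placed by a pathwise separation argument. Bernstein's theorem is proved in quantile
    form because [h] is a function of time and a decreasing function is determined by the lengths of
    its level sets. One polynomial approximation of a threshold, [step_poly], extracts these lengths
    from [k_U] and also produces the half-spaces in the uniqueness of characteristic functions.
    Polar integrals are controlled only for almost every direction and need not have measurable
    integrands, so they are compared through lemmas free of measurability assumptions. *)

Section euclid.
Context (R : realType) (B : normedModType R) (ip : B -> B -> R).
Hypothesis hB : euclidean ip.
Implicit Types x y z : B.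

Lemma ip0l z : ip 0 z = 0.
Proof.
by have := ip_linear hB 1 0 0 z; rewrite scale1r addr0 mul1r => /esym/eqP;
  rewrite -subr_eq0 addrK => /eqP.
Qed.

Lemma ipDl x y z : ip (x + y) z = ip x z + ip y z.
Proof. by have := ip_linear hB 1 x y z; rewrite scale1r mul1r. Qed.

Lemma ipZl a x z : ip (a *: x) z = a * ip x z.
Proof. by have := ip_linear hB a x 0 z; rewrite addr0 ip0l addr0. Qed.

Lemma ipNl x z : ip (- x) z = - ip x z.
Proof. by rewrite -scaleN1r ipZl mulN1r. Qed.

Lemma ipBl x y z : ip (x - y) z = ip x z - ip y z.
Proof. by rewrite ipDl ipNl. Qed.

Lemma ip_suml (I : Type) (s : seq I) (f : I -> B) z :
  ip (\sum_(i <- s) f i) z = \sum_(i <- s) ip (f i) z.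
Proof.
by elim: s => [|i s ih]; rewrite ?big_nil ?ip0l// !big_cons ipDl ih.
Qed.

Lemma ip0r z : ip z 0 = 0. Proof. by rewrite (ip_sym hB) ip0l. Qed.
Lemma ipDr x y z : ip z (x + y) = ip z x + ip z y.
Proof. by rewrite !(ip_sym hB z) ipDl. Qed.
Lemma ipZr a x z : ip z (a *: x) = a * ip z x.
Proof. by rewrite !(ip_sym hB z) ipZl. Qed.
Lemma ipNr x z : ip z (- x) = - ip z x.
Proof. by rewrite !(ip_sym hB z) ipNl. Qed.
Lemma ipBr x y z : ip z (x - y) = ip z x - ip z y.
Proof. by rewrite !(ip_sym hB z) ipBl. Qed.
Lemma ip_sumr (I : Type) (s : seq I) (f : I -> B) z :
  ip z (\sum_(i <- s) f i) = \sum_(i <- s) ip z (f i).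
Proof.
by rewrite (ip_sym hB) ip_suml; apply: eq_bigr => i _; rewrite (ip_sym hB).
Qed.

Lemma ip_ge0 x : 0 <= ip x x.
Proof. by rewrite (ip_norm hB) exprn_ge0. Qed.

Lemma cauchy_schwarz x y : `|ip x y| <= `|x| * `|y|.
Proof.
have [->|y0] := eqVneq y 0; first by rewrite ip0r !normr0 mulr0.
have n0 : 0 < ip y y by rewrite (ip_norm hB) exprn_gt0// normr_gt0.
have := ip_ge0 (ip y y *: x - ip x y *: y).
rewrite !(ipBl, ipBr, ipZl, ipZr) (ip_sym hB y x).
rewrite (_ : _ - _ = ip y y * (ip x x * ip y y - ip x y ^+ 2)); last by ring.
rewrite pmulr_rge0// subr_ge0 !(ip_norm hB) -exprMn.
by rewrite -(real_normK (num_real (ip x y))) ler_sqr ?nnegrE ?mulr_ge0.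
Qed.

Definition orthonormal m (e : 'I_m -> B) :=
  forall i j, ip (e i) (e j) = (i == j)%:R.

Lemma ip_orthosum m (e : 'I_m -> B) (a : 'I_m -> R) i :
  orthonormal e -> ip (e i) (\sum_j a j *: e j) = a i.
Proof.
move=> oe; rewrite ip_sumr (bigD1 i)//= ipZr oe eqxx mulr1 big1 ?addr0// => j ji.
by rewrite ipZr oe eq_sym (negbTE ji) mulr0.
Qed.

(** With more vectors than generators, the coordinate matrix [M] has a nonzero left kernel vector
    [v]; pairing the resulting relation among the [e i] with each [e i] shows that [v] vanishes. *)
Lemma orthonormal_bound : exists n : nat, forall m (e : 'I_m -> B),
  orthonormal e -> (m <= n)%N.
Proof.
have [n [b hb]] := ip_fin_dim hB; exists n => m e oe.
rewrite leqNgt; apply/negP => nm.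
have [c hc] : {c : 'I_m -> 'I_n -> R & forall i, e i = \sum_j c i j *: b j}.
  by apply: (@choice _ _ (fun i d => e i = \sum_j d j *: b j)) => i; exact: hb.
pose M : 'M[R]_(m, n) := \matrix_(i, j) c i j.
have : kermx M != 0.
  rewrite -mxrank_eq0 mxrank_ker subn_eq0 -ltnNge.
  by rewrite (leq_ltn_trans _ nm)// rank_leq_col.
move=> /rowV0Pn[v /sub_kermxP vM /eqP]; apply.
have s0 : \sum_i v 0 i *: e i = 0.
  under eq_bigr do rewrite hc scaler_sumr.
  rewrite exchange_big/= big1// => j _.
  under eq_bigr do rewrite scalerA.
  rewrite -scaler_suml (_ : \sum_i _ = (v *m M) 0 j).
    by rewrite vM mxE scale0r.
  by rewrite mxE; apply: eq_bigr => i _; rewrite mxE.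
apply/rowP => i; rewrite mxE -(@ip_orthosum _ e (fun i => v 0 i))//.
by rewrite s0 ip0r.
Qed.

(** Take an orthonormal system of maximal size inside the double orthogonal complement of [C]: a
    vector of [C] outside its span would leave a residue that, once normalized, enlarges the system.
    The second clause expresses that each [e i] lies in the span of [C]. *)
Lemma span_basis (C : set B) : exists m (e : 'I_m -> B),
  [/\ orthonormal e,
      (forall i y, (forall c, C c -> ip y c = 0) -> ip y (e i) = 0) &
      (forall c, C c -> c = \sum_i ip (e i) c *: e i)].
Proof.
pose Q (m : nat) := `[<exists e : 'I_m -> B, orthonormal e /\
  (forall i y, (forall c, C c -> ip y c = 0) -> ip y (e i) = 0)>].
have Q0 : exists m, Q m.
  exists 0%N; apply/asboolP; exists (fun=> 0); split; by case.
have [n hn] := orthonormal_bound.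
have Qn m : Q m -> (m <= n)%N by move=> /asboolP[e [oe _]]; exact: hn oe.
case: (ex_maxnP Q0 Qn) => m /asboolP[e [oe eC]] mmax.
exists m, e; split => // c Cc; apply/eqP; rewrite -subr_eq0; apply/negPn/negP.
set d := c - _ => d0.
have de i : ip (e i) d = 0.
  by rewrite /d ipBr (ip_orthosum (fun i => ip (e i) c))// subrr.
have dn : `|d| != 0 by rewrite normr_eq0.
suff /mmax : Q m.+1 by rewrite ltnn.
apply/asboolP.
exists (fun i : 'I_m.+1 => if unlift ord0 i is Some j then e j else `|d|^-1 *: d).
split.
  move=> i j.
  case: (unliftP ord0 i) => [i'|] ->; case: (unliftP ord0 j) => [j'|] ->.
  - by rewrite oe (inj_eq lift_inj).
  - by rewrite ipZr de mulr0 eq_sym (negbTE (neq_lift _ _)).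
  - by rewrite ipZl (ip_sym hB) de mulr0 (negbTE (neq_lift _ _)).
  - by rewrite eqxx ipZl ipZr (ip_norm hB) mulrA -invfM mulVf// mulf_neq0.
move=> i y yC; case: (unliftP ord0 i) => [i'|] _; first exact: eC.
have s0 : \sum_i ip y (ip (e i) c *: e i) = 0.
  by rewrite big1// => j _; rewrite ipZr eC ?mulr0.
by rewrite ipZr /d ipBr yC// ip_sumr s0 subr0 mulr0.
Qed.

Lemma orthonormal_basis : exists m (e : 'I_m -> B),
  orthonormal e /\ forall x, x = \sum_i ip (e i) x *: e i.
Proof.
by have [m [e [oe _ eC]]] := span_basis setT; exists m, e; split => // x; exact: eC.
Qed.

End euclid.

(* Extending a positive functional from a hyperplane: the admissible slopes
   form an interval [sup, inf], nonempty because the cone is convex. *)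
Lemma cone_supporting (R : realType) (m : nat) (C : set ('I_m -> R)) :
  C (fun=> 0) ->
  (forall c c', C c -> C c' -> C (fun i => c i + c' i)) ->
  (forall t c, 0 <= t -> C c -> C (fun i => t * c i)) ->
  (exists p, ~ C p) ->
  exists a : 'I_m -> R, (exists i, a i != 0) /\
    forall c, C c -> 0 <= \sum_i a i * c i.
Proof.
elim: m C => [|m ih] C C0 CD CZ [p Cp].
  exfalso; apply: Cp; rewrite (_ : p = fun=> 0)//.
  by apply/funext; case.
pose cons (x : R) (w : 'I_m -> R) : 'I_m.+1 -> R := fun i =>
  if unlift ord0 i is Some j then w j else x.
have consE c : c = cons (c ord0) (fun i => c (lift ord0 i)).
  apply/funext => i; rewrite /cons.
  by case: (unliftP ord0 i) => [j|] ->.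
have cons0 x w : cons x w ord0 = x by rewrite /cons unlift_none.
have consS x w i : cons x w (lift ord0 i) = w i by rewrite /cons liftK.
have consD x w x' w' : (fun i => cons x w i + cons x' w' i) =
    cons (x + x') (fun i => w i + w' i).
  by apply/funext => i; rewrite /cons; case: unlift.
have consZ t x w : (fun i => t * cons x w i) = cons (t * x) (fun i => t * w i).
  by apply/funext => i; rewrite /cons; case: unlift.
have CDc x w x' w' : C (cons x w) -> C (cons x' w') ->
    C (cons (x + x') (fun i => w i + w' i)).
  by move=> h h'; rewrite -consD; exact: CD.
have CZc t x w : 0 <= t -> C (cons x w) -> C (cons (t * x) (fun i => t * w i)).
  by move=> t0 h; rewrite -consZ; exact: CZ.
have sumE b x w c : c = cons x w ->
    \sum_(i < m.+1) cons b (fun=> 0) i * c i = b * x.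
  move=> ->; rewrite big_ord_recl !cons0 big1 ?addr0// => i _.
  by rewrite consS mul0r.
have cC c : C c -> C (cons (c ord0) (fun i => c (lift ord0 i))) by rewrite -consE.
(* If the first coordinate keeps one sign on [C], it or its opposite is the functional. Otherwise
   [n] and [q] are points of [C] strictly on either side of the hyperplane. *)
have [pos|/existsNP[n /not_implyP[Cn n0]]] :=
    pselect (forall c, C c -> 0 <= c ord0).
  exists (cons 1 (fun=> 0)); split; first by exists ord0; rewrite cons0 oner_neq0.
  by move=> c Cc; rewrite (sumE _ _ _ _ (consE c)) mul1r; exact: pos.
have [neg|/existsNP[q /not_implyP[Cq q0]]] :=
    pselect (forall c, C c -> c ord0 <= 0).
  exists (cons (-1) (fun=> 0)); split.
    by exists ord0; rewrite cons0 oppr_eq0 oner_neq0.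
  by move=> c Cc; rewrite (sumE _ _ _ _ (consE c)) mulN1r oppr_ge0; exact: neg.
move/negP : n0; rewrite -ltNge => n0; move/negP : q0; rewrite -ltNge => q0.
pose W := [set w | C (cons 0 w)].
have [a [a0 aW]] : exists a : 'I_m -> R, (exists i, a i != 0) /\
    forall c, W c -> 0 <= \sum_i a i * c i.
  apply: ih.
  - by rewrite /W/= (_ : cons 0 _ = fun=> 0)//; apply/funext => i; rewrite /cons; case: unlift.
  - by move=> c c' Wc Wc'; have := CDc _ _ _ _ Wc Wc'; rewrite addr0.
  - by move=> t c t0 Wc; have := CZc _ _ _ t0 Wc; rewrite mulr0.
  (* Were the slice the whole hyperplane, a nonnegative multiple of [n] or [q] with the right first
     coordinate, corrected inside the hyperplane, would reach the excluded point [p]. *)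
  - apply: contrapT => /forallNP WT; apply: Cp.
    have WT' w : C (cons 0 w) by apply: contrapT; exact: WT.
    rewrite (consE p).
    have [p0|p0|p0] := ltgtP (p ord0) 0.
    + have := CDc _ _ _ _ (CZc (p ord0 / n ord0) _ _ _ (cC _ Cn)) (WT' (fun i =>
        p (lift ord0 i) - p ord0 / n ord0 * n (lift ord0 i))).
      rewrite addr0 divfK ?lt_eqF//.
      rewrite (_ : (fun i : 'I_m => _ + _) = fun i => p (lift ord0 i)); last first.
        by apply/funext => i; rewrite addrC subrK.
      by apply; rewrite -mulrNN -invrN divr_ge0// oppr_ge0 ltW.
    + have := CDc _ _ _ _ (CZc (p ord0 / q ord0) _ _ _ (cC _ Cq)) (WT' (fun i =>
        p (lift ord0 i) - p ord0 / q ord0 * q (lift ord0 i))).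
      rewrite addr0 divfK ?gt_eqF//.
      rewrite (_ : (fun i : 'I_m => _ + _) = fun i => p (lift ord0 i)); last first.
        by apply/funext => i; rewrite addrC subrK.
      by apply; rewrite divr_ge0// ltW.
    + by rewrite p0; exact: WT'.
pose F (c : 'I_m.+1 -> R) := \sum_(i < m) a i * c (lift ord0 i).
pose S := [set - F c / c ord0 | c in [set c | C c /\ 0 < c ord0]].
(* Points on opposite sides are rescaled to first coordinates 1 and -1; their sum lies in the slice,
   where [a] is nonnegative. So every lower bound for the slope lies below every upper bound. *)
have key c c' : C c -> 0 < c ord0 -> C c' -> c' ord0 < 0 ->
    - F c / c ord0 <= - F c' / c' ord0.
  move=> Cc c0 Cc' c'0.
  have := aW (fun i => (c ord0)^-1 * c (lift ord0 i) +
                       (- c' ord0)^-1 * c' (lift ord0 i)).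
  have : C (cons 0 (fun i => (c ord0)^-1 * c (lift ord0 i) +
                       (- c' ord0)^-1 * c' (lift ord0 i))).
    have := CDc _ _ _ _ (CZc (c ord0)^-1 _ _ _ (cC _ Cc)) (CZc (- c' ord0)^-1 _ _ _ (cC _ Cc')).
    have e : (- c' ord0)^-1 * c' ord0 = -1.
      by rewrite invrN mulNr mulVf// lt_eqF.
    rewrite mulVf ?gt_eqF// e subrr.
    by apply; rewrite invr_ge0 ?oppr_ge0 ltW.
  move=> h /(_ h).
  rewrite (eq_bigr (fun i => (c ord0)^-1 * (a i * c (lift ord0 i)) +
     (- c' ord0)^-1 * (a i * c' (lift ord0 i)))); last by move=> i _; ring.
  rewrite big_split/= -!mulr_sumr -/(F c) -/(F c').
  rewrite invrN mulNr subr_ge0 => ?.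
  by rewrite !mulNr lerN2 ![F _ / _]mulrC.
have S0 : S !=set0 by exists (- F q / q ord0), q.
have Sub : has_ubound S.
  by exists (- F n / n ord0) => _ [c [Cc c0] <-]; exact: key.
exists (cons (sup S) a); split.
  by case: a0 => i ai; exists (lift ord0 i); rewrite consS.
move=> c Cc.
rewrite big_ord_recl cons0 (eq_bigr (fun i => a i * c (lift ord0 i))); last first.
  by move=> i _; rewrite consS.
rewrite -/(F c); have [c0|c0|c0] := ltgtP (c ord0) 0.
- have : sup S <= - F c / c ord0.
    by apply: ge_sup => // _ [c' [Cc' c'0] <-]; exact: key.
  by rewrite ler_ndivlMr// -subr_ge0; lra.
- have : - F c / c ord0 <= sup S by apply: ub_le_sup => //; exists c.
  by rewrite ler_pdivrMr//; lra.
- rewrite c0 mulr0 add0r; apply: (aW (fun i => c (lift ord0 i))).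
  by rewrite /W/= -c0 -consE.
Qed.

Section separation.
Context (R : realType) (B : normedModType R) (ip : B -> B -> R).
Hypothesis hB : euclidean ip.

Lemma cone_separation (C : set B) (p : B) : C 0 ->
  (forall x y, C x -> C y -> C (x + y)) ->
  (forall t x, 0 <= t -> C x -> C (t *: x)) -> ~ C p ->
  exists y, [/\ (forall c, C c -> 0 <= ip y c), ip y p <= 0 &
    ip y p < 0 \/ exists2 c, C c & 0 < ip y c].
Proof.
move=> C0 CD CZ Cp.
have [m [e [oe eC Ce]]] := span_basis hB C.
pose d := p - \sum_i ip (e i) p *: e i.
have de i : ip (e i) d = 0.
  by rewrite /d (ipBr hB) (ip_orthosum hB (fun i => ip (e i) p))// subrr.
have [d0|d0] := eqVneq d 0; last first.
  exists (- d); have dp : ip (- d) p < 0.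
    rewrite (ipNl hB) oppr_lt0 (_ : p = d + \sum_i ip (e i) p *: e i); last first.
      by rewrite subrK.
    rewrite (ipDr hB) (ip_sumr hB) big1 ?addr0; last first.
      by move=> i _; rewrite (ipZr hB) (ip_sym hB d) de mulr0.
    by rewrite (ip_norm hB) exprn_gt0// normr_gt0.
  split; [|exact: ltW|by left].
  move=> c Cc; rewrite {1}(Ce _ Cc) (ip_sumr hB) big1// => i _.
  by rewrite (ipZr hB) (ipNl hB) (ip_sym hB d) de oppr0 mulr0.
have pe : p = \sum_i ip (e i) p *: e i by apply/eqP; rewrite -subr_eq0 -/d d0.
pose co (x : B) : 'I_m -> R := fun i => ip (e i) x.
pose D := [set v : 'I_m -> R | exists2 c, C c & exists2 t : R, 0 <= t &
  v = co (c - t *: p)].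
have [a [[i0 ai0] aD]] : exists a : 'I_m -> R, (exists i, a i != 0) /\
    forall c, D c -> 0 <= \sum_i a i * c i.
  apply: cone_supporting.
  - exists 0 => //; exists 0 => //; apply/funext => i.
    by rewrite /co scale0r subr0 (ip0r hB).
  - move=> _ _ [c Cc [t t0 ->]] [c' Cc' [t' t'0 ->]].
    exists (c + c'); first exact: CD.
    exists (t + t'); first exact: addr_ge0.
    apply/funext => i; rewrite /co !(ipBr hB, ipDr hB, ipZr hB); ring.
  - move=> s _ s0 [c Cc [t t0 ->]].
    exists (s *: c); first exact: CZ.
    exists (s * t); first exact: mulr_ge0.
    apply/funext => i; rewrite /co !(ipBr hB, ipDr hB, ipZr hB); ring.
  (* The enlarged cone misses [p]: from [p = c - t p] follows [p = c / (1 + t)], a point of [C]. *)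
  - exists (co p) => -[c Cc [t t0 h]]; apply: Cp.
    have /eqP : p = c - t *: p.
      rewrite (Ce _ Cc) {1}pe {2}pe scaler_sumr -sumrB; apply: eq_bigr => i _.
      rewrite scalerA -scalerBl; congr (_ *: _).
      by have := congr1 (fun f => f i) h; rewrite /co (ipBr hB) (ipZr hB).
    rewrite eq_sym subr_eq -{1}(scale1r p) -scalerDl => /eqP cE.
    have t1 : 0 < 1 + t by rewrite ltr_pwDl.
    rewrite (_ : p = (1 + t)^-1 *: c); last first.
      by rewrite cE scalerA mulVf ?scale1r// gt_eqF.
    by apply: CZ => //; rewrite invr_ge0 ltW.
pose y := \sum_i a i *: e i.
have yE x : ip y x = \sum_i a i * co x i.
  by rewrite /y (ip_suml hB); apply: eq_bigr => i _; rewrite (ipZl hB).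
have yC c : C c -> 0 <= ip y c.
  move=> Cc; rewrite yE; apply: aD; exists c => //; exists 0 => //.
  by rewrite scale0r subr0.
have yp : ip y p <= 0.
  rewrite -oppr_ge0 -(ipNr hB) yE; apply: aD; exists 0 => //; exists 1 => //.
  by rewrite scale1r sub0r.
exists y; split => //; right; apply: contrapT => nC.
have y0 c : C c -> ip y c = 0.
  move=> Cc; apply/eqP; rewrite eq_le yC// andbT leNgt; apply/negP => yc0.
  by apply: nC; exists c.
(* A functional vanishing on [C] vanishes on each [e i], whereas its value at [e i0] is [a i0]. *)
have := eC i0 y y0; rewrite (ip_sym hB) /y (ip_orthosum hB)// => /eqP.
by rewrite (negbTE ai0).
Qed.

End separation.

(** * Borel measurability read off coordinates *)

Section borel_measurability.
Context (R : realType) (B : normedModType R) (ip : B -> B -> R).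
Hypothesis hB : euclidean ip.

Lemma measurable_openb (O : set B) : open O -> measurable (O : set (borel B)).
Proof. exact: sub_sigma_algebra. Qed.

Lemma continuous_measurable_borel (f : B -> R) :
  continuous f -> measurable_fun setT (f : borel B -> R).
Proof.
move=> /continuousP cf; apply: (measurability _ (RGenOpens.measurableE R)).
move=> _ [_ [a [b ->]] <-]; rewrite setTI.
by apply: measurable_openb; apply: cf; exact: interval_open.
Qed.

Lemma continuous_ip y : continuous (ip y).
Proof.
move=> x; apply/cvgrPdist_le => /= e e0.
near=> t; rewrite -(ipBr hB) (le_trans (cauchy_schwarz hB _ _))//.
have -> : e = (`|y| + 1) * (e / (`|y| + 1)).
  by rewrite mulrC divfK// gt_eqF// ltr_wpDl.
apply: ler_pM => //; first by rewrite lerDl.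
near: t; apply: (@cvgr_dist_le _ _ _ (nbhs x) _ (fun t : B => t) x) => //.
by rewrite divr_gt0// ltr_wpDl.
Unshelve. all: by end_near. Qed.

Lemma measurable_ip y : measurable_fun setT (ip y : borel B -> R).
Proof. by apply: continuous_measurable_borel; exact: continuous_ip. Qed.

Lemma measurable_normb : measurable_fun setT (fun x : borel B => `|x : B|).
Proof. by apply: continuous_measurable_borel => x; exact: norm_continuous. Qed.

(** Rational boxes in coordinates form a base of the topology; the index type is countable, so that
    unions over it are countable and its elements can be enumerated by [pickle]. *)
Definition rbox n (e : 'I_n -> B) (c : {ffun 'I_n -> rat} * rat) : set B :=
  [set x | forall i, `|ip (e i) x - ratr (c.1 i)| < ratr c.2].

Lemma rbox_base n (e : 'I_n -> B) (O : set B) x :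
  (forall x, x = \sum_i ip (e i) x *: e i) -> open O -> O x ->
  exists c, rbox e c x /\ rbox e c `<=` O.
Proof.
move=> he oO Ox.
have /nbhs_ballP[r /= r0 rO] : nbhs x O by exact: open_nbhs_nbhs.
(* Two points of a box of half-side [d] differ by at most [2 d] in each coordinate, hence by at most
   [2 d] times the sum of the norms; the extra 1 makes [s] positive and the final inequality
   strict. *)
pose s := \sum_i `|e i| + 1.
have s0 : 0 < s by rewrite ltr_wpDl// sumr_ge0.
have /rat_in_itvoo[d] : 0 < r / s / 2 :> R by rewrite !divr_gt0.
rewrite in_itv/= => /andP[d0 dr].
have /choice[c hc] : forall i : 'I_n, exists c : rat, `|ip (e i) x - ratr c| < ratr d.
  move=> i; have /rat_in_itvoo[c] : ip (e i) x - ratr d < ip (e i) x + ratr d.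
    by rewrite ltrBlDr -addrA ltrDl addr_gt0.
  rewrite in_itv/= => /andP[h1 h2]; exists c.
  by rewrite distrC ltr_distl h1 h2.
exists ([ffun i => c i], d); split; first by move=> i; rewrite ffunE.
move=> y hy; apply: rO; rewrite -ball_normE /ball_/=.
rewrite (he (x - y)) (le_lt_trans (ler_norm_sum _ _ _))//.
have hi i : `|ip (e i) (x - y) *: e i| <= r / s * `|e i|.
  rewrite normrZ ler_wpM2r// (ipBr hB).
  rewrite (_ : _ - _ = (ip (e i) x - ratr (c i)) - (ip (e i) y - ratr (c i))); last by ring.
  rewrite (le_trans (ler_normB _ _))//.
  have := hc i; have := hy i; rewrite /= ffunE => /ltW h1 /ltW h2.
  rewrite (le_trans (lerD h2 h1))//; move: dr; set u := r / s; lra.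
rewrite (le_lt_trans (ler_sum _ (fun i _ => hi i)))//.
rewrite -mulr_sumr mulrAC ltr_pdivrMr// ltr_pM2l//.
by rewrite /s ltrDl.
Qed.

Lemma open_rbox_bigcup n (e : 'I_n -> B) (O : set B) :
  (forall x, x = \sum_i ip (e i) x *: e i) -> open O ->
  O = \bigcup_c (if pselect (rbox e c `<=` O) then rbox e c else set0).
Proof.
move=> he oO; apply/seteqP; split => [x Ox|x [c _]].
  have [c [cx cO]] := rbox_base he oO Ox.
  by exists c => //; case: pselect.
by case: pselect => // cO; exact: cO.
Qed.

(** An open set is a countable union of rational boxes, and the preimage of a box is a finite
    intersection of preimages of intervals under coordinates. *)
Lemma measurable_borelP d (T : measurableType d) (D : set T) (f : T -> borel B) :
  (forall y, measurable_fun D (fun t => ip y (f t))) -> measurable_fun D f.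
Proof.
move=> mf mD; suff : measurable_fun D f by exact.
apply: (@measurability _ _ T (borel B) D f (@open B) erefl).
move=> _ [U oO <-].
have [n [e [_ he]]] := orthonormal_basis hB.
rewrite (open_rbox_bigcup he oO) preimage_bigcup setI_bigcupr.
apply: countable_bigcupT_measurable; first exact: countableP.
move=> c; case: pselect => cO; last by rewrite preimage_set0 setI0.
rewrite (_ : _ `&` _ = D `&` \bigcap_(i in [set: 'I_n])
    (D `&` (fun t => ip (e i) (f t)) @^-1`
      `](ratr (c.1 i) - ratr c.2), (ratr (c.1 i) + ratr c.2)[)).
  apply: measurableI => //; apply: fin_bigcap_measurable; first exact: finite_finset.
  by move=> i _; apply: mf.
apply/seteqP; split => t.
  move=> [Dt h]; split => // i _; split => //=.
  by have := h i; rewrite in_itv/= ltr_distl.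
move=> [Dt h]; split => // i /=.
by have [_] := h i I; rewrite /= in_itv/= ltr_distl.
Qed.

Section arith.
Context d (T : measurableType d) (D : set T).
Implicit Types (f g : T -> borel B) (a : T -> R).

Lemma measurable_ipf y f : measurable_fun D f -> measurable_fun D (fun t => ip y (f t)).
Proof. by move=> mf; apply: measurableT_comp => //; exact: measurable_ip. Qed.

Lemma measurable_normf f :
  measurable_fun D f -> measurable_fun D (fun t => `|f t : B|).
Proof. by move=> mf; apply: measurableT_comp => //; exact: measurable_normb. Qed.

Lemma measurable_scaleb a f : measurable_fun D a -> measurable_fun D f ->
  measurable_fun D (fun t => a t *: (f t : B) : borel B).
Proof.
move=> ma mf; apply: measurable_borelP => y.
under eq_fun do rewrite (ipZr hB).
by apply: measurable_funM => //; exact: measurable_ipf.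
Qed.

Lemma measurable_addb f g : measurable_fun D f -> measurable_fun D g ->
  measurable_fun D (fun t => (f t : B) + g t : borel B).
Proof.
move=> mf mg; apply: measurable_borelP => y.
under eq_fun do rewrite (ipDr hB).
by apply: measurable_funD; exact: measurable_ipf.
Qed.

Lemma measurable_oppb f : measurable_fun D f ->
  measurable_fun D (fun t => - (f t : B) : borel B).
Proof.
move=> mf; apply: measurable_borelP => y.
under eq_fun do rewrite (ipNr hB).
exact/measurable_funN/measurable_ipf.
Qed.

Lemma measurable_sumb I (s : seq I) (f : I -> T -> borel B) :
  (forall i, measurable_fun D (f i)) ->
  measurable_fun D (fun t => \sum_(i <- s) (f i t : B) : borel B).
Proof.
move=> mf; apply: measurable_borelP => y.
under eq_fun do rewrite (ip_sumr hB).
by apply: measurable_sum => i; exact: measurable_ipf.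
Qed.

End arith.
End borel_measurability.

Section integration_tools.
Context d (T : measurableType d) (R : realType).
Implicit Type mu : {measure set T -> \bar R}.

Lemma dominated_cvgR mu (D : set T) (f_ : nat -> T -> R) (f g : T -> R) :
  measurable D -> (forall n, measurable_fun D (f_ n)) -> measurable_fun D f ->
  {ae mu, forall x, D x -> f_ n x @[n --> \oo] --> f x} ->
  mu.-integrable D (EFin \o g) ->
  (forall n x, D x -> `|f_ n x| <= g x) ->
  mu.-integrable D (EFin \o f) /\
  (\int[mu]_(x in D) f_ n x)%R @[n --> \oo] --> (\int[mu]_(x in D) f x)%R.
Proof.
move=> mD mf_ mf cf ig fg.
have [] := @dominated_convergence _ _ _ mu D mD (fun n x => (f_ n x)%:E)
  (fun x => (f x)%:E) (fun x => (g x)%:E).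
- by move=> n; exact/measurable_EFinP.
- exact/measurable_EFinP.
- by apply: filterS cf => x h Dx; apply: cvg_EFin; [exact: nearW|exact: h].
- exact: ig.
- by apply: aeW => x n Dx; rewrite lee_fin fg.
move=> ifi _ h; split => //.
apply: fine_cvg; rewrite /Rintegral fineK//.
exact: integrable_fin_num.
Qed.

Lemma bounded_integrableR mu (D : set T) (f : T -> R) M :
  (mu setT < +oo)%E -> measurable D -> measurable_fun D f ->
  (forall x, D x -> `|f x| <= M) -> mu.-integrable D (EFin \o f).
Proof.
move=> muT mD mf fM; apply: measurable_bounded_integrable => //.
  by rewrite (le_lt_trans _ muT)//; apply: le_measure => //; rewrite inE.
by exists M; split; [exact: num_real|move=> x Mx y /fM h /=; exact: le_trans h (ltW Mx)].
Qed.

End integration_tools.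

Lemma bounded_integrable_prob d (T : measurableType d) (R : realType)
    (P : probability T R) (f : T -> R) M : measurable_fun setT f ->
  (forall x, `|f x| <= M) -> P.-integrable setT (EFin \o f).
Proof.
move=> mf fM; apply: (bounded_integrableR (M := M)) => //.
have h : (P setT < +oo)%E by rewrite probability_setT ltry.
exact: h.
Qed.

(** * Polynomial approximation of a threshold *)

Section step_polynomial.
Context {R : realType}.
Implicit Types v : R.

(* Polynomials in [v] converging to the indicator of [v >= 1/2] on [0, 1]; the
   factor [m] in the exponent settles the value at [v = 1/2]. *)
Definition step_poly (m : nat) v : R := 1 - (1 - v ^+ m) ^+ (m * 2 ^ m).

Lemma step_poly_itv m v : 0 <= v <= 1 -> 0 <= step_poly m v <= 1.
Proof.
move=> /andP[v0 v1].
have w0 : 0 <= 1 - v ^+ m by rewrite subr_ge0 exprn_ile1.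
have w1 : 1 - v ^+ m <= 1 by rewrite gerBl exprn_ge0.
by rewrite /step_poly subr_ge0 exprn_ile1//= gerBl exprn_ge0.
Qed.

Lemma bernoulli_ineq (x : R) n : 0 <= x <= 1 -> 1 - n%:R * x <= (1 - x) ^+ n.
Proof.
move=> /andP[x0 x1]; elim: n => [|n ih]; first by rewrite mul0r subr0 expr0.
rewrite exprS (le_trans _ (ler_wpM2l _ ih)) ?subr_ge0//.
rewrite -subr_ge0 -natr1.
have : 0 <= n%:R * x * x by rewrite !mulr_ge0.
lra.
Qed.

Lemma step_poly_le m v : 0 <= v <= 1 -> step_poly m v <= m%:R * (2 * v) ^+ m.
Proof.
move=> /andP[v0 v1]; rewrite /step_poly.
have := @bernoulli_ineq (v ^+ m) (m * 2 ^ m).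
rewrite exprn_ge0// exprn_ile1// => /(_ erefl).
rewrite natrM natrX exprMn; lra.
Qed.

(** Being linear in [v] and uniform in [m], this bound can dominate on a half-line, where a constant
    would not be integrable. Below 1/4 it follows from [m (2 v)^m = (m / 2^m) (4 v)^m]. *)
Lemma step_poly_le4 m v : 0 <= v <= 1 -> step_poly m v <= 4 * v.
Proof.
move=> v01; have /andP[v0 v1] := v01.
have [v4|v4] := leP v (1 / 4); last first.
  by have /andP[_ h] := step_poly_itv m v01; rewrite (le_trans h)//; lra.
case: m => [|m]; first by rewrite /step_poly mul0n expr0 subrr mulr_ge0.
rewrite (le_trans (step_poly_le _ v01))//.
have -> : 2 * v = 2^-1 * (4 * v) by lra.
rewrite exprMn mulrA -[leRHS]mul1r; apply: ler_pM.
- by rewrite mulr_ge0// exprn_ge0// invr_ge0.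
- by rewrite exprn_ge0// mulr_ge0.
- rewrite exprVn ler_pdivrMr ?exprn_gt0// mul1r -natrX ler_nat.
  exact/ltnW/ltn_expl.
- by rewrite -[leRHS]expr1 ler_wiXn2l//; lra.
Qed.

Lemma cvg_natr_expr (x : R) : 0 <= x < 1 -> m%:R * x ^+ m @[m --> \oo] --> 0.
Proof.
(* With [w] the square root of [x], the sequence is [(m w^m) w^m]; Bernoulli's inequality for
   [1 / w = 1 + b] bounds the first factor by [1 / b]. *)
move=> /andP[x0 x1].
pose w := Num.sqrt x.
have w0 : 0 <= w by exact: sqrtr_ge0.
have w1 : w < 1 by rewrite -sqrtr1 ltr_sqrt.
have [wE|wn0] := eqVneq w 0.
  have x00 : x = 0.
    by apply/eqP; rewrite eq_le x0 andbT -sqrtr_eq0 -/w wE.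
  apply: cvg_near_cst; exists 1%N => // -[//|m] _.
  by rewrite x00 expr0n mulr0.
have wgt0 : 0 < w by rewrite lt_def wn0.
have xE : x = w * w by rewrite -expr2 sqr_sqrtr.
pose b := w^-1 - 1.
have b0 : 0 < b by rewrite subr_gt0 invf_gt1.
have hb m : m%:R * w ^+ m <= b^-1.
  rewrite -ler_pdivlMr ?exprn_gt0// -[leLHS]mulr1.
  have : 1 + m%:R * b <= (w^-1) ^+ m.
    elim: m => [|m ih]; first by rewrite mul0r addr0 expr0.
    rewrite exprS (le_trans _ (ler_wpM2l _ ih)) ?invr_ge0//.
    have -> : w^-1 = 1 + b by rewrite /b addrC subrK.
    rewrite -subr_ge0 -natr1.
    have : 0 <= m%:R * b * b by rewrite !mulr_ge0// ltW.
    lra.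
  rewrite exprVn => h; rewrite mulr1 mulrC ler_pdivlMr//; lra.
apply: (squeeze_cvgr (f := cst 0) (h := fun m => b^-1 * w ^+ m)).
- apply: nearW => m; rewrite mulr_ge0 ?exprn_ge0//=.
  by rewrite xE exprMn mulrA ler_wpM2r// exprn_ge0.
- exact: cvg_cst.
- rewrite -[X in _ --> X](mulr0 b^-1); apply: cvgMr.
  by apply: cvg_expr; rewrite ger0_norm.
Qed.

Lemma step_poly_cvg v : 0 <= v <= 1 ->
  step_poly m v @[m --> \oo] --> ((2^-1 <= v)%R%:R : R).
Proof.
move=> v01; have /andP[v0 v1] := v01.
have [v2|v2] := leP 2^-1 v; last first.
  apply: (squeeze_cvgr (f := cst 0) (h := fun m => m%:R * (2 * v) ^+ m)).
  - apply: nearW => m; have /andP[-> _]/= := step_poly_itv m v01.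
    exact: step_poly_le.
  - exact: cvg_cst.
  - by apply: cvg_natr_expr; lra.
apply: (squeeze_cvgr (f := fun m => 1 - (m.+1)%:R^-1) (h := cst 1)).
- apply: nearW => m; have /andP[_ -> /=] := step_poly_itv m v01; rewrite andbT.
  (* By [1 - x <= exp (- x)] the product is at most [exp (- m (2 v)^m)], hence at most [exp (- m)],
     because [2 v >= 1]. *)
  rewrite /step_poly lerB// (le_trans (_ : _ <= expR (- m%:R)))//.
    have h : 1 - v ^+ m <= expR (- v ^+ m).
      by have := expR_ge1Dx (- v ^+ m).
    rewrite (le_trans (lerXn2r (m * 2 ^ m) _ _ h)) ?nnegrE ?expR_ge0//.
      by rewrite subr_ge0 exprn_ile1.
    rewrite -expRM_natl ler_expR natrM natrX mulrN lerN2 -mulrA -exprMn.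
    by rewrite ler_peMr// exprn_ege1//; lra.
  rewrite expRN lef_pV2 ?posrE ?expR_gt0//.
  by have := expR_ge1Dx (m%:R : R); rewrite nat1r.
- rewrite -[X in _ --> X](subr0 1); apply: cvgB; first exact: cvg_cst.
  exact: cvg_harmonic.
- exact: cvg_cst.
Qed.

End step_polynomial.

(** * Uniqueness of characteristic functions *)

Section characteristic_function.
Context (R : realType) (B : normedModType R) (ip : B -> B -> R).
Hypothesis hB : euclidean ip.
Variables mu nu : probability (borel B) R.

Let same_int (g : borel B -> R) :=
  [/\ measurable_fun setT g, exists M, forall x, `|g x| <= M &
      (\int[mu]_x g x = \int[nu]_x g x)%R].

Let same_int_ext g h : g =1 h -> same_int g -> same_int h.
Proof. by move=> /funext ->. Qed.

Let same_int_integrable g (m : probability (borel B) R) :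
  same_int g -> m.-integrable setT (EFin \o g).
Proof.
by move=> [mg [M gM] _]; exact: (@bounded_integrable_prob _ _ _ _ _ (M)).
Qed.

Let same_int_lin a b g h : same_int g -> same_int h ->
  same_int (fun x => a * g x + b * h x).
Proof.
move=> eg eh.
have I (m : probability (borel B) R) c k : same_int k ->
    m.-integrable setT (EFin \o (fun x => c * k x)).
  move=> ek; rewrite (_ : _ \o _ = fun x => c%:E * (EFin \o k) x)%E//.
  by apply: integrableZl => //; exact: same_int_integrable.
have [mg [M gM] ge] := eg; have [mh [N hN] he] := eh; split.
- by apply: measurable_funD; apply: measurable_funM => //; exact: measurable_cst.
- exists (`|a| * M + `|b| * N) => x.
  by rewrite (le_trans (ler_normD _ _))// !normrM lerD// ler_wpM2l.
- rewrite !RintegralD//; [|exact: I..].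
  by rewrite !RintegralZl ?ge ?he//; exact: same_int_integrable.
Qed.

Let same_int_lim (g_ : nat -> borel B -> R) g M :
  (forall n, same_int (g_ n)) -> (forall n x, `|g_ n x| <= M) ->
  (forall x, g_ n x @[n --> \oo] --> g x) -> same_int g.
Proof.
move=> eg gM cg.
have mg : measurable_fun setT g.
  by apply: (measurable_fun_cvg (h := g_)) => [n|x _]; [case: (eg n)|exact: cg].
have L (m : probability (borel B) R) :
    (\int[m]_x g_ n x)%R @[n --> \oo] --> (\int[m]_x g x)%R.
  apply: (dominated_cvgR (g := cst M) _ _ mg _ _ _).2 => //.
  - by move=> n; case: (eg n).
  - by apply: aeW => x _; exact: cg.
  - exact: (@bounded_integrable_prob _ _ _ _ _ (`|M|)).
split => //.
  exists M => x; apply: (cvgr_to_le (cvg_norm (cg x))).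
  exact: nearW.
apply: (cvg_unique _ (L mu)) => //.
have E : (fun n => \int[mu]_x g_ n x)%R = (fun n => \int[nu]_x g_ n x)%R.
  by apply/funext => n; case: (eg n).
by rewrite E; exact: L.
Qed.

(** Testing [f] against every frequency at once makes the class stable under products with sines,
    besides linear combinations and bounded pointwise limits. Starting from the constant 1 it thus
    reaches indicators of half-spaces and of their finite intersections. *)
Let V (f : borel B -> R) := forall z : B,
  same_int (fun x => f x * cos (ip z x)) /\ same_int (fun x => f x * sin (ip z x)).

Let V_ext f g : f =1 g -> V f -> V g.
Proof. by move=> /funext ->. Qed.

Let V_lin a b f g : V f -> V g -> V (fun x => a * f x + b * g x).
Proof.
move=> Vf Vg z; have [fc fs] := Vf z; have [gc gs] := Vg z; split.
  under eq_fun do rewrite mulrDl -!mulrA.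
  exact: same_int_lin.
under eq_fun do rewrite mulrDl -!mulrA.
exact: same_int_lin.
Qed.

Let V_lim (f_ : nat -> borel B -> R) f M : (forall n, V (f_ n)) ->
  (forall n x, `|f_ n x| <= M) ->
  (forall x, f_ n x @[n --> \oo] --> f x) -> V f.
Proof.
move=> Vf fM cf z.
have bnd n x (t : R) : `|t| <= 1 -> `|f_ n x * t| <= M.
  by move=> t1; rewrite normrM (le_trans _ (fM n x))// ler_piMr.
split.
  apply: (same_int_lim (M := M) (g_ := fun n x => f_ n x * cos (ip z x))) => [n|n x|x].
  - by case: (Vf n z).
  - exact/bnd/cos_max.
  - apply: cvgMl; exact: cf.
apply: (same_int_lim (M := M) (g_ := fun n x => f_ n x * sin (ip z x))) => [n|n x|x].
- by case: (Vf n z).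
- exact/bnd/sin_max.
- apply: cvgMl; exact: cf.
Qed.

(** Product-to-sum formulas: multiplication by a sine of frequency [w] replaces the test frequency
    [z] by [w + z] and [w - z]. *)
Let V_sin w c f : V f -> V (fun x => f x * sin (ip w x - c)).
Proof.
move=> Vf z; have [Ac As] := Vf (w + z); have [Bc Bs] := Vf (w - z); split.
  apply: (same_int_ext _ (same_int_lin 1 1 (same_int_lin (2^-1 * cos c) (- (2^-1 * sin c)) As Ac)
    (same_int_lin (2^-1 * cos c) (- (2^-1 * sin c)) Bs Bc))) => x.
  rewrite !(ipDl hB, ipNl hB) !(sinB, cosB, sinD, cosD); by field.
apply: (same_int_ext _ (same_int_lin 1 1 (same_int_lin (2^-1 * cos c) (2^-1 * sin c) Bc Bs)
    (same_int_lin (- (2^-1 * cos c)) (- (2^-1 * sin c)) Ac As))) => x.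
rewrite !(ipDl hB, ipNl hB) !(sinB, cosB, sinD, cosD); by field.
Qed.

Let V_bump w c f m : V f ->
  V (fun x => f x * step_poly m ((1 + sin (ip w x - c)) / 2)).
Proof.
pose v x := (1 + sin (ip w x - c)) / 2.
have Vv g : V g -> V (fun x => g x * v x).
  move=> Vg; apply: (V_ext _ (V_lin 2^-1 2^-1 Vg (V_sin w c Vg))) => x.
  by rewrite /v; field.
have Vvm g k : V g -> V (fun x => g x * v x ^+ k).
  elim: k g => [|k ih] g Vg.
    by under eq_fun do rewrite expr0 mulr1.
  by under eq_fun do rewrite exprS mulrA; exact/ih/Vv.
have V1 g k : V g -> V (fun x => g x * (1 - v x ^+ m) ^+ k).
  elim: k g => [|k ih] g Vg.
    by under eq_fun do rewrite expr0 mulr1.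
  under eq_fun do rewrite exprS mulrA; apply: ih.
  apply: (V_ext _ (V_lin 1 (-1) Vg (Vvm _ m Vg))) => x.
  by ring.
move=> Vf; apply: (V_ext _ (V_lin 1 (-1) Vf (V1 _ (m * 2 ^ m)%N Vf))) => x.
by rewrite /step_poly -/(v x); ring.
Qed.

Let V_bounded f : V f -> exists M, forall x, `|f x| <= M.
Proof.
move=> /(_ 0)[[_ [M fM] _] _]; exists M => x.
by have := fM x; rewrite (ip0l hB) cos0 mulr1.
Qed.

Let V_halfspace w c f : V f -> V (fun x => f x * (c <= ip w x)%R%:R).
Proof.
move=> Vf; have [M fM] := V_bounded Vf.
(* The quantity [(1 + sin) / 2] lies in [0, 1] and is at least 1/2 exactly where the sine is
   nonnegative, so [step_poly] of it converges to that indicator. *)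
have Vs w' c' : V (fun x => f x * (0 <= sin (ip w' x - c'))%R%:R).
  apply: (V_lim (M := M) (f_ := fun m x => f x * step_poly m
    ((1 + sin (ip w' x - c')) / 2))).
  - by move=> m; exact: V_bump.
  - move=> m x.
    have /andP[s0 s1] : 0 <= step_poly m ((1 + sin (ip w' x - c')) / 2) <= 1.
      by apply: step_poly_itv; have := sin_geN1 (ip w' x - c');
        have := sin_le1 (ip w' x - c'); lra.
    by rewrite normrM (ger0_norm s0) (le_trans _ (fM x))// ler_piMr.
  - move=> x; apply: cvgMr.
    rewrite (_ : (0 <= _) = (2^-1 <= (1 + sin (ip w' x - c')) / 2)).
      apply: step_poly_cvg; have := sin_geN1 (ip w' x - c').
      by have := sin_le1 (ip w' x - c'); lra.
    by apply/idP/idP; lra.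
(* Dividing the argument by [n + 1] brings it eventually into the interval from [- pi] to [pi],
   where the sine has the sign of [ip w x - c]. *)
apply: (V_lim (M := M) (f_ := fun n x => f x *
  (0 <= sin (ip (n.+1%:R^-1 *: w) x - c / n.+1%:R))%R%:R)).
- by move=> n; exact: Vs.
- move=> n x; rewrite normrM (le_trans _ (fM x))// ler_piMr//.
  by rewrite normr_nat lern1 leq_b1.
- move=> x; apply: cvgMr; apply: cvg_near_cst.
  near=> n; congr ((nat_of_bool _)%:R).
  rewrite (ipZl hB) mulrC -mulrBl; set t := ip w x - c.
  have -> : (c <= ip w x) = (0 <= t) by rewrite subr_ge0.
  have n0 : 0 < n.+1%:R :> R by rewrite ltr0n.
  have small : `|t| / n.+1%:R < pi.
    rewrite ltr_pdivrMr// -ltr_pdivrMl ?pi_gt0//.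
    rewrite (@lt_trans _ _ n%:R)//; last by rewrite ltr_nat.
    near: n; exact: nbhs_infty_gtr.
  have [t0|t0] := leP 0 t.
    rewrite sin_ge0_pi// divr_ge0//= ltW//.
    by rewrite ger0_norm in small.
  apply/negbTE; rewrite -ltNge -oppr_gt0 -sinN; apply: sin_gt0_pi.
  rewrite -mulNr divr_gt0 ?oppr_gt0//=.
  by rewrite ltr0_norm in small.
Unshelve. all: by end_near. Qed.

Lemma characteristic_function_unique :
  (forall z, (\int[mu]_x cos (ip z x) = \int[nu]_x cos (ip z x))%R) ->
  (forall z, (\int[mu]_x sin (ip z x) = \int[nu]_x sin (ip z x))%R) ->
  forall A : set (borel B), measurable A -> mu A = nu A.
Proof.
move=> hc hs.
have V1 : V (fun=> 1).
  move=> z; split; (under eq_fun do rewrite mul1r); split => //.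
  - apply: continuous_measurable_borel => x.
    apply: continuous_comp; first exact: continuous_ip.
    exact: continuous_cos.
  - by exists 1 => x; exact: cos_max.
  - apply: continuous_measurable_borel => x.
    apply: continuous_comp; first exact: continuous_ip.
    exact: continuous_sin.
  - by exists 1 => x; exact: sin_max.
(* Finite intersections of half-spaces, indexed by lists: concatenation shows that they are stable
   under intersection. *)
pose H (s : seq (B * R)) := [set x : borel B | all (fun p => p.2 <= ip p.1 x) s].
have VH s : V (fun x => \1_(H s) x).
  elim: s => [|p s ih].
    by rewrite (_ : (fun x => _) = fun=> 1)//; apply/funext => x; rewrite indicE mem_set.
  apply: (V_ext _ (V_halfspace p.1 p.2 ih)) => x.
  rewrite !indicE -natrM mulnb /H; congr ((nat_of_bool _)%:R).
  by apply/andP/idP => [[/set_mem/= h1 h2]|/set_mem/= /andP[h1 h2]];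
    [apply/mem_set; rewrite /= h1 h2|split => //; apply/mem_set].
have mH s : measurable (H s).
  (* At frequency 0 the cosine is 1, so the test function is the indicator itself. *)
  have [[mf _ _] _] := VH s 0.
  rewrite (_ : H s = (fun x => \1_(H s) x * cos (ip 0 x)) @^-1` [set 1]).
    by rewrite -[X in measurable X]setTI; apply: mf => //.
  apply/seteqP; split => x; rewrite /= (ip0l hB) cos0 mulr1 indicE.
    by move=> hx; rewrite mem_set.
  case: (boolP (x \in H s)) => [/set_mem//|_ /eqP].
  by rewrite eq_sym oner_eq0.
have eH s : mu (H s) = nu (H s).
  have [[_ _ e] _] := VH s 0.
  have E (m : probability (borel B) R) :
      m (H s) = (\int[m]_x (\1_(H s) x * cos (ip 0 x)))%R%:E.
    rewrite (_ : (fun x => _) = (fun x => \1_(H s) x)).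
      by rewrite /Rintegral integral_indic// setIT fineK// fin_num_measure.
    by apply/funext => x; rewrite (ip0l hB) cos0 mulr1.
  by rewrite !E e.
pose G : set (set B) := range H.
move=> A mA; apply: (@g_sigma_algebra_measure_unique _ R (borel B) G _
    (fun=> setT) _ _ mu nu).
- by move=> _ [s _ <-]; exact: mH.
- by move=> _; exists [::] => //; apply/seteqP.
- by rewrite bigcup_const//; exists 0%N.
- move=> _ _ [s _ <-] [t _ <-]; exists (s ++ t) => //.
  by apply/seteqP; split => x; rewrite /H/= all_cat => /andP.
- by move=> _ [s _ <-]; exact: eH.
- move=> _; have h : (mu setT < +oo)%E by rewrite probability_setT ltry.
  exact: h.
have mid : measurable_fun setT (idfun : g_sigma_algebraType G -> borel B).
  apply: (measurable_borelP hB) => y.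
  apply: (measurability _ (RGenCInfty.measurableE R)).
  move=> _ [_ [c ->] <-]; rewrite setTI; apply: sub_sigma_algebra.
  exists [:: (y, c)] => //; by apply/seteqP; split => x; rewrite /H/= in_itv/= !andbT.
by have := mid measurableT A mA; rewrite setTI.
Qed.

End characteristic_function.

(** * Poisson integrals *)

Section poisson_series.
Context {R : realType}.
Implicit Types a b x : R.

Lemma mvt_abs_le (f df : R -> R) (x : R) :
  (forall y, is_derive y (1:R) f (df y)) -> (forall y, `|df y| <= 1) ->
  `|f x - f 0| <= `|x|.
Proof.
move=> fd df1.
have cf y : {for y, continuous f}.
  by apply/differentiable_continuous/derivable1_diffP; case: (fd y).
have [x0|x0|->] := ltgtP x 0; last by rewrite subrr normr0.
- have [c _] := @MVT _ f df x 0 x0 (fun y _ => fd y) (continuous_in_subspaceT (fun y _ => cf y)).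
  rewrite distrC => ->; rewrite normrM sub0r normrN ler_piMl//.
- have [c _] := @MVT _ f df 0 x x0 (fun y _ => fd y) (continuous_in_subspaceT (fun y _ => cf y)).
  by move=> ->; rewrite normrM subr0 ler_piMl.
Qed.

Lemma sin_abs_le x : `|sin x| <= `|x|.
Proof.
by have := mvt_abs_le x (@is_derive_sin R) (@cos_max R); rewrite sin0 subr0.
Qed.

Lemma cosB1_abs_le x : `|cos x - 1| <= `|x|.
Proof.
have h (y : R) : `|- sin y| <= 1 by rewrite normrN sin_max.
by have := mvt_abs_le x (@is_derive_cos R) h; rewrite cos0.
Qed.

Lemma bounded_pseries_cvg (c : R^nat) x :
  (forall n, `|c n| <= 1) -> cvgn (pseries (fun n => c n / n`!%:R) x).
Proof.
move=> c1; apply: normed_cvg.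
apply: (@series_le_cvg _ _ (exp_coeff `|x|)).
- by move=> n /=.
- by move=> n; rewrite exp_coeffE/= mulr_ge0.
- move=> n /=; rewrite exp_coeffE normrM normrX ler_wpM2r ?exprn_ge0//.
  by rewrite normrM [X in _ * X <= _]ger0_norm ?invr_ge0// ler_piMl ?invr_ge0.
- exact: is_cvg_series_exp_coeff.
Qed.

Let cs b : R -> R := fun x => limn (pseries (fun n => cos (b * n%:R) / n`!%:R) x).
Let sn b : R -> R := fun x => limn (pseries (fun n => sin (b * n%:R) / n`!%:R) x).

Let diffsE (c : R^nat) : pseries_diffs (fun n => c n / n`!%:R) =
  (fun n => c n.+1 / n`!%:R).
Proof.
apply/funext => n; rewrite /pseries_diffs factS natrM invfM mulrCA.
by congr (_ * _); rewrite mulVKf.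
Qed.

Let is_derive_bounded (c : R^nat) x : (forall n, `|c n| <= 1) ->
  is_derive x (1:R) (fun x => limn (pseries (fun n => c n / n`!%:R) x))
    (limn (pseries (fun n => c n.+1 / n`!%:R) x)).
Proof.
move=> c1; rewrite -diffsE; apply: (@pseries_snd_diffs _ _ (`|x| + 1)).
- exact: bounded_pseries_cvg.
- by rewrite diffsE; exact: bounded_pseries_cvg.
- by rewrite !diffsE; exact: bounded_pseries_cvg.
- by rewrite [ltRHS]ger0_norm ?addr_ge0// ltrDl.
Qed.

Let pseries_lin (p q : R) (c e : R^nat) x :
  (forall n, `|c n| <= 1) -> (forall n, `|e n| <= 1) ->
  limn (pseries (fun n => (p * c n + q * e n) / n`!%:R) x) =
  p * limn (pseries (fun n => c n / n`!%:R) x) +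
  q * limn (pseries (fun n => e n / n`!%:R) x).
Proof.
move=> c1 e1; apply: cvg_lim => //.
rewrite (_ : pseries _ x = (fun n => p * pseries (fun n => c n / n`!%:R) x n +
   q * pseries (fun n => e n / n`!%:R) x n)).
  by apply: cvgD; apply: cvgMr; exact: bounded_pseries_cvg.
apply/funext => n; rewrite /pseries /series/= !mulr_sumr -big_split/=.
by apply: eq_bigr => i _; ring.
Qed.

Let is_derive_cs b x : is_derive x (1:R) (cs b) (cos b * cs b x + - sin b * sn b x).
Proof.
have := @is_derive_bounded (fun n => cos (b * n%:R)) x (fun n => cos_max _).
rewrite (_ : (fun n => cos (b * n.+1%:R) / n`!%:R) =
  fun n => (cos b * cos (b * n%:R) + - sin b * sin (b * n%:R)) / n`!%:R).
  by rewrite pseries_lin// => n; rewrite ?cos_max ?sin_max.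
by apply/funext => n; rewrite -nat1r mulrDr mulr1 cosD mulNr.
Qed.

Let is_derive_sn b x : is_derive x (1:R) (sn b) (sin b * cs b x + cos b * sn b x).
Proof.
have := @is_derive_bounded (fun n => sin (b * n%:R)) x (fun n => sin_max _).
rewrite (_ : (fun n => sin (b * n.+1%:R) / n`!%:R) =
  fun n => (sin b * cos (b * n%:R) + cos b * sin (b * n%:R)) / n`!%:R).
  by rewrite pseries_lin// => n; rewrite ?cos_max ?sin_max.
by apply/funext => n; rewrite -nat1r mulrDr mulr1 sinD.
Qed.

Let pseries_at0 (c : R^nat) : limn (pseries (fun n => c n / n`!%:R) 0) = c 0%N.
Proof.
apply: cvg_lim => //; apply: cvg_near_cst; exists 1%N => // -[//|n] _ /=.
rewrite /pseries /series/= big_nat_recl//= fact0 divr1 expr0 mulr1 big1 ?addr0//.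
by move=> i _; rewrite expr0n/= mulr0.
Qed.

(* [cs b + i sn b] is the power series of [exp (x e^{ib})]; both solve the same
   linear differential equation. *)
Let cs_snE b x : cs b x = expR (x * cos b) * cos (x * sin b) /\
                 sn b x = expR (x * cos b) * sin (x * sin b).
Proof.
pose E (y : R) := expR (- (y * cos b)).
pose C (y : R) := cos (y * sin b).
pose S (y : R) := sin (y * sin b).
have dE (y : R) : is_derive y (1:R) E (- cos b * E y).
  rewrite /E; apply: is_derive_eq.
  by rewrite /GRing.scale/= mulr1 mulrC; ring.
have dC (y : R) : is_derive y (1:R) C (- sin b * S y).
  rewrite /C /S; apply: is_derive_eq.
  by rewrite /GRing.scale/=; ring.
have dS (y : R) : is_derive y (1:R) S (sin b * C y).
  rewrite /C /S; apply: is_derive_eq.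
  by rewrite /GRing.scale/=; ring.
have F1 : E x * (cs b x * C x + sn b x * S x) = 1.
  have h (y : R) : is_derive y (1:R) (fun x => E x * (cs b x * C x + sn b x * S x)) 0.
    apply: (is_derive_eq (is_deriveM (dE y) (is_deriveD (is_deriveM
      (is_derive_cs b y) (dC y)) (is_deriveM (is_derive_sn b y) (dS y)))));
      rewrite /GRing.scale/= ?fctE; ring.
  have := is_derive_0_is_cst x 0 h; rewrite ?fctE => ->.
  rewrite /E /C /S !mul0r oppr0 expR0 cos0 sin0 mulr0 addr0 mulr1 mul1r.
  by rewrite /cs pseries_at0 mulr0 cos0.
have G0 : E x * (sn b x * C x - cs b x * S x) = 0.
  have h (y : R) : is_derive y (1:R) (fun x => E x * (sn b x * C x - cs b x * S x)) 0.
    apply: (is_derive_eq (is_deriveM (dE y) (is_deriveB (is_deriveM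
      (is_derive_sn b y) (dC y)) (is_deriveM (is_derive_cs b y) (dS y)))));
      rewrite /GRing.scale/= ?fctE; ring.
  have := is_derive_0_is_cst x 0 h; rewrite ?fctE => ->.
  rewrite /E /C /S !mul0r oppr0 expR0 cos0 sin0 mulr0 subr0 mulr1 mul1r.
  by rewrite /sn pseries_at0 mulr0 sin0.
have E0 : expR (x * cos b) * E x = 1.
  by rewrite /E expRN mulfV// gt_eqF// expR_gt0.
have CS : C x ^+ 2 + S x ^+ 2 = 1 by exact: cos2Dsin2.
split.
  transitivity (expR (x * cos b) * E x * (C x ^+ 2 + S x ^+ 2) * cs b x).
    by rewrite E0 CS !mul1r.
  transitivity (expR (x * cos b) * (C x * (E x * (cs b x * C x + sn b x * S x))
    - S x * (E x * (sn b x * C x - cs b x * S x)))); first by ring.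
  by rewrite F1 G0 mulr1 mulr0 subr0.
transitivity (expR (x * cos b) * E x * (C x ^+ 2 + S x ^+ 2) * sn b x).
  by rewrite E0 CS !mul1r.
transitivity (expR (x * cos b) * (S x * (E x * (cs b x * C x + sn b x * S x))
  + C x * (E x * (sn b x * C x - cs b x * S x)))); first by ring.
by rewrite F1 G0 mulr1 mulr0 addr0.
Qed.

(** Real part of the mean of [exp ((- a + i b) n)] under the Poisson law: once [expR (- l)] is taken
    out, what remains is the series [cs b] at [l * expR (- a)]. *)
Lemma poisson_cos_cvg l a b :
  series (fun n => expR (- a * n%:R) * cos (b * n%:R) *
    (l ^+ n / n`!%:R * expR (- l))) @ \oo -->
  expR (l * (expR (- a) * cos b - 1)) * cos (l * (expR (- a) * sin b)).
Proof.
have -> : expR (l * (expR (- a) * cos b - 1)) * cos (l * (expR (- a) * sin b)) =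
    expR (- l) * cs b (l * expR (- a)).
  by rewrite (cs_snE _ _).1 mulrA -expRD; congr (expR _ * cos _); ring.
rewrite (_ : series _ = fun n => expR (- l) *
    pseries (fun n => cos (b * n%:R) / n`!%:R) (l * expR (- a)) n).
  by apply: cvgMr; apply: bounded_pseries_cvg => n; exact: cos_max.
apply/funext => n; rewrite /pseries /series/= mulr_sumr; apply: eq_bigr => i _.
by rewrite mulrC (mulrC (- a)) expRM_natl exprMn; ring.
Qed.

Lemma poisson_sin_cvg l a b :
  series (fun n => expR (- a * n%:R) * sin (b * n%:R) *
    (l ^+ n / n`!%:R * expR (- l))) @ \oo -->
  expR (l * (expR (- a) * cos b - 1)) * sin (l * (expR (- a) * sin b)).
Proof.
have -> : expR (l * (expR (- a) * cos b - 1)) * sin (l * (expR (- a) * sin b)) =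
    expR (- l) * sn b (l * expR (- a)).
  by rewrite (cs_snE _ _).2 mulrA -expRD; congr (expR _ * sin _); ring.
rewrite (_ : series _ = fun n => expR (- l) *
    pseries (fun n => sin (b * n%:R) / n`!%:R) (l * expR (- a)) n).
  by apply: cvgMr; apply: bounded_pseries_cvg => n; exact: sin_max.
apply/funext => n; rewrite /pseries /series/= mulr_sumr; apply: eq_bigr => i _.
by rewrite mulrC (mulrC (- a)) expRM_natl exprMn; ring.
Qed.

End poisson_series.

Section complex_exponential.
Context {R : realType}.
Implicit Types a b x : R.

(* Real and imaginary parts of [exp ((- a + i b) x)]. *)
Definition ec a b x := expR (- (a * x)) * cos (b * x).
Definition es a b x := expR (- (a * x)) * sin (b * x).

Lemma ec0 a b : ec a b 0 = 1.
Proof. by rewrite /ec !mulr0 oppr0 expR0 cos0 mulr1. Qed.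

Lemma es0 a b : es a b 0 = 0.
Proof. by rewrite /es !mulr0 oppr0 expR0 sin0 mulr0. Qed.

Lemma ec00 x : ec 0 0 x = 1.
Proof. by rewrite /ec !mul0r oppr0 expR0 cos0 mulr1. Qed.

Lemma es00 x : es 0 0 x = 0.
Proof. by rewrite /es !mul0r sin0 mulr0. Qed.

Lemma ecD a b x y : ec a b (x + y) = ec a b x * ec a b y - es a b x * es a b y.
Proof. by rewrite /ec /es !mulrDr opprD expRD cosD; ring. Qed.

Lemma esD a b x y : es a b (x + y) = es a b x * ec a b y + ec a b x * es a b y.
Proof. by rewrite /ec /es !mulrDr opprD expRD sinD; ring. Qed.

Lemma ec_le1 a b x : 0 <= a * x -> `|ec a b x| <= 1.
Proof.
move=> ax; rewrite /ec normrM ger0_norm ?expR_ge0// mulr_ile1 ?expR_ge0 ?cos_max//.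
by rewrite expR_le1 oppr_le0.
Qed.

Lemma es_le1 a b x : 0 <= a * x -> `|es a b x| <= 1.
Proof.
move=> ax; rewrite /es normrM ger0_norm ?expR_ge0// mulr_ile1 ?expR_ge0 ?sin_max//.
by rewrite expR_le1 oppr_le0.
Qed.

(** Near 0 the function is Lipschitz with constant [|a| + |b|], and its distance to 1 is at most 2
    everywhere. The bound is by the function that Levy measures integrate; the sign condition bears
    on [a * x] so that [a = 0] admits every real [x]. *)
Lemma ecB1_le a b x : 0 <= a * x ->
  `|ec a b x - 1| <= (`|a| + `|b| + 2) * Num.min `|x| 1.
Proof.
move=> ax.
have h2 : `|ec a b x - 1| <= 2.
  by rewrite (le_trans (ler_normB _ _))// normr1 -[leRHS]/(1 + 1) lerD2r ec_le1.
have h1 : `|ec a b x - 1| <= (`|a| + `|b|) * `|x|.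
  have -> : ec a b x - 1 =
      expR (- (a * x)) * (cos (b * x) - 1) + (expR (- (a * x)) - 1).
    by rewrite /ec; ring.
  rewrite (le_trans (ler_normD _ _))// mulrDl addrC lerD//.
    rewrite ler0_norm ?subr_le0 ?expR_le1 ?oppr_le0// opprB lerBlDr -lerBlDl.
    rewrite (le_trans _ (expR_ge1Dx _))// lerD2l lerN2 -normrM.
    exact: ler_norm.
  rewrite normrM -[leRHS]mul1r; apply: ler_pM => //.
    by rewrite ger0_norm ?expR_ge0// expR_le1 oppr_le0.
  by rewrite -normrM cosB1_abs_le.
have [x1|x1] := leP `|x| 1.
  by rewrite (le_trans h1)// ler_wpM2r// lerDl.
by rewrite mulr1 (le_trans h2)// lerDr addr_ge0.
Qed.

Lemma es_le a b x : 0 <= a * x ->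
  `|es a b x| <= (`|a| + `|b| + 2) * Num.min `|x| 1.
Proof.
move=> ax; have h2 := es_le1 b ax.
have h1 : `|es a b x| <= `|b| * `|x|.
  rewrite /es normrM -[leRHS]mul1r; apply: ler_pM => //.
    by rewrite ger0_norm ?expR_ge0// expR_le1 oppr_le0.
  by rewrite -normrM sin_abs_le.
have [x1|x1] := leP `|x| 1.
  by rewrite (le_trans h1)// ler_wpM2r// addrAC lerDr addr_ge0.
by rewrite mulr1 (le_trans h2)//; have := normr_ge0 a; have := normr_ge0 b; lra.
Qed.

Lemma continuous_ec a b : continuous (ec a b).
Proof.
move=> x; apply: cvgM.
  apply: (@continuous_comp _ _ _ (fun x => - (a * x)) expR).
    by apply: cvgN; apply: cvgMr; exact: cvg_id.
  exact: continuous_expR.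
apply: (@continuous_comp _ _ _ (fun x => b * x) cos).
  by apply: cvgMr; exact: cvg_id.
exact: continuous_cos.
Qed.

Lemma continuous_es a b : continuous (es a b).
Proof.
move=> x; apply: cvgM.
  apply: (@continuous_comp _ _ _ (fun x => - (a * x)) expR).
    by apply: cvgN; apply: cvgMr; exact: cvg_id.
  exact: continuous_expR.
apply: (@continuous_comp _ _ _ (fun x => b * x) sin).
  by apply: cvgMr; exact: cvg_id.
exact: continuous_sin.
Qed.

Lemma poisson_ec_cvg (l a b : R) :
  series (fun n => ec a b n%:R * (l ^+ n / n`!%:R * expR (- l))) @ \oo -->
  expR (l * (ec a b 1 - 1)) * cos (l * es a b 1).
Proof.
have := @poisson_cos_cvg R l a b; rewrite /ec /es !mulr1.
by under eq_fun do rewrite mulNr.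
Qed.

Lemma poisson_es_cvg (l a b : R) :
  series (fun n => es a b n%:R * (l ^+ n / n`!%:R * expR (- l))) @ \oo -->
  expR (l * (ec a b 1 - 1)) * sin (l * es a b 1).
Proof.
have := @poisson_sin_cvg R l a b; rewrite /ec /es !mulr1.
by under eq_fun do rewrite mulNr.
Qed.

Lemma ecM a b c x : ec (a * c) (b * c) x = ec a b (c * x).
Proof. by rewrite /ec !mulrA. Qed.

Lemma esM a b c x : es (a * c) (b * c) x = es a b (c * x).
Proof. by rewrite /es !mulrA. Qed.

End complex_exponential.

Section poisson_law.
Context d (Omega : measurableType d) (R : realType) (P : probability Omega R).
Variables (X : Omega -> \bar R) (l : R).
Hypothesis mX : measurable_fun setT X.
Let pmf n : R := l ^+ n / n`!%:R * expR (- l).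
Let Z n := [set w | X w = n%:R%:E].
Hypothesis lawX : forall n, P (Z n) = (pmf n)%:E.

Lemma measurable_eq_nat n : measurable (Z n).
Proof.
rewrite (_ : Z n = setT `&` X @^-1` [set n%:R%:E]); last by rewrite setTI.
by apply: mX => //; exact: emeasurable_set1.
Qed.

Lemma poisson_eq_inj w m n : Z m w -> Z n w -> m = n.
Proof. by rewrite /Z/= => -> [] /eqP; rewrite eqr_nat => /eqP. Qed.

Let trivZ : trivIset setT Z.
Proof. by move=> m n _ _ [w [mw nw]]; exact: poisson_eq_inj mw nw. Qed.

Lemma poisson_ae_nat : {ae P, forall w, exists n : nat, X w = n%:R%:E}.
Proof.
have mU : measurable (\bigcup_n Z n).
  by apply: bigcupT_measurable => n; exact: measurable_eq_nat.
exists (~` \bigcup_n Z n); split; first exact: measurableC.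
  rewrite [LHS]probability_setC//.
  rewrite measure_bigcup//=; last by move=> n _; exact: measurable_eq_nat.
  rewrite (_ : \sum_(_ <oo | _) _ = 1)%E ?subee//.
  apply: cvg_lim => //.
  rewrite (_ : (fun n => _) = EFin \o series (fun n => ec 0 0 n%:R * pmf n)).
    (* At [a = b = 0] the mean is that of the constant 1, so the masses sum to 1. *)
    have := @poisson_ec_cvg R l 0 0; rewrite ec00 es00 subrr !mulr0 expR0 cos0 mulr1.
    by move=> ?; apply: cvg_EFin => //; exact: nearW.
  apply/funext => n /=; rewrite /series/= -sumEFin; apply: eq_big => [i|i _].
    by rewrite mem_set.
  by rewrite lawX ec00 mul1r.
by move=> w /=; apply: contra_not => -[n _ Zn]; exists n.
Qed.

(** The factor [G] decouples from each event [Z n]. Truncating [psi] to the first values of [X]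
    makes the identity a finite sum, and domination removes the truncation. This is how one Poisson
    variable is integrated out in the presence of others. *)
Lemma poisson_integral_mul (G psi : Omega -> R) (phi : nat -> R) (M M' kappa s : R) :
  measurable_fun setT G -> (forall w, `|G w| <= M) ->
  (forall n, (\int[P]_w (G w * \1_(Z n) w) = kappa * pmf n)%R) ->
  measurable_fun setT psi -> (forall w, `|psi w| <= M') ->
  (forall n w, Z n w -> psi w = phi n) ->
  series (fun n => phi n * pmf n) @ \oo --> s ->
  (\int[P]_w (G w * psi w) = kappa * s)%R.
Proof.
move=> mG GM GZ mpsi psiM psiE cs.
have M0 : 0 <= M by rewrite (le_trans _ (GM point)).
have M'0 : 0 <= M' by rewrite (le_trans _ (psiM point)).
have mZ n : measurable_fun setT (\1_(Z n) : Omega -> R).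
  exact/measurable_indicP/measurable_eq_nat.
pose psi_ K w := \sum_(n < K) phi n * \1_(Z n) w.
have psi_Z K n w : Z n w -> psi_ K w = if (n < K)%N then psi w else 0.
  move=> Znw; rewrite /psi_; have h i : i != n -> \1_(Z i) w = 0 :> R.
    move=> ni; rewrite indicE memNset// => Zi; move/eqP: ni; apply.
    exact: poisson_eq_inj Zi Znw.
  case: ltnP => nK.
    rewrite (bigD1 (Ordinal nK))//= big1 ?addr0; first last.
      by move=> i; rewrite -val_eqE/= => ni; rewrite h ?mulr0.
    by rewrite indicE mem_set// mulr1 -(psiE _ _ Znw).
  by rewrite big1// => i _; rewrite h ?mulr0// ltn_eqF// (leq_trans (ltn_ord i)).
have psi_N K w : (forall n, ~ Z n w) -> psi_ K w = 0.
  by move=> h; rewrite /psi_ big1// => i _; rewrite indicE memNset ?mulr0.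
have psi_le K w : `|psi_ K w| <= M'.
  have [[n Zn]|/forallNP h] := pselect (exists n, Z n w).
    by rewrite (psi_Z _ _ _ Zn); case: ifPn; rewrite ?normr0.
  by rewrite psi_N ?normr0.
have mpsi_ K : measurable_fun setT (psi_ K).
  by apply: measurable_sum => i; apply: measurable_funM => //; exact: measurable_cst.
have L : (\int[P]_w (G w * psi_ K w))%R @[K --> \oo] --> (\int[P]_w (G w * psi w))%R.
  apply: (dominated_cvgR (g := fun=> M * M') _ _ _ _ _ _).2 => //.
  - by move=> n; exact: measurable_funM.
  - exact: measurable_funM.
  - apply: filterS poisson_ae_nat => w [n Zn] _; apply: cvgMr.
    by apply: cvg_near_cst; exists n.+1 => // k /= nk; rewrite (psi_Z _ _ _ Zn) nk.
  - by apply: (@bounded_integrable_prob _ _ _ _ _ `|M * M'|).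
  - by move=> n w _; rewrite normrM ler_pM.
apply: (cvg_unique _ L) => //.
rewrite (_ : (fun K => _) = (fun K => kappa * series (fun n => phi n * pmf n) K)).
  exact: cvgMr.
apply/funext => K; rewrite /series/= mulr_sumr big_mkord.
transitivity (\int[P]_w (\sum_(i < K) (phi i * (G w * \1_(Z i) w))))%R.
  apply: eq_Rintegral => w _; rewrite /psi_ mulr_sumr.
  by apply: eq_bigr => i _; ring.
have iG i : P.-integrable setT (EFin \o (fun w => G w * \1_(Z i) w)).
  apply: (@bounded_integrable_prob _ _ _ _ _ M); first exact: measurable_funM.
  move=> w; rewrite normrM -[leRHS]mulr1 ler_pM// indicE normr_nat.
  by rewrite lern1 leq_b1.
elim: K => [|K ih].
  under eq_Rintegral do rewrite big_ord0.
  by rewrite big_ord0 Rintegral_cst// mul0r.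
under eq_Rintegral do rewrite big_ord_recr.
rewrite big_ord_recr RintegralD//=.
- by rewrite ih RintegralZl// GZ; congr (_ + _); ring.
- rewrite (_ : _ \o _ = (fun w => \sum_(i <- enum 'I_K) (phi i * (G w * \1_(Z i) w))%R%:E)%E).
    apply: integrable_sum => // i _.
    rewrite (_ : (fun x => _) = fun w => (phi i)%:E * (EFin \o (fun w => (G w * \1_(Z i) w)%R)) w)%E//.
    exact: integrableZl.
  by apply/funext => w; rewrite /= big_enum/= sumEFin.
- rewrite (_ : _ \o _ = fun w => (phi K)%:E * (EFin \o (fun w => (G w * \1_(Z K) w)%R)) w)%E//.
  exact: integrableZl.
Qed.

End poisson_law.

Section poisson_simple.
Context d (Omega : measurableType d) (R : realType) (P : probability Omega R).
Context d' (T : measurableType d') (N : R.-ker Omega ~> T).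
Variable lam : {measure set T -> \bar R}.
Hypothesis prm : poisson_random_measure P N lam.
Variables (n : nat) (E : 'I_n -> set T).
Hypotheses (mE : forall i, measurable (E i)) (tE : trivIset setT E).
Hypothesis finE : forall i, (lam (E i) < +oo)%E.
Variables (v : 'I_n -> R) (a b : R).
Hypothesis av : forall i, 0 <= a * v i.

Let X i w := N w (E i).
Let l i := fine (lam (E i)).
Let Z i (k : nat) := [set w | X i w = k%:R%:E].
Let S (t : seq 'I_n) w := \sum_(i <- t) v i * fine (X i w).
Let pmf i k : R := l i ^+ k / k`!%:R * expR (- l i).
Let kc t := expR (\sum_(i <- t) l i * (ec a b (v i) - 1)) *
            cos (\sum_(i <- t) l i * es a b (v i)).
Let ks t := expR (\sum_(i <- t) l i * (ec a b (v i) - 1)) *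
            sin (\sum_(i <- t) l i * es a b (v i)).
Let I s (m : 'I_n -> nat) w : R := \prod_(i <- s) \1_(Z i (m i)) w.

Let mX i : measurable_fun setT (X i).
Proof. exact: measurable_kernel. Qed.

Let mx i : measurable_fun setT (fun w => fine (X i w)).
Proof. exact: measurableT_comp. Qed.

Let lawX i k : P (Z i k) = (pmf i k)%:E.
Proof. by case: prm => + _ _; apply. Qed.

Let mZ i k : measurable (Z i k).
Proof. exact: measurable_eq_nat. Qed.

Let mS t : measurable_fun setT (S t).
Proof.
by apply: measurable_sum => i; apply: measurable_funM => //; exact: measurable_cst.
Qed.

Let mI s m : measurable_fun setT (I s m).
Proof.
rewrite /I; elim: s => [|i s ih].
  by under eq_fun do rewrite big_nil; exact: measurable_cst.
by under eq_fun do rewrite big_cons; apply: measurable_funM.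
Qed.

Let I_le1 s m w : `|I s m w| <= 1.
Proof.
rewrite /I normr_prod; elim: s => [|i s ih]; first by rewrite big_nil.
by rewrite big_cons mulr_ile1 ?prodr_ge0// indicE normr_nat lern1 leq_b1.
Qed.

Let aS t w : 0 <= a * S t w.
Proof.
by rewrite mulr_sumr sumr_ge0// => i _; rewrite mulrA mulr_ge0// fine_ge0.
Qed.

Let mec (f : Omega -> R) : measurable_fun setT f -> measurable_fun setT (fun w => ec a b (f w)).
Proof.
move=> mf; apply: measurableT_comp => //.
by apply: continuous_measurable_fun; exact: continuous_ec.
Qed.

Let mes (f : Omega -> R) : measurable_fun setT f -> measurable_fun setT (fun w => es a b (f w)).
Proof.
move=> mf; apply: measurableT_comp => //.
by apply: continuous_measurable_fun; exact: continuous_es.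
Qed.

Let int_I s m : uniq s -> (\int[P]_w I s m w = \prod_(i <- s) pmf i (m i))%R.
Proof.
move=> us.
have -> : I s m = \1_(\bigcap_(i in [set` s]) (X i @^-1` [set (m i)%:R%:E])).
  apply/funext => w; rewrite /I; elim: s {us} => [|i s ih].
    by rewrite big_nil indicE mem_set// => i.
  rewrite big_cons ih !indicE -natrM mulnb; congr ((nat_of_bool _)%:R).
  apply/andP/idP.
    move=> [/set_mem/= zi /set_mem/= h]; apply/mem_set => j /=.
    by rewrite inE => /predU1P[->//|js]; exact: h.
  move=> /set_mem/= h; split; apply/mem_set.
    by apply: h; rewrite /= inE eqxx.
  by move=> j js; apply: h; rewrite /= inE js orbT.
have [_ _ /(_ n E mE tE s (fun i => [set (m i)%:R%:E]) us) ind] := prm.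
rewrite /Rintegral integral_indic// ?setIT.
  transitivity (fine (\prod_(i <- s) (pmf i (m i))%:E)); last by rewrite prodEFin.
  congr fine; transitivity (\prod_(i <- s) P (Z i (m i)))%E.
    by apply: ind => i; exact: emeasurable_set1.
  by apply: eq_bigr => i _; exact: lawX.
by apply: fin_bigcap_measurable => // i _; exact: mZ.
Qed.

(** Independence is given on events, so all variables start as indicators [I s m]. The induction
    turns them one by one into exponentials; the variables in [s] stay frozen at the values [m],
    which is what [poisson_integral_mul] requires of its factor. *)
Let step t : forall s m, uniq (t ++ s) ->
  (\int[P]_w (ec a b (S t w) * I s m w) = kc t * \prod_(i <- s) pmf i (m i))%R /\
  (\int[P]_w (es a b (S t w) * I s m w) = ks t * \prod_(i <- s) pmf i (m i))%R.
Proof.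
elim: t => [|i t ih] s m us.
  rewrite /S /kc /ks !big_nil expR0 cos0 sin0 mulr1 mul1r mulr0 mul0r.
  split.
    under eq_Rintegral do rewrite big_nil ec0 mul1r.
    exact: int_I.
  under eq_Rintegral do rewrite big_nil es0 mul0r.
  by rewrite Rintegral_cst// mul0r.
have [/= its /= uts] := andP us.
have mi s' m' k : i \notin s' -> I s' (fun j => if j == i then k else m' j) = I s' m'.
  move=> is'; apply/funext => w; rewrite /I; apply: eq_big_seq => j js.
  by case: eqP => // ji; rewrite -ji js in is'.
have pi s' m' k : i \notin s' ->
    \prod_(j <- s') pmf j (if j == i then k else m' j) = \prod_(j <- s') pmf j (m' j).
  move=> is'; apply: eq_big_seq => j js.
  by case: eqP => // ji; rewrite -ji js in is'.
have is_ : i \notin s by apply: contra its; rewrite mem_cat => ->; rewrite orbT.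
have uti : uniq (t ++ i :: s).
  by move: us; rewrite /= -cat_rcons -cats1 -catA uniq_catCA.
pose C w := ec a b (S t w) * I s m w.
pose Q w := es a b (S t w) * I s m w.
have C1 w : `|C w| <= 1 by rewrite /C normrM mulr_ile1 ?ec_le1.
have Q1 w : `|Q w| <= 1 by rewrite /Q normrM mulr_ile1 ?es_le1.
have mC : measurable_fun setT C by apply: measurable_funM => //; exact: mec.
have mQ : measurable_fun setT Q by apply: measurable_funM => //; exact: mes.
have IE k w : I (i :: s) (fun j => if j == i then k else m j) w =
    I s m w * \1_(Z i k) w.
  by rewrite {1}/I big_cons eqxx -/(I s _ w) mi// mulrC.
have CZ k : (\int[P]_w (C w * \1_(Z i k) w) =
    (kc t * \prod_(i <- s) pmf i (m i)) * pmf i k)%R.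
  have [+ _] := ih (i :: s) (fun j => if j == i then k else m j) uti.
  under eq_Rintegral do rewrite IE mulrA.
  by rewrite /C => ->; rewrite big_cons eqxx pi// mulrCA mulrC.
have QZ k : (\int[P]_w (Q w * \1_(Z i k) w) =
    (ks t * \prod_(i <- s) pmf i (m i)) * pmf i k)%R.
  have [_ +] := ih (i :: s) (fun j => if j == i then k else m j) uti.
  under eq_Rintegral do rewrite IE mulrA.
  by rewrite /Q => ->; rewrite big_cons eqxx pi// mulrCA mulrC.
pose xi w := v i * fine (X i w).
have axi w : 0 <= a * xi w.
  by rewrite mulrA mulr_ge0// fine_ge0// measure_ge0.
have mxi : measurable_fun setT xi.
  by apply: measurable_funM => //; exact: measurable_cst.
have ZE k w : Z i k w -> xi w = v i * k%:R by rewrite /xi /Z/= => ->.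
pose ei := expR (l i * (ec a b (v i) - 1)).
have sc : series (fun k => ec a b (v i * k%:R) * pmf i k) @ \oo -->
    ei * cos (l i * es a b (v i)).
  have := @poisson_ec_cvg R (l i) (a * v i) (b * v i); rewrite ecM esM mulr1.
  by under eq_fun do rewrite ecM.
have ss : series (fun k => es a b (v i * k%:R) * pmf i k) @ \oo -->
    ei * sin (l i * es a b (v i)).
  have := @poisson_es_cvg R (l i) (a * v i) (b * v i); rewrite ecM esM mulr1.
  by under eq_fun do rewrite esM.
have pc (G : Omega -> R) kappa : measurable_fun setT G -> (forall w, `|G w| <= 1) ->
    (forall k, (\int[P]_w (G w * \1_(Z i k) w) = kappa * pmf i k)%R) ->
    (\int[P]_w (G w * ec a b (xi w)) = kappa * (ei * cos (l i * es a b (v i))))%R.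
  move=> mG G1 GZ.
  apply: (@poisson_integral_mul _ _ _ P (X i) (l i) (mX i) (lawX i) G
    (fun w => ec a b (xi w)) (fun k => ec a b (v i * k%:R)) 1 1 kappa _ mG G1 GZ
    (mec mxi) (fun w => ec_le1 b (axi w)) _ sc).
  by move=> k w /ZE ->.
have ps (G : Omega -> R) kappa : measurable_fun setT G -> (forall w, `|G w| <= 1) ->
    (forall k, (\int[P]_w (G w * \1_(Z i k) w) = kappa * pmf i k)%R) ->
    (\int[P]_w (G w * es a b (xi w)) = kappa * (ei * sin (l i * es a b (v i))))%R.
  move=> mG G1 GZ.
  apply: (@poisson_integral_mul _ _ _ P (X i) (l i) (mX i) (lawX i) G
    (fun w => es a b (xi w)) (fun k => es a b (v i * k%:R)) 1 1 kappa _ mG G1 GZ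
    (mes mxi) (fun w => es_le1 b (axi w)) _ ss).
  by move=> k w /ZE ->.
have iGf (G f : Omega -> R) : measurable_fun setT G -> measurable_fun setT f ->
    (forall w, `|G w| <= 1) -> (forall w, `|f w| <= 1) ->
    P.-integrable setT (EFin \o (fun w => G w * f w)).
  move=> mG mf G1 f1; apply: (@bounded_integrable_prob _ _ _ _ _ 1).
    exact: measurable_funM.
  by move=> w; rewrite normrM mulr_ile1.
have SE w : S (i :: t) w = xi w + S t w by rewrite /S big_cons.
have iec (G : Omega -> R) : measurable_fun setT G -> (forall w, `|G w| <= 1) ->
    P.-integrable setT (EFin \o (fun w => G w * ec a b (xi w))).
  by move=> mG G1; apply: iGf => //; [exact: mec|move=> w; exact: ec_le1].
have ies (G : Omega -> R) : measurable_fun setT G -> (forall w, `|G w| <= 1) ->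
    P.-integrable setT (EFin \o (fun w => G w * es a b (xi w))).
  by move=> mG G1; apply: iGf => //; [exact: mes|move=> w; exact: es_le1].
split.
  transitivity (\int[P]_w (C w * ec a b (xi w) - Q w * es a b (xi w)))%R.
    by apply: eq_Rintegral => w _; rewrite SE ecD /C /Q; ring.
  rewrite RintegralB//; [|exact: iec|exact: ies].
  rewrite (pc _ _ mC C1 CZ) (ps _ _ mQ Q1 QZ) /kc /ks /ei !big_cons expRD cosD.
  ring.
transitivity (\int[P]_w (C w * es a b (xi w) + Q w * ec a b (xi w)))%R.
  by apply: eq_Rintegral => w _; rewrite SE esD /C /Q; ring.
rewrite RintegralD//; [|exact: ies|exact: iec].
rewrite (ps _ _ mC C1 CZ) (pc _ _ mQ Q1 QZ) /kc /ks /ei !big_cons expRD sinD.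
ring.
Qed.

Lemma prm_simple :
  (\int[P]_w ec a b (\sum_i v i * fine (N w (E i))) =
    expR (\sum_i fine (lam (E i)) * (ec a b (v i) - 1)) *
    cos (\sum_i fine (lam (E i)) * es a b (v i)))%R /\
  (\int[P]_w es a b (\sum_i v i * fine (N w (E i))) =
    expR (\sum_i fine (lam (E i)) * (ec a b (v i) - 1)) *
    sin (\sum_i fine (lam (E i)) * es a b (v i)))%R.
Proof.
have /step : uniq (index_enum 'I_n ++ [::]) by rewrite cats0 index_enum_uniq.
move=> /(_ (fun=> 0%N))[hc hs]; split.
  move: hc; rewrite big_nil mulr1; apply: etrans.
  by apply: eq_Rintegral => w _; rewrite /I big_nil mulr1.
move: hs; rewrite big_nil mulr1; apply: etrans.
by apply: eq_Rintegral => w _; rewrite /I big_nil mulr1.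
Qed.

End poisson_simple.

Lemma ge0_integral_ae_lty d (T : measurableType d) (R : realType)
    (mu : {measure set T -> \bar R}) (f : T -> \bar R) :
  measurable_fun setT f -> (forall x, (0 <= f x)%E) ->
  (\int[mu]_x f x < +oo)%E -> {ae mu, forall x, (f x < +oo)%E}.
Proof.
move=> mf f0 fi.
have : mu.-integrable setT f.
  by apply/integrableP; split => //; under eq_integral do rewrite gee0_abs//.
move=> /(integrable_ae measurableT); apply: filterS => x /(_ I).
by rewrite ge0_fin_numE.
Qed.

Section poisson_finiteness.
Context d (Omega : measurableType d) (R : realType) (P : probability Omega R).
Context d' (T : measurableType d') (N : R.-ker Omega ~> T).
Variable lam : {measure set T -> \bar R}.
Hypothesis prm : poisson_random_measure P N lam.
Local Open Scope ereal_scope.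

Let mN E : measurable E -> measurable_fun setT (N ^~ E).
Proof. exact: measurable_kernel. Qed.

Let lawN E k : measurable E -> lam E < +oo ->
  P [set w | N w E = k%:R%:E] =
  (fine (lam E) ^+ k / k`!%:R * expR (- fine (lam E)))%R%:E.
Proof. by case: prm => h _ _ mE Ey; exact: h. Qed.

Lemma prm_ae_nat E : measurable E -> lam E < +oo ->
  {ae P, forall w, exists n : nat, N w E = n%:R%:E}.
Proof.
by move=> mE Ey; apply: (poisson_ae_nat (mN mE)) => n; exact: lawN.
Qed.

Lemma prm_ae_lty E : measurable E -> lam E < +oo -> {ae P, forall w, N w E < +oo}.
Proof.
move=> mE Ey; apply: filterS (prm_ae_nat mE Ey) => w [n ->].
by rewrite ltry.
Qed.

Lemma prm_ae0 E : measurable E -> lam E = 0 -> {ae P, forall w, N w E = 0}.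
Proof.
move=> mE E0.
have mZ : measurable [set w | N w E = 0].
  rewrite (_ : [set _ | _] = setT `&` (N ^~ E) @^-1` [set 0]); last by rewrite setTI.
  by apply: mN => //; exact: emeasurable_set1.
exists (~` [set w | N w E = 0]); split => //; first exact: measurableC.
have := @lawN E 0%N mE; rewrite E0 => /(_ (ltry _)).
rewrite expr0 fact0 divr1 oppr0 expR0 mulr1 => h.
by rewrite [LHS]probability_setC// h subee.
Qed.

(** As [N w E] is a.s. a natural number, the mean is a series whose partial sums are [l * exp (- l)]
    times partial sums of the exponential series at [l]. *)
Lemma prm_mean_le E : measurable E -> \int[P]_w N w E <= lam E.
Proof.
move=> mE; have [->|Ey'] := eqVneq (lam E) +oo; first exact: leey.
have Ey : lam E < +oo by rewrite ltey.
pose l := fine (lam E).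
have lE : lam E = l%:E by rewrite fineK// ge0_fin_numE.
pose Z n := [set w | N w E = n%:R%:E].
have mZ n : measurable (Z n) by exact: (measurable_eq_nat (mN mE)).
have mU : measurable (\bigcup_n Z n) by exact: bigcupT_measurable.
have tZ : trivIset setT Z.
  move=> m n _ _ [w [mw nw]]; by move: mw nw; rewrite /Z/= => -> [] /eqP; rewrite eqr_nat => /eqP.
have [U [mU' U0 hU]] := prm_ae_nat mE Ey.
have NU : P (~` \bigcup_n Z n) = 0.
  apply/eqP; rewrite -measure_le0 -U0 le_measure ?inE//; first exact: measurableC.
  apply: subset_trans hU => w /= h [n Zn]; apply: h; by exists n.
rewrite (ge0_negligible_integral _ _ _ _ NU)//; first last.
- exact: mN.
- exact: measurableC.
rewrite setTD setCK ge0_integral_bigcup//; last first.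
  by apply: measurable_funTS; exact: mN.
apply: lime_le.
  by apply: is_cvg_nneseries => n _ _; exact: integral_ge0.
apply: nearW => K.
rewrite lE (eq_bigr (fun n => (n%:R * (l ^+ n / n`!%:R * expR (- l)))%R%:E)).
  rewrite sumEFin lee_fin.
  have l0 : (0 <= l)%R by rewrite fine_ge0.
  case: K => [|K]; first by rewrite big_nil.
  rewrite big_nat_recl// mul0r add0r.
  rewrite (eq_bigr (fun i => (l * expR (- l)) * exp_coeff l i)%R); last first.
    move=> i _; rewrite /exp_coeff/= factS natrM invfM exprS.
    set u := (i.+1%:R)%R; set v := (i`!%:R^-1)%R; set e := expR _.
    transitivity ((u * u^-1) * (l * e * (l ^+ i * v)))%R; first by ring.
    by rewrite mulfV ?mul1r// /u pnatr_eq0.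
  rewrite -mulr_sumr -mulrA ler_piMr// expRN mulrC ler_pdivrMr ?expR_gt0// mul1r.
  apply: nondecreasing_cvgn_le; last exact: is_cvg_series_exp_coeff.
  apply: nondecreasing_series => i _ _; by rewrite /exp_coeff/= divr_ge0 ?exprn_ge0.
move=> n _; rewrite (eq_integral (cst n%:R%:E)); last by move=> w /set_mem.
by rewrite integral_cst// [X in _ * X](lawN n mE Ey) -EFinM.
Qed.

Lemma measurable_prm_integral (f : T -> \bar R) :
  measurable_fun setT f -> (forall x, 0 <= f x) ->
  measurable_fun setT (fun w => \int[N w]_x f x).
Proof.
by move=> mf f0; apply: measurable_fun_integral_kernel => // U; exact: mN.
Qed.

Import HBNNSimple.

Lemma prm_mean_integral_le (f : T -> \bar R) :
  measurable_fun setT f -> (forall x, 0 <= f x) ->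
  \int[P]_w \int[N w]_x f x <= \int[lam]_x f x.
Proof.
move=> mf f0; pose g := nnsfun_approx measurableT mf.
have gf x : EFin \o g^~ x @ \oo --> f x by exact: cvg_nnsfun_approx.
have ndg : nondecreasing_seq (g : (T -> R)^nat) by exact: nd_nnsfun_approx.
have ndg' x : nondecreasing_seq (g^~ x).
  by move=> m n /ndg /lefP.
have mg n : measurable_fun setT (EFin \o g n).
  exact/measurable_EFinP.
have g0 n x : 0 <= (EFin \o g n) x by rewrite lee_fin.
have limE (m : {measure set T -> \bar R}) :
    \int[m]_x f x = limn (fun n => \int[m]_x (EFin \o g n) x).
  rewrite -monotone_convergence//; last by move=> x _ i j ij; rewrite lee_fin ndg'.
  by apply: eq_integral => x _; apply/esym/cvg_lim => //; exact: gf.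
rewrite (eq_integral (fun w => limn (fun n => \int[N w]_x (EFin \o g n) x))); last first.
  by move=> w _; exact: limE.
rewrite monotone_convergence//; first last.
- move=> w _ i j ij; apply: ge0_le_integral => // x _.
  by rewrite lee_fin ndg'.
- by move=> n w _; exact: integral_ge0.
- by move=> n; exact: measurable_prm_integral.
apply: lime_le.
  apply: ereal_nondecreasing_is_cvgn => i j ij; apply: ge0_le_integral => //.
  - by move=> w _; exact: integral_ge0.
  - exact: measurable_prm_integral.
  - exact: measurable_prm_integral.
  - move=> w _; apply: ge0_le_integral => // x _.
    by rewrite lee_fin ndg'.
apply: nearW => n.
apply: (@le_trans _ _ (\int[lam]_x (EFin \o g n) x)); last first.
  apply: ge0_le_integral => // x _.
  apply: (cvge_to_ge (gf x)); exists n => // k /= nk.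
  by rewrite lee_fin ndg'.
have sE (m : {measure set T -> \bar R}) :
    \int[m]_x (EFin \o g n) x = \sum_(x \in range (g n)) x%:E * m (g n @^-1` [set x]).
  by rewrite integralT_nnsfun sintegralE.
rewrite sE (eq_integral (fun w => \sum_(x \in range (g n)) x%:E * N w (g n @^-1` [set x])));
  last by move=> w _; exact: sE.
rewrite ge0_integral_fsum//; first last.
- by move=> x w _; exact: nnsfun_mulemu_ge0.
- by move=> x; apply: measurable_funeM; exact: mN.
rewrite !fsbig_finite//=; apply: lee_sum => x _.
have [x0|x0] := ltP x 0%R.
  rewrite [X in _ <= _ * X](_ : _ = 0).
    rewrite mule0; under eq_integral.
      by move=> w _; rewrite preimage_nnfun0// measure0 mule0; over.
    by rewrite integral0.
  by rewrite preimage_nnfun0.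
rewrite ge0_integralZl ?lee_fin//; last exact: mN.
by rewrite lee_wpmul2l ?lee_fin// prm_mean_le.
Qed.

(** The truncation at 1 has finite mean. The sets [E M] where [f > M + 1] decrease to the empty set
    with finite intensity, and [E M] is charged with probability at most its intensity; so a.s. some
    [E M] carries no point, while finitely many points lie in [E 0]. *)
Lemma prm_integral_ae_lty (f : T -> R) :
  measurable_fun setT f -> (forall x, 0 <= f x)%R ->
  \int[lam]_x (Num.min (f x) 1)%R%:E < +oo ->
  {ae P, forall w, \int[N w]_x (f x)%:E < +oo}.
Proof.
move=> mf f0 fi.
pose mn x := (Num.min (f x) 1)%R.
have mn0 x : (0 <= mn x)%R by rewrite /mn le_min f0 ler01.
have mmn : measurable_fun setT mn.
  exact: (measurable_minr mf (measurable_cst (1%R : R))).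
have mE : measurable_fun setT (EFin \o mn) by exact/measurable_EFinP.
have h1 : {ae P, forall w, \int[N w]_x (mn x)%:E < +oo}.
  have mn0E x : 0 <= (EFin \o mn) x by rewrite lee_fin.
  apply: ge0_integral_ae_lty.
  - exact: measurable_prm_integral mE mn0E.
  - by move=> w; apply: integral_ge0 => x _; exact: mn0E.
  - exact: le_lt_trans (prm_mean_integral_le mE mn0E) fi.
pose E (M : nat) := [set x | (M.+1%:R < f x)%R].
have mEM M : measurable (E M).
  rewrite (_ : E M = setT `&` f @^-1` `]M.+1%:R, +oo[); first exact: mf.
  by rewrite setTI; apply/seteqP; split => x /=; rewrite in_itv/= andbT.
have E0y : lam (E 0%N) < +oo.
  apply: le_lt_trans fi.
  have -> : lam (E 0%N) = \int[lam]_x (\1_(E 0%N) x)%:E by rewrite integral_indic// setIT.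
  apply: ge0_le_integral => //.
    by apply/measurable_EFinP; exact/measurable_indicP.
  move=> x _; rewrite lee_fin indicE; case: (boolP (x \in E 0%N)) => [/set_mem|_ //=].
    by rewrite /E/= => /ltW h; rewrite le_min h lexx.
  exact: mn0.
have Ecvg : (lam \o E) M @[M --> \oo] --> 0.
  rewrite -(measure0 lam) (_ : set0 = \bigcap_M E M).
    apply: nonincreasing_cvg_mu => //; first exact: bigcap_measurableType.
    move=> m n mn'; apply/subsetPset => x; rewrite /E/=; apply: le_lt_trans.
    by rewrite ler_nat ltnS.
  apply/seteqP; split => // x /(_ _) h.
  have := h (Num.truncn (f x)) I; rewrite /E/= ltNge => /negP; apply.
  by rewrite ltW// truncnS_gt.
pose B M := [set w | N w (E M) != 0].
have mB M : measurable (B M).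
  rewrite (_ : B M = ~` [set w | N w (E M) = 0]).
    apply: measurableC.
    rewrite (_ : [set _ | _] = setT `&` (N ^~ (E M)) @^-1` [set 0]); last by rewrite setTI.
    by apply: mN => //; exact: emeasurable_set1.
  by apply/seteqP; split => w /= /eqP.
have EM_le M : lam (E M) <= lam (E 0%N).
  rewrite le_measure ?inE// => x; rewrite /E/=; apply: le_lt_trans.
  by rewrite ler_nat.
have PB M : P (B M) <= lam (E M).
  have Ey : lam (E M) < +oo by exact: le_lt_trans E0y.
  rewrite (_ : B M = ~` [set w | N w (E M) = 0%:R%:E]); last first.
    by apply/seteqP; split => w /= /eqP.
  rewrite probability_setC; last exact: (measurable_eq_nat (mN (mEM M))).
  rewrite (lawN 0 (mEM M) Ey) expr0 fact0 divr1 mul1r.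
  have lE : lam (E M) = (fine (lam (E M)))%:E by rewrite fineK// ge0_fin_numE.
  rewrite [leRHS]lE -EFinB lee_fin lerBlDr -lerBlDl.
  exact: expR_ge1Dx.
have h2 : {ae P, forall w, exists M, N w (E M) = 0}.
  exists (\bigcap_M B M); split; first exact: bigcap_measurableType.
    apply/eqP; rewrite -measure_le0.
    apply: (cvge_to_ge Ecvg); apply: nearW => M /=.
    apply: le_trans (PB M); rewrite le_measure ?inE//.
      exact: bigcap_measurableType.
    by move=> w; apply.
  by move=> w /= /forallNP h M _; apply/eqP/h.
have h3 := prm_ae_lty (mEM 0%N) E0y.
apply: filterS3 h1 h2 h3 => w w1 [M wM] w3.
have mcE : measurable_fun setT (fun x => ((M.+1%:R * \1_(E 0%N) x)%R : R)%:E).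
  by apply/measurable_EFinP/measurable_funM; [exact: measurable_cst|exact/measurable_indicP].
(* Off the null set [E M], [f] is at most its truncation plus [M + 1] times the indicator of
   [E 0]. *)
apply: (@le_lt_trans _ _ (\int[N w]_x ((mn x)%:E + (M.+1%:R * \1_(E 0%N) x)%:E))).
  apply: ae_ge0_le_integral => //.
  - by move=> x _; rewrite lee_fin.
  - exact/measurable_EFinP.
  - by move=> x _; rewrite -EFinD lee_fin addr_ge0// mulr_ge0.
  - exact: (emeasurable_funD mE mcE).
  exists (E M); split => // x /= h; apply: contrapT => /negP.
  rewrite -leNgt => fM; apply: h => _; rewrite -EFinD lee_fin /mn indicE.
  have [f1|f1] := leP (f x) 1%R; first by rewrite lerDl mulr_ge0.
  rewrite mem_set ?mulr1; first by rewrite (le_trans fM)// lerDr.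
  by rewrite /E.
rewrite ge0_integralD//; first last.
- by move=> x _; rewrite lee_fin.
rewrite lte_add_pinfty//.
under eq_integral do rewrite EFinM.
rewrite ge0_integralZl//; last by apply/measurable_EFinP; exact/measurable_indicP.
by rewrite integral_indic// setIT lte_mul_pinfty.
Qed.

End poisson_finiteness.

Section finite_range.
Context d (T : measurableType d) (R : realType).

Lemma Rintegral_sum (mu : {measure set T -> \bar R}) n (f : 'I_n -> T -> R) :
  (forall i, mu.-integrable setT (EFin \o f i)) ->
  mu.-integrable setT (EFin \o (fun x => \sum_i f i x)) /\
  (\int[mu]_x (\sum_i f i x) = \sum_i \int[mu]_x f i x)%R.
Proof.
move=> fi; split.
  rewrite (_ : _ \o _ = fun x => \sum_(i < n) (EFin \o f i) x)%E.
    exact: integrable_sum.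
  by apply/funext => x /=; rewrite sumEFin.
rewrite /Rintegral; under eq_integral do rewrite -sumEFin.
rewrite integral_sum//.
rewrite (eq_bigr (fun i => (fine (\int[mu]_x (f i x)%:E))%:E)) ?sumEFin//.
by move=> i _; rewrite fineK//; exact: (integrable_fin_num _ (fi i)).
Qed.

Lemma Rintegral_step (mu : {measure set T -> \bar R}) n (E : 'I_n -> set T)
    (c : 'I_n -> R) :
  (forall i, measurable (E i)) -> (forall i, (mu (E i) < +oo)%E) ->
  mu.-integrable setT (EFin \o (fun x => \sum_i c i * \1_(E i) x)) /\
  (\int[mu]_x (\sum_i c i * \1_(E i) x) = \sum_i c i * fine (mu (E i)))%R.
Proof.
move=> mE Ey.
have i1 i : mu.-integrable setT (EFin \o \1_(E i)).
  apply/integrableP; split; first by apply/measurable_EFinP; exact/measurable_indicP.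
  under eq_integral do rewrite /= ger0_norm//.
  by rewrite integral_indic// setIT.
have i2 i : mu.-integrable setT (EFin \o (fun x => c i * \1_(E i) x)).
  rewrite (_ : _ \o _ = fun x => (c i)%:E * (EFin \o \1_(E i)) x)%E//.
  exact: integrableZl.
have [h ->] := Rintegral_sum i2; split => //.
apply: eq_bigr => i _; rewrite RintegralZl//.
by rewrite /Rintegral integral_indic// setIT.
Qed.

(** The value 0 is left out because its level set may have infinite measure; the condition [g 0 = 0]
    accounts for it. *)
Lemma finite_range_decomposition (f : T -> R) : finite_set (range f) ->
  exists n (y : 'I_n -> R), [/\ forall i, y i != 0,
    trivIset setT (fun i => f @^-1` [set y i]) &
    forall (g : R -> R), g 0 = 0 ->
      forall x, g (f x) = \sum_i g (y i) * \1_(f @^-1` [set y i]) x].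
Proof.
move=> ff; pose s : seq R := [seq y <- finmap.enum_fset (fset_set (range f)) | y != 0].
have us : uniq s by rewrite filter_uniq ?finmap.fset_uniq.
exists (size s), (fun i => s`_i); split.
- move=> i; have : s`_i \in s by rewrite mem_nth.
  by rewrite mem_filter => /andP[].
- move=> i j _ _ [x [/= fi fj]]; apply/val_inj => /=.
  by apply/eqP; rewrite -(nth_uniq 0 _ _ us)//; rewrite -fi -fj.
- move=> g g0 x.
  have [fx|fx] := eqVneq (f x) 0.
    rewrite fx g0 big1// => i _; rewrite indicE memNset ?mulr0//= fx => e.
    have : s`_i \in s by rewrite mem_nth.
    by rewrite -e mem_filter/= eqxx.
  have fs : f x \in s.
    by rewrite mem_filter/= fx in_fset_set// inE; exists x.
  have is_ : (index (f x) s < size s)%N by rewrite index_mem.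
  rewrite (bigD1 (Ordinal is_))//= big1 ?addr0.
    by rewrite indicE mem_set/= ?nth_index// mulr1.
  move=> i; rewrite -val_eqE/= => ni; rewrite indicE memNset ?mulr0//= => e.
  by move: ni; rewrite e index_uniq// eqxx.
Qed.

End finite_range.

Section campbell.
Context d (Omega : measurableType d) (R : realType) (P : probability Omega R).
Context d' (T : measurableType d') (N : R.-ker Omega ~> T).
Variable lam : {measure set T -> \bar R}.
Hypothesis prm : poisson_random_measure P N lam.
Variables a b : R.
Hypothesis a0 : 0 <= a.

(** Campbell's formula for the exponent [- a + i b]. With [a * f >= 0] as the only sign condition,
    one proof covers Laplace transforms ([a = 1], [b = 0]) and characteristic functions ([a = 0],
    [b = 1]). *)
Let campbell_for (f : T -> R) :=
  (\int[P]_w ec a b (\int[N w]_x f x) =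
     expR (\int[lam]_x (ec a b (f x) - 1)) * cos (\int[lam]_x es a b (f x)))%R /\
  (\int[P]_w es a b (\int[N w]_x f x) =
     expR (\int[lam]_x (ec a b (f x) - 1)) * sin (\int[lam]_x es a b (f x)))%R.

Lemma measurable_prm_Rintegral (f : T -> R) : measurable_fun setT f ->
  measurable_fun setT (fun w => \int[N w]_x f x)%R.
Proof.
move=> mf; apply: measurableT_comp => //.
have mE : measurable_fun setT (EFin \o f) by exact/measurable_EFinP.
under eq_fun do rewrite integralE.
apply: emeasurable_funB; apply: (measurable_prm_integral N) => //.
- exact: measurable_funepos.
- exact: measurable_funeneg.
Qed.

Let mec f : measurable_fun setT f -> measurable_fun setT (fun x : T => ec a b (f x)).
Proof.
move=> mf; apply: measurableT_comp => //.
by apply: continuous_measurable_fun; exact: continuous_ec.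
Qed.

Let mes f : measurable_fun setT f -> measurable_fun setT (fun x : T => es a b (f x)).
Proof.
move=> mf; apply: measurableT_comp => //.
by apply: continuous_measurable_fun; exact: continuous_es.
Qed.

Let campbell_step (f : T -> R) : measurable_fun setT f -> finite_set (range f) ->
  (forall x, 0 <= a * f x) ->
  (forall y, y != 0 -> (lam (f @^-1` [set y]) < +oo)%E) -> campbell_for f.
Proof.
move=> mf ff af ly.
have [n [y [y0 tE hg]]] := finite_range_decomposition ff.
pose E i := f @^-1` [set y i].
have mE i : measurable (E i) by rewrite -[E i]setTI; exact: mf.
have Ey i : (lam (E i) < +oo)%E by exact: ly.
(* The decomposition does not record that each [y i] is attained; replacing an unattained value by 0
   changes no sum and gives the sign condition for every index. *)
have ay i : 0 <= a * (if pselect (E i !=set0) then y i else 0).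
  case: (pselect (E i !=set0)) => [[x Ex]|nE]; last by rewrite mulr0.
  by rewrite -[y i]Ex; exact: af.
pose y' i := if pselect (E i !=set0) then y i else 0.
have y'E g x i : g (y i) * \1_(E i) x = g (y' i) * \1_(E i) x :> R.
  rewrite /y'; case: (pselect (E i !=set0)) => // h; rewrite indicE memNset ?mulr0// => Ex.
  by apply: h; exists x.
have fE (g : R -> R) : g 0 = 0 -> forall x, g (f x) = \sum_i g (y' i) * \1_(E i) x.
  by move=> g0 x; rewrite (hg g g0); apply: eq_bigr => i _; rewrite y'E.
have [hc hs] := prm_simple prm mE tE Ey b ay.
have NE : {ae P, forall w, (\int[N w]_x f x = \sum_i y' i * fine (N w (E i)))%R}.
  have : {ae P, forall w i, (N w (E i) < +oo)%E}.
    by apply: filter_forall => i; exact: (prm_ae_lty prm).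
  apply: filterS => w wy; have [_ <-] := Rintegral_step (mu := N w) y' mE wy.
  by apply: eq_Rintegral => x _; rewrite -(fE id).
have mNE : measurable_fun setT (fun w => \sum_i y' i * fine (N w (E i))).
  apply: measurable_sum => i; apply: measurable_funM; first exact: measurable_cst.
  by apply: measurableT_comp => //; exact: measurable_kernel.
have aeR (g : R -> R) : continuous g ->
    (\int[P]_w g (\int[N w]_x f x) = \int[P]_w g (\sum_i y' i * fine (N w (E i))))%R.
  move=> cg; have mg := continuous_measurable_fun cg.
  congr fine; apply: ae_eq_integral => //.
  - apply/measurable_EFinP; apply: measurableT_comp => //.
    exact: measurable_prm_Rintegral.
  - apply/measurable_EFinP; exact: measurableT_comp.
  - by apply: filterS NE => w /= -> _.
have lE (g : R -> R) : g 0 = 0 -> (\int[lam]_x g (f x) =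
    \sum_i fine (lam (E i)) * g (y' i))%R.
  move=> g0; transitivity (\int[lam]_x (\sum_i g (y' i) * \1_(E i) x))%R.
    by apply: eq_Rintegral => x _; exact: fE.
  by rewrite (Rintegral_step _ mE Ey).2; apply: eq_bigr => i _; rewrite mulrC.
split.
  rewrite aeR; last exact: continuous_ec.
  by rewrite (lE (fun x => ec a b x - 1)) ?ec0 ?subrr// (lE (es a b)) ?es0.
rewrite aeR; last exact: continuous_es.
by rewrite (lE (fun x => ec a b x - 1)) ?ec0 ?subrr// (lE (es a b)) ?es0.
Qed.

Import HBNNSimple.

(** Positive and negative parts are approximated separately by simple functions, so that [g n] keeps
    the sign of [f] and satisfies [|g n| <= |f|]: the first preserves the sign condition, the second
    gives domination by [min (|f|, 1)]. *)
Lemma campbell (f : T -> R) : measurable_fun setT f ->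
  (forall x, 0 <= a * f x) ->
  (\int[lam]_x (Num.min `|f x| 1)%R%:E < +oo)%E -> campbell_for f.
Proof.
move=> mf af fi.
have mE : measurable_fun setT (EFin \o f) by exact/measurable_EFinP.
pose fp := (EFin \o f)^\+%E; pose fn := (EFin \o f)^\-%E.
have mfp : measurable_fun setT fp by exact: measurable_funepos.
have mfn : measurable_fun setT fn by exact: measurable_funeneg.
pose p := nnsfun_approx measurableT mfp; pose q := nnsfun_approx measurableT mfn.
pose g n x := p n x - q n x.
have cp x : EFin \o p^~ x @ \oo --> fp x.
  by apply: cvg_nnsfun_approx => // t _; exact: funepos_ge0.
have cq x : EFin \o q^~ x @ \oo --> fn x.
  by apply: cvg_nnsfun_approx => // t _; exact: funeneg_ge0.
have ndle (h : {nnsfun T >-> R}^nat) (F : \bar R) x :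
    nondecreasing_seq (h : (T -> R)^nat) -> EFin \o h^~ x @ \oo --> F ->
    forall n, ((h n x)%:E <= F)%E.
  move=> nd c n; apply: (cvge_to_ge c); exists n => // k /= nk.
  by rewrite lee_fin; have /lefP := nd _ _ nk; exact.
have ple n x : ((p n x)%:E <= fp x)%E.
  by apply: (ndle _ _ _ _ (cp x)); exact: nd_nnsfun_approx.
have qle n x : ((q n x)%:E <= fn x)%E.
  by apply: (ndle _ _ _ _ (cq x)); exact: nd_nnsfun_approx.
have fpE x : fp x = (Num.max (f x) 0)%:E by rewrite /fp funeposE/= -EFin_max.
have fnE x : fn x = (Num.max (- f x) 0)%:E by rewrite /fn funenegE/= -EFin_max.
have p0 n x : 0 <= p n x by [].
have q0 n x : 0 <= q n x by [].
have gf x : g n x @[n --> \oo] --> f x.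
  have -> : f x = Num.max (f x) 0 - Num.max (- f x) 0 by case: (leP (f x) 0) => ?; case: (leP (- f x) 0) => ?; lra.
  apply: cvgB.
    by have := cp x; rewrite fpE => /fine_cvg.
  by have := cq x; rewrite fnE => /fine_cvg.
have gcase n x : (0 <= f x -> q n x = 0 /\ p n x <= f x) /\
    (f x <= 0 -> p n x = 0 /\ q n x <= - f x).
  have := ple n x; have := qle n x; rewrite fpE fnE !lee_fin => h1 h2.
  have := p0 n x; have := q0 n x.
  by split => fx; move: h1 h2; case: (leP (f x) 0) => ?; case: (leP (- f x) 0) => ?; lra.
have gle n x : `|g n x| <= `|f x|.
  have [h1 h2] := gcase n x; rewrite /g.
  have [f0|/ltW f0] := leP 0 (f x).
    by have [-> ?] := h1 f0; rewrite subr0 (ger0_norm (p0 n x)) (ger0_norm f0).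
  by have [-> ?] := h2 f0; rewrite sub0r normrN (ger0_norm (q0 n x)) (ler0_norm f0).
have ag n x : 0 <= a * g n x.
  have [h1 h2] := gcase n x; have := af x; have := p0 n x; have := q0 n x.
  rewrite /g; have [f0|f0|f0] := ltgtP (f x) 0.
  - have [-> ?] := h2 (ltW f0); rewrite nmulr_lge0// sub0r => q0' _ af0.
    by rewrite mulrN -mulNr mulr_ge0// oppr_ge0.
  - have [-> ?] := h1 (ltW f0); rewrite pmulr_lge0// subr0 => _ p0' af0.
    by rewrite mulr_ge0.
  - have [-> ple0] : q n x = 0 /\ p n x <= f x by apply: h1; rewrite f0.
    have [-> _] : p n x = 0 /\ q n x <= - f x by apply: h2; rewrite f0.
    by rewrite subrr mulr0.
have mg n : measurable_fun setT (g n) by apply: measurable_funB.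
have fing n : finite_set (range (g n)).
  have h : finite_set [set x.1 - x.2 | x in range (p n) `*` range (q n)].
    by apply: finite_image; apply: finite_setX; exact: fimfunP.
  apply: (sub_finite_set _ h) => _ [t _ <-].
  by exists (p n t, q n t) => //; split; exists t.
(* On the level set of a nonzero [y] one has [min (|f|, 1) >= min (|y|, 1) > 0], so its measure is
   finite by Markov's inequality. *)
have finl n y : y != 0 -> (lam (g n @^-1` [set y]) < +oo)%E.
  move=> y0; set A := _ @^-1` _.
  have mA : measurable A by rewrite -[A]setTI; exact: mg.
  pose c := Num.min `|y| 1.
  have c0 : 0 < c by rewrite lt_min normr_gt0 y0/=.
  have : (c%:E * lam A <= \int[lam]_x (Num.min `|f x| 1)%:E)%E.
    have -> : lam A = (\int[lam]_x (\1_A x)%:E)%E by rewrite integral_indic// setIT.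
    rewrite -ge0_integralZl//; [|by apply/measurable_EFinP; exact/measurable_indicP|by rewrite lee_fin ltW].
    apply: ge0_le_integral => //.
    - by move=> x _; rewrite -EFinM lee_fin mulr_ge0// ltW.
    - apply/measurable_EFinP; apply: measurable_funM; first exact: measurable_cst.
      exact/measurable_indicP.
    - apply/measurable_EFinP; apply: (measurable_minr _ (measurable_cst (1:R))).
      exact: measurableT_comp.
    - move=> x _; rewrite -EFinM lee_fin indicE.
      case: (boolP (x \in A)) => [/set_mem Ax|_]; last first.
        by rewrite mulr0 le_min normr_ge0 ler01.
      rewrite mulr1 /c -Ax le_min !ge_min lexx orbT andbT.
      by rewrite (gle n x).
  move=> h; rewrite ltey; apply/eqP => lA.
  have := le_lt_trans h fi; rewrite lA gt0_muley ?lte_fin//.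
have cg n : campbell_for (g n) by exact: (campbell_step (mg n) (fing n) (ag n) (finl n)).
have mmin : measurable_fun setT (fun x => Num.min `|f x| 1).
  apply: (measurable_minr _ (measurable_cst (1:R))).
  exact: measurableT_comp.
pose C := `|a| + `|b| + 2.
have iC : lam.-integrable setT (EFin \o (fun x => C * Num.min `|f x| 1)).
  rewrite (_ : _ \o _ = fun x => C%:E * (EFin \o (fun x => Num.min `|f x| 1)%R) x)%E//.
  apply: integrableZl => //; apply/integrableP; split; first exact/measurable_EFinP.
  apply: le_lt_trans fi; apply: ge0_le_integral => //.
  - by apply/measurable_EFinP; exact: measurableT_comp.
  - exact/measurable_EFinP.
  - by move=> x _; rewrite lee_fin ger0_norm// le_min normr_ge0 ler01.
have Cle n x : C * Num.min `|g n x| 1 <= C * Num.min `|f x| 1.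
  rewrite ler_wpM2l ?addr_ge0// le_min !ge_min lexx orbT andbT.
  by rewrite (gle n x).
have L1 : (\int[lam]_x (ec a b (g n x) - 1))%R @[n --> \oo] -->
    (\int[lam]_x (ec a b (f x) - 1))%R.
  apply: (dominated_cvgR _ _ _ _ iC _).2 => //.
  - by move=> n; apply: measurable_funB => //; exact: mec.
  - by apply: measurable_funB => //; exact: mec.
  - apply: aeW => x _; apply: cvgB; last exact: cvg_cst.
    exact: (cvg_comp _ _ (gf x) (@continuous_ec _ a b (f x))).
  - by move=> n x _; rewrite (le_trans (ecB1_le b (ag n x)))// Cle.
have L2 : (\int[lam]_x es a b (g n x))%R @[n --> \oo] -->
    (\int[lam]_x es a b (f x))%R.
  apply: (dominated_cvgR _ _ _ _ iC _).2 => //.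
  - by move=> n; exact: mes.
  - exact: mes.
  - apply: aeW => x _.
    exact: (cvg_comp _ _ (gf x) (@continuous_es _ a b (f x))).
  - by move=> n x _; rewrite (le_trans (es_le b (ag n x)))// Cle.
have L3 : {ae P, forall w, (\int[N w]_x g n x)%R @[n --> \oo] --> (\int[N w]_x f x)%R}.
  have mnf : measurable_fun setT (fun x => `|f x|) by exact: measurableT_comp.
  apply: filterS (prm_integral_ae_lty prm mnf (fun x => normr_ge0 (f x)) fi) => w fw.
  apply: (dominated_cvgR (g := fun x => `|f x|) _ mg mf _ _ _).2 => //.
  - by apply: aeW => x _; exact: gf.
  - apply/integrableP; split; first exact/measurable_EFinP.
    by under eq_integral do rewrite /= normr_id.
have anN (m : {measure set T -> \bar R}) (h : T -> R) :
    (forall x, 0 <= a * h x) -> 0 <= a * (\int[m]_x h x)%R.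
  move=> ah; have [->|an0] := eqVneq a 0; first by rewrite mul0r.
  rewrite mulr_ge0// Rintegral_ge0// => x _.
  by have := ah x; rewrite pmulr_rge0// lt_def an0.
have mNr h : measurable_fun setT h -> measurable_fun setT (fun w => \int[N w]_x h x)%R.
  exact: measurable_prm_Rintegral.
have mecP (F : Omega -> R) : measurable_fun setT F ->
    measurable_fun setT (fun w => ec a b (F w)).
  move=> mF; apply: measurableT_comp => //.
  by apply: continuous_measurable_fun; exact: continuous_ec.
have mesP (F : Omega -> R) : measurable_fun setT F ->
    measurable_fun setT (fun w => es a b (F w)).
  move=> mF; apply: measurableT_comp => //.
  by apply: continuous_measurable_fun; exact: continuous_es.
have i1 : P.-integrable setT (EFin \o (fun=> 1 : R)).
  by apply: (@bounded_integrable_prob _ _ _ _ _ 1) => // ?; rewrite normr1.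
have L4 : (\int[P]_w ec a b (\int[N w]_x g n x))%R @[n --> \oo] -->
    (\int[P]_w ec a b (\int[N w]_x f x))%R.
  apply: (dominated_cvgR (g := fun=> 1) _ _ _ _ i1 _).2 => //.
  - by move=> n; apply: mecP; exact: mNr.
  - by apply: mecP; exact: mNr.
  - apply: filterS L3 => w h _; exact: (cvg_comp _ _ h (@continuous_ec _ a b _)).
  - by move=> n w _; apply: ec_le1; apply: anN; exact: ag.
have L5 : (\int[P]_w es a b (\int[N w]_x g n x))%R @[n --> \oo] -->
    (\int[P]_w es a b (\int[N w]_x f x))%R.
  apply: (dominated_cvgR (g := fun=> 1) _ _ _ _ i1 _).2 => //.
  - by move=> n; apply: mesP; exact: mNr.
  - by apply: mesP; exact: mNr.
  - apply: filterS L3 => w h _; exact: (cvg_comp _ _ h (@continuous_es _ a b _)).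
  - by move=> n w _; apply: es_le1; apply: anN; exact: ag.
have L6 := cvg_comp _ _ L1 (@continuous_expR R _).
split.
  have E4 := funext (fun n => (cg n).1); rewrite E4 in L4.
  apply: (cvg_unique _ L4) => //.
  exact: cvgM L6 (cvg_comp _ _ L2 (@continuous_cos R _)).
have E5 := funext (fun n => (cg n).2); rewrite E5 in L5.
apply: (cvg_unique _ L5) => //.
exact: cvgM L6 (cvg_comp _ _ L2 (@continuous_sin R _)).
Qed.

End campbell.

(** * Image measures, densities and integrals on the half-line *)

Section image_measures.
Local Open Scope ereal_scope.

Lemma image_measure d d' (T : measurableType d) (T' : measurableType d')
    (R : realType) (mu : {measure set T -> \bar R}) (g : T -> T') :
  measurable_fun setT g -> exists nu : {measure set T' -> \bar R},
    forall phi : T' -> \bar R, measurable_fun setT phi -> (forall x, 0 <= phi x) ->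
    \int[nu]_x phi x = \int[mu]_x phi (g x).
Proof.
move=> mg; pose nu0 (A : set T') := mu (g @^-1` A).
have h0 : nu0 set0 = 0 by rewrite /nu0 preimage_set0 measure0.
have h1 A : 0 <= nu0 A by exact: measure_ge0.
have mp A : measurable A -> measurable (g @^-1` A).
  by move=> mA; rewrite -[X in measurable X]setTI; exact: mg.
have h2 : semi_sigma_additive nu0.
  move=> F mF tF mUF; rewrite /nu0 preimage_bigcup.
  apply: measure_semi_sigma_additive.
  - by move=> n; exact: mp.
  - apply/trivIsetP => /= i j _ _ ij; rewrite -preimage_setI.
    by move/trivIsetP : tF => /(_ _ _ _ _ ij) ->//; rewrite preimage_set0.
  - by rewrite -preimage_bigcup; exact: mp.
pose m := isMeasure.Build _ _ _ nu0 h0 h1 h2.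
pose nu : {measure set T' -> \bar R} := HB.pack nu0 m.
exists nu => phi mphi phi0.
have := @ge0_integral_pushforward _ _ _ _ R g mg mu setT phi measurableT mphi (fun x _ => phi0 x).
rewrite preimage_setT => <-.
by apply: eq_measure_integral => A mA _.
Qed.

Import HBNNSimple.

Lemma density_measure d (T : measurableType d) (R : realType)
    (mu : {measure set T -> \bar R}) (f : T -> R) :
  measurable_fun setT f -> (forall x, 0 <= f x)%R ->
  exists nu : {measure set T -> \bar R},
    forall phi : T -> \bar R, measurable_fun setT phi -> (forall x, 0 <= phi x) ->
    \int[nu]_x phi x = \int[mu]_x (phi x * (f x)%:E).
Proof.
move=> mf f0.
have mfE : measurable_fun setT (EFin \o f) by exact/measurable_EFinP.
pose nu0 (A : set T) := \int[mu]_(x in A) (f x)%:E.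
have h0 : nu0 set0 = 0 by rewrite /nu0 integral_set0.
have h1 A : 0 <= nu0 A by apply: integral_ge0 => x _; rewrite lee_fin.
have h2 : semi_sigma_additive nu0.
  move=> F mF tF mUF; rewrite /nu0 ge0_integral_bigcup//.
  - by apply: is_cvg_nneseries => n _ _; exact: h1.
  - exact: measurable_funS mfE.
  - by move=> x _; rewrite lee_fin.
pose m := isMeasure.Build _ _ _ nu0 h0 h1 h2.
pose nu : {measure set T -> \bar R} := HB.pack nu0 m.
exists nu => phi mphi phi0; pose g := nnsfun_approx measurableT mphi.
have gphi x : EFin \o g^~ x @ \oo --> phi x by exact: cvg_nnsfun_approx.
have ndg x : nondecreasing_seq (g^~ x).
  by move=> i j ij; have /lefP := nd_nnsfun_approx measurableT mphi ij; exact.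
have mg n : measurable_fun setT (EFin \o g n) by exact/measurable_EFinP.
have mgf n : measurable_fun setT (fun x => (g n x)%:E * (f x)%:E).
  exact: (emeasurable_funM (mg n) mfE).
have gf0 n x : setT x -> 0 <= (g n x)%:E * (f x)%:E.
  by rewrite -EFinM lee_fin mulr_ge0.
have gfphi x : (g n x)%:E * (f x)%:E @[n --> \oo] --> phi x * (f x)%:E.
  by apply: cvgeZr => //; exact: gphi.
have -> : \int[nu]_x phi x = limn (fun n => \int[nu]_x (g n x)%:E).
  rewrite -monotone_convergence//; first last.
  - by move=> x _ i j ij; rewrite lee_fin ndg.
  - by move=> n x _; rewrite lee_fin.
  by apply: eq_integral => x _; apply/esym/cvg_lim => //; exact: gphi.
have -> : \int[mu]_x (phi x * (f x)%:E) = limn (fun n => \int[mu]_x ((g n x)%:E * (f x)%:E)).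
  rewrite -monotone_convergence//; last first.
    by move=> x _ i j ij; rewrite lee_pmul ?lee_fin// ndg.
  by apply: eq_integral => x _; apply/esym/cvg_lim => //; exact: gfphi.
rewrite (_ : (fun n => \int[nu]_x (g n x)%:E) =
  (fun n => \int[mu]_x ((g n x)%:E * (f x)%:E)))//; apply/funext => n.
rewrite integralT_nnsfun sintegralE.
transitivity (\int[mu]_x \sum_(y \in range (g n)) (y%:E * ((f x)%:E * (\1_(g n @^-1` [set y]) x)%:E))).
  rewrite ge0_integral_fsum//; first last.
  - move=> y x _; rewrite -!EFinM lee_fin.
    have [y0|y0] := ltP y 0%R; last by rewrite !mulr_ge0.
    by rewrite preimage_nnfun0// indicE in_set0/= !mulr0.
  - move=> y; apply: measurable_funeM; apply: emeasurable_funM => //.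
    by apply/measurable_EFinP; exact/measurable_indicP.
  rewrite !fsbig_finite//=; apply: eq_bigr => y _.
  have [y0|y0] := ltP y 0%R.
    rewrite preimage_nnfun0// h0 mule0.
    by under eq_integral do rewrite indicE in_set0/= !mule0; rewrite integral0.
  rewrite ge0_integralZl//; first last.
  - by move=> x _; rewrite -EFinM lee_fin mulr_ge0.
  - apply: emeasurable_funM => //.
    by apply/measurable_EFinP; exact/measurable_indicP.
  congr (_ * _); rewrite /nu/= /nu0 integral_mkcond; apply: eq_integral => x _.
  by rewrite patchE indicE; case: ifPn; rewrite ?mule1 ?mule0.
apply: eq_integral => x _; rewrite [g n x]fimfunE -fsumEFin// ge0_mule_fsuml.
  by apply: eq_fsbigr => y _; rewrite EFinM -muleA; congr (_ * _); exact: muleC.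
move=> y; rewrite lee_fin.
have [y0|y0] := ltP y 0%R; last by rewrite mulr_ge0.
by rewrite preimage_nnfun0// indicE in_set0/= mulr0.
Qed.
End image_measures.

Section lebesgue_halfline.
Context {R : realType}.
Local Notation leb := (@lebesgue_measure R).
Local Open Scope ereal_scope.

(** [c] times the image of Lebesgue measure under [r -> c * r] agrees with it on intervals, hence
    everywhere. The substitution thus holds for any nonnegative measurable [f] with values in the
    extended reals. *)
Lemma ge0_integral_scale (c : R) (f : R -> \bar R) : (0 < c)%R ->
  measurable_fun setT f -> (forall r, 0 <= f r) ->
  \int[leb]_(r in `]0%R, +oo[) f r = c%:E * \int[leb]_(r in `]0%R, +oo[) f (c * r)%R.
Proof.
move=> c0 mf f0.
have mc : measurable_fun setT (fun r : measurableTypeR R => (c * r)%R : measurableTypeR R).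
  by apply: measurable_funM => //; exact: measurable_cst.
have cnn : (0 <= c)%R by exact: ltW.
have [nu hnu] := image_measure leb mc.
have nuE A : measurable A -> nu A = leb ((fun r => c * r)%R @^-1` A).
  move=> mA; rewrite -[X in nu X]setIT -integral_indic// hnu//.
  - rewrite (_ : (fun x => _) = (fun x => (\1_((fun r => c * r)%R @^-1` A) x)%:E)).
      rewrite integral_indic ?setIT//; rewrite -[X in measurable X]setTI; exact: mc.
    by apply/funext => x; rewrite !indicE.
  - by apply/measurable_EFinP; exact/measurable_indicP.
have lebE A : measurable A -> leb A = (mscale (NngNum cnn) nu) A.
  apply: lebesgue_measure_unique => _ [[a b]] _ <-.
  transitivity (c%:E * nu `]a, b]%classic); last by [].
  rewrite nuE//.
  rewrite (_ : _ @^-1` _ = `](a / c)%R, (b / c)%R]%classic).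
    rewrite !lebesgue_measure_itv/= !lte_fin ltr_pM2r ?invr_gt0//.
    case: ifPn => _; last by rewrite mule0.
    by rewrite -EFinB -EFinM -mulrBl mulrC divfK// gt_eqF.
  apply/seteqP; split => r /=; rewrite !in_itv/= ltr_pdivrMr// ler_pdivlMr//.
    by rewrite ![(r * c)%R]mulrC.
  by rewrite ![(c * r)%R]mulrC.
have mf1 : measurable_fun setT (f \_ `]0%R, +oo[).
  by apply/(measurable_restrictT _ _).1 => //; exact: measurable_funTS.
have f10 r : 0 <= (f \_ `]0%R, +oo[) r by apply: erestrict_ge0 => ? _.
rewrite [LHS]integral_mkcond (eq_measure_integral (mscale (NngNum cnn) nu)); last first.
  by move=> A mA _; exact: lebE.
rewrite ge0_integral_mscale//= hnu//; congr (_ * _).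
rewrite [RHS]integral_mkcond; apply: eq_integral => r _.
have e : (c * r \in `]0%R, +oo[%classic)%R = (r \in `]0%R, +oo[%classic).
  by apply/idP/idP => /set_mem/= h; apply/mem_set => /=; move: h;
    rewrite !in_itv/= !andbT pmulr_rgt0.
by rewrite !patchE e.
Qed.

Lemma continuous_expRN (c : R) : continuous (fun r : R => expR (- (c * r))).
Proof.
move=> x; apply: (@continuous_comp _ _ _ (fun r => - (c * r))%R expR).
  by apply: cvgN; apply: cvgMr; exact: cvg_id.
exact: continuous_expR.
Qed.

Lemma integral_expR_halfline (c : R) : (0 < c)%R ->
  \int[leb]_(r in `]0%R, +oo[) (expR (- (c * r)))%:E = c^-1%:E.
Proof.
move=> c0; have := integral_exponential_pdf c0.
rewrite /exponential_pdf (_ : (fun x => (_ x)%:E) =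
    (fun r => (c * expR (- (c * r)))%:E) \_ `[0%R, +oo[); last first.
  by apply/funext => r; rewrite !patchE; case: ifPn => _; rewrite ?mulNr.
rewrite -integral_mkcond => h.
have mexp : measurable_fun setT (fun r : R => expR (- (c * r))).
  by apply: continuous_measurable_fun; exact: continuous_expRN.
rewrite integral_itv_obnd_cbnd; last by apply/measurable_EFinP/measurable_funTS.
move: h; under eq_integral do rewrite EFinM.
rewrite ge0_integralZl//; first last.
- by rewrite lee_fin ltW.
- by apply/measurable_EFinP/measurable_funTS.
move=> h.
set J := \int[_]_(_ in _) _ in h *.
have : c^-1%:E * (c%:E * J) = c^-1%:E by rewrite h mule1.
by rewrite muleA -EFinM mulVf ?gt_eqF// mul1e.
Qed.

Lemma FTC2_is_derive (f F : R -> R) (a b : R) : (a < b)%R ->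
  (forall x, (a <= x <= b)%R -> is_derive x (1%R:R) F (f x)) ->
  (forall x, (a <= x <= b)%R -> {for x, continuous f}) ->
  \int[leb]_(x in `[a, b]) (f x)%:E = (F b - F a)%R%:E.
Proof.
move=> ab dF cf.
have cF x : (a <= x <= b)%R -> {for x, continuous F}.
  by move=> /dF dx; apply/differentiable_continuous/derivable1_diffP; case: dx.
rewrite (@continuous_FTC2 _ f F a b)//.
- apply: continuous_in_subspaceT => x; rewrite inE/= in_itv/=; exact: cf.
- split.
  + by move=> x; rewrite in_itv/= => /andP[/ltW ax /ltW xb]; case: (dF x) => //; rewrite ax xb.
  + by apply: cvg_at_right_filter; apply: cF; rewrite lexx ltW.
  + by apply: cvg_at_left_filter; apply: cF; rewrite lexx ltW.
- move=> x; rewrite in_itv/= => /andP[/ltW ax /ltW xb]; rewrite derive1E.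
  by apply: derive_val; apply: dF; rewrite ax xb.
Qed.

(** The integrand is the integral of [exp (- y r)] over [y] between [b] and [b + h]; Tonelli then
    leaves the integral of [1 / y]. *)
Lemma frullani (h b : R) : (0 <= h)%R -> (0 < b)%R ->
  \int[leb]_(r in `]0%R, +oo[) ((1 - expR (- (h * r))) * (expR (- (b * r)) / r))%:E =
  (ln (1 + h / b))%:E.
Proof.
move=> h0 b0; have [->|hn0] := eqVneq h 0%R.
  rewrite mul0r addr0 ln1; apply: integral0_eq => r _.
  by rewrite mul0r oppr0 expR0 subrr mul0r.
have hgt0 : (0 < h)%R by rewrite lt_def hn0.
have bh : (b < b + h)%R by rewrite ltrDl.
have E1 (r : R) : r \in `]0%R, +oo[%classic -> ((1 - expR (- (h * r))) * (expR (- (b * r)) / r))%:E =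
    \int[leb]_(y in `[b, (b + h)%R]) (expR (- (y * r)))%:E.
  rewrite inE/= in_itv/= andbT => r0; have rn0 : r != 0%R by rewrite gt_eqF.
  have dF (y : R) : is_derive y (1%R:R) (fun y => - (expR (- (y * r)) * r^-1))%R
      (expR (- (y * r))).
    have d2 : is_derive y (1%R:R) (fun y => expR (- (y * r)))%R (- r * expR (- (y * r)))%R.
      by apply: is_derive_eq; rewrite /GRing.scale/=; ring.
    have d3 : is_derive y (1%R:R) (fun y => - (expR (- (y * r)) * r^-1))%R
        (- (r^-1 * (- r * expR (- (y * r)))))%R.
      apply: is_deriveN; have d := is_deriveM d2 (is_derive_cst (r^-1)%R y (1%R:R)).
      by apply: (is_derive_eq d); rewrite /GRing.scale/= mulr0 add0r.
    by apply: (is_derive_eq d3); rewrite mulrA mulrN mulVf// mulN1r opprK.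
  have cF (y : R) : {for y, continuous (fun y : R => expR (- (y * r)))}.
    suff H : continuous (fun y : R => expR (- (y * r))) by exact: H.
    rewrite (_ : (fun y => _) = (fun y => expR (- (r * y))))%R; first exact: continuous_expRN.
    by apply/funext => ?; rewrite mulrC.
  rewrite (FTC2_is_derive bh (fun y _ => dF y) (fun y _ => cF y)).
  by congr EFin; rewrite opprK (mulrDl b h r) (opprD (b * r)%R) expRD; field.
transitivity (\int[leb]_(r in `]0%R, +oo[) \int[leb]_(y in `[b, (b + h)%R]) (expR (- (y * r)))%:E).
  by apply: eq_integral => r; exact: E1.
pose F (z : measurableTypeR R * measurableTypeR R) : \bar R :=
  ((\1_(`]0%R, +oo[%classic `*` `[b, (b + h)%R]%classic) z * expR (- (z.2 * z.1)))%R : R)%:E.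
have mF : measurable_fun setT F.
  apply/measurable_EFinP/measurable_funM.
    by apply/measurable_indicP; exact: measurableX.
  apply: measurableT_comp => //; apply: measurable_funN; apply: measurable_funM.
    exact: measurable_snd.
  exact: measurable_fst.
have F0 z : 0 <= F z by rewrite lee_fin mulr_ge0// expR_ge0.
have FE (A B : set R) (x y : R) : (\1_(A `*` B) (x, y) = \1_A x * \1_B y :> R)%R.
  rewrite !indicE -natrM mulnb; congr ((nat_of_bool _)%:R).
  by apply/idP/andP => [/set_mem[/= ? ?]|[/set_mem ? /set_mem ?]]; [split|]; exact/mem_set.
transitivity (\int[leb]_r \int[leb]_y F (r, y)).
  rewrite [LHS]integral_mkcond; apply: eq_integral => r _.
  rewrite patchE; case: ifPn => [r0|r0].
    rewrite [LHS]integral_mkcond; apply: eq_integral => y _.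
    by rewrite patchE /F/= FE !indicE r0 mul1r; case: ifPn; rewrite ?mul1r ?mul0r.
  rewrite integral0_eq// => y _; rewrite /F/= FE !indicE (negbTE r0).
  by rewrite !mul0r.
rewrite (@fubini_tonelli _ _ _ _ _ leb leb F)//.
transitivity (\int[leb]_(y in `[b, (b + h)%R]) (y^-1)%:E).
  rewrite [RHS]integral_mkcond; apply: eq_integral => y _.
  rewrite patchE; case: ifPn => [yb|yb]; last first.
    rewrite integral0_eq// => r _; rewrite /F/= FE !indicE (negbTE yb).
    by rewrite mulr0 mul0r.
  have y0 : (0 < y)%R.
    by move: yb; rewrite inE/= in_itv/= => /andP[by_ _]; exact: lt_le_trans b0 by_.
  rewrite -(integral_expR_halfline y0) [RHS]integral_mkcond; apply: eq_integral => r _.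
  by rewrite patchE /F/= FE !indicE yb mulr1; case: ifPn; rewrite ?mul1r ?mul0r.
have pos x : (b <= x <= b + h -> 0 < x)%R by move=> /andP[bx _]; exact: lt_le_trans b0 bx.
have cV x : (b <= x <= b + h)%R -> {for x, continuous (fun x : R => x^-1)%R}.
  by move=> /pos x0; apply: cvgV; rewrite ?gt_eqF//; exact: cvg_id.
rewrite (FTC2_is_derive bh (fun x xb => is_derive1_ln (pos x xb)) cV).
congr EFin; rewrite -ln_div ?posrE ?(lt_trans b0 bh)//; congr ln.
by rewrite mulrDl divff// gt_eqF.
Qed.
End lebesgue_halfline.

Lemma measurable_invr (R : realType) : measurable_fun setT (@GRing.inv R : measurableTypeR R -> measurableTypeR R).
Proof.
rewrite -(setvU [set 0%R]); apply/measurable_funU => //; first exact: measurableC.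
split.
  apply: open_continuous_measurable_fun.
    by rewrite openC; exact: closed_eq.
  by move=> x; rewrite inE/= => /eqP x0; exact: inv_continuous.
exact: measurable_fun_set1.
Qed.

Lemma measurable_funVr d (T : measurableType d) (R : realType) (f : T -> R) D :
  measurable_fun D f -> measurable_fun D (fun x => (f x)^-1).
Proof. by move=> mf; apply: (measurableT_comp (@measurable_invr R)). Qed.

Lemma in_itv0y (R : realType) (r : R) : (r \in `]0, +oo[%classic) = (0 < r).
Proof. by rewrite mem_setE in_itv/= andbT. Qed.

Section integral_null_sets.
Local Open Scope ereal_scope.
Import HBNNSimple.

(* No measurability of [f] or [g] is needed: the integral is a supremum of
   integrals of simple functions, which ignore null sets. *)
Lemma ge0_ae_le_integral_nonmeas d (T : measurableType d) (R : realType)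
    (mu : {measure set T -> \bar R}) (f g : T -> \bar R) :
  (forall x, 0 <= f x) -> (forall x, 0 <= g x) ->
  {ae mu, forall x, f x <= g x} -> \int[mu]_x f x <= \int[mu]_x g x.
Proof.
move=> f0 g0 [A [mA A0 fgA]].
  rewrite !ge0_integralTE//; apply: ge_ereal_sup => _ [h hf <-].
  have mAc : measurable (~` A) by exact: measurableC.
  pose h' : {nnsfun T >-> R} := mul_nnsfun h (indic_nnsfun R mAc).
  apply: ereal_sup_ubound; exists h'.
    move=> x /=; rewrite /mindic indicE; case: (pselect (A x)) => Ax.
      by rewrite memNset ?mulr0//= => /(_ Ax).
    rewrite mem_set// mulr1; apply: le_trans (hf x) _.
    by apply: contrapT => /fgA.
  rewrite -!integralT_nnsfun; apply: ge0_ae_eq_integral => //.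
  - by apply/measurable_EFinP.
  - by apply/measurable_EFinP.
  - by move=> x _; rewrite lee_fin.
  - by move=> x _; rewrite lee_fin.
  exists A; split => // x /= hx; apply: contrapT => Ax; apply: hx => _.
  by congr EFin; rewrite /h'/= /mindic indicE mem_set// mulr1.
Qed.

Lemma ae_eq_integral_nonmeas d (T : measurableType d) (R : realType)
    (mu : {measure set T -> \bar R}) (f g : T -> \bar R) :
  {ae mu, forall x, f x = g x} -> \int[mu]_x f x = \int[mu]_x g x.
Proof.
move=> fg; rewrite integralE [RHS]integralE; congr (_ - _);
  apply/eqP; rewrite eq_le; apply/andP; split;
  apply: ge0_ae_le_integral_nonmeas => //; apply: filterS fg => x fgx.
- by rewrite !funeposE fgx.
- by rewrite !funeposE fgx.
- by rewrite !funenegE fgx.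
- by rewrite !funenegE fgx.
Qed.

Lemma ae_imply d (T : measurableType d) (R : realType)
    (mu : {measure set T -> \bar R}) (P Q : T -> Prop) :
  {ae mu, forall x, P x} -> (forall x, P x -> Q x) -> {ae mu, forall x, Q x}.
Proof. by move=> h PQ; apply: filterS h. Qed.

End integral_null_sets.

(** * Jumps of Gamma processes *)

Section gamma_intensity_measure.
Context (R : realType) (B : normedModType R) (ip : B -> B -> R).
Hypothesis hB : euclidean ip.
Variables (beta : borel B -> R) (alpha : {finite_measure set (borel B) -> \bar R}).
Hypothesis mbeta : measurable_fun setT beta.
Local Notation leb := (@lebesgue_measure R).
Local Notation T := (timespace R B).
Local Open Scope ereal_scope.

Definition gamma_density (U : borel B) (r : R) : R := (expR (- (beta U * r)) / r)%R.

Let dens (z : T * measurableTypeR R) : R :=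
  (\1_(`[0%R, +oo[%classic : set R) z.1.1 * \1_(`]0%R, +oo[%classic : set R) z.2 *
   gamma_density z.1.2 z.2)%R.

Let mdens : measurable_fun setT dens.
Proof.
apply: measurable_funM.
  apply: measurable_funM; apply: measurableT_comp => //.
  by apply: (measurableT_comp measurable_fst); exact: measurable_fst.
apply: measurable_funM.
  apply: measurableT_comp => //; apply: measurable_funN; apply: measurable_funM => //.
  apply: measurableT_comp => //.
  by apply: (measurableT_comp measurable_snd); exact: measurable_fst.
by apply: measurable_funVr.
Qed.

Let dens0 z : (0 <= dens z)%R.
Proof.
rewrite /dens !indicE; case: (boolP (z.2 \in _)) => [|_]; last by rewrite mulr0 mul0r.
rewrite inE/= in_itv/= andbT => z0.
by rewrite mulr_ge0// divr_ge0 ?expR_ge0// ltW.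
Qed.

Let emb (z : T * measurableTypeR R) : T := (z.1.1, (z.2 *: (z.1.2 : B))%R : borel B).

Let memb : measurable_fun setT emb.
Proof.
apply: measurable_fun_pair.
  by apply: (measurableT_comp measurable_fst); exact: measurable_fst.
apply: (measurable_scaleb hB) => //.
by apply: (measurableT_comp measurable_snd); exact: measurable_fst.
Qed.

Let leb_alpha_sigma_finite : exists m12 : {sigma_finite_measure set T -> \bar R},
  m12 = (leb \x alpha) :> (set T -> \bar R).
Proof.
have h : sigma_finite setT (leb \x alpha).
  have [F TF Foo] := sigma_finiteT leb.
  exists (fun n => F n `*` setT).
    by rewrite -setXTT TF predeqE => -[x y]; split=> [[[n _ Fx] _]|[n _ [Fx _]]];
      [exists n|split => //; exists n].
  move=> n; have [mF Fn] := Foo n; split; first exact: measurableX.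
  rewrite product_measure1E// lte_mul_pinfty ?ge0_fin_numE//.
  by rewrite -ge0_fin_numE//; exact: fin_num_measure.
pose m := Measure_isSigmaFinite.Build _ _ _ (leb \x alpha) h.
pose m12 : {sigma_finite_measure set T -> \bar R} := HB.pack (leb \x alpha) m.
by exists m12.
Qed.

(** [gamma_intensity] is only a set function. The image, under [(s, U, r) -> (s, r U)], of a measure
    with density on times, directions and radii is a measure with the same values, and Tonelli gives
    its integrals with time and direction taken jointly or successively. *)
Lemma gamma_intensity_measure : exists lam : {measure set T -> \bar R},
  [/\ forall E, measurable E -> lam E = gamma_intensity beta alpha E,
      forall phi : T -> \bar R, measurable_fun setT phi -> (forall z, 0 <= phi z) ->
        \int[lam]_z phi z = \int[leb \x alpha]_z
          ((\1_(`[0%R, +oo[%classic : set R) z.1)%:E * \int[leb]_(r in `]0%R, +oo[)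
            (phi (z.1, (r *: (z.2 : B))%R : borel B) * (gamma_density z.2 r)%:E)) &
      forall phi : T -> \bar R, measurable_fun setT phi -> (forall z, 0 <= phi z) ->
        \int[lam]_z phi z = \int[alpha]_U \int[leb]_(s in `[0%R, +oo[)
          \int[leb]_(r in `]0%R, +oo[)
            (phi (s, (r *: (U : B))%R : borel B) * (gamma_density U r)%:E)].
Proof.
have [m1 hm1] := density_measure ((leb \x alpha) \x leb) mdens dens0.
have [lam hlam] := image_measure m1 memb.
have base (phi : T -> \bar R) : measurable_fun setT phi -> (forall z, 0 <= phi z) ->
    let F z := \int[leb]_r (phi (emb (z, r)) * (dens (z, r))%:E) in
    [/\ \int[lam]_z phi z = \int[leb \x alpha]_z F z, measurable_fun setT F,
      (forall z, 0 <= F z) &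
    forall z, F z = (\1_(`[0%R, +oo[%classic : set R) z.1)%:E * \int[leb]_(r in `]0%R, +oo[)
            (phi (z.1, (r *: (z.2 : B))%R : borel B) * (gamma_density z.2 r)%:E)].
  move=> mphi phi0 F.
  pose G (z : T * measurableTypeR R) := phi (emb z) * (dens z)%:E.
  have mG : measurable_fun setT G.
    apply: emeasurable_funM; first exact: measurableT_comp.
    exact/measurable_EFinP.
  have G0 z : 0 <= G z by rewrite mule_ge0// lee_fin.
  split.
  - rewrite hlam// hm1//; last exact: measurableT_comp.
    have [m12 e12] := leb_alpha_sigma_finite.
    have := @fubini_tonelli1 _ _ _ _ _ m12 leb G mG G0; rewrite e12; exact.
  - exact: (@measurable_fun_fubini_tonelli_F _ _ _ _ _ leb G mG G0).
  - by move=> z; apply: integral_ge0 => r _; exact: (G0 (z, r)).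
  move=> z; rewrite /F /emb /dens /=; rewrite [\1_(`[0%R, +oo[%classic) z.1]indicE.
  case: (z.1 \in _); last first.
    by rewrite mul0e integral0_eq// => r _; rewrite !mul0r mule0.
  rewrite mul1e [RHS]integral_mkcond; apply: eq_integral => r _.
  by rewrite patchE indicE mul1r; case: ifPn; rewrite ?mul1r ?mul0r ?mule0.
exists lam; split.
- move=> E mE.
  have mI : measurable_fun setT (EFin \o (\1_E : T -> R)) by exact/measurable_EFinP/measurable_indicP.
  have I0 z : 0 <= (EFin \o (\1_E : T -> R)) z by rewrite lee_fin.
  have [h1 h2 h3 h4] := base _ mI I0.
  have -> : lam E = \int[lam]_z (EFin \o (\1_E : T -> R)) z by rewrite /comp integral_indic// setIT.
  rewrite h1 (@fubini_tonelli1 _ _ _ _ _ leb alpha _ h2 h3) /gamma_intensity.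
  rewrite [RHS]integral_mkcond; apply: eq_integral => s _.
  rewrite patchE /fubini_F; under eq_integral do rewrite h4/=.
  rewrite indicE; case: ifPn => _; last by under eq_integral do rewrite mul0e; rewrite integral0.
  rewrite /gamma_levy /polar; apply: eq_integral => U _; rewrite mul1e; apply: eq_integral => r _.
  by rewrite -EFinM !indicE mem_xsection.
- move=> phi mphi phi0; have [-> _ _ h4] := base _ mphi phi0.
  by apply: eq_integral => z _; exact: h4.
move=> phi mphi phi0; have [-> h2 h3 h4] := base _ mphi phi0.
rewrite (@fubini_tonelli2 _ _ _ _ _ leb alpha _ h2 h3); apply: eq_integral => U _.
rewrite /fubini_G [RHS]integral_mkcond; apply: eq_integral => s _.
rewrite h4 patchE/= indicE; case: ifPn => _; first by rewrite mul1e.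
by rewrite mul0e.
Qed.

End gamma_intensity_measure.

Section directional_integral.
Context (R : realType) (B : normedModType R) (ip : B -> B -> R).
Hypothesis hB : euclidean ip.
Variables (beta : borel B -> R) (alpha : {measure set (borel B) -> \bar R}).
Hypothesis mbeta : measurable_fun setT beta.
Local Notation leb := (@lebesgue_measure R).
Local Notation T := (timespace R B).
Local Notation gamma_density := (gamma_density beta).
Local Open Scope ereal_scope.
Variable lam : {measure set T -> \bar R}.
Hypothesis lamE : forall phi : T -> \bar R, measurable_fun setT phi -> (forall z, 0 <= phi z) ->
        \int[lam]_z phi z = \int[alpha]_U \int[leb]_(s in `[0%R, +oo[)
          \int[leb]_(r in `]0%R, +oo[)
            (phi (s, (r *: (U : B))%R : borel B) * (gamma_density U r)%:E).
Hypothesis sphere_alpha : {ae alpha, forall U, (`|U : B| = 1)%R /\ (0 < beta U)%R}.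
Variable H : T -> R.
Hypothesis mH : measurable_fun setT H.
Hypothesis H0 : forall z, (0 <= H z)%R.

Definition directional (z : T) : borel B :=
  (H (z.1, (`|z.2 : B|^-1 *: (z.2 : B))%R : borel B) *: (z.2 : B))%R.

Lemma measurable_direction : measurable_fun setT
  (fun z : T => (z.1, (`|z.2 : B|^-1 *: (z.2 : B))%R : borel B) : T).
Proof.
apply: measurable_fun_pair; first exact: measurable_fst.
apply: (measurable_scaleb hB); last exact: measurable_snd.
apply: measurable_funVr.
apply: measurable_normf; exact: measurable_snd.
Qed.

Lemma measurable_directional : measurable_fun setT directional.
Proof.
apply: (measurable_scaleb hB); last exact: measurable_snd.
exact: (measurableT_comp mH measurable_direction).
Qed.

Lemma directional_ray s (U : borel B) r : (`|U : B| = 1)%R -> (0 < r)%R ->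
  directional (s, (r *: (U : B))%R : borel B) = ((H (s, U) * r) *: (U : B))%R.
Proof.
move=> U1 r0; rewrite /directional/= normrZ U1 mulr1 gtr0_norm// !scalerA mulVf ?gt_eqF//.
by rewrite scale1r.
Qed.

(** The function [k_U] attached to [H]. Times with [H = 0] contribute 0, the limit of the
    exponential as [H] decreases to 0 when [beta U] and [r] are positive. *)
Definition thinning (U : borel B) (r : R) : \bar R :=
  \int[leb]_(s in `[0%R, +oo[)
    (if (0 < H (s, U))%R then expR (- (beta U * (r / H (s, U)))) else 0%R)%:E.

(** For fixed time and direction the substitution [r -> H r] acts along the ray; Tonelli then
    exchanges time and radius. The condition on [psi] at 0 discards the jumps that [H = 0] sends to
    the origin, whose intensity may be infinite. *)
Lemma integral_directional (psi : borel B -> \bar R) :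
  measurable_fun setT psi -> (forall x, 0 <= psi x) -> psi (0%R : B) = 0 ->
  \int[lam]_z psi (directional z) =
  \int[alpha]_U \int[leb]_(r in `]0%R, +oo[)
    (psi ((r *: (U : B))%R : borel B) * (thinning U r * (r^-1)%:E)).
Proof.
move=> mpsi psi0 psi00.
rewrite lamE//; last exact: (measurableT_comp mpsi measurable_directional).
apply: ae_eq_integral_nonmeas; apply: (ae_imply sphere_alpha) => U [U1 bU].
pose e (s r : R) : R := if (0 < H (s, U))%R then expR (- (beta U * (r / H (s, U)))) else 0%R.
have e0 s r : (0 <= e s r)%R by rewrite /e; case: ifP => _ //; exact: expR_ge0.
have mHU : measurable_fun setT (fun s : measurableTypeR R => H (s, U)).
  by apply: (measurableT_comp mH); exact: measurable_pair2.
have mrU : measurable_fun setT (fun r : measurableTypeR R => psi ((r *: (U : B))%R : borel B)).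
  by apply: (measurableT_comp mpsi); apply: (measurable_scaleb hB) => //; exact: measurable_cst.
have me : measurable_fun setT (fun z : measurableTypeR R * measurableTypeR R => e z.1 z.2).
  apply: measurable_fun_ifT => //.
  - apply: measurable_fun_ltr => //; exact: (measurableT_comp mHU measurable_fst).
  - apply: measurableT_comp => //; apply: measurable_funN; apply: measurable_funM => //.
    apply: measurable_funM; first exact: measurable_snd.
    by apply: measurable_funVr; exact: (measurableT_comp mHU measurable_fst).
have step s : \int[leb]_(r in `]0%R, +oo[)
    (psi (directional (s, (r *: (U : B))%R : borel B)) * (gamma_density U r)%:E) =
   \int[leb]_(r in `]0%R, +oo[) (psi ((r *: (U : B))%R : borel B) * (e s r / r)%:E).
  case: (ltgtP 0%R (H (s, U))) (H0 (s, U)) => // [Hs _|Hs _]; last first.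
    transitivity (0 : \bar R); last apply/esym; apply: integral0_eq => r /mem_set;
      rewrite in_itv0y => r0.
      by rewrite directional_ray// -[H (s, U)]Hs mul0r scale0r psi00 mul0e.
    by rewrite /e -[H (s, U)]Hs ltxx mul0r mule0.
  (* The absolute value makes the integrand nonnegative on the whole line, as the scaling lemma
     requires, without changing it on the half-line. *)
  transitivity (\int[leb]_(r in `]0%R, +oo[) (psi ((r *: (U : B))%R : borel B) * (`|e s r / r|)%:E)); last first.
    apply: eq_integral => r; rewrite in_itv0y => r0.
    by rewrite ger0_norm// divr_ge0// ltW.
  rewrite (@ge0_integral_scale R (H (s, U)) (fun r => psi ((r *: (U : B))%R : borel B) * (`|e s r / r|)%:E))//; last 2 first.
  - apply: emeasurable_funM => //; apply/measurable_EFinP; apply: measurableT_comp => //.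
    apply: measurable_funM; last by apply: measurable_funVr; exact: measurable_id.
    exact: (measurableT_comp me (measurable_pair1 s)).
  - by move=> r; rewrite mule_ge0.
  rewrite -ge0_integralZl//; last 3 first.
  - apply: measurable_funTS; apply: emeasurable_funM.
      apply: (measurableT_comp mrU); apply: measurable_funM => //; exact: measurable_cst.
    apply/measurable_EFinP; apply: measurableT_comp => //; apply: measurable_funM.
      apply: (measurableT_comp (measurableT_comp me (measurable_pair1 s))).
      by apply: measurable_funM => //; exact: measurable_cst.
    by apply: measurable_funVr; apply: measurable_funM => //; exact: measurable_cst.
  - by move=> r _; rewrite mule_ge0.
  - by rewrite lee_fin ltW.
  apply: eq_integral => r; rewrite in_itv0y => r0.
  rewrite directional_ray// muleCA; congr (_ * _).
  rewrite /gamma_density /e Hs -EFinM; congr EFin.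
  rewrite ger0_norm; last by rewrite divr_ge0 ?expR_ge0// mulr_ge0// ltW.
  have hr : (H (s, U) * r / H (s, U) = r)%R by rewrite mulrC mulKf// gt_eqF.
  by rewrite hr; field; rewrite !gt_eqF.
under eq_integral do rewrite step.
pose G (z : measurableTypeR R * measurableTypeR R) : \bar R :=
  (\1_(`[0%R, +oo[%classic `*` `]0%R, +oo[%classic) z)%:E *
  (psi ((z.2 *: (U : B))%R : borel B) * (`|e z.1 z.2 / z.2|)%:E).
have mG : measurable_fun setT G.
  apply: emeasurable_funM.
    by apply/measurable_EFinP/measurable_indicP; exact: measurableX.
  apply: emeasurable_funM; first exact: (measurableT_comp mrU measurable_snd).
  apply/measurable_EFinP; apply: measurableT_comp => //; apply: measurable_funM => //.
  by apply: measurable_funVr; exact: measurable_snd.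
have G0 z : 0 <= G z by rewrite !mule_ge0// lee_fin.
have GE s r : G (s, r) = if (s \in `[0%R, +oo[%classic) && (r \in `]0%R, +oo[%classic)
    then psi ((r *: (U : B))%R : borel B) * (e s r / r)%:E else 0.
  rewrite /G indicE/= in_setX/=; case: ifPn => [/andP[_]|_]; last by rewrite mul0e.
  rewrite in_itv0y => r0; rewrite mul1e ger0_norm//.
  by rewrite divr_ge0 ?e0// ltW.
transitivity (\int[leb]_s \int[leb]_r G (s, r)).
  rewrite [LHS]integral_mkcond; apply: eq_integral => s _; rewrite patchE.
  case: ifPn => hs; last first.
    by rewrite integral0_eq// => r _; rewrite GE (negbTE hs).
  rewrite [LHS]integral_mkcond; apply: eq_integral => r _.
  by rewrite patchE GE hs.
rewrite (@fubini_tonelli _ _ _ _ _ leb leb G)// [RHS]integral_mkcond.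
apply: eq_integral => r _; rewrite patchE; case: ifPn => hr; last first.
  by rewrite integral0_eq// => s _; rewrite GE (negbTE hr) andbF.
have r0 : (0 < r)%R by move: hr; rewrite in_itv0y.
rewrite [thinning U r * _]muleC muleA /thinning -ge0_integralZl//; last 3 first.
- apply: measurable_funTS; apply/measurable_EFinP.
  exact: (measurableT_comp me (measurable_pair2 r)).
- by move=> s _; rewrite lee_fin e0.
- by rewrite mule_ge0// lee_fin invr_ge0 ltW.
rewrite [RHS]integral_mkcond; apply: eq_integral => s _.
rewrite GE hr andbT patchE; case: ifPn => // _.
by rewrite -/(e s r) EFinM muleAC muleA.
Qed.

(** [1 - exp (- |x|)] is comparable to [min (|x|, 1)] and is the function for which Frullani's
    integral is exact: it links the logarithmic condition to the integrability of the jumps. *)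
Lemma integral_directional_ln :
  \int[lam]_z (1 - expR (- `|directional z : B|))%R%:E =
  \int[alpha]_U \int[leb]_(s in `[0%R, +oo[) (ln (1 + H (s, U) / beta U))%:E.
Proof.
rewrite lamE; last 2 first.
- apply/measurable_EFinP; apply: measurable_funB => //; apply: measurableT_comp => //.
  apply: measurable_funN; exact: (measurable_normf measurable_directional).
- by move=> z; rewrite lee_fin subr_ge0 -expR0 ler_expR oppr_le0.
apply: ae_eq_integral_nonmeas; apply: (ae_imply sphere_alpha) => U [U1 bU].
apply: eq_integral => s _; rewrite -frullani//; apply: eq_integral => r.
rewrite in_itv0y => r0; rewrite directional_ray// -EFinM.
by rewrite normrZ U1 mulr1 ger0_norm// mulr_ge0// ltW.
Qed.
End directional_integral.

(* The gliding hump argument behind the Nikodym convergence theorem. *)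
Lemma gliding_hump d (T : measurableType d) (R : realType)
    (p a : nat -> set T -> R) (A : nat -> set T) :
  (forall M, measurable (A M)) -> (forall M M', (M <= M')%N -> A M `<=` A M') ->
  (forall n C D, measurable C -> measurable D -> C `<=` D ->
     p n D <= p n C + p n (D `\` C)) ->
  (forall n C D, measurable C -> measurable D -> C `<=` D ->
     p n C <= p n D + p n (D `\` C)) ->
  (forall n C, measurable C -> 0 <= p n C <= a n C) ->
  (forall n C D, measurable C -> measurable D -> C `<=` D -> a n C <= a n D) ->
  (forall M, a n (A M) @[n --> \oo] --> 0) ->
  (forall n, a n (~` A M) @[M --> \oo] --> 0) ->
  (forall C, measurable C -> cvgn (p ^~ C)) ->
  p n setT @[n --> \oo] --> 0.
Proof.
move=> mA ndA psub pdif pa amono a1 a2 pc.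
have mAc M : measurable (~` A M) by exact: measurableC.
have p0 n C : measurable C -> 0 <= p n C by move=> /(pa n) /andP[].
pose l := limn (p ^~ setT).
have pl : p n setT @[n --> \oo] --> l by exact: pc.
have l0 : 0 <= l by apply: limr_ge; [exact: pc|near=> n; exact: p0].
move: l0; rewrite le_eqVlt => /predU1P[->//|l0].
(* Were the limit [l] positive, the totals would eventually exceed [7 e]; two losses of [e] leave
   [5 e] on a shell, and two more leave [3 e] on the union of shells. *)
pose e := l / 8; have e0 : 0 < e by rewrite divr_gt0.
have ex1 (Mk : nat * nat) : exists n, [/\ (Mk.2 <= n)%N, a n (A Mk.1) <= e & 7 * e <= p n setT].
  have h1 : \forall n \near \oo, a n (A Mk.1) <= e.
    by apply: (cvgr_le (0:R)) => //; exact: a1.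
  have h2 : \forall n \near \oo, 7 * e <= p n setT.
    by apply: (cvgr_ge l) => //; rewrite /e; lra.
  have h3 : \forall n \near \oo, (Mk.2 <= n)%N by exact: nbhs_infty_ge.
  near \oo => n; exists n; split; near: n => //.
have ex2 (nM : nat * nat) : exists M', (nM.2 <= M')%N /\ a nM.1 (~` A M') <= e.
  have h1 : \forall M \near \oo, a nM.1 (~` A M) <= e.
    by apply: (cvgr_le (0:R)) => //; exact: a2.
  have h3 : \forall n \near \oo, (nM.2 <= n)%N by exact: nbhs_infty_ge.
  near \oo => n; exists n; split; near: n => //.
have [fn hn] := choice ex1; have [fM hM] := choice ex2.
(* Alternate choices: [n_ j] so late that [a (n_ j)] has little mass in [A (M_ j)], then [M_ j.+1]
   so large that little of it lies outside [A (M_ j.+1)]. The mass of index [n_ j] is then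
   concentrated on the shell [C j]. *)
pose st := fix st j := if j is j'.+1 then
   let M := fM (st j') in (fn (M, (st j').1.+1), M) else (fn (0%N, 0%N), 0%N).
pose n_ j := (st j).1; pose M_ j := (st j).2.
have MS j : M_ j.+1 = fM (n_ j, M_ j) by rewrite /M_ /n_/=; case: (st j).
have nS j : n_ j.+1 = fn (M_ j.+1, (n_ j).+1) by [].
have P1 j : a (n_ j) (A (M_ j)) <= e /\ 7 * e <= p (n_ j) setT.
  by case: j => [|j]; rewrite ?nS; [have [] := hn (0%N, 0%N)|have [] := hn (M_ j.+1, (n_ j).+1)].
have P2 j : a (n_ j) (~` A (M_ j.+1)) <= e by rewrite MS; have [] := hM (n_ j, M_ j).
have Mle j : (M_ j <= M_ j.+1)%N by rewrite MS; have [] := hM (n_ j, M_ j).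
have Mmono i j : (i <= j)%N -> (M_ i <= M_ j)%N.
  by move=> /subnK <-; elim: (j - i)%N => // k /leq_trans; apply; rewrite addSn.
have nlt j : (n_ j < n_ j.+1)%N by rewrite nS; have [] := hn (M_ j.+1, (n_ j).+1).
have nge j : (j <= n_ j)%N by elim: j => // j IH; exact: leq_ltn_trans (nlt j).
pose C j := A (M_ j.+1) `\` A (M_ j).
have mC j : measurable (C j) by exact: measurableD.
(* Keeping every other shell makes [p (n_ j) E] at least [3 e] for even [j] and at most [2 e] for
   odd [j], against the convergence of [p n E]. *)
pose E := \bigcup_(j in [set j | ~~ odd j]) C j.
have mE : measurable E by exact: bigcup_measurable.
have CE j x : C j x -> E x -> ~~ odd j.
  move=> [h1 h2] [i /= oi [h3 h4]].
  case: (ltngtP i j) => [ij|ji|<-//].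
    by exfalso; apply: h2; apply: (ndA _ _ _ _ h3); exact: Mmono.
  by exfalso; apply: h4; apply: (ndA _ _ _ _ h1); exact: Mmono.
have small n D j : measurable D -> (D `&` C j = set0) -> n = n_ j -> p n D <= 2 * e.
  move=> mD DC ->.
  have mDA : measurable (D `&` A (M_ j)) by exact: measurableI.
  have mDA' : measurable (D `\` (D `&` A (M_ j))) by exact: measurableD.
  apply: le_trans (psub _ (D `&` A (M_ j)) D mDA mD _) _; first by move=> x [].
  have h1 : p (n_ j) (D `&` A (M_ j)) <= e.
    have /andP[_ h] := pa (n_ j) _ mDA; apply: le_trans h _.
    by apply: le_trans (P1 j).1; apply: amono => // x [].
  have h2 : p (n_ j) (D `\` (D `&` A (M_ j))) <= e.
    have /andP[_ h] := pa (n_ j) _ mDA'; apply: le_trans h _.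
    apply: le_trans (P2 j); apply: amono => // x [Dx nx] Ax.
    have : (D `&` C j) x by split => //; split => // Ax'; apply: nx.
    by rewrite DC.
  by lra.
have big j : 5 * e <= p (n_ j) (C j).
  have h1 := psub (n_ j) (C j) setT (mC j) measurableT (@subsetT _ _).
  have h2 : p (n_ j) (setT `\` C j) <= 2 * e.
    apply: (small _ _ j) => //; first by apply: measurableD.
    by rewrite setIC setIDA setIT setDv.
  have := (P1 j).2; lra.
have even j : ~~ odd j -> 3 * e <= p (n_ j) E.
  move=> oj; have CjE : C j `<=` E by move=> x Cx; exists j.
  have h1 := pdif (n_ j) (C j) E (mC j) mE CjE.
  have h2 : p (n_ j) (E `\` C j) <= 2 * e.
    apply: (small _ _ j) => //; first by apply: measurableD.
    by rewrite setDE -setIA setICl setI0.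
  have := big j; lra.
have oddp j : odd j -> p (n_ j) E <= 2 * e.
  move=> oj; apply: (small _ _ j) => //.
  by rewrite -subset0 => x [Ex Cx]; have := CE _ _ Cx Ex; rewrite oj.
have pE : p n E @[n --> \oo] --> limn (p ^~ E) by exact: pc.
have h1 : limn (p ^~ E) <= 5/2 * e.
  rewrite leNgt; apply/negP => h.
  have [N _ hN] : \forall n \near \oo, 5/2 * e < p n E by exact: (cvgr_gt _ pE).
  have := hN (n_ N.*2.+1); rewrite /= => /(_ (leq_trans _ (nge _))).
  rewrite -addnn ltnW ?ltnS ?leq_addr// => /(_ isT).
  have := oddp N.*2.+1; rewrite /= odd_double => /(_ isT); rewrite -addnn; lra.
have h2 : \forall n \near \oo, p n E < 3 * e.
  by apply: (cvgr_lt _ pE); lra.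
have [N _ hN] := h2.
have := hN (n_ N.*2); rewrite /= => /(_ (leq_trans _ (nge _))).
rewrite -addnn leq_addr => /(_ isT).
have := even N.*2; rewrite odd_double => /(_ isT); rewrite -addnn; lra.
Unshelve. all: by end_near. Qed.

(** * Convergence in probability *)

Section convergence_in_probability.
Context d (Omega : measurableType d) (R : realType) (P : probability Omega R).

Implicit Types X Y : Omega -> R.

(** Applied to the norm of a difference, the Ky Fan type functional that metrizes convergence in
    probability; it is subadditive and blind to null sets. *)
Definition min1 (X : Omega -> R) : R := \int[P]_w Num.min (X w) 1.

Lemma min1_integrable (X : Omega -> R) : measurable_fun setT X -> (forall w, 0 <= X w) ->
  P.-integrable setT (EFin \o (fun w => Num.min (X w) 1)).
Proof.
move=> mX X0; apply: (@bounded_integrable_prob _ _ _ _ _ 1).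
  exact: measurable_minr.
by move=> w; rewrite ger0_norm ?le_min ?X0//= ge_min lexx orbT.
Qed.

Lemma min1_ge0 X : (forall w, 0 <= X w) -> 0 <= min1 X.
Proof. by move=> X0; apply: Rintegral_ge0 => w _; rewrite le_min X0/=. Qed.

Lemma min1_le X Y : measurable_fun setT X -> measurable_fun setT Y ->
  (forall w, 0 <= X w) -> (forall w, 0 <= Y w) ->
  {ae P, forall w, X w <= Y w} -> min1 X <= min1 Y.
Proof.
move=> mX mY X0 Y0 XY; rewrite /min1 /Rintegral fine_le//.
- exact: integrable_fin_num (min1_integrable mX X0).
- exact: integrable_fin_num (min1_integrable mY Y0).
apply: ae_ge0_le_integral => //.
- by move=> w _; rewrite lee_fin le_min X0/=.
- by apply/measurable_EFinP; exact: measurable_minr.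
- by move=> w _; rewrite lee_fin le_min Y0/=.
- by apply/measurable_EFinP; exact: measurable_minr.
apply: filterS XY => w XYw _; rewrite lee_fin le_min ge_min XYw/=.
by rewrite ge_min lexx orbT.
Qed.

Lemma min1D X Y : measurable_fun setT X -> measurable_fun setT Y ->
  (forall w, 0 <= X w) -> (forall w, 0 <= Y w) ->
  min1 (fun w => X w + Y w) <= min1 X + min1 Y.
Proof.
move=> mX mY X0 Y0.
have iX := min1_integrable mX X0; have iY := min1_integrable mY Y0.
rewrite /min1 -RintegralD//; apply: le_Rintegral => //.
- apply: (@min1_integrable (fun w => X w + Y w)); first exact: measurable_funD.
  by move=> w; rewrite addr_ge0.
- exact: integrableD iX iY.
move=> w _; have := X0 w; have := Y0 w.
by rewrite !minEle; do 3 case: ifP; lra.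
Qed.

Lemma min1_eq0 X : measurable_fun setT X -> (forall w, 0 <= X w) ->
  min1 X = 0 -> {ae P, forall w, X w = 0}.
Proof.
move=> mX X0 h.
have h' : (\int[P]_w (Num.min (X w) 1)%:E = 0)%E.
  have f := integrable_fin_num measurableT (min1_integrable mX X0).
  by move: h; rewrite /min1 /Rintegral -[X in _ -> X = _]fineK// => ->.
have := ae_eq_integral_abs P measurableT (f := fun w => (Num.min (X w) 1)%:E).
have mm : measurable_fun setT (fun w => (Num.min (X w) 1)%:E).
  by apply/measurable_EFinP; exact: measurable_minr.
move=> /(_ mm)[+ _]; have -> : (\int[P]_x `|(Num.min (X x) 1)%:E| = 0)%E.
  by rewrite -h'; apply: eq_integral => w _; rewrite gee0_abs// lee_fin le_min X0/=.
move=> /(_ erefl); apply: filterS => w /(_ I) /= [].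
by rewrite minEle; case: ifP => // _ /eqP; rewrite oner_eq0.
Qed.

Section in_B.
Context (B : normedModType R) (ip : B -> B -> R) (hB : euclidean ip).
Implicit Types (Z : nat -> Omega -> borel B) (V : Omega -> borel B).

Let mnorm (X V : Omega -> borel B) : measurable_fun setT X -> measurable_fun setT V ->
  measurable_fun setT (fun w => `|(X w : B) - (V w : B)|).
Proof.
move=> mX mY; apply: (@measurable_normf R B _ _ setT (fun w => (X w : B) - V w : borel B)).
by apply: (measurable_addb hB) => //; exact: (measurable_oppb hB).
Qed.

Lemma cvg_in_probability_min1 Z V : (forall n, measurable_fun setT (Z n)) ->
  measurable_fun setT V ->
  cvg_in_probability P (Z : nat -> Omega -> B) (V : Omega -> B) <->
  min1 (fun w => `|(Z n w : B) - (V w : B)|) @[n --> \oo] --> 0.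
Proof.
move=> mZ mY.
have mD n : measurable_fun setT (fun w => `|(Z n w : B) - (V w : B)|) by exact: mnorm.
have mS n (e : R) : measurable [set w | e <= `|(Z n w : B) - (V w : B)|].
  rewrite (_ : [set w | _] = setT `&` (fun w => `|(Z n w : B) - (V w : B)|) @^-1` `[e, +oo[).
    by apply: mD.
  by rewrite setTI; apply/seteqP; split => w /=; rewrite in_itv/= andbT.
have Pfin n (e : R) : P [set w | e <= `|(Z n w : B) - (V w : B)|] \is a fin_num.
  exact: fin_num_measure.
have i1 n (e : R) : P.-integrable setT (EFin \o (\1_[set w | e <= `|(Z n w : B) - (V w : B)|] : Omega -> R)).
  apply: (@bounded_integrable_prob _ _ _ _ _ 1); first by apply/measurable_indicP; exact: mS.
  by move=> w; rewrite indicE; case: (_ \in _); rewrite ?normr1// normr0.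
have R1 n (e : R) : \int[P]_w (\1_[set w | e <= `|(Z n w : B) - (V w : B)|] w) =
   fine (P [set w | e <= `|(Z n w : B) - (V w : B)|]).
  by rewrite /Rintegral integral_indic// setIT.
split=> [h|h e e0].
  apply/cvgrPdist_le => /= e e0; pose e2 := e / 2.
  have e20 : 0 < e2 by rewrite divr_gt0.
  have /fine_cvgP[_ /cvgrPdist_le/(_ _ e20)] := h _ e20.
  apply: filterS => n; rewrite /= !sub0r !normrN => hn.
  rewrite ger0_norm; last by apply: min1_ge0.
  (* [min (X, 1)] is at most [e / 2] plus the indicator of [X >= e / 2]. *)
  apply: (@le_trans _ _ (\int[P]_w (e2 + \1_[set w | e2 <= `|(Z n w : B) - (V w : B)|] w))).
    apply: le_Rintegral => //.
    - exact: min1_integrable.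
    - apply: (@integrableD _ _ _ _ _ _ (cst e2%:E) (EFin \o _)) => //.
      exact: finite_measure_integrable_cst.
    move=> w _; rewrite indicE; case: (boolP (w \in _)) => [_|].
      by apply: (@le_trans _ _ 1); [rewrite ge_min lexx orbT|rewrite lerDr ltW].
    by rewrite notin_setE/= => /negP; rewrite -ltNge addr0 => /ltW ?; rewrite ge_min; apply/orP; left.
  rewrite RintegralD//; last exact: finite_measure_integrable_cst.
  have -> : \int[P]_w e2 = e2.
    have h1 : fine (P setT) = 1 by rewrite probability_setT.
    by transitivity (e2 * fine (P setT)); [exact: Rintegral_cst|rewrite h1 mulr1].
  rewrite R1.
  by move: hn; rewrite ger0_norm ?fine_ge0//; rewrite /e2; lra.
apply/fine_cvgP; split; first by near=> n; exact: Pfin.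
(* Markov's inequality: [min (e, 1)] times the indicator of [X >= e] is at most [min (X, 1)]. *)
pose m := Num.min e 1; have m0 : 0 < m by rewrite lt_min e0/=.
have hc : m^-1 * min1 (fun w => `|(Z n w : B) - (V w : B)|) @[n --> \oo] --> 0.
  by rewrite -(mulr0 m^-1); apply: cvgMr.
apply: (@squeeze_cvgr _ _ _ _ (cst 0) (fun n => m^-1 * min1 (fun w => `|(Z n w : B) - (V w : B)|))) => //; last exact: cvg_cst.
near=> n; rewrite /= fine_ge0//= -R1 ler_pdivlMl// /min1 -RintegralZl//.
apply: le_Rintegral => //; [exact: (integrableZl measurableT m (i1 n e))|exact: min1_integrable|].
move=> w _; rewrite indicE; case: (boolP (w \in _)) => [|_].
  rewrite inE/= => h1; rewrite mulr1 le_min /m ge_min h1/= ge_min lexx orbT//.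
by rewrite mulr0 le_min normr_ge0/=.
Unshelve. all: by end_near. Qed.

End in_B.
End convergence_in_probability.

(** * Vector-valued integrals and their Poisson versions *)

Section vector_integral.
Context (R : realType) (B : normedModType R) (ip : B -> B -> R).
Hypothesis hB : euclidean ip.
Variables (dim : nat) (e : 'I_dim -> B).
Hypothesis oe : orthonormal ip e.
Hypothesis he : forall x, x = \sum_i ip (e i) x *: e i.

Lemma orthonormal_norm i : `|e i| = 1.
Proof.
apply/eqP; rewrite -(@eqrXn2 _ 2)// expr1n -(ip_norm hB); apply/eqP.
by rewrite oe eqxx.
Qed.

Lemma norm_le_coords (x : B) : `|x| <= \sum_i `|ip (e i) x|.
Proof.
rewrite {1}[x]he; apply: le_trans (ler_norm_sum _ _ _) _.
by apply: ler_sum => i _; rewrite normrZ orthonormal_norm mulr1.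
Qed.

Lemma ip_le_norm (i : 'I_dim) (x : B) : `|ip (e i) x| <= `|x|.
Proof. by have := cauchy_schwarz hB (e i) x; rewrite orthonormal_norm mul1r. Qed.

Section one_measure.
Context d (T : measurableType d) (m : {measure set T -> \bar R}).
Implicit Types f g : T -> borel B.

(** An explicit coordinatewise integral, in place of [vintegral], which is defined by choice. The
    two agree on integrable functions, and the explicit formula makes measurability in the random
    measure visible. *)
Definition bint f : B := \sum_i (\int[m]_x ip (e i) (f x)) *: e i.

Definition bintegrable f :=
  measurable_fun setT f /\ (\int[m]_x (`|f x : B|)%:E < +oo)%E.

Lemma bintegrable_coord f : bintegrable f ->
  forall i, m.-integrable setT (EFin \o (fun x => ip (e i) (f x))).
Proof.
move=> [mf fi] i; apply/integrableP; split.
  by apply/measurable_EFinP; exact: (measurable_ipf hB).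
apply: le_lt_trans fi; apply: ge0_le_integral => //.
- apply/measurable_EFinP; apply: measurableT_comp => //.
  exact: (measurable_ipf hB).
- by apply/measurable_EFinP; exact: measurable_normf.
- by move=> x _; rewrite lee_fin ip_le_norm.
Qed.

Lemma bint_ip f y : bintegrable f ->
  m.-integrable setT (EFin \o (fun x => ip y (f x))) /\
  \int[m]_x ip y (f x) = ip y (bint f).
Proof.
move=> fi; have ci := bintegrable_coord fi.
have E : (fun x => ip y (f x)) = (fun x => \sum_i ip y (e i) * ip (e i) (f x)).
  apply/funext => x; rewrite [in LHS](he (f x)) (ip_sumr hB).
  by apply: eq_bigr => i _; rewrite (ipZr hB) mulrC.
have ci' i : m.-integrable setT (EFin \o (fun x => ip y (e i) * ip (e i) (f x))).
  exact: (integrableZl measurableT _ (ci i)).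
have [h1 h2] := Rintegral_sum ci'; rewrite E; split => //.
rewrite h2 /bint (ip_sumr hB); apply: eq_bigr => i _.
by rewrite (ipZr hB) mulrC RintegralZl.
Qed.

Lemma bint_unique f v : (forall i, \int[m]_x ip (e i) (f x) = ip (e i) v) -> bint f = v.
Proof. by move=> h; rewrite [RHS]he; apply: eq_bigr => i _; rewrite h. Qed.

Lemma ip_ext u v : (forall y, ip y u = ip y v) -> u = v.
Proof. by move=> h; rewrite [u]he [v]he; apply: eq_bigr => i _; rewrite h. Qed.

Lemma vintegralE f : bintegrable f -> vintegral ip m f = bint f.
Proof.
move=> fi; rewrite /vintegral.
pose S : set B := [set v | forall y, m.-integrable setT (fun x => (ip y (f x))%:E) /\
    (\int[m]_x (ip y (f x))%:E = (ip y v)%:E)%E].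
have P0 : S (bint f).
  move=> y; have [h1 h2] := bint_ip y fi; split => //.
  rewrite -h2 /Rintegral fineK//; exact: integrable_fin_num.
have := xgetPex 0 (ex_intro S (bint f) P0); rewrite -/S; set u := xget _ _ => hu.
apply: ip_ext => y; apply: EFin_inj.
by rewrite -(hu y).2 (P0 y).2.
Qed.

(** A vector meeting the defining condition would make every coordinate of [f] integrable, hence
    also the norm; so there is none and the default value 0 is taken. *)
Lemma vintegral0 f : measurable_fun setT f -> ~ bintegrable f -> vintegral ip m f = 0.
Proof.
move=> mf nf; apply: xgetPN => v hv; apply: nf; split => //.
have ci i : m.-integrable setT (EFin \o (fun x => `|ip (e i) (f x)|)).
  exact: (integrable_norm (hv (e i)).1).
have [/integrableP[_ h1] _] := Rintegral_sum ci.
apply: le_lt_trans h1; apply: ge0_le_integral => //.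
- by apply/measurable_EFinP; exact: measurable_normf.
- apply: measurableT_comp => //; apply/measurable_EFinP.
  apply: measurable_sum => i; apply: measurableT_comp => //.
  exact: (measurable_ipf hB).
- move=> x _; rewrite lee_fin; apply: le_trans (norm_le_coords _) _; exact: ler_norm.
Qed.

Lemma bint_norm f : bintegrable f ->
  ((`|bint f|)%:E <= dim%:R%:E * \int[m]_x (`|f x : B|)%:E)%E.
Proof.
move=> fi; have ci := bintegrable_coord fi.
have [mf foo] := fi; have f0 : (0 <= \int[m]_x (`|f x : B|)%:E)%E by exact: integral_ge0.
rewrite -(@fineK _ (\int[m]_x _)%E) ?ge0_fin_numE// -EFinM lee_fin.
rewrite /bint; apply: le_trans (ler_norm_sum _ _ _) _.
rewrite mulr_natl -[X in _ *+ X]card_ord -sumr_const; apply: ler_sum => i _.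
rewrite normrZ orthonormal_norm mulr1.
apply: le_trans (le_normr_Rintegral measurableT (ci i)) _.
rewrite /Rintegral fine_le//.
- by apply: (integrable_fin_num measurableT); exact: integrable_norm.
- by rewrite ge0_fin_numE.
apply: ge0_le_integral => //.
- apply/measurable_EFinP; apply: measurableT_comp => //.
  exact: (measurable_ipf hB).
- by apply/measurable_EFinP; exact: measurable_normf.
- by move=> x _; rewrite lee_fin ip_le_norm.
Qed.

Lemma bintegrableB f g : bintegrable f -> bintegrable g ->
  bintegrable (fun x => (f x : B) - (g x : B) : borel B) /\
  bint (fun x => (f x : B) - (g x : B) : borel B) = bint f - bint g.
Proof.
move=> fi gi; have [mf foo] := fi; have [mg goo] := gi.
have mfg : measurable_fun setT (fun x => (f x : B) - (g x : B) : borel B).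
  by apply: (measurable_addb hB) => //; exact: (measurable_oppb hB).
split.
  split => //; apply: (@le_lt_trans _ _ (\int[m]_x ((`|f x : B|)%:E + (`|g x : B|)%:E))%E).
    apply: ge0_le_integral => //.
    - by apply/measurable_EFinP; exact: measurable_normf.
    - by apply: emeasurable_funD; apply/measurable_EFinP; exact: measurable_normf.
    - by move=> x _; rewrite -EFinD lee_fin ler_normB.
  rewrite ge0_integralD//; first exact: lte_add_pinfty.
  - by apply/measurable_EFinP; exact: measurable_normf.
  - by apply/measurable_EFinP; exact: measurable_normf.
apply: bint_unique => i; under eq_Rintegral do rewrite (ipBr hB).
rewrite RintegralB//; [|exact: bintegrable_coord..].
by rewrite (ipBr hB) (bint_ip _ fi).2 (bint_ip _ gi).2.
Qed.

Lemma bint_sum n (c : 'I_n -> R) (f : 'I_n -> T -> borel B) :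
  (forall j, bintegrable (f j)) ->
  bint (fun x => \sum_j c j *: (f j x : B) : borel B) = \sum_j c j *: bint (f j).
Proof.
move=> fi; apply: bint_unique => i.
under eq_Rintegral => x _.
  rewrite (ip_sumr hB); under eq_bigr do rewrite (ipZr hB).
  over.
have ci j : m.-integrable setT (EFin \o (fun x => c j * ip (e i) (f j x))).
  exact: (integrableZl measurableT _ (bintegrable_coord (fi j) i)).
rewrite (Rintegral_sum ci).2 (ip_sumr hB); apply: eq_bigr => j _.
by rewrite (ipZr hB) RintegralZl ?(bint_ip _ (fi j)).2//; exact: bintegrable_coord.
Qed.
End one_measure.

Section kernel.
Context d (Omega : measurableType d) d' (T : measurableType d') (N : R.-ker Omega ~> T).
Variable f : T -> borel B.
Hypothesis mf : measurable_fun setT f.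

Let mnorm : measurable_fun setT (fun w => \int[N w]_x (`|f x : B|)%:E)%E.
Proof.
apply: measurable_prm_integral => //.
by apply/measurable_EFinP; exact: measurable_normf.
Qed.

Lemma measurable_bint : measurable_fun setT (fun w => bint (N w) f : borel B).
Proof.
apply: (measurable_sumb hB) => i; apply: (measurable_scaleb hB); last exact: measurable_cst.
by apply: measurable_prm_Rintegral; exact: (measurable_ipf hB).
Qed.

Lemma measurable_vintegral : measurable_fun setT (fun w => vintegral ip (N w) f : borel B).
Proof.
pose D := [set w | \int[N w]_x (`|f x : B|)%:E < +oo]%E.
have mD : measurable D.
  rewrite (_ : D = setT `&` D); last by rewrite setTI.
  by apply: emeasurable_fun_infty_o.
(* The choice in [vintegral] is resolved for every [w]: it is [bint] on the measurable set where the
   norm is integrable, and 0 elsewhere. *)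
rewrite (_ : (fun w => _) = (fun w => (\1_D w : R) *: (bint (N w) f) : borel B)).
  by apply: (measurable_scaleb hB); [exact/measurable_indicP|exact: measurable_bint].
apply/funext => w; rewrite indicE; case: (pselect (D w)) => Dw.
  by rewrite mem_set// scale1r vintegralE.
by rewrite memNset// scale0r vintegral0// => -[].
Qed.
End kernel.

Section poisson.
Context d (Omega : measurableType d) (P : probability Omega R).
Context d' (T : measurableType d') (N : R.-ker Omega ~> T).
Variable lam : {measure set T -> \bar R}.
Hypothesis prm : poisson_random_measure P N lam.
Variable f : T -> borel B.
Hypothesis mf : measurable_fun setT f.
Hypothesis fi : (\int[lam]_x (Num.min `|f x : B| 1)%:E < +oo)%E.

Lemma prm_bintegrable : {ae P, forall w, bintegrable (N w) f}.
Proof.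
have := prm_integral_ae_lty prm (measurable_normf mf) (fun _ => normr_ge0 _) fi.
by apply: filterS.
Qed.

(* Jumps smaller than 1 are controlled by their mean and the others by their number. *)
Lemma prm_bint_min1 :
  (\int[P]_w (Num.min `|bint (N w) f| 1)%:E <=
   dim.+1%:R%:E * \int[lam]_x (Num.min `|f x : B| 1)%:E)%E.
Proof.
pose V x := `|f x : B|.
have mV : measurable_fun setT V by exact: measurable_normf.
pose E := [set x | 1 < V x].
have mE : measurable E.
  rewrite (_ : E = V @^-1` `]1, +oo[); first by rewrite -[X in measurable X]setTI; exact: mV.
  by apply/seteqP; split => x /=; rewrite in_itv/= andbT.
(* [min (V, 1)] splits into the jumps of norm at most 1 and the indicator of the larger ones. *)
pose V1 x := (V x * \1_(~` E) x)%R.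
have mV1 : measurable_fun setT V1.
  by apply: measurable_funM => //; apply/measurable_indicP; exact: measurableC.
have V10 x : 0 <= V1 x by rewrite /V1 mulr_ge0// /V.
have IE (m : {measure set T -> \bar R}) : (\int[m]_x (\1_E x)%:E = m E)%E.
  by rewrite integral_indic// setIT.
have mV1E : measurable_fun setT (EFin \o V1) by exact/measurable_EFinP.
have m1E : measurable_fun setT (EFin \o (\1_E : T -> R)).
  by apply/measurable_EFinP/measurable_indicP.
have splitE : (\int[lam]_x (Num.min (V x) 1)%:E = \int[lam]_x (V1 x)%:E + lam E)%E.
  rewrite -IE -ge0_integralD//; last by move=> x _; rewrite lee_fin.
  apply: eq_integral => x _; rewrite -EFinD /V1 !indicE; congr EFin.
  case: (pselect (E x)) => Ex.
    have nE : (x \in ~` E) = false by apply: memNset => /(_ Ex).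
    by rewrite nE (mem_set Ex) mulr0 add0r minEle leNgt (Ex : 1 < V x).
  rewrite (memNset Ex) mem_set// mulr1 addr0 minEle.
  by move/negP: Ex; rewrite -leNgt => ->.
have lamE : (lam E < +oo)%E.
  apply: le_lt_trans fi; rewrite -/V splitE leeDr//.
  by apply: integral_ge0 => x _; rewrite lee_fin.
have mI1 : measurable_fun setT (fun w => \int[N w]_x (V1 x)%:E)%E.
  by apply: measurable_prm_integral => // x; rewrite lee_fin.
have mN : measurable_fun setT (N ^~ E) by exact: measurable_kernel.
apply: (@le_trans _ _ (\int[P]_w (dim.+1%:R%:E * (\int[N w]_x (V1 x)%:E + N w E)))%E).
  apply: ae_ge0_le_integral => //.
  - apply/measurable_EFinP; apply: measurable_minr => //.
    exact: (measurable_normf (measurable_bint N mf)).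
  - move=> w _; rewrite mule_ge0// adde_ge0//.
    by apply: integral_ge0 => x _; rewrite lee_fin.
  - by apply: measurable_funeM; exact: emeasurable_funD.
  have h1 := prm_bintegrable; have h2 := prm_ae_nat prm mE lamE.
  move: h1 h2; apply: filterS2 => w wi [k Nk] _.
  have I0 : (0 <= \int[N w]_x (V1 x)%:E)%E by apply: integral_ge0 => x _; rewrite lee_fin.
  (* Without large jumps the norm of the integral is bounded through [V1]; with at least one,
     [N w E >= 1] already bounds the truncated norm. *)
  case: k Nk => [|k] Nk.
    rewrite Nk adde0.
    have VE : (\int[N w]_x (V x)%:E = \int[N w]_x (V1 x)%:E)%E.
      apply: ae_eq_integral_nonmeas; exists E; split => // x /= hx.
      apply: contrapT => Ex; apply: hx; rewrite /V1 indicE mem_set// mulr1//.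
    apply: le_trans (_ : (`|bint (N w) f|)%:E <= _)%E; first by rewrite lee_fin ge_min lexx.
    apply: le_trans (bint_norm wi) _; rewrite -/V VE.
    by apply: lee_wpmul2r => //; rewrite lee_fin ler_nat.
  apply: (@le_trans _ _ 1%:E); first by rewrite lee_fin ge_min lexx orbT.
  rewrite -(mule1 1%:E); apply: lee_pmul => //; first by rewrite lee_fin ler1n.
  apply: le_trans (_ : N w E <= _)%E; last by rewrite leeDr.
  by rewrite Nk lee_fin ler1n.
rewrite ge0_integralZl//; last 2 first.
- exact: emeasurable_funD.
- move=> w _; rewrite adde_ge0//.
  by apply: integral_ge0 => x _; rewrite lee_fin.
apply: lee_wpmul2l => //; rewrite -/V splitE ge0_integralD//; last first.
  by move=> w _; apply: integral_ge0 => x _; rewrite lee_fin.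
apply: leeD; last exact: (prm_mean_le prm).
by apply: (prm_mean_integral_le prm) => // x; rewrite lee_fin.
Qed.
End poisson.
End vector_integral.

Lemma ae_forall_ord d (T : measurableType d) (R : realType)
    (mu : {measure set T -> \bar R}) n (P : 'I_n -> T -> Prop) :
  (forall i, {ae mu, forall x, P i x}) -> {ae mu, forall x, forall i, P i x}.
Proof.
move=> h; have := @ae_foralln _ _ _ mu (fun k x => forall i : 'I_n, k = i -> P i x).
move=> H; apply: (ae_imply (H _)) => [k|x hx i]; last exact: (hx i).
have [kn|nk] := ltnP k n.
  apply: (ae_imply (h (Ordinal kn))) => x hx i ki.
  by rewrite (_ : i = Ordinal kn)//; exact: val_inj.
apply: aeW => x i ki; exfalso.
by have := ltn_ord i; rewrite -ki ltnNge nk.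
Qed.

Lemma min1_le_expR (R : realType) (x : R) : 0 <= x -> Num.min x 1 <= 2 * (1 - expR (- x)).
Proof.
move=> x0; have h : 1 + x <= expR x by exact: expR_ge1Dx.
have e0 : expR (- x) * expR x = 1 by rewrite -expRD addNr expR0.
have e1 := expR_gt0 (- x).
by rewrite minEle; case: ifP => hx; [nra|move/negbT: hx; rewrite -ltNge => hx; nra].
Qed.

Lemma expR_le_min1 (R : realType) (x : R) : 0 <= x -> 1 - expR (- x) <= Num.min x 1.
Proof.
move=> x0; have h : 1 + - x <= expR (- x) by exact: expR_ge1Dx.
have e1 := expR_gt0 (- x).
by rewrite minEle; case: ifP => hx; lra.
Qed.

(** * Integrands measured by the intensity of their jumps *)

Section jump_mass.
Context (R : realType) (B : normedModType R) (ip : B -> B -> R).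
Hypothesis hB : euclidean ip.
Variables (beta : borel B -> R) (alpha : {finite_measure set (borel B) -> \bar R}).
Hypothesis mbeta : measurable_fun setT beta.
Local Notation leb := (@lebesgue_measure R).
Local Notation T := (timespace R B).
Variable lam : {measure set T -> \bar R}.
Hypothesis lamE1 : forall phi : T -> \bar R, measurable_fun setT phi -> (forall z, (0 <= phi z)%E) ->
  (\int[lam]_z phi z = \int[leb \x alpha]_z
    ((\1_(`[0%R, +oo[%classic : set R) z.1)%:E * \int[leb]_(r in `]0%R, +oo[)
      (phi (z.1, (r *: (z.2 : B))%R : borel B) * (gamma_density beta z.2 r)%:E)))%E.
Hypothesis lamE2 : forall phi : T -> \bar R, measurable_fun setT phi -> (forall z, (0 <= phi z)%E) ->
  (\int[lam]_z phi z = \int[alpha]_U \int[leb]_(s in `[0%R, +oo[)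
    \int[leb]_(r in `]0%R, +oo[)
      (phi (s, (r *: (U : B))%R : borel B) * (gamma_density beta U r)%:E))%E.
Variables (S0 : set (borel B)) (c : R).
Hypothesis mS0 : measurable S0.
Hypothesis S0a : alpha (~` S0) = 0%E.
Hypothesis c0 : 0 < c.
Hypothesis S0P : forall U, S0 U -> (`|U : B| = 1) /\ (c <= beta U).

Definition direction (z : T) : T := (z.1, (`|z.2 : B|^-1 *: (z.2 : B))%R : borel B).

Lemma S0_ae : {ae alpha, forall U, S0 U}.
Proof. by exists (~` S0); split => //; exact: measurableC. Qed.

Lemma sphere_ae : {ae alpha, forall U, `|U : B| = 1 /\ 0 < beta U}.
Proof.
apply: (ae_imply S0_ae) => U /S0P[-> h]; split => //; exact: lt_le_trans h.
Qed.

Lemma S0_prod_ae : {ae (leb \x alpha)%E, forall z : T, S0 z.2}.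
Proof.
exists (setT `*` (~` S0)); split.
- by apply: measurableX => //; exact: measurableC.
- rewrite (product_measure1E _ _ measurableT (measurableC mS0)).
  by apply: (etrans (congr1 (fun x => leb setT * x)%E S0a)); rewrite mule0.
- by move=> z /= h; split.
Qed.

(** All points of an open ray have the same direction, so a null set of times and directions pulls
    back along [direction] to a set that meets almost no ray. *)
Lemma ae_direction (Q : T -> Prop) :
  {ae (leb \x alpha)%E, forall z : T, 0 <= z.1 -> Q z} ->
  {ae lam, forall z, 0 <= z.1 /\ Q (direction z)}.
Proof.
move=> [A [mA A0 AQ]].
pose W := [set z : T | z.1 < 0] `|` direction @^-1` A.
have mdir := measurable_direction hB.
have mW : measurable W.
  apply: measurableU; last by rewrite -[X in measurable X]setTI; exact: mdir.
  rewrite (_ : [set z : T | z.1 < 0] = setT `&` (fst : T -> R) @^-1` `]-oo, 0[).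
    exact: (@measurable_fst _ _ (measurableTypeR R) (borel B)).
  by rewrite setTI; apply/seteqP; split => z /=; rewrite in_itv.
have W0 : lam W = 0%E.
  have -> : lam W = (\int[lam]_z (\1_W z)%:E)%E by rewrite integral_indic// setIT.
  rewrite lamE1; last 2 first.
  - by apply/measurable_EFinP/measurable_indicP.
  - by move=> z; rewrite lee_fin.
  transitivity (\int[leb \x alpha]_z (0 : \bar R))%E; last by rewrite integral0.
  apply: ae_eq_integral_nonmeas.
  have hA : {ae (leb \x alpha)%E, forall z : T, ~ A z}.
    by exists A; split => // z /= h; apply: contrapT => /h.
  move: hA S0_prod_ae; apply: filterS2 => z nA /S0P[U1 _].
  rewrite indicE; case: (boolP (_ \in _)) => [|_]; last by rewrite mul0e.
  rewrite mem_setE in_itv/= andbT => z0; rewrite integral0_eq ?mule0// => r.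
  rewrite /= in_itv/= andbT => r0; rewrite indicE memNset ?mul0e//= => -[/=|].
    by rewrite ltNge z0.
  rewrite /direction/= normrZ U1 mulr1 gtr0_norm// scalerA mulVf ?gt_eqF// scale1r.
  by case: z nA {z0 U1} => z1 z2.
exists W; split => // z /= h; apply: contrapT => nW; apply: h.
have z0 : 0 <= z.1 by rewrite leNgt; apply/negP => z0; apply: nW; left.
split => //; apply: contrapT => nQ; apply: nW; right; apply: AQ => /=.
by move=> /(_ z0).
Qed.

(** It acts as a modular on integrands: monotone in the modulus, subadditive, and, for [H >= 0],
    finite exactly under the logarithmic condition. It also controls Poisson integrals in
    probability. *)
Definition jump_mass (H : T -> R) : \bar R :=
  (\int[lam]_z (Num.min `|directional H z : B| 1)%:E)%E.

Lemma norm_directional (H : T -> R) z :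
  `|directional H z : B| = `|H (direction z)| * `|z.2 : B|.
Proof. by rewrite /directional normrZ. Qed.

Lemma measurable_jump (H : T -> R) : measurable_fun setT H ->
  measurable_fun setT (fun z => Num.min `|directional H z : B| 1).
Proof.
move=> mH; apply: measurable_minr => //.
exact: (measurable_normf (measurable_directional hB mH)).
Qed.

Lemma jump_mass_le (H H' : T -> R) : (forall z, `|H z| <= `|H' z|) ->
  (jump_mass H <= jump_mass H')%E.
Proof.
move=> HH'; apply: ge0_ae_le_integral_nonmeas.
- by move=> z; rewrite lee_fin le_min normr_ge0/=.
- by move=> z; rewrite lee_fin le_min normr_ge0/=.
apply: aeW => z; rewrite lee_fin !norm_directional le_min !ge_min lexx orbT andbT.
by rewrite ler_wpM2r.
Qed.

Lemma jump_massD (H H' : T -> R) : measurable_fun setT H -> measurable_fun setT H' ->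
  (jump_mass (fun z => H z + H' z)%R <= jump_mass H + jump_mass H')%E.
Proof.
move=> mH mH'; rewrite /jump_mass -ge0_integralD//; first last.
- by apply/measurable_EFinP; exact: measurable_jump.
- by apply/measurable_EFinP; exact: measurable_jump.
apply: ge0_ae_le_integral_nonmeas.
- by move=> z; rewrite lee_fin le_min normr_ge0/=.
- by move=> z; rewrite adde_ge0// lee_fin le_min normr_ge0/=.
apply: aeW => z; rewrite -EFinD lee_fin /directional scalerDl.
set u := _ *: _; set v := _ *: _; have := ler_normD u v.
have := normr_ge0 u; have := normr_ge0 v; rewrite !minEle.
by do 3 case: ifP; lra.
Qed.

Lemma jump_mass_le_ln (H : T -> R) : measurable_fun setT H -> (forall z, 0 <= H z) ->
  (jump_mass H <= 2%:E * \int[alpha]_U \int[leb]_(s in `[0%R, +oo[)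
     (ln (1 + H (s, U) / beta U))%:E)%E.
Proof.
move=> mH H0; rewrite -(integral_directional_ln hB lamE2 sphere_ae mH H0).
have p0 z : 0 <= 1 - expR (- `|directional H z : B|).
  by rewrite subr_ge0 -expR0 ler_expR oppr_le0.
rewrite -ge0_integralZl//; last first.
- apply/measurable_EFinP; apply: measurable_funB => //; apply: measurableT_comp => //.
  by apply: measurable_funN; exact: (measurable_normf (measurable_directional hB mH)).
apply: ge0_ae_le_integral_nonmeas.
- by move=> z; rewrite lee_fin le_min normr_ge0/=.
- by move=> z; rewrite mule_ge0// lee_fin.
by apply: aeW => z; rewrite -EFinM lee_fin min1_le_expR.
Qed.

Lemma ln_le_jump_mass (H : T -> R) : measurable_fun setT H -> (forall z, 0 <= H z) ->
  (\int[alpha]_U \int[leb]_(s in `[0%R, +oo[) (ln (1 + H (s, U) / beta U))%:E <=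
   jump_mass H)%E.
Proof.
move=> mH H0; rewrite -(integral_directional_ln hB lamE2 sphere_ae mH H0).
apply: ge0_ae_le_integral_nonmeas.
- by move=> z; rewrite lee_fin subr_ge0 -expR0 ler_expR oppr_le0.
- by move=> z; rewrite lee_fin le_min normr_ge0/=.
by apply: aeW => z; rewrite lee_fin expR_le_min1.
Qed.

(** The logarithm is at most [ln (1 + C / c)] on a time interval of finite length, and [alpha] is
    finite. The lower bound [c] of [beta] enters here: it makes step functions integrable. *)
Lemma jump_mass_bounded (H : T -> R) (C t : R) : measurable_fun setT H ->
  (forall z, `|H z| <= C) -> (forall z, H z != 0 -> 0 <= z.1 <= t) ->
  (jump_mass H < +oo)%E.
Proof.
move=> mH HC Ht.
have C0 : 0 <= C by apply: le_trans (HC (0, (0 : B))); exact: normr_ge0.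
apply: (@le_lt_trans _ _ (jump_mass (fun z => `|H z|))).
  by apply: jump_mass_le => z; rewrite normr_id.
apply: le_lt_trans (jump_mass_le_ln _ _) _ => //; first exact: measurableT_comp.
apply: lte_mul_pinfty => //.
pose D : set R := `[0, `|t|]%classic.
pose M := ln (1 + C / c).
have M0 : 0 <= M by rewrite ln_ge0// lerDl divr_ge0// ltW.
have b0 U : S0 U -> 0 < beta U by move=> /S0P[_]; exact: lt_le_trans.
have ln0 U s : S0 U -> 0 <= ln (1 + `|H (s, U)| / beta U).
  by move=> /b0 bU; rewrite ln_ge0// lerDl divr_ge0// ltW.
rewrite (_ : (\int[alpha]_U _ = \int[alpha]_U `| \int[leb]_(s in `[0%R, +oo[)
     (ln (1 + `|H (s, U)| / beta U))%:E |)%E); last first.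
  apply: ae_eq_integral_nonmeas; apply: (ae_imply S0_ae) => U SU.
  by rewrite gee0_abs// integral_ge0// => s _; rewrite lee_fin ln0.
apply: (@le_lt_trans _ _ (\int[alpha]_U (M%:E * leb D)))%E.
  apply: ge0_ae_le_integral_nonmeas => //.
    by move=> U; rewrite mule_ge0// lee_fin.
  apply: (ae_imply S0_ae) => U SU; have [_ cb] := S0P SU.
  rewrite gee0_abs; last by apply: integral_ge0 => s _; rewrite lee_fin ln0.
  have -> : leb D = (\int[leb]_s (\1_D s)%:E)%E by rewrite integral_indic ?setIT//; exact: measurable_itv.
  rewrite -ge0_integralZl//; last first.
    by apply/measurable_EFinP/measurable_indicP; exact: measurable_itv.
  rewrite [X in (X <= _)%E]integral_mkcond; apply: ge0_ae_le_integral_nonmeas.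
  - by move=> s; apply: erestrict_ge0 => ? _; rewrite lee_fin ln0.
  - by move=> s; rewrite mule_ge0// lee_fin.
  apply: aeW => s; rewrite patchE; case: ifPn => _; last by rewrite mule_ge0// lee_fin.
  rewrite -EFinM lee_fin; have [H0|Hn0] := eqVneq (H (s, U)) 0.
    by rewrite H0 normr0 mul0r addr0 ln1 mulr_ge0.
  have /andP[/= s0 st] := Ht (s, U) Hn0.
  rewrite indicE mem_set ?mulr1; last first.
    by rewrite /D/= in_itv/= s0/=; apply: le_trans st _; exact: ler_norm.
  rewrite /M ler_ln ?posrE; last 2 first.
  - by rewrite ltr_wpDr// divr_ge0// ltW// b0.
  - by rewrite ltr_wpDr// divr_ge0// ltW// b0.
  rewrite lerD2l; apply: ler_pM => //; first by rewrite invr_ge0 ltW// b0.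
  by rewrite lef_pV2// posrE// b0.
rewrite integral_cst//; apply: lte_mul_pinfty => //.
- by rewrite mule_ge0// lee_fin.
- by rewrite fin_numM// /D lebesgue_measure_itv/=; case: ifP.
by rewrite -ge0_fin_numE//; exact: fin_num_measure.
Qed.

Definition jump_massR (H : T -> R) : R := \int[lam]_z Num.min `|directional H z : B| 1.

Lemma jump_integrable H : measurable_fun setT H -> (jump_mass H < +oo)%E ->
  lam.-integrable setT (EFin \o (fun z => Num.min `|directional H z : B| 1)).
Proof.
move=> mH Hoo; apply/integrableP; split.
  by apply/measurable_EFinP; exact: measurable_jump.
move: Hoo; congr (_ < _)%E; apply: eq_integral => z _ /=.
by rewrite ger0_norm// le_min normr_ge0/=.
Qed.

Lemma jump_massRE H : measurable_fun setT H -> (jump_mass H < +oo)%E ->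
  (jump_massR H)%:E = jump_mass H.
Proof.
move=> mH Hoo; rewrite /jump_massR /Rintegral fineK//.
exact: integrable_fin_num (jump_integrable mH Hoo).
Qed.

(** Dominated convergence for the modular; [ae_direction] carries the almost everywhere convergence
    from times and directions to the jumps. *)
Lemma jump_massR_cvg (H : nat -> T -> R) (G : T -> R) :
  (forall n, measurable_fun setT (H n)) -> measurable_fun setT G ->
  (jump_mass G < +oo)%E -> (forall n z, `|H n z| <= `|G z|) ->
  {ae (leb \x alpha)%E, forall z : T, 0 <= z.1 -> H n z @[n --> \oo] --> 0} ->
  jump_massR (H n) @[n --> \oo] --> 0.
Proof.
move=> mH mG Goo HG H0.
have h1 : {ae lam, forall z, setT z -> Num.min `|directional (H n) z : B| 1 @[n --> \oo] --> (0 : R)}.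
  apply: (ae_imply (ae_direction H0)) => z [_ hz] _.
  have : `|H n (direction z)| * `|z.2 : B| @[n --> \oo] --> 0.
    rewrite -(mul0r `|z.2 : B|); apply: cvgMl.
    by rewrite -(normr0 R); apply: cvg_norm.
  apply: squeeze_cvgr; last exact: cvg_cst.
  near=> n; rewrite le_min normr_ge0 ler01/= norm_directional.
  by rewrite ge_min lexx.
have h2 n z : setT z -> `|Num.min `|directional (H n) z : B| 1| <= Num.min `|directional G z : B| 1.
  move=> _; rewrite ger0_norm; last by rewrite le_min normr_ge0/=.
  rewrite le_min !ge_min lexx orbT andbT !norm_directional.
  by rewrite ler_wpM2r.
have [_] := @dominated_cvgR _ _ _ lam setT (fun n z => Num.min `|directional (H n) z : B| 1)
  (cst 0) (fun z => Num.min `|directional G z : B| 1) measurableT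
  (fun n => measurable_jump (mH n)) (measurable_cst _) h1 (jump_integrable mG Goo) h2.
by have -> : \int[lam]_z cst 0 z = 0 :> R by rewrite /Rintegral integral0.
Unshelve. all: by end_near. Qed.

End jump_mass.

(** * The Rajput-Rosinski integral *)

Section stochastic_integrals.
Context (R : realType) (B : normedModType R) (ip : B -> B -> R).
Hypothesis hB : euclidean ip.
Variables (dim : nat) (e : 'I_dim -> B).
Hypothesis oe : orthonormal ip e.
Hypothesis he : forall x, x = \sum_i ip (e i) x *: e i.
Variable K : set B.
Variables (beta : borel B -> R) (alpha : {finite_measure set (borel B) -> \bar R}).
Hypothesis mbeta : measurable_fun setT beta.
Local Notation leb := (@lebesgue_measure R).
Local Notation T := (timespace R B).
Variable lam : {measure set T -> \bar R}.
Hypothesis lamE1 : forall phi : T -> \bar R, measurable_fun setT phi -> (forall z, (0 <= phi z)%E) ->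
  (\int[lam]_z phi z = \int[leb \x alpha]_z
    ((\1_(`[0%R, +oo[%classic : set R) z.1)%:E * \int[leb]_(r in `]0%R, +oo[)
      (phi (z.1, (r *: (z.2 : B))%R : borel B) * (gamma_density beta z.2 r)%:E)))%E.
Hypothesis lamE2 : forall phi : T -> \bar R, measurable_fun setT phi -> (forall z, (0 <= phi z)%E) ->
  (\int[lam]_z phi z = \int[alpha]_U \int[leb]_(s in `[0%R, +oo[)
    \int[leb]_(r in `]0%R, +oo[)
      (phi (s, (r *: (U : B))%R : borel B) * (gamma_density beta U r)%:E))%E.
Variables (S0 : set (borel B)) (c : R).
Hypothesis mS0 : measurable S0.
Hypothesis S0a : alpha (~` S0) = 0%E.
Hypothesis c0 : 0 < c.
Hypothesis S0K : S0 `<=` unit_sphere K.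
Hypothesis cbeta : forall U, unit_sphere K U -> c <= beta U.
Context d (Omega : measurableType d) (P : probability Omega R) (N : R.-ker Omega ~> T).
Hypothesis prm : poisson_random_measure P N lam.

Let S0P U : S0 U -> (`|U : B| = 1) /\ (c <= beta U).
Proof. by move=> /S0K SU; split; [case: SU|exact: cbeta]. Qed.

Local Notation jump_mass := (jump_mass lam).
Local Notation jump_massR := (jump_massR lam).

(** The pathwise candidate for the stochastic integral, with a value at every [w]; it is a genuine
    integral a.s. when [jump_mass H] is finite. *)
Definition sint (H : T -> R) (w : Omega) : borel B := bint ip e (N w) (directional H).

Lemma measurable_sint H : measurable_fun setT H -> measurable_fun setT (sint H).
Proof.
by move=> mH; apply: (measurable_bint hB); exact: (measurable_directional hB mH).
Qed.

Lemma sint_ae H : measurable_fun setT H -> (jump_mass H < +oo)%E ->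
  {ae P, forall w, bintegrable (N w) (directional H)}.
Proof. by move=> mH; apply: (prm_bintegrable prm); exact: (measurable_directional hB mH). Qed.

Local Notation nrm V := (fun w => `|V w : B|).

Lemma sint_min1 H : measurable_fun setT H -> (jump_mass H < +oo)%E ->
  min1 P (nrm (sint H)) <= dim.+1%:R * jump_massR H.
Proof.
move=> mH Hoo.
have := prm_bint_min1 hB oe prm (measurable_directional hB mH) Hoo.
rewrite -/(jump_mass H) -(jump_massRE hB mH Hoo) -EFinM => h.
rewrite -lee_fin /min1 /Rintegral fineK//.
apply: (integrable_fin_num measurableT); apply: min1_integrable => //.
by apply: measurable_normf; exact: measurable_sint.
Qed.

Lemma directionalB (H H' : T -> R) z :
  directional (fun z => H z - H' z) z = (directional H z : B) - (directional H' z : B) :> B.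
Proof. by rewrite /directional scalerBl. Qed.

Lemma jump_massB H H' : measurable_fun setT H -> measurable_fun setT H' ->
  (jump_mass H < +oo)%E -> (jump_mass H' < +oo)%E ->
  (jump_mass (fun z => H z - H' z)%R < +oo)%E.
Proof.
move=> mH mH' Hoo H'oo; apply: le_lt_trans (jump_massD hB _ mH _) _.
  exact: measurable_funN.
apply: lte_add_pinfty => //; apply: le_lt_trans (jump_mass_le _ (H' := H') _) _ => //.
by move=> z; rewrite normrN.
Qed.

Lemma sintB H H' : measurable_fun setT H -> measurable_fun setT H' ->
  (jump_mass H < +oo)%E -> (jump_mass H' < +oo)%E ->
  {ae P, forall w, (sint H w : B) - (sint H' w : B) = sint (fun z => H z - H' z) w}.
Proof.
move=> mH mH' Hoo H'oo; move: (sint_ae mH Hoo) (sint_ae mH' H'oo).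
apply: filterS2 => w i1 i2; rewrite /sint -(bintegrableB hB oe he i1 i2).2.
by congr bint; apply/funext => z; rewrite directionalB.
Qed.

Section dist.
Implicit Types V W : Omega -> borel B.

Lemma measurable_dist V W : measurable_fun setT V -> measurable_fun setT W ->
  measurable_fun setT (fun w => `|(V w : B) - (W w : B)|).
Proof.
move=> mV mW; apply: (@measurable_normf R B _ _ setT (fun w => (V w : B) - W w : borel B)).
by apply: (measurable_addb hB) => //; exact: (measurable_oppb hB).
Qed.

Definition dist V W : R := min1 P (fun w => `|(V w : B) - (W w : B)|).

Lemma dist_ge0 V W : 0 <= dist V W.
Proof. exact: min1_ge0. Qed.

Lemma dist_triangle V W Z : measurable_fun setT V -> measurable_fun setT W ->
  measurable_fun setT Z -> dist V Z <= dist V W + dist W Z.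
Proof.
move=> mV mW mZ; apply: le_trans (min1D _ _ _ _ _) => //; try exact: measurable_dist.
apply: min1_le => //; try exact: measurable_dist.
  by apply: measurable_funD; exact: measurable_dist.
by apply: aeW => w; exact: ler_distD.
Qed.

Lemma distC V W : dist V W = dist W V.
Proof. by congr (min1 P _); apply/funext => w; rewrite distrC. Qed.

Lemma dist_sint V V' H H' : measurable_fun setT H -> measurable_fun setT H' ->
  (jump_mass H < +oo)%E -> (jump_mass H' < +oo)%E ->
  measurable_fun setT V -> measurable_fun setT V' ->
  {ae P, forall w, V w = sint H w} -> {ae P, forall w, V' w = sint H' w} ->
  dist V V' <= dim.+1%:R * jump_massR (fun z => H z - H' z).
Proof.
move=> mH mH' Hoo H'oo mV mV' VH VH'.
apply: le_trans (sint_min1 _ (jump_massB mH mH' Hoo H'oo)); last exact: measurable_funB.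
apply: min1_le => //; try exact: measurable_dist.
  by apply: measurable_normf; apply: measurable_sint; exact: measurable_funB.
have h := sintB mH mH' Hoo H'oo; move: VH VH'; apply: filterS3 h => w h -> ->.
by rewrite h.
Qed.
End dist.

Section steps.
Variable f : step_function K.

Lemma step_eval_bounded : exists C t : R,
  (forall z, `|step_eval f z| <= C) /\ (forall z, step_eval f z != 0 -> 0 <= z.1 <= t).
Proof.
have [t ht] := choice (@step_bounded _ _ K f).
exists (\sum_j `|step_coef (s := f) j|), (\sum_j `|t j|); split.
  move=> z; apply: le_trans (ler_norm_sum _ _ _) _; apply: ler_sum => j _.
  by rewrite normrM ler_piMr// indicE; case: (_ \in _); rewrite ?normr1 ?normr0.
move=> z; apply: contraNT => hz; rewrite /step_eval big1// => j _.
rewrite indicE; case: (boolP (z \in _)) => [|_]; last by rewrite mulr0.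
rewrite inE => /ht [/=]; rewrite in_itv/= => /andP[z0 zt] _.
exfalso; move/negP: hz; apply; rewrite z0/=.
apply: le_trans zt _; apply: le_trans (ler_norm _) _.
by rewrite (bigD1 j)//= lerDl sumr_ge0.
Qed.

Lemma measurable_step_eval : measurable_fun setT (step_eval f).
Proof.
apply: measurable_sum => j; apply: measurable_funM => //.
by apply/measurable_indicP; exact: step_measurable.
Qed.

Lemma step_jump_mass : (jump_mass (step_eval f) < +oo)%E.
Proof.
have [C [t [h1 h2]]] := step_eval_bounded.
exact: (jump_mass_bounded hB lamE2 mS0 S0a c0 S0P measurable_step_eval h1 h2).
Qed.

Lemma measurable_step_integral A : measurable A ->
  measurable_fun setT (step_integral ip N f A : Omega -> borel B).
Proof.
move=> mA; apply: (measurable_sumb hB) => j; apply: (measurable_scaleb hB) => //.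
have mI : measurable_fun setT (\1_(A `&` step_set (s := f) j) : T -> R).
  by apply/measurable_indicP; apply: measurableI => //; exact: step_measurable.
exact: (measurable_vintegral hB oe he N (measurable_directional hB mI)).
Qed.

(** Each [Lambda] is a.s. a [bint], with a null set depending on the step; as the steps are finitely
    many, linearity holds off one null set. *)
Lemma step_integralE A : measurable A ->
  {ae P, forall w, step_integral ip N f A w = sint (fun z => \1_A z * step_eval f z) w}.
Proof.
move=> mA; pose I j : T -> R := \1_(A `&` step_set (s := f) j).
have mI j : measurable_fun setT (I j).
  by apply/measurable_indicP; apply: measurableI => //; exact: step_measurable.
have Ioo j : (jump_mass (I j) < +oo)%E.
  have [t ht] := @step_bounded _ _ K f j.
  apply: (jump_mass_bounded hB lamE2 mS0 S0a c0 S0P (mI j) (C := 1) (t := t)).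
    by move=> z; rewrite /I indicE; case: (_ \in _); rewrite ?normr1 ?normr0.
  move=> z; rewrite /I indicE; case: (boolP (z \in _)) => [|_]; last by rewrite eqxx.
  by rewrite inE => -[_ /ht [/=]]; rewrite in_itv.
have h := ae_forall_ord (fun j => sint_ae (mI j) (Ioo j)).
apply: (ae_imply h) => w hw.
rewrite /step_integral /sint.
rewrite (_ : directional _ = fun z => \sum_j step_coef (s := f) j *: (directional (I j) z : B)).
  rewrite (bint_sum hB oe he _ hw); apply: eq_bigr => j _; congr (_ *: _).
  exact: (vintegralE hB oe he (hw j)).
apply/funext => z; rewrite /directional /step_eval mulr_sumr scaler_suml.
apply: eq_bigr => j _; rewrite scalerA /I; congr (_ *: _).
by rewrite mulrCA; congr (_ * _); rewrite !indicE in_setI -natrM mulnb.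
Qed.
End steps.

Import HBNNSimple.

Lemma nnsfun_step (g : {nnsfun T >-> R}) (t : R) :
  (forall z, g z != 0 -> (`[0, t]%classic `*` unit_sphere K) z) ->
  exists f : step_function K, forall z, step_eval f z = g z.
Proof.
move=> hg; have [n [y [yn0 _ hy]]] := finite_range_decomposition (fimfunP g).
have sm (j : 'I_n) : measurable (g @^-1` [set y j]).
  by rewrite -[X in measurable X]setTI; apply: measurable_funP.
have sb (j : 'I_n) : exists t : R, g @^-1` [set y j] `<=` `[0, t] `*` unit_sphere K.
  by exists t => z /= gz; apply: hg; rewrite gz.
exists (@StepFunction _ _ K n y (fun j => g @^-1` [set y j]) sm sb) => z.
by rewrite /step_eval/= [RHS](hy id).
Qed.

Variable h : T -> R.
Hypothesis hint : gamma_integrand K beta alpha h.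

Let D : set T := `[0, +oo[%classic `*` S0.
Let mD : measurable D.
Proof. by apply: measurableX. Qed.

(* [h] with its irrelevant values set to 0 *)
Definition sphere_restr (z : T) : R := (h \_ D) z.

Lemma measurable_sphere_restr : measurable_fun setT sphere_restr.
Proof.
apply/(measurable_restrictT _ mD); have [mh _ _] := hint.
apply: measurable_funS mh; last by move=> z [/=]; rewrite in_itv/= andbT.
rewrite (_ : [set z : T | 0 <= z.1] = setT `&` (fst : T -> R) @^-1` `[0, +oo[).
  exact: (@measurable_fst _ _ (measurableTypeR R) (borel B)).
by rewrite setTI; apply/seteqP; split => z /=; rewrite in_itv/= andbT.
Qed.

Lemma sphere_restrE (s : R) U : 0 <= s -> S0 U -> sphere_restr (s, U) = h (s, U).
Proof.
by move=> s_0 SU; rewrite /sphere_restr patchE mem_set//; split => //=; rewrite in_itv/= s_0.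
Qed.

Lemma sphere_restr_ge0 z : 0 <= sphere_restr z.
Proof.
have [_ h0 _] := hint; rewrite /sphere_restr patchE; case: ifPn => //.
rewrite inE => -[/=]; rewrite in_itv/= andbT; case: z => s U /= s_0 /S0K SU.
exact: h0.
Qed.

Lemma sphere_restr_jump_mass : (jump_mass sphere_restr < +oo)%E.
Proof.
apply: le_lt_trans (jump_mass_le_ln hB lamE2 mS0 S0a c0 S0P measurable_sphere_restr sphere_restr_ge0) _.
apply: lte_mul_pinfty => //; have [_ _] := hint; congr (_ < _)%E.
apply: ae_eq_integral_nonmeas; apply: (ae_imply (S0_ae mS0 S0a)) => U SU.
apply: eq_integral => s; rewrite mem_setE in_itv/= andbT => s_0.
by rewrite sphere_restrE.
Qed.

Let H := sphere_restr.
Let mH := measurable_sphere_restr.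
Let H0 := sphere_restr_ge0.
Let Hoo := sphere_restr_jump_mass.

Let mIH A : measurable A -> measurable_fun setT (fun z => \1_A z * H z).
Proof. by move=> mA; apply: measurable_funM => //; exact/measurable_indicP. Qed.

Let indic_le1 (A : set T) (x : R) z : `|\1_A z * x| <= `|x|.
Proof.
by rewrite indicE; case: (_ \in _); rewrite ?mul1r ?mul0r ?normr0.
Qed.

Let jump_mass_indic A G : (jump_mass G < +oo)%E -> (jump_mass (fun z => \1_A z * G z)%R < +oo)%E.
Proof. by apply: le_lt_trans; apply: jump_mass_le => z; exact: indic_le1. Qed.

(** Simple functions increasing to [H], cut off at time [n] and to directions in [S0], differ from
    [H] by at most [H]; so dominated convergence of the modular gives convergence in probability
    over every Borel set. *)
Theorem stochastic_integral_exists : stochastic_integral ip K P N alpha h (sint H).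
Proof.
have mHE : measurable_fun setT (EFin \o H) by exact/measurable_EFinP.
pose g := nnsfun_approx measurableT mHE.
have gH z : (g n z) @[n --> \oo] --> H z.
  have : EFin \o g^~ z @ \oo --> (EFin \o H) z by apply: cvg_nnsfun_approx => // x _; rewrite lee_fin H0.
  by move=> /fine_cvg.
have gle n z : g n z <= H z.
  rewrite -lee_fin; rewrite /g nnsfun_approxE; apply: le_approx => // x _.
  by rewrite lee_fin H0.
pose Dn n : set T := `[0, n%:R]%classic `*` S0.
have mDn n : measurable (Dn n) by apply: measurableX.
pose g' n := proj_nnsfun (g n) (mDn n).
have g'E n z : g' n z = g n z * \1_(Dn n) z by [].
have hex n : exists f : step_function K, forall z, step_eval f z = g' n z.
  apply: (@nnsfun_step _ n%:R) => z; rewrite g'E indicE.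
  case: (boolP (z \in _)) => [|_]; last by rewrite mulr0 eqxx.
  by rewrite inE => -[? ?] _; split => //; exact: S0K.
have [f hf] := choice hex.
have fE n z : step_eval (f n) z = g n z * \1_(Dn n) z by rewrite hf g'E.
have f0 n z : 0 <= step_eval (f n) z by rewrite fE mulr_ge0.
have fH n z : `|step_eval (f n) z - H z| <= `|H z|.
  have h1 : step_eval (f n) z <= H z.
    rewrite fE; apply: le_trans (gle n z).
    by rewrite indicE; case: (_ \in _); rewrite ?mulr1// mulr0.
  by rewrite distrC !ger0_norm ?subr_ge0// lerBlDr lerDl.
have fcvg : {ae (leb \x alpha)%E, forall z : T, 0 <= z.1 -> step_eval (f n) z @[n --> \oo] --> H z}.
  apply: (ae_imply (S0_prod_ae mS0 S0a)) => z Sz z0.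
  apply: cvg_trans (gH z); apply: near_eq_cvg; near=> n; rewrite fE indicE mem_set ?mulr1//.
  split => //=; rewrite in_itv/= z0/=; near: n; exact: nbhs_infty_ger.
have cvgA A : measurable A -> cvg_in_probability P
    (fun n => step_integral ip N (f n) A : Omega -> B) (sint (fun z => \1_A z * H z) : Omega -> B).
  move=> mA; apply/(cvg_in_probability_min1 P hB) => [n||].
  - exact: measurable_step_integral.
  - by apply: measurable_sint; exact: mIH.
  pose F n z := \1_A z * step_eval (f n) z - \1_A z * H z.
  have FE n z : F n z = \1_A z * (step_eval (f n) z - H z) by rewrite /F mulrBr.
  have mF n : measurable_fun setT (F n).
    apply: measurable_funB; last exact: mIH.
    apply: measurable_funM; first exact/measurable_indicP.
    exact: measurable_step_eval.
  have hc : dim.+1%:R * jump_massR (F n) @[n --> \oo] --> 0.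
    rewrite -(mulr0 dim.+1%:R); apply: cvgMr.
    apply: (jump_massR_cvg hB lamE1 mS0 S0a S0P mF mH Hoo).
      by move=> n z; rewrite FE; apply: le_trans (indic_le1 _ _ _) (fH n z).
    apply: (ae_imply fcvg) => z hz z0.
    under eq_fun do rewrite FE; rewrite -(mulr0 (\1_A z)); apply: cvgMr.
    by rewrite -(subrr (H z)); apply: cvgB; [exact: hz|exact: cvg_cst].
  apply: squeeze_cvgr hc; last exact: cvg_cst.
  near=> n; rewrite min1_ge0//=.
  apply: (@dist_sint _ _ (fun z => \1_A z * step_eval (f n) z) (fun z => \1_A z * H z)).
  - by apply: measurable_funM; [exact/measurable_indicP|exact: measurable_step_eval].
  - exact: mIH.
  - by apply: jump_mass_indic; exact: step_jump_mass.
  - exact: jump_mass_indic.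
  - exact: measurable_step_integral.
  - by apply: measurable_sint; exact: mIH.
  - exact: step_integralE.
  - exact: aeW.
exists f; split.
- move: fcvg (S0_prod_ae mS0 S0a); apply: filterS2 => -[s U] hz SU s_0.
  by rewrite -sphere_restrE//; exact: hz.
- move=> A mA; exists (sint (fun z => \1_A z * H z)); last exact: cvgA.
  by apply: measurable_sint; exact: mIH.
- exact: measurable_sint.
have := cvgA setT measurableT; rewrite (_ : (fun z => _) = H)//.
by apply/funext => z; rewrite indicT mul1r.
Unshelve. all: by end_near. Qed.

(** With [D_ n] the error of the [n]-th step function, the gliding hump is applied to [p n A], the
    size in probability of the integral of [D_ n] over [A], dominated by the modular [a n A]. The
    definition supplies convergence over each set, which forces [p n setT] to 0. *)
Theorem stochastic_integral_unique Y : stochastic_integral ip K P N alpha h Y ->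
  {ae P, forall w, Y w = sint H w}.
Proof.
move=> [f [fh fA mY fY]].
have mf n : measurable_fun setT (step_eval (f n)) by exact: measurable_step_eval.
have foo n : (jump_mass (step_eval (f n)) < +oo)%E by exact: step_jump_mass.
pose D_ n z := step_eval (f n) z - H z.
have mD_ n : measurable_fun setT (D_ n) by exact: measurable_funB.
have Doo n : (jump_mass (D_ n) < +oo)%E by exact: jump_massB.
pose E n A z := \1_A z * D_ n z.
have mE n A : measurable A -> measurable_fun setT (E n A).
  by move=> mA; apply: measurable_funM => //; exact/measurable_indicP.
have Eoo n A : (jump_mass (E n A) < +oo)%E by exact: jump_mass_indic.
pose p n A := min1 P (nrm (sint (E n A))).
pose a n A := dim.+1%:R * jump_massR (E n A).
(* Up to time [M], the points where all errors of index at least [M] are bounded by 1. On this set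
   the modular tends to 0 by domination; for fixed [n] the complements exhaust nothing as [M] grows,
   by convergence almost everywhere. *)
pose AM M : set T := (`[0, M%:R]%classic `*` S0) `&`
   \bigcap_(n in [set n | (M <= n)%N]) [set z | `|D_ n z| <= 1].
have mnD n : measurable_fun setT (fun z => `|D_ n z|) by exact: measurableT_comp.
have mAM M : measurable (AM M).
  apply: measurableI; first exact: measurableX.
  apply: bigcap_measurable => [|n _]; first by exists M => /=.
  rewrite (_ : [set z | _] = setT `&` (fun z => `|D_ n z|) @^-1` `]-oo, 1]).
    exact: mnD.
  by rewrite setTI; apply/seteqP; split => z /=; rewrite in_itv.
have msint n A : measurable A -> measurable_fun setT (sint (E n A)).
  by move=> mA; apply: measurable_sint; exact: mE.
have sub n C D' : measurable C -> measurable D' -> C `<=` D' ->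
    {ae P, forall w, (sint (E n D') w : B) - (sint (E n C) w : B) = sint (E n (D' `\` C)) w}.
  move=> mC mD' CD; apply: (ae_imply (sintB (mE n _ mD') (mE n _ mC) (Eoo _ _) (Eoo _ _))).
  move=> w ->; congr sint; apply/funext => z; rewrite /E -mulrBl; congr (_ * _).
  rewrite !indicE in_setD; case: (boolP (z \in C)) => [|_].
    by rewrite inE => /CD /mem_set ->; rewrite subrr.
  by rewrite subr0 andbT.
have mnrm n A : measurable A -> measurable_fun setT (nrm (sint (E n A))).
  by move=> mA; apply: measurable_normf; exact: msint.
have p0 : p n setT @[n --> \oo] --> 0.
  apply: (@gliding_hump _ T R p a AM) => //.
  - move=> M M' MM' z [[/= z1 z2] z3]; split.
      split => //=; move: z1; rewrite !in_itv/= => /andP[-> /le_trans]; apply.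
      by rewrite ler_nat.
    by move=> n /= M'n; apply: z3 => /=; exact: leq_trans M'n.
  - move=> n C D' mC mD' CD; have mDC : measurable (D' `\` C) by exact: measurableD.
    apply: le_trans (min1D _ _ _ _ _) => //; try exact: mnrm.
    apply: min1_le => //; try exact: mnrm.
      by apply: measurable_funD; exact: mnrm.
    apply: (ae_imply (sub n C D' mC mD' CD)) => w <-.
    by rewrite -lerBlDl; exact: lerB_dist.
  - move=> n C D' mC mD' CD; have mDC : measurable (D' `\` C) by exact: measurableD.
    apply: le_trans (min1D _ _ _ _ _) => //; try exact: mnrm.
    apply: min1_le => //; try exact: mnrm.
      by apply: measurable_funD; exact: mnrm.
    apply: (ae_imply (sub n C D' mC mD' CD)) => w <-.
    by rewrite distrC -lerBlDl; exact: lerB_dist.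
  - by move=> n C mC; rewrite min1_ge0//=; apply: sint_min1 => //; exact: mE.
  - move=> n C D' mC mD' CD; apply: ler_wpM2l => //.
    rewrite -lee_fin !(jump_massRE hB)//; try exact: mE.
    apply: jump_mass_le => z; rewrite /E !normrM ler_wpM2r// !indicE.
    by case: (boolP (z \in C)) => [|_]; [rewrite inE => /CD /mem_set ->|rewrite normr0].
  - move=> M; rewrite -(mulr0 dim.+1%:R); apply: cvgMr.
    pose G : T -> R := \1_(`[0, M%:R]%classic `*` S0).
    have mG : measurable_fun setT G by apply/measurable_indicP; exact: measurableX.
    have Goo : (jump_mass G < +oo)%E.
      apply: (jump_mass_bounded hB lamE2 mS0 S0a c0 S0P mG (C := 1) (t := M%:R)).
        by move=> z; rewrite /G indicE; case: (_ \in _); rewrite ?normr1 ?normr0.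
      move=> z; rewrite /G indicE; case: (boolP (z \in _)) => [|_]; last by rewrite eqxx.
      by rewrite inE => -[/=]; rewrite in_itv.
    (* The bound by 1 holds for indices [n >= M] only, hence the shift of the sequence by [M]. *)
    have shift (u : nat -> R) (l : R) : (u (n + M)%N @[n --> \oo] --> l) = (u @ \oo --> l).
      exact: cvg_shiftn.
    rewrite -shift.
    have hc := jump_massR_cvg hB lamE1 mS0 S0a S0P (fun n => mE (n + M)%N _ (mAM M)) mG Goo.
    apply: hc.
    + move=> n z; rewrite /E /G !indicE; case: (boolP (z \in AM M)) => [|_].
        rewrite inE => -[/mem_set -> /(_ (n + M)%N)]; rewrite mul1r normr1; apply.
        exact: leq_addl.
      by rewrite mul0r normr0.
    move: fh (S0_prod_ae mS0 S0a); apply: filterS2 => -[s U] hz SU s_0.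
    rewrite -(mulr0 (\1_(AM M) (s, U))); apply: cvgMr; rewrite (shift (fun n => D_ n (s, U))).
    rewrite -(subrr (H (s, U))); apply: cvgB; last exact: cvg_cst.
    by rewrite /H sphere_restrE//; exact: hz.
  - move=> n; rewrite -(mulr0 dim.+1%:R); apply: cvgMr.
    have hc := jump_massR_cvg hB lamE1 mS0 S0a S0P
      (fun M => mE n _ (measurableC (mAM M))) (mD_ n) (Doo n).
    apply: hc; first by move=> M z; exact: indic_le1.
    move: fh (S0_prod_ae mS0 S0a); apply: filterS2 => -[s U] hz SU s_0.
    have Dz : D_ m (s, U) @[m --> \oo] --> 0.
      rewrite -(subrr (H (s, U))); apply: cvgB; last exact: cvg_cst.
      by rewrite /H sphere_restrE//; exact: hz.
    have [M0 _ hM0] : \forall m \near \oo, `|D_ m (s, U)| <= 1.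
      by have /cvgrPdist_le/(_ _ ltr01) := Dz; apply: filterS => m; rewrite sub0r normrN.
    apply: cvg_near_cst; near=> M; rewrite /E indicE memNset ?mul0r//; apply.
    split; first by split => //=; rewrite in_itv/= s_0; near: M; exact: nbhs_infty_ger.
    move=> m /= Mm; apply: hM0 => /=; apply: leq_trans Mm.
    by near: M; exact: nbhs_infty_ge.
  - move=> C mC; have [Z mZ] := fA C mC.
    move=> /(cvg_in_probability_min1 P hB (fun n => measurable_step_integral (f n) mC) mZ) hZ.
    have mSH : measurable_fun setT (sint (fun z => \1_C z * H z)).
      by apply: measurable_sint; exact: mIH.
    (* The limit [Z] over [C] is not yet identified, but [p n C] converges to its distance from the
       Poisson integral over [C]. *)
    pose l := dist Z (sint (fun z => \1_C z * H z)).
    suff : p n C @[n --> \oo] --> l by move=> hl; apply/cvg_ex; exists l.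
    have pE n : p n C = dist (step_integral ip N (f n) C) (sint (fun z => \1_C z * H z)).
      have mst := measurable_step_integral (f n) mC.
      have h1 : {ae P, forall w, (step_integral ip N (f n) C w : B) -
          (sint (fun z => \1_C z * H z) w : B) = sint (E n C) w}.
        have mCf : measurable_fun setT (fun z => \1_C z * step_eval (f n) z).
          by apply: measurable_funM => //; exact/measurable_indicP.
        have h2 := sintB mCf (mIH mC)
          (jump_mass_indic _ (foo n)) (jump_mass_indic _ Hoo).
        move: (step_integralE (f n) mC) h2; apply: filterS2 => w -> ->.
        by congr sint; apply/funext => z; rewrite /E /D_ mulrBr.
      apply/eqP; rewrite eq_le; apply/andP; split; apply: min1_le => //;
        try exact: mnrm; try exact: measurable_dist; by apply: (ae_imply h1) => w ->.
    apply/cvgrPdist_le => /= eps e0.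
    move/cvgrPdist_le : hZ => /(_ _ e0); apply: filterS => n.
    rewrite sub0r normrN ger0_norm; last exact: min1_ge0.
    rewrite -/(dist (step_integral ip N (f n) C) Z) pE => hn.
    have mst := measurable_step_integral (f n) mC.
    have t1 := dist_triangle mst mZ mSH; have t2 := dist_triangle mZ mst mSH.
    rewrite (distC Z (step_integral ip N (f n) C)) in t2; rewrite ler_norml; apply/andP; split; rewrite /l; lra.
have mH' := measurable_sint mH.
have d0 : dist Y (sint H) = 0.
  apply/eqP; rewrite eq_le dist_ge0 andbT; apply/ler_addgt0Pl => eps e0.
  have e20 : 0 < eps / 2 by rewrite divr_gt0.
  have mst n := measurable_step_integral (f n) measurableT.
  move: fY => /(cvg_in_probability_min1 P hB mst mY)/cvgrPdist_le/(_ _ e20) h1.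
  move/cvgrPdist_le : p0 => /(_ _ e20) h2.
  near \oo => n.
  have : `|0 - min1 P (fun w => `|(step_integral ip N (f n) setT w : B) - (Y w : B)|)| <= eps / 2.
    by near: n.
  have : `|0 - p n setT| <= eps / 2 by near: n.
  rewrite !sub0r !normrN !ger0_norm; [|exact: min1_ge0..].
  have -> : p n setT = dist (step_integral ip N (f n) setT) (sint H).
    have h3 : {ae P, forall w, (step_integral ip N (f n) setT w : B) - (sint H w : B) = sint (E n setT) w}.
      move: (step_integralE (f n) measurableT) (sintB (mf n) mH (foo n) Hoo); apply: filterS2 => w ->.
      rewrite (_ : (fun z => \1_setT z * _) = step_eval (f n)); last first.
        by apply/funext => z; rewrite indicT mul1r.
      by move=> ->; congr sint; apply/funext => z; rewrite /E indicT mul1r.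
    apply/eqP; rewrite eq_le; apply/andP; split; apply: min1_le => //;
      try exact: mnrm; try exact: measurable_dist; by apply: (ae_imply h3) => w ->.
  rewrite -/(dist (step_integral ip N (f n) setT) Y) (distC _ Y) => h1' h2'.
  by have := dist_triangle mY (mst n) mH'; lra.
have := min1_eq0 (measurable_dist mY mH') _ d0.
move=> /(_ (fun _ => normr_ge0 _)); apply: filterS => w /eqP.
by rewrite normr_eq0 subr_eq0 => /eqP.
Unshelve. all: by end_near. Qed.

End stochastic_integrals.

Section integral_transfer.
Local Open Scope ereal_scope.

(** Passes from nonnegative to signed integrands. [Q] is a side condition inherited by positive and
    negative parts, such as vanishing at 0. *)
Lemma integral_transfer d d' (T : measurableType d) (T' : measurableType d') (R : realType)
    (m : {measure set T -> \bar R}) (m' : {measure set T' -> \bar R}) (g : T -> T')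
    (Q : (T' -> \bar R) -> Prop) :
  (forall phi, Q phi -> Q phi^\+ /\ Q phi^\-) ->
  (forall phi, measurable_fun setT phi -> (forall x, 0 <= phi x) -> Q phi ->
    \int[m']_x phi x = \int[m]_x phi (g x)) ->
  forall phi, measurable_fun setT phi -> Q phi -> \int[m']_x phi x = \int[m]_x phi (g x).
Proof.
move=> Qpn h phi mphi Qphi; have [Qp Qn] := Qpn _ Qphi.
rewrite integralE [RHS]integralE; congr (_ - _).
- rewrite (h _ (measurable_funepos mphi) _ Qp)//.
  by apply: eq_integral => x _; rewrite !funeposE.
- rewrite (h _ (measurable_funeneg mphi) _ Qn)//.
  by apply: eq_integral => x _; rewrite !funenegE.
Qed.

Section law.
Context d (Omega : measurableType d) (R : realType) (P : probability Omega R).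
Context d' (T : measurableType d') (mu : probability T R) (X : Omega -> T).
Hypothesis lawX : has_law P X mu.

Lemma integral_has_law (phi : T -> \bar R) : measurable_fun setT phi ->
  \int[mu]_x phi x = \int[P]_w phi (X w).
Proof.
have [mX hX] := lawX => mphi.
apply: (integral_transfer (Q := fun=> True)) => // psi mpsi psi0 _.
have := @ge0_integral_pushforward _ _ _ _ R X mX P setT psi measurableT mpsi (fun x _ => psi0 x).
rewrite preimage_setT => <-.
by apply: eq_measure_integral => A mA _; first [exact: hX|apply/esym; exact: hX].
Qed.

Lemma Rintegral_has_law (phi : T -> R) : measurable_fun setT phi ->
  (\int[mu]_x phi x = \int[P]_w phi (X w))%R.
Proof.
move=> mphi; rewrite /Rintegral (@integral_has_law (EFin \o phi))//.
exact/measurable_EFinP.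
Qed.
End law.

Lemma law_exists d (Omega : measurableType d) (R : realType) (P : probability Omega R)
    d' (T : measurableType d') (X : Omega -> T) : measurable_fun setT X ->
  exists mu : probability T R, has_law P X mu.
Proof.
move=> mX; pose m := isMeasurableFun.Build _ _ _ _ X mX.
pose X' : {mfun Omega >-> T} := HB.pack X m.
by exists (distribution P X'); split.
Qed.
End integral_transfer.

(** * Laplace transforms are completely monotone *)

Section laplace_completely_monotone.
Context d (Y : measurableType d) (R : realType) (mu : {measure set Y -> \bar R}).
Variables (D : set Y) (y : Y -> R).
Hypothesis mD : measurable D.
Hypothesis my : measurable_fun setT y.
Hypothesis y0 : forall x, D x -> 0 <= y x.
Hypothesis yint : forall r, 0 < r -> mu.-integrable D (fun x => (expR (- (y x * r)))%:E).

Let g n (r : R) x := (- y x) ^+ n * expR (- (y x * r)).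

Let mg n r : measurable_fun D (g n r).
Proof.
apply: measurable_funTS; apply: measurable_funM.
  by apply: measurable_funX; exact: measurable_funN.
by apply: measurableT_comp => //; apply: measurable_funN; exact: measurable_funM.
Qed.

(** From [y exp (- y r / 2) <= 2 / r]: one more factor [y] costs half of the exponent. Integrability
    of all derivatives thus follows by induction from that of the transform at every [r > 0]. *)
Let g_dom n r x : 0 < r -> D x -> `|g n.+1 r x| <= 2 / r * `|g n (r / 2) x|.
Proof.
move=> r0 Dx; have yx := y0 Dx.
rewrite /g !normrM !normrX !normrN (ger0_norm yx) !(ger0_norm (expR_ge0 _)).
have -> : - (y x * r) = - (y x * (r / 2)) + - (y x * (r / 2)) by field.
rewrite expRD exprS.
have h : y x * expR (- (y x * (r / 2))) <= 2 / r.
  have e0 : expR (- (y x * (r / 2))) * expR (y x * (r / 2)) = 1 by rewrite -expRD addNr expR0.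
  have h1 : 1 + y x * (r / 2) <= expR (y x * (r / 2)) by exact: expR_ge1Dx.
  have e1 := expR_gt0 (- (y x * (r / 2))).
  have h2 := ler_wpM2l (ltW e1) h1; rewrite e0 in h2; rewrite ler_pdivlMr//; nra.
have -> : y x * y x ^+ n * (expR (- (y x * (r / 2))) * expR (- (y x * (r / 2)))) =
   (y x * expR (- (y x * (r / 2)))) * (y x ^+ n * expR (- (y x * (r / 2)))) by ring.
by rewrite ler_wpM2r// mulr_ge0// ?exprn_ge0// expR_ge0.
Qed.

Let gint n r : 0 < r -> mu.-integrable D (EFin \o g n r).
Proof.
elim: n r => [|n IH] r r0.
  apply: eq_integrable (yint r0) => // x _.
  by rewrite /g/= expr0 mul1r.
have r20 : 0 < r / 2 by rewrite divr_gt0.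
have h := integrable_norm (IH _ r20).
apply: (le_integrable mD _ _ (integrableZl mD (2 / r) h)).
  exact/measurable_EFinP.
move=> x Dx; rewrite /= lee_fin; apply: le_trans (g_dom n r0 Dx) _.
exact: ler_norm.
Qed.

Let F n (r : R) : R := \int[mu]_(x in D) g n r x.

Let g_derive n (r : R) x : is_derive r (1:R) (g n ^~ x) (g n.+1 r x).
Proof.
rewrite /g; apply: is_derive_eq; rewrite /GRing.scale/= exprS; ring.
Qed.

(** On the interval from [r / 2] to [2 r] the next derivative of the integrand is dominated by its
    modulus at the left end, which allows differentiation under the integral. *)
Let F_derive n (r : R) : 0 < r -> is_derive r (1:R) (F n) (F n.+1 r).
Proof.
move=> r0; pose u := r / 2; pose v := 2 * r.
have u0 : 0 < u by rewrite divr_gt0.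
have Ir : `]u, v[%classic r by rewrite /= in_itv/= /u /v; apply/andP; split; lra.
have I0 t : `]u, v[%classic t -> u < t by rewrite /= in_itv/= => /andP[].
have d1 t x : partial1of2 (g n) t x = g n.+1 t x.
  by rewrite partial1of2E; exact: derive_val.
have intf t : `]u, v[%classic t -> mu.-integrable D (EFin \o g n t).
  by move=> /I0 ut; apply: gint; exact: lt_trans ut.
have df t x : `]u, v[%classic t -> D x -> derivable (g n ^~ x) t 1.
  by move=> _ _; case: (g_derive n t x).
have G0 x : 0 <= `|g n.+1 u x| by [].
have iG : mu.-integrable D (EFin \o (fun x => `|g n.+1 u x|)).
  exact: (integrable_norm (gint n.+1 u0)).
have Gub t x : `]u, v[%classic t -> D x -> `|partial1of2 (g n) t x| <= `|g n.+1 u x|.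
  move=> /I0 ut Dx; rewrite d1 /g !normrM; apply: ler_wpM2l => //.
  rewrite !(ger0_norm (expR_ge0 _)) ler_expR lerN2.
  by apply: ler_wpM2l; [exact: y0|exact: ltW].
split; first exact: (derivable_under_integral mD Ir intf df G0 iG Gub).
rewrite -derive1E (differentiation_under_integral mD Ir intf df G0 iG Gub).
by apply: eq_Rintegral => x _; exact: d1.
Qed.

Lemma laplace_completely_monotone (f : R -> R) :
  (forall r, 0 < r -> f r = \int[mu]_(x in D) expR (- (y x * r))) -> completely_monotone f.
Proof.
move=> fE.
have near_pos (r : R) : 0 < r -> \forall s \near r, 0 < s.
  by move=> r0; exact: lt_nbhsr.
have fn n r : 0 < r -> derive1n n f r = F n r.
  elim: n r => [|n IH] r r0.
    by rewrite /= fE// /F; apply: eq_Rintegral => x _; rewrite /g expr0 mul1r.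
  rewrite derive1nS derive1E (@near_eq_derive _ _ _ _ (F n)).
    by have dF := F_derive n r0; exact: derive_val.
  by apply: filterS (near_pos _ r0) => s; exact: IH.
move=> n r r0; split.
  apply: (@near_eq_derivable _ _ _ (F n)); last by case: (F_derive n r0).
  by apply: filterS (near_pos _ r0) => s s0; rewrite fn.
rewrite fn// -RintegralZl//; last exact: gint.
apply: Rintegral_ge0 => x Dx; rewrite /g mulrA -exprMn mulN1r opprK.
by rewrite mulr_ge0 ?exprn_ge0 ?y0// expR_ge0.
Qed.
End laplace_completely_monotone.

(** * The law of the integral *)

Section directional_levy.
Context (R : realType) (B : normedModType R) (ip : B -> B -> R).
Hypothesis hB : euclidean ip.
Variable K : set B.
Hypothesis coneK : is_cone K.
Variables (beta : borel B -> R) (alpha : {finite_measure set (borel B) -> \bar R}).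
Hypothesis mbeta : measurable_fun setT beta.
Hypothesis alphaK : carried_by (unit_sphere K) alpha.
Local Notation leb := (@lebesgue_measure R).
Local Notation T := (timespace R B).
Variable lam : {measure set T -> \bar R}.
Hypothesis lamE2 : forall phi : T -> \bar R, measurable_fun setT phi -> (forall z, (0 <= phi z)%E) ->
  (\int[lam]_z phi z = \int[alpha]_U \int[leb]_(s in `[0%R, +oo[)
    \int[leb]_(r in `]0%R, +oo[)
      (phi (s, (r *: (U : B))%R : borel B) * (gamma_density beta U r)%:E))%E.
Variables (S0 : set (borel B)) (c : R).
Hypothesis mS0 : measurable S0.
Hypothesis S0a : alpha (~` S0) = 0%E.
Hypothesis c0 : 0 < c.
Hypothesis S0K : S0 `<=` unit_sphere K.
Hypothesis cbeta : forall U, unit_sphere K U -> c <= beta U.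
Variable H : T -> R.
Hypothesis mH : measurable_fun setT H.
Hypothesis H0 : forall z, 0 <= H z.
Hypothesis HD : forall z, H z != 0 -> S0 z.2.
Hypothesis Hoo : (jump_mass lam H < +oo)%E.

Let S0P U : S0 U -> (`|U : B| = 1) /\ (c <= beta U).
Proof. by move=> /S0K SU; split; [case: SU|exact: cbeta]. Qed.

Let b0 U : S0 U -> 0 < beta U.
Proof. by move=> /S0P[_]; exact: lt_le_trans. Qed.

Let mdir := measurable_directional hB mH.

Lemma cone0 : K 0.
Proof. by have [[x Kx] _ h] := coneK; rewrite -(scale0r x); exact: h. Qed.

Lemma coneD x y : K x -> K y -> K (x + y).
Proof.
have [_ cK sK] := coneK => Kx Ky.
have h2 : (0 : R) <= 2 by [].
have := cK _ _ 2^-1 (sK _ _ h2 Kx) (sK _ _ h2 Ky).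
rewrite !scalerA mulVf// (_ : 1 - 2^-1 = 2^-1); last by field.
by rewrite mulVf// !scale1r; apply; apply/andP; split; lra.
Qed.

Lemma directional_cone z : K (directional H z).
Proof.
have [_ _ sK] := coneK; rewrite /directional.
set x : B := z.2; have [->|x0] := eqVneq (H (z.1, (`|x|^-1 *: x : borel B))) 0.
  by rewrite scale0r; exact: cone0.
apply: (sK) => //; have [xK _] := S0K (HD x0).
have [->|xn0] := eqVneq x 0; first exact: cone0.
have -> : x = `|x| *: (`|x|^-1 *: x) by rewrite scalerA mulfV ?normr_eq0// scale1r.
exact: sK.
Qed.

Let mHU U : measurable_fun setT (fun s : measurableTypeR R => H (s, U)).
Proof. by apply: (measurableT_comp mH); exact: measurable_pair2. Qed.

Let thin_int (z : T) (r : R) : R :=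
  \1_(`[0, +oo[%classic : set R) z.1 *
  (if 0 < H z then expR (- (beta z.2 * (r / H z))) else 0).

Let thinningE U r : thinning beta H U r = (\int[leb]_s (thin_int (s, U) r)%:E)%E.
Proof.
rewrite /thinning integral_mkcond; apply: eq_integral => s _.
by rewrite patchE /thin_int/= indicE; case: ifP; rewrite ?mul1r ?mul0r.
Qed.

Let thin_int0 z r : 0 <= thin_int z r.
Proof. by rewrite mulr_ge0//; case: ifP => // _; exact: expR_ge0. Qed.

Let mthin r : measurable_fun setT (thin_int ^~ r).
Proof.
apply: measurable_funM; first by apply: measurableT_comp => //; exact: measurable_fst.
apply: measurable_fun_ifT => //.
- by apply: measurable_fun_ltr => //; exact: mH.
- apply: measurableT_comp => //; apply: measurable_funN; apply: measurable_funM.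
    exact: (measurableT_comp mbeta measurable_snd).
  by apply: measurable_funM => //; exact: measurable_funVr.
Qed.

Lemma measurable_thinning r : measurable_fun setT (fun U => thinning beta H U r).
Proof.
under eq_fun do rewrite thinningE.
apply: (@measurable_fun_fubini_tonelli_G _ _ _ _ _ leb (EFin \o thin_int ^~ r)).
  exact/measurable_EFinP.
by move=> z; rewrite lee_fin.
Qed.

(** With [t = x / b] the chain is [exp (- r / t) <= t / (t + r) <= (1 + 1 / r) t / (1 + t) <= (1 + 1
    / r) ln (1 + t)]. The logarithmic condition thus bounds the thinning at every positive
    radius. *)
Let thin_le_ln (x b r : R) : 0 < x -> 0 < b -> 0 < r ->
  expR (- (b * (r / x))) <= (1 + r^-1) * ln (1 + x / b).
Proof.
move=> x0 b_0 r0; pose t := x / b; have t0 : 0 < t by rewrite divr_gt0.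
rewrite -/t (_ : b * (r / x) = r / t); last by rewrite /t; field; rewrite !gt_eqF.
have h1 : expR (- (r / t)) <= t / (t + r).
  rewrite expRN (_ : t / (t + r) = (1 + r / t)^-1); last by field; rewrite !gt_eqF// addr_gt0.
  rewrite lef_pV2 ?posrE ?expR_gt0 ?expR_ge1Dx//.
  by rewrite addr_gt0// divr_gt0.
have h2 : t / (1 + t) <= ln (1 + t).
  have t1 : 0 < 1 + t by lra.
  have := @le_ln1Dx R ((1 + t)^-1 - 1); rewrite (_ : 1 + ((1 + t)^-1 - 1) = (1 + t)^-1); last by ring.
  have hp : 0 < (1 + t)^-1 by rewrite invr_gt0.
  have hi : -1 < (1 + t)^-1 - 1 by lra.
  move=> /(_ hi); rewrite lnV ?posrE// => h.
  have -> : t / (1 + t) = 1 - (1 + t)^-1 by field; rewrite gt_eqF.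
  by lra.
apply: le_trans h1 _; apply: le_trans (_ : (1 + r^-1) * (t / (1 + t)) <= _); last first.
  by apply: ler_wpM2l => //; rewrite addr_ge0// invr_ge0 ltW.
rewrite -subr_ge0 (_ : _ - _ = t * (r ^+ 2 + t) / (r * (1 + t) * (t + r))).
  apply: divr_ge0; first by apply: mulr_ge0; nra.
  by apply: mulr_ge0; [apply: mulr_ge0|]; lra.
by field; rewrite !gt_eqF// ?addr_gt0.
Qed.

(** In the bound by [thin_le_ln] the radius enters only through a constant factor, so one null set
    of directions serves all [r]. *)
Lemma thinning_fin : {ae alpha, forall U, S0 U /\ forall r, 0 < r -> (thinning beta H U r < +oo)%E}.
Proof.
pose l (z : T) : \bar R := (`|\1_(`[0, +oo[%classic : set R) z.1 * ln (1 + H z / beta z.2)|)%:E.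
have ml : measurable_fun setT l.
  apply/measurable_EFinP; apply: measurableT_comp => //; apply: measurable_funM.
    by apply: measurableT_comp => //; exact: measurable_fst.
  apply: measurableT_comp => //; apply: measurable_funD => //; apply: measurable_funM => //.
  by apply: measurable_funVr; exact: (measurableT_comp mbeta measurable_snd).
have lE U : S0 U -> (\int[leb]_s l (s, U) = \int[leb]_(s in `[0%R, +oo[) (ln (1 + H (s, U) / beta U))%:E)%E.
  move=> SU; rewrite [RHS]integral_mkcond; apply: eq_integral => s _.
  rewrite patchE /l/= indicE; case: ifP => _; last by rewrite mul0r normr0.
  by rewrite mul1r ger0_norm// ln_ge0// lerDl divr_ge0// ltW// b0.
have l0 U : (0 <= \int[leb]_s l (s, U))%E by apply: integral_ge0 => s _; rewrite /l lee_fin.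
have := ge0_integral_ae_lty (mu := alpha) (f := fun U => (\int[leb]_s l (s, U))%E).
move=> /(_ _ l0); move=> H1.
have lfin : (\int[alpha]_U \int[leb]_s l (s, U) < +oo)%E.
  apply: le_lt_trans Hoo.
  apply: le_trans (ln_le_jump_mass hB lamE2 mS0 S0a c0 S0P mH H0).
  rewrite le_eqVlt; apply/orP; left; apply/eqP; apply: ae_eq_integral_nonmeas.
  by apply: (ae_imply (S0_ae mS0 S0a)) => U; exact: lE.
have ml2' : measurable_fun setT (fun U => (\int[leb]_s l (s, U))%E).
  by apply: (@measurable_fun_fubini_tonelli_G _ _ _ _ _ leb l ml) => z; rewrite /l lee_fin.
move: (H1 ml2' lfin) (S0_ae mS0 S0a); apply: filterS2 => U lU SU; split => // r r0.
apply: (@le_lt_trans _ _ ((1 + r^-1)%:E * \int[leb]_s l (s, U))%E); last first.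
  by apply: lte_mul_pinfty => //; rewrite lee_fin addr_ge0// invr_ge0 ltW.
rewrite thinningE -ge0_integralZl//; last 3 first.
- by apply: (measurableT_comp ml); exact: measurable_pair2.
- by move=> s _; rewrite /l lee_fin.
- by rewrite lee_fin addr_ge0// invr_ge0 ltW.
apply: ge0_ae_le_integral_nonmeas.
- by move=> s; rewrite lee_fin.
- move=> s; have cr : 0 <= 1 + r^-1 by rewrite addr_ge0// invr_ge0 ltW.
  by rewrite /l mule_ge0 ?lee_fin.
apply: aeW => s; rewrite /l /thin_int/= -EFinM lee_fin.
rewrite indicE; case: (_ \in _); last by rewrite !mul0r normr0 mulr0.
rewrite !mul1r; case: ifP => Hs.
  by apply: le_trans (thin_le_ln Hs (b0 SU) r0) _; rewrite ler_wpM2l ?ler_norm// addr_ge0// invr_ge0 ltW.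
by rewrite mulr_ge0// addr_ge0// invr_ge0 ltW.
Qed.

Definition thinningR (U : borel B) (r : R) : R := fine (thinning beta H U r).

Lemma thinning_completely_monotone : {ae alpha, forall U, completely_monotone (thinningR U)}.
Proof.
apply: (ae_imply thinning_fin) => U [SU Uoo].
pose D : set (measurableTypeR R) := `[0, +oo[%classic `&` [set s | 0 < H (s, U)].
have mD : measurable D.
  apply: measurableI => //.
  rewrite (_ : [set s | _] = setT `&` (fun s => H (s, U)) @^-1` `]0, +oo[).
    exact: mHU.
  by rewrite setTI; apply/seteqP; split => s /=; rewrite in_itv/= andbT.
pose y (s : measurableTypeR R) := beta U / H (s, U).
have my : measurable_fun setT y by apply: measurable_funM => //; exact: measurable_funVr.
have yE r s : beta U * (r / H (s, U)) = y s * r by rewrite /y; ring.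
have tE r : thinning beta H U r = (\int[leb]_(s in D) (expR (- (y s * r)))%:E)%E.
  rewrite /thinning [LHS]integral_mkcond [RHS]integral_mkcond; apply: eq_integral => s _.
  rewrite !patchE /D in_setI; case: (s \in _) => //=.
  case: ifP => Hs; first by rewrite mem_set// yE.
  by rewrite memNset//= Hs.
have me r : measurable_fun D (fun s => (expR (- (y s * r)))%:E).
  apply/measurable_EFinP; apply: measurable_funTS; apply: measurableT_comp => //.
  by apply: measurable_funN; exact: measurable_funM.
apply: (@laplace_completely_monotone _ _ _ leb D y mD my).
- by move=> s [_ /= Hs]; rewrite /y divr_ge0// ltW// b0.
- move=> r r0; apply/integrableP; split => //.
  have := Uoo r r0; rewrite tE; congr (_ < _)%E; apply: eq_integral => s _.
  by rewrite /= ger0_norm// expR_ge0.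
- by move=> r r0; rewrite /thinningR tE.
Qed.

Lemma measurable_thinningR r : measurable_fun setT (thinningR ^~ r).
Proof. by apply: measurableT_comp => //; exact: measurable_thinning. Qed.

(** The function [k] is left free up to null sets of directions, so that the statement serves
    [thinningR] as well as the [k] of a given Levy measure; in the second case finiteness of the
    jump mass is deduced from it. *)
Lemma directional_measure : exists nu : {measure set (borel B) -> \bar R},
  (forall phi : borel B -> \bar R, measurable_fun setT phi -> phi (0 : B) = 0%E ->
    (\int[nu]_x phi x = \int[lam]_z phi (directional H z))%E) /\
  forall k : borel B -> R -> R,
    {ae alpha, forall U, forall r, 0 < r -> thinning beta H U r = (k U r)%:E} ->
    forall E, measurable E -> nu E = polar alpha k E.
Proof.
have set1m : measurable ([set 0 : B] : set (borel B)).
  rewrite (_ : [set 0 : B] = setT `&` (fun x : borel B => `|x : B|) @^-1` [set 0]).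
    exact: (@measurable_normb R B measurableT [set 0]).
  by rewrite setTI; apply/seteqP; split => x /= => [->|/normr0_eq0//]; rewrite normr0.
(* The image measure could have infinite mass at 0, from jumps killed by [H = 0]; this density
   removes them. *)
pose f z : R := \1_(directional H @^-1` (~` [set (0 : B)])) z.
have mf : measurable_fun setT f.
  apply/measurable_indicP; rewrite -[X in measurable X]setTI; apply: mdir => //.
  exact: measurableC.
have [nu1 h1] := density_measure lam mf (fun z => ler0n _ _).
have [nu h2] := image_measure nu1 mdir.
have nuE (phi : borel B -> \bar R) : measurable_fun setT phi -> phi (0 : B) = 0%E ->
    (\int[nu]_x phi x = \int[lam]_z phi (directional H z))%E.
  move=> mphi phi0; apply: (@integral_transfer _ _ _ _ R lam nu (directional H) (fun phi => phi (0 : B) = 0%E)) => //.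
    by move=> psi psi0; split; rewrite ?funeposE ?funenegE psi0 ?oppe0 maxxx.
  move=> psi mpsi psi_ge0 psi0; rewrite h2// h1//; last exact: measurableT_comp.
  apply: eq_integral => z _; rewrite /f indicE; case: (boolP (z \in _)) => hz; first by rewrite mule1.
  rewrite mule0; move: hz; rewrite notin_setE/= => /contrapT ->.
  by rewrite psi0.
have nupolar k : {ae alpha, forall U, forall r, 0 < r -> thinning beta H U r = (k U r)%:E} ->
    forall E, measurable E -> nu E = polar alpha k E.
  move=> hk E mE; pose psi (x : borel B) : \bar R := (\1_(E `\` [set (0 : B)]) x)%:E.
  have mE0 : measurable (E `\` [set (0 : B)]) by exact: measurableD.
  have mpsi : measurable_fun setT psi by exact/measurable_EFinP/measurable_indicP.
  have psi00 : psi (0 : B) = 0%E by rewrite /psi indicE memNset// => -[_]; apply.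
  have nu0 : nu [set (0 : B)] = 0%E.
    have -> : nu [set (0 : B)] = (\int[nu]_x (\1_[set (0 : B)] x)%:E)%E by rewrite integral_indic// setIT.
    have mi0 : measurable_fun setT (fun x : borel B => (\1_[set (0 : B)] x : R)%:E).
      by apply/measurable_EFinP/measurable_indicP.
    rewrite h2// h1//; last exact: (measurableT_comp mi0 mdir).
    rewrite integral0_eq// => z _; rewrite /f !indicE.
    case: (boolP (z \in _)) => hz; last by rewrite mule0.
    by rewrite memNset ?mul0e//; move: hz; rewrite inE.
  have -> : nu E = (\int[nu]_x psi x)%E.
    transitivity (\int[nu]_x (\1_E x)%:E)%E; first by rewrite integral_indic// setIT.
    apply: ae_eq_integral_nonmeas; exists [set (0 : B)]; split => // x /= hx.
    apply: contrapT => x0; apply: hx; rewrite /psi !indicE in_setD.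
    by rewrite (_ : (x \in [set (0 : B)]) = false) ?andbT//; exact: memNset.
  rewrite nuE// (integral_directional hB lamE2 (sphere_ae mS0 S0a c0 S0P) mH H0)//; last first.
    by move=> x; rewrite lee_fin.
  apply: ae_eq_integral_nonmeas; apply: filterS2 (S0_ae mS0 S0a) hk => U SU Uk.
  apply: eq_integral => r; rewrite in_itv0y => r0.
  have rU : (r *: (U : B) : B) != 0.
    have [U1 _] := S0P SU.
    by rewrite -normr_eq0 normrZ U1 mulr1 normr_eq0 gt_eqF.
  rewrite /psi indicE in_setD (_ : (_ \in [set (0 : B)]) = false) ?andbT; last first.
    by apply: memNset => /= h; move: rU; rewrite h eqxx.
  by rewrite EFinM indicE Uk// EFinM.
by exists nu; split.
Qed.

Lemma directional_levy : exists nu : {measure set (borel B) -> \bar R},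
  [/\ forall phi : borel B -> \bar R, measurable_fun setT phi -> phi (0 : B) = 0%E ->
        (\int[nu]_x phi x = \int[lam]_z phi (directional H z))%E,
      is_levy_measure_on K nu,
      (forall E, measurable E -> nu E = polar alpha thinningR E) &
      GGC_levy_measure K nu].
Proof.
have [nu [nuE nupol]] := directional_measure.
have nupolar E : measurable E -> nu E = polar alpha thinningR E.
  apply: nupol; apply: (ae_imply thinning_fin) => U [_ Uoo] r r0.
  rewrite /thinningR fineK// ge0_fin_numE ?Uoo//.
  by rewrite thinningE; apply: integral_ge0 => s _; rewrite lee_fin.
exists nu; split; [exact: nuE| |exact: nupolar|].
- split.
    pose E0 : set (borel B) := [set x | S0 ((`|x : B|^-1 *: (x : B)) : borel B)].
    have mE0 : measurable E0.
      rewrite (_ : E0 = setT `&` (fun x : borel B => ((`|x : B|^-1 *: (x : B)) : borel B)) @^-1` S0); last by rewrite setTI.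
      suff : measurable_fun setT (fun x : borel B => ((`|x : B|^-1 *: (x : B)) : borel B)) by apply.
      apply: (measurable_scaleb hB) => //; apply: measurable_funVr; exact: measurable_normb.
    exists (~` E0); split; first exact: measurableC.
      rewrite nupolar; last exact: measurableC.
      rewrite /polar (_ : 0%E = \int[alpha]_U 0)%E; last by rewrite integral0.
      apply: ae_eq_integral_nonmeas; apply: (ae_imply (S0_ae mS0 S0a)) => U SU.
      apply: integral0_eq => r; rewrite /= in_itv/= andbT => r0.
      rewrite indicE memNset ?mul0r//=; apply; rewrite /E0/=.
      have [U1 _] := S0P SU.
      by rewrite normrZ U1 mulr1 gtr0_norm// scalerA mulVf ?gt_eqF// scale1r.
    apply: subsetC => x /S0K[Kx _].
    have [_ _ sK] := coneK; have [->|xn0] := eqVneq (x : B) 0; first exact: cone0.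
    have -> : (x : B) = `|x : B| *: (`|x : B|^-1 *: (x : B)).
      by rewrite scalerA mulfV ?normr_eq0// scale1r.
    exact: sK.
  rewrite nuE//.
    apply/measurable_EFinP; apply: measurable_minr => //; exact: measurable_normb.
  by rewrite normr0 minEle ler01.
- exists alpha, thinningR; split => //.
  + by move=> r _; exact: measurable_thinningR.
  + exact: thinning_completely_monotone.
Qed.

Section law.
Variables (dim : nat) (e : 'I_dim -> B).
Hypothesis oe : orthonormal ip e.
Hypothesis he : forall x, x = \sum_i ip (e i) x *: e i.
Context d (Omega : measurableType d) (P : probability Omega R) (N : R.-ker Omega ~> T).
Hypothesis prm : poisson_random_measure P N lam.
Variables (mu : probability (borel B) R) (nu : {measure set (borel B) -> \bar R}).
Hypothesis lawmu : has_law P (sint ip e N H) mu.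
Hypothesis nuE : forall phi : borel B -> \bar R, measurable_fun setT phi -> phi (0 : B) = 0%E ->
  (\int[nu]_x phi x = \int[lam]_z phi (directional H z))%E.
Hypothesis levynu : is_levy_measure_on K nu.

Let RnuE (phi : borel B -> R) : measurable_fun setT phi -> phi (0 : B) = 0 ->
  \int[nu]_x phi x = \int[lam]_z phi (directional H z).
Proof.
move=> mphi phi0; rewrite /Rintegral (nuE (phi := EFin \o phi))//; first exact/measurable_EFinP.
by rewrite /= phi0.
Qed.

Let ip_sint (z : B) : {ae P, forall w, ip z (sint ip e N H w) = \int[N w]_x ip z (directional H x)}.
Proof.
apply: (ae_imply (prm_bintegrable prm mdir Hoo)) => w iw.
by rewrite (bint_ip hB oe he z iw).2.
Qed.

Lemma ip_jump_integrable (z : B) : (\int[lam]_x (Num.min `|ip z (directional H x)| 1)%:E < +oo)%E.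
Proof.
have mnrm := measurable_normf mdir.
apply: (@le_lt_trans _ _ ((Num.max `|z| 1)%:E * jump_mass lam H)%E); last first.
  by apply: lte_mul_pinfty => //; rewrite lee_fin le_max ler01 orbT.
rewrite -ge0_integralZl//; last first.   by apply/measurable_EFinP; exact: (measurable_jump hB mH).
apply: ge0_ae_le_integral_nonmeas.
- by move=> x; rewrite lee_fin le_min normr_ge0/=.
- by move=> x; rewrite -EFinM lee_fin mulr_ge0// ?le_max ?ler01 ?orbT// le_min normr_ge0/=.
apply: aeW => x; rewrite -EFinM lee_fin.
have := cauchy_schwarz hB z (directional H x).
set u := `|ip _ _|; have := normr_ge0 (ip z (directional H x)); rewrite -/u.
have := normr_ge0 (directional H x : B); have := normr_ge0 z.
set a := `|z|; set b := `|directional H x : B|.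
rewrite /Num.max !minEle; case: ltP; do 2 case: ifP; nra.
Qed.

(** Campbell's formula with exponent [i] gives the characteristic function for every [z]; with
    exponent -1 it gives the Laplace transform for [theta] in the dual cone, where the pairing with
    each jump is nonnegative. No drift arises because the small jumps are not compensated. *)
Lemma sint_LK : regular_LK ip K mu 0 nu.
Proof.
have mipz z : measurable_fun setT (fun x : borel B => ip z x) by exact: measurable_ip.
have mipd z : measurable_fun setT (fun x => ip z (directional H x)) by exact: (measurable_ipf hB).
have msint := measurable_sint hB e N mH.
have aeR (phi : R -> R) z : measurable_fun setT phi ->
    \int[mu]_x phi (ip z x) = \int[P]_w phi (\int[N w]_x ip z (directional H x)).
  move=> mphi; rewrite (Rintegral_has_law lawmu (phi := fun x => phi (ip z x))); last exact: measurableT_comp.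
  rewrite /Rintegral; congr fine; apply: ae_eq_integral_nonmeas.
  by apply: (ae_imply (ip_sint z)) => w ->.
have mcos : measurable_fun setT (@cos R) by apply: continuous_measurable_fun; exact: continuous_cos.
have msin : measurable_fun setT (@sin R) by apply: continuous_measurable_fun; exact: continuous_sin.
have ec01 v : ec 0 1 v = cos v :> R by rewrite /ec mul0r oppr0 expR0 !mul1r.
have es01 v : es 0 1 v = sin v :> R by rewrite /es mul0r oppr0 expR0 !mul1r.
have z0 z x : 0 <= 0 * ip z (directional H x) by rewrite mul0r.
have cf z := campbell prm (a := 0) 1 (lexx 0) (mipd z) (z0 z) (ip_jump_integrable z).
have nucos z : \int[nu]_x (cos (ip z x) - 1) = \int[lam]_x (ec 0 1 (ip z (directional H x)) - 1).
  rewrite RnuE; last 2 first.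
  - by apply: measurable_funB => //; exact: measurableT_comp.
  - by rewrite (ip0r hB) cos0 subrr.
  by apply: eq_Rintegral => x _; rewrite ec01.
have nusin z : \int[nu]_x sin (ip z x) = \int[lam]_x es 0 1 (ip z (directional H x)).
  rewrite RnuE; last 2 first.
  - exact: measurableT_comp.
  - by rewrite (ip0r hB) sin0.
  by apply: eq_Rintegral => x _; rewrite es01.
split.
- by split => //; exact: cone0.
- move=> theta th.
  have d0 x : 0 <= 1 * ip theta (directional H x) by rewrite mul1r; apply: th; exact: directional_cone.
  have [cl _] := campbell prm (a := 1) 0 ler01 (mipd theta) d0 (ip_jump_integrable theta).
  have ec10 v : ec 1 0 v = expR (- v) :> R by rewrite /ec mul1r mul0r cos0 mulr1.
  have es10 v : es 1 0 v = 0 :> R by rewrite /es mul1r mul0r sin0 mulr0.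
  have mexp : measurable_fun setT (fun v : R => expR (- v)) by apply: measurableT_comp => //; exact: measurable_funN.
  have mI : measurable_fun setT (fun w => \int[N w]_x ip theta (directional H x)).
    exact: measurable_prm_Rintegral.
  have intP : P.-integrable setT (EFin \o (fun w => expR (- \int[N w]_x ip theta (directional H x)))).
    apply: (@bounded_integrable_prob _ _ _ _ _ 1); first exact: (measurableT_comp mexp mI).
    move=> w; rewrite ger0_norm ?expR_ge0// -expR0 ler_expR oppr_le0.
    by apply: Rintegral_ge0 => x _; apply: th; exact: directional_cone.
  have -> : (\int[mu]_x (expR (- ip theta x))%:E =
      (\int[P]_w expR (- \int[N w]_x ip theta (directional H x)))%:E)%E.
    rewrite (integral_has_law lawmu (phi := fun x => (expR (- ip theta x))%:E)); last first.
      by apply/measurable_EFinP; exact: (measurableT_comp mexp (mipz theta)).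
    rewrite [RHS]fineK; last exact: integrable_fin_num intP.
    by apply: ae_eq_integral_nonmeas; apply: (ae_imply (ip_sint theta)) => w ->.
  congr EFin; move: cl; under eq_Rintegral do rewrite ec10; move=> ->.
  rewrite (_ : \int[lam]_x es 1 0 _ = 0) ?cos0 ?mulr1; last first.
    by under eq_Rintegral do rewrite es10; rewrite /Rintegral integral0.
  rewrite (ip0r hB) oppr0 sub0r; congr expR.
  rewrite RnuE; last 2 first.
  - by apply: measurable_funB => //; exact: (measurableT_comp mexp).
  - by rewrite (ip0r hB) oppr0 expR0 subrr.
  rewrite -[RHS]mulN1r -RintegralZl//; last first.
    apply: (@le_integrable _ _ _ lam setT measurableT _ (EFin \o (fun x => Num.min `|ip theta (directional H x)| 1))).
    - apply/measurable_EFinP; apply: measurable_funB => //.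
      exact: (measurableT_comp mexp (mipd theta)).
    - move=> x _; rewrite /= lee_fin.
      have d1 : 0 <= ip theta (directional H x) by apply: th; exact: directional_cone.
      rewrite ger0_norm; last by rewrite subr_ge0 -expR0 ler_expR oppr_le0.
      rewrite [leRHS]ger0_norm; last by rewrite le_min normr_ge0/=.
      by rewrite (ger0_norm d1); exact: expR_le_min1.
    apply/integrableP; split.
      by apply/measurable_EFinP; apply: measurable_minr => //; exact: measurableT_comp.
    have := ip_jump_integrable theta; congr (_ < _)%E; apply: eq_integral => x _.
    by rewrite gee0_abs// lee_fin le_min normr_ge0/=.
  by apply: eq_Rintegral => x _; rewrite ec10; ring.
- move=> z; have [h _] := cf z; rewrite (ip0r hB) add0r aeR// nucos nusin -h.
  by apply: eq_Rintegral => w _; rewrite ec01.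
- move=> z; have [_ h] := cf z; rewrite (ip0r hB) add0r aeR// nucos nusin -h.
  by apply: eq_Rintegral => w _; rewrite es01.
Qed.
End law.
End directional_levy.

(** * The integral takes its values in the cone *)

Section countable_cone.
Context (R : realType) (B : normedModType R) (K : set B).
Hypothesis coneK : is_cone K.
Variable Q : nat -> B.
Hypothesis QK : forall n, K (Q n).

(** Combinations of the first [m] generators with coefficients in [0, m]: the image of a compact box
    under a continuous map. Their union is the generated cone, which is therefore Borel even when
    [K] is not. *)
Let C_ m : set B := [set x | exists2 v : 'rV[R]_m,
  (forall i, `[0, m%:R]%classic (v ord0 i)) & \sum_(i < m) v ord0 i *: Q i = x].

Definition countable_cone : set B := \bigcup_m C_ m.

Let C_P m (a : nat -> R) : (forall i, (i < m)%N -> 0 <= a i <= m%:R) ->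
  C_ m (\sum_(i < m) a i *: Q i).
Proof.
move=> ha; exists (\row_(i < m) a i); first by move=> i; rewrite mxE /= in_itv/= ha.
by apply: eq_bigr => i _; rewrite mxE.
Qed.

Let C_E m x : C_ m x -> exists a : nat -> R,
  [/\ forall i, 0 <= a i <= m%:R, forall i, (m <= i)%N -> a i = 0 & x = \sum_(i < m) a i *: Q i].
Proof.
move=> [v hv <-]; exists (fun i => if insub i is Some j then v ord0 j else 0); split.
- move=> i; case: insubP => [j _ _|_]; last by rewrite lexx ler0n.
  by have := hv j; rewrite /= in_itv.
- by move=> i mi; rewrite insubF// ltnNge mi.
by apply: eq_bigr => i _; rewrite valK.
Qed.

Let C_mono m n (a : nat -> R) : (m <= n)%N -> (forall i, (m <= i)%N -> a i = 0) ->
  \sum_(i < m) a i *: Q i = \sum_(i < n) a i *: Q i.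
Proof.
move=> mn am; rewrite -!(big_mkord xpredT (fun i => a i *: Q i)) (big_cat_nat (n := m) (p := n))//=.
rewrite [X in _ + X]big_nat_cond [X in _ + X]big1 ?addr0// => i.
by rewrite andbT => /andP[mi _]; rewrite am// scale0r.
Qed.

Lemma countable_cone0 : countable_cone 0.
Proof. by exists 0%N => //; have := @C_P 0 (fun=> 0); rewrite big_ord0; apply. Qed.

Lemma countable_cone_gen n : countable_cone (Q n).
Proof.
exists n.+1 => //; have h := @C_P n.+1 (fun i => (i == n)%:R).
rewrite (_ : Q n = \sum_(i < n.+1) (i == n :> nat)%:R *: Q i).
  by apply: h => i _; rewrite ler0n/= ler_nat; case: (i == n).
rewrite (bigD1 ord_max)//= eqxx scale1r big1 ?addr0// => i ni.
by rewrite (_ : (i == n :> nat) = false) ?scale0r//; apply: negbTE; move: ni; rewrite -val_eqE.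
Qed.

Lemma countable_coneD x y : countable_cone x -> countable_cone y -> countable_cone (x + y).
Proof.
move=> [m _ /C_E[a [ha am ->]]] [n _ /C_E[b [hb bn ->]]].
exists (m + n)%N => //.
rewrite (C_mono (leq_addr n m) am) (C_mono (leq_addl m n) bn) -big_split/=.
rewrite (eq_bigr (fun i : 'I_(m + n) => (a i + b i) *: Q i)); last by move=> i _; rewrite scalerDl.
apply: (C_P (a := fun i => a i + b i)) => i _.
have /andP[a0 a1] := ha i; have /andP[b0 b1] := hb i.
by rewrite addr_ge0//= natrD lerD.
Qed.

Lemma countable_coneZ t x : 0 <= t -> countable_cone x -> countable_cone (t *: x).
Proof.
move=> t0 [m _ /C_E[a [ha am ->]]].
pose k := Num.bound t; have tk : t <= k%:R by apply/ltW/archi_boundP.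
(* The scaled coefficients are at most [m * k]; adding [m] keeps at least [m] generators
   available. *)
exists (m * k + m)%N => //.
rewrite (C_mono (leq_addl (m * k) m) am) scaler_sumr.
rewrite (eq_bigr (fun i : 'I_(m * k + m) => (t * a i) *: Q i)); last by move=> i _; rewrite scalerA.
apply: (C_P (a := fun i => t * a i)) => i _.
have /andP[a0 a1] := ha i; rewrite mulr_ge0//= natrD natrM.
apply: le_trans (_ : m%:R * k%:R <= _); last by rewrite lerDl.
by rewrite mulrC ler_pM.
Qed.

Lemma countable_cone_sub : countable_cone `<=` K.
Proof.
have [_ _ sK] := coneK.
move=> x [m _ /C_E[a [ha _ ->]]]; elim/big_ind : _ => [|u v|i _].
- exact: cone0.
- exact: coneD.
by apply: (sK); [have /andP[] := ha i|exact: QK].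
Qed.

Lemma measurable_countable_cone : measurable (countable_cone : set (borel B)).
Proof.
apply: bigcupT_measurable => m.
suff : closed (C_ m).
  move=> cC; rewrite -[X in measurable X]setCK; apply: measurableC.
  by apply: measurable_openb; rewrite openC.
apply: compact_closed; first exact: norm_hausdorff.
rewrite (_ : C_ m = (fun v : 'rV[R]_m => \sum_(i < m) v ord0 i *: Q i) @`
    [set v : 'rV[R]_m | forall i, `[0, m%:R]%classic (v ord0 i)]); last first.
  by apply/seteqP; split => x [v hv hx]; exists v.
have hc := @rV_compact R m (fun=> `[0, m%:R]%classic) (fun i => @segment_compact R 0 m%:R).
apply: (continuous_compact _ hc); apply: continuous_subspaceT.
suff h (s : seq 'I_m) : continuous (fun v : 'rV[R]_m => \sum_(i <- s) v ord0 i *: Q i) by exact: h.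
elim: s => [|i s IH].
  rewrite (_ : (fun v => _) = cst 0); first exact: cst_continuous.
  by apply/funext => v; rewrite big_nil.
rewrite (_ : (fun v => _) = (fun v : 'rV[R]_m => v ord0 i *: Q i + \sum_(j <- s) v ord0 j *: Q j)); last first.
  by apply/funext => v; rewrite big_cons.
move=> v; have hv : (fun u : 'rV[R]_m => u ord0 i) u @[u --> v] --> v ord0 i.
  exact: coord_continuous.
have hq : (fun u : 'rV[R]_m => u ord0 i *: Q i) u @[u --> v] --> v ord0 i *: Q i.
  apply: (@cvg_comp _ _ _ (fun u : 'rV[R]_m => u ord0 i) (fun t : R => t *: Q i) _ _ _ hv).
  exact: (@scalel_continuous _ _ (Q i) (v ord0 i)).
exact: (cvgD hq (IH v)).
Qed.
End countable_cone.

Section carried.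
Context (R : realType) (B : normedModType R) (ip : B -> B -> R).
Hypothesis hB : euclidean ip.
Variable K : set B.
Hypothesis coneK : is_cone K.
Variables (beta : borel B -> R) (alpha : {finite_measure set (borel B) -> \bar R}).
Local Notation leb := (@lebesgue_measure R).
Local Notation T := (timespace R B).
Variable lam : {measure set T -> \bar R}.
Hypothesis lamE2 : forall phi : T -> \bar R, measurable_fun setT phi -> (forall z, (0 <= phi z)%E) ->
  (\int[lam]_z phi z = \int[alpha]_U \int[leb]_(s in `[0%R, +oo[)
    \int[leb]_(r in `]0%R, +oo[)
      (phi (s, (r *: (U : B))%R : borel B) * (gamma_density beta U r)%:E))%E.
Variables (S0 : set (borel B)) (c : R).
Hypothesis mS0 : measurable S0.
Hypothesis S0a : alpha (~` S0) = 0%E.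
Hypothesis c0 : 0 < c.
Hypothesis S0K : S0 `<=` unit_sphere K.
Hypothesis cbeta : forall U, unit_sphere K U -> c <= beta U.
Variable H : T -> R.
Hypothesis mH : measurable_fun setT H.
Hypothesis H0 : forall z, 0 <= H z.
Hypothesis HD : forall z, H z != 0 -> S0 z.2.
Hypothesis Hoo : (jump_mass lam H < +oo)%E.
Variables (dim : nat) (e : 'I_dim -> B).
Hypothesis oe : orthonormal ip e.
Hypothesis he : forall x, x = \sum_i ip (e i) x *: e i.
Context d (Omega : measurableType d) (P : probability Omega R) (N : R.-ker Omega ~> T).
Hypothesis prm : poisson_random_measure P N lam.

Let S0P U : S0 U -> (`|U : B| = 1) /\ (c <= beta U).
Proof. by move=> /S0K SU; split; [case: SU|exact: cbeta]. Qed.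

Let b0 U : S0 U -> 0 < beta U.
Proof. by move=> /S0P[_]; exact: lt_le_trans. Qed.

(** Frullani's integral with [h = beta U * exp M] has a smaller integrand and equals
    [ln (1 + exp M)], which exceeds [M]. *)
Lemma gamma_density_infinite U : 0 < beta U ->
  (\int[leb]_(r in `]0%R, +oo[) (gamma_density beta U r)%:E = +oo)%E.
Proof.
move=> bU; apply/eqyP => M M0.
pose h := beta U * expR M.
have h0 : 0 <= h by rewrite mulr_ge0 ?expR_ge0// ltW.
have := frullani h0 bU; rewrite /h mulrAC divff ?gt_eqF// mul1r => hM.
apply: (@le_trans _ _ (ln (1 + expR M))%:E).
  by rewrite lee_fin -[leLHS]expRK ler_ln ?posrE ?addr_gt0 ?expR_gt0// lerDr.
rewrite -hM integral_mkcond [leRHS]integral_mkcond; apply: ge0_ae_le_integral_nonmeas.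
- move=> r; apply: erestrict_ge0 => {}r; rewrite /= in_itv/= andbT => r0.
  rewrite lee_fin mulr_ge0 ?divr_ge0 ?expR_ge0 ?(ltW r0)//.
  by rewrite subr_ge0 -expR0 ler_expR oppr_le0 mulr_ge0// ltW.
- move=> r; apply: erestrict_ge0 => {}r; rewrite /= in_itv/= andbT => r0.
  by rewrite lee_fin divr_ge0 ?expR_ge0// ltW.
apply: aeW => r; rewrite !patchE; case: ifPn => //; rewrite in_itv0y => r0.
rewrite lee_fin /gamma_density ler_piMl// ?divr_ge0 ?expR_ge0 ?(ltW r0)//.
Qed.

(* The jumps in a given set of directions are a.s. absent or infinitely many. *)
Lemma direction_dichotomy (A : set T) : measurable A ->
  let E := [set z | (directional H z : B) != 0 /\ A (direction z)] in
  measurable E /\ (lam E = 0%E \/ lam E = +oo%E).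
Proof.
move=> mA E.
have mdir := measurable_directional hB mH.
have mE : measurable E.
  rewrite (_ : E = (setT `&` (fun z => `|directional H z : B|) @^-1` `]0, +oo[) `&`
      (setT `&` @direction R B @^-1` A)).
    by apply: measurableI; [exact: (measurable_normf mdir)|exact: (measurable_direction hB)].
  rewrite !setTI; apply/seteqP; split => z /=; rewrite in_itv/= andbT normr_gt0 => -[? ?]; split => //.
split => //.
have m1 : measurable_fun setT (EFin \o (\1_E : T -> R)).
  by apply/measurable_EFinP/measurable_indicP.
have -> : lam E = (\int[lam]_z (EFin \o (\1_E : T -> R)) z)%E by rewrite /comp integral_indic// setIT.
set L := (\int[lam]_z _)%E.
(* Each ray contributes 0 or [+oo], values unchanged by doubling; a nonnegative [L] with [2 L = L]
   is 0 or [+oo]. *)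
have L2 : (2%:E * L)%E = L.
  rewrite /L -ge0_integralZl//; last by move=> z _; rewrite lee_fin.
  have i0 z : (0 <= (EFin \o (\1_E : T -> R)) z)%E by rewrite lee_fin.
  have i2 z : (0 <= 2%:E * (EFin \o (\1_E : T -> R)) z)%E by rewrite mule_ge0.
  have l1 := lamE2 (measurable_funeM 2%:E m1) i2; have l2 := lamE2 m1 i0.
  rewrite l1 l2.
  apply: ae_eq_integral_nonmeas; apply: (ae_imply (S0_ae mS0 S0a)) => U SU.
  have [U1 _] := S0P SU; apply: eq_integral => s _ /=.
  have dirr r : 0 < r -> direction (s, (r *: (U : B))%R : borel B) = (s, U).
    move=> r0; rewrite /direction/=; congr pair.
    by rewrite normrZ U1 mulr1 gtr0_norm// scalerA mulVf ?gt_eqF// scale1r.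
  pose chi : R := ((H (s, U) != 0) && `[< A (s, U) >])%:R.
  have chiE r : r \in `]0, +oo[%classic -> \1_E (s, (r *: (U : B))%R : borel B) = chi.
    rewrite in_itv0y => r0; rewrite indicE; congr ((nat_of_bool _)%:R).
    rewrite /E; apply/idP/idP.
      rewrite inE /= directional_ray// dirr//.
      move=> [h1 /asboolT ->]; rewrite andbT; apply: contraNneq h1 => ->.
      by rewrite mul0r scale0r.
    move=> /andP[Hn0 /asboolW As]; rewrite inE /= directional_ray// dirr//.
    split => //; rewrite -normr_eq0 normrZ U1 mulr1 normr_eq0 mulf_neq0//.
    by rewrite gt_eqF.
  have I1 : (\int[leb]_(r in `]0%R, +oo[) ((\1_E (s, (r *: (U : B))%R : borel B))%:E * (gamma_density beta U r)%:E) =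
     if chi == 0%R then 0 else +oo)%E.
    case: ifPn => hc.
      by apply: integral0_eq => r /mem_set hr; rewrite chiE// (eqP hc) mul0e.
    rewrite -(gamma_density_infinite (b0 SU)); apply: eq_integral => r hr.
    rewrite chiE// (_ : chi = 1) ?mul1e//.
    by move: hc; rewrite /chi; case: (_ && _); rewrite ?eqxx.
  transitivity (2%:E * (if chi == 0%R then 0 else +oo : \bar R))%E; last first.
    by rewrite I1; case: ifP => _; rewrite ?mule0// gt0_muley.
  rewrite -I1 -ge0_integralZl//.
  - by apply: eq_integral => r _; rewrite muleA.
  - apply: measurable_funTS; apply: emeasurable_funM.
      apply: (measurableT_comp m1); apply: measurable_fun_pair; first exact: measurable_cst.
      by apply: (measurable_scaleb hB) => //; exact: measurable_cst.
    apply/measurable_EFinP; apply: measurable_funM; last exact: measurable_funVr.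
    by apply: measurableT_comp => //; apply: measurable_funN; exact: measurable_funM.
  - move=> r; rewrite /= in_itv/= andbT => r0.
    by rewrite -EFinM lee_fin mulr_ge0// divr_ge0 ?expR_ge0// ltW.
have L0 : (0 <= L)%E by apply: integral_ge0 => z _; rewrite lee_fin.
move: L0 L2; case: L => [x|//|//]; last by right.
rewrite -EFinM lee_fin => x0 [] x2; left; congr EFin; lra.
Qed.

(** The set [C] is the cone generated by one well-chosen direction in each charged rational box. A
    value outside [C] is separated from it by some [y]. A jump direction with [y < 0] would lie in a
    charged box inside that half-space, contradicting [y >= 0] on [C]; so [y] is nonnegative on all
    jumps, its pairing with the integral is 0, and yet some charged box lies in the half-space
    [y > 0]. *)
Theorem sint_carried : exists C : set (borel B),
  [/\ measurable C, C `<=` K & {ae P, forall w, C (sint ip e N H w)}].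
Proof.
have mdir := measurable_directional hB mH.
have mrb k : measurable (rbox ip e k : set (borel B)).
  rewrite (_ : rbox ip e k = \bigcap_(i in [set: 'I_dim]) (setT `&` (ip (e i) : borel B -> R) @^-1`
      `](ratr (k.1 i) - ratr k.2), (ratr (k.1 i) + ratr k.2)[)).
    apply: fin_bigcap_measurable; first exact: finite_finset.
    by move=> i _; apply: (measurable_ip hB).
  apply/seteqP; split => x h i; first by split => //=; have := h i; rewrite in_itv/= ltr_distl.
  by have [_] := h i I; rewrite /= in_itv/= ltr_distl.
pose E k := [set z | (directional H z : B) != 0 /\ (setT `*` rbox ip e k : set T) (direction z)].
have hE k := direction_dichotomy (measurableX (@measurableT _ (measurableTypeR R)) (mrb k)).
have mE k : measurable (E k) by have [] := hE k.
have Eoo k : lam (E k) != 0%E -> lam (E k) = +oo%E.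
  by have [_ [->|->]] := hE k; rewrite ?eqxx.
have dirE z : (directional H z : B) != 0 ->
    [/\ S0 (direction z).2, 0 < H (direction z), (z.2 : B) != 0 &
      (directional H z : B) = (H (direction z) * `|z.2 : B|) *: ((direction z).2 : B)].
  move=> dz; have [Hn0 zn0] : H (direction z) != 0 /\ (z.2 : B) != 0.
    split; apply: contraNneq dz; rewrite /directional.
      by rewrite /direction => ->; rewrite scale0r.
    by move=> ->; rewrite scaler0.
  split => //; first exact: HD.
    by rewrite lt_def Hn0 H0.
  by rewrite /direction/= scalerA -mulrA mulfV ?normr_eq0// mulr1.
(* Removing the countably many null boxes from a charged box leaves a set of positive intensity; any
   jump in it has a direction [q] all of whose rational neighbourhoods are charged. *)
have exq k : exists q : B, K q /\ (lam (E k) != 0%E ->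
    [/\ S0 q, rbox ip e k q & forall k', lam (E k') = 0%E -> ~ rbox ip e k' q]).
  have [Ek0|Ek] := eqVneq (lam (E k)) 0%E; first by exists 0; split => //; exact: cone0.
  apply: contrapT => hq; move/eqP: Ek; apply; apply: measure_negligible => //.
  pose F n : set T := if @unpickle ({ffun 'I_dim -> rat} * rat)%type n is Some k' then
     if pselect (lam (E k') = 0%E) then E k' else set0 else set0.
  have FN n : lam.-negligible (F n).
    rewrite /F; case: unpickle => [k'|]; last exact: negligible_set0.
    case: pselect => h; last exact: negligible_set0.
    by apply/negligibleP.
  apply: negligibleS (negligible_bigcup FN) => z [dz [_ /= kz]].
  have [Sd _ _ _] := dirE _ dz.
  have [k' [k'0 k'z]] : exists k', lam (E k') = 0%E /\ rbox ip e k' (direction z).2.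
    apply: contrapT => hk'; apply: hq; exists (direction z).2.
    have [Kd _] := S0K Sd; split => // _; split => // k' k'0 k'z.
    by apply: hk'; exists k'.
  by exists (pickle k') => //; rewrite /F pickleK; case: pselect.
have [q hq] := choice exq.
pose Q n : B := if @unpickle ({ffun 'I_dim -> rat} * rat)%type n is Some k then
  if lam (E k) == 0%E then 0 else q k else 0.
have QK n : K (Q n).
  rewrite /Q; case: unpickle => [k|]; last exact: cone0.
  case: ifP => _; [exact: cone0|by have [] := hq k].
exists (countable_cone Q); split.
- by apply: measurable_countable_cone.
- exact: countable_cone_sub.
(* A single almost sure event for all boxes: null boxes contain no jump and charged ones contain
   infinitely many. The rest of the argument is pathwise, which matters because [y] depends on
   [w]. *)
pose G n w : Prop := if @unpickle ({ffun 'I_dim -> rat} * rat)%type n is Some k then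
  (lam (E k) = 0%E -> N w (E k) = 0%E) /\ (lam (E k) != 0%E -> N w (E k) = +oo%E) else True.
have Gae n : {ae P, forall w, G n w}.
  rewrite /G; case: unpickle => [k|]; last exact: aeW.
  have [k0|kn0] := eqVneq (lam (E k)) 0%E.
    by apply: (ae_imply (prm_ae0 prm (mE k) k0)) => w ->; split => // _; rewrite k0 eqxx.
  have [_ p2 _] := prm; apply: (ae_imply (p2 _ (mE k) (Eoo _ kn0))) => w ->; split => //.
  by move=> k0; move: kn0; rewrite k0 eqxx.
move: (ae_foralln Gae) (prm_bintegrable prm mdir Hoo); apply: filterS2 => w Gw iw.
have G0 k : lam (E k) = 0%E -> N w (E k) = 0%E by have := Gw (pickle k); rewrite /G pickleK => -[].
have G1 k : lam (E k) != 0%E -> N w (E k) = +oo%E by have := Gw (pickle k); rewrite /G pickleK => -[].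
apply: contrapT => nC.
have [y [yC yp yy]] := cone_separation hB (countable_cone0 Q) (countable_coneD (Q := Q)) (countable_coneZ (Q := Q)) nC.
have qC k : lam (E k) != 0%E -> countable_cone Q (q k).
  move=> k0; have := countable_cone_gen Q (pickle k).
  by rewrite {2}/Q pickleK (negbTE k0).
pose f z := ip y (directional H z).
have mf : measurable_fun setT f by exact: (measurable_ipf hB).
have [fi fE] := bint_ip hB oe he y iw.
(* A jump with negative pairing has a rational box around its direction inside [y < 0]. A charged
   box would contain a generator with negative pairing, so the box is null and carries no jump. *)
have fpos : {ae N w, forall z, 0 <= f z}.
  pose F n : set T := if @unpickle ({ffun 'I_dim -> rat} * rat)%type n is Some k then
     if pselect (lam (E k) = 0%E) then E k else set0 else set0.
  have FN n : (N w).-negligible (F n).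
    rewrite /F; case: unpickle => [k|]; last exact: negligible_set0.
    case: pselect => h; last exact: negligible_set0.
    by apply/negligibleP => //; exact: G0.
  apply: negligibleS (negligible_bigcup FN) => z /= nfz.
  have fz : f z < 0 by rewrite ltNge; apply/negP.
  have dz : (directional H z : B) != 0.
    by apply/eqP => d0; move: fz; rewrite /f d0 (ip0r hB) ltxx.
  have [Sd Hd _ dE] := dirE _ dz.
  have yd : ip y (direction z).2 < 0.
    rewrite ltNge; apply/negP => yd; apply: nfz; rewrite /f dE (ipZr hB) mulr_ge0//.
    by rewrite mulr_ge0// ltW.
  have oO : open [set x : B | ip y x < 0].
    have cy : continuous (ip y) by exact: (continuous_ip hB).
    move/continuousP : cy => /(_ _ (@open_lt R 0)).
    by rewrite (_ : _ @^-1` _ = [set x : B | ip y x < 0]).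
  have [k [kz kO]] := rbox_base hB he oO yd.
  exists (pickle k) => //; rewrite /F pickleK; case: pselect => kn0; first by split.
  exfalso; have [_ hk] := hq k; have /eqP kn := kn0; have [_ qk _] := hk kn.
  by have := kO _ qk; rewrite /= ltNge yC//; exact: qC.
have If : \int[N w]_z f z = \int[N w]_z `|f z|.
  rewrite /Rintegral; congr fine; apply: ae_eq_integral_nonmeas.
  by apply: (ae_imply fpos) => z fz; rewrite ger0_norm.
(* Nonnegativity of [f] against [yp] leaves only 0. This excludes the strict case of the separation,
   so some generator pairs positively with [y]. *)
have If0 : \int[N w]_z f z = 0.
  apply/eqP; rewrite eq_le; apply/andP; split.
    by rewrite -[X in X <= _]/(\int[N w]_z f z) fE.
  by rewrite If; apply: Rintegral_ge0.
case: yy => [|[x [m _ hx] yx]].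
  by rewrite -[X in ip y X]/(bint ip e (N w) (directional H)) -fE -/f If0 ltxx.
have [n yn] : exists n, 0 < ip y (Q n).
  apply: contrapT => hn; move: yx; rewrite ltNge => /negP; apply.
  have [v hv <-] := hx; rewrite (ip_sumr hB); apply: sumr_le0 => i _.
  rewrite (ipZr hB) mulr_ge0_le0//; first by have := hv i; rewrite /= in_itv/= => /andP[].
  by rewrite leNgt; apply/negP => yQ; apply: hn; exists i.
move: yn; rewrite /Q; case: unpickle => [k|]; last by rewrite (ip0r hB) ltxx.
case: ifPn => kn0; first by rewrite (ip0r hB) ltxx.
move=> yq; have [_ hk] := hq k; have [_ _ qnull] := hk kn0.
have oO : open [set x : B | 0 < ip y x].
  have cy : continuous (ip y) by exact: (continuous_ip hB).
    move/continuousP : cy => /(_ _ (@open_gt R 0)).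
  by rewrite (_ : _ @^-1` _ = [set x : B | 0 < ip y x]).
(* The generator lies in no null box, so this box is charged and contains jumps; there [f] is
   positive, whereas its vanishing integral makes it 0 almost everywhere. *)
have [k' [k'q k'O]] := rbox_base hB he oO yq.
have k'n0 : lam (E k') != 0%E by apply/eqP => k'0; exact: (qnull _ k'0).
have := G1 _ k'n0; suff -> : N w (E k') = 0%E by [].
apply: measure_negligible => //.
have h0 : (\int[N w]_z `|(f z)%:E| = 0)%E.
  have /integrableP[_ foo] := fi.
  have fin : (\int[N w]_z `|(f z)%:E|)%E \is a fin_num by rewrite ge0_fin_numE//; exact: integral_ge0.
  by rewrite -(fineK fin); congr EFin; move: If0; rewrite If /Rintegral.
have mfE : measurable_fun setT (EFin \o f) by exact/measurable_EFinP.
have [h1 _] := ae_eq_integral_abs (N w) measurableT mfE.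
have := h1 h0; apply: negligibleS => z [dz [_ /= kz]] hz.
have [Sd Hd zn0 dE] := dirE _ dz.
have : 0 < f z.
  rewrite /f dE (ipZr hB) mulr_gt0//; last exact: k'O.
  by rewrite mulr_gt0// normr_gt0.
by have /= [->] := hz I; rewrite ltxx.
Qed.
End carried.

(** * A criterion of infinite divisibility *)

Section product_bounded.
Context d1 d2 (T1 : measurableType d1) (T2 : measurableType d2) (R : realType).
Variables (P1 : probability T1 R) (P2 : probability T2 R).

Lemma Rintegral_prod_bounded (f : T1 -> R) (g : T2 -> R) :
  measurable_fun setT f -> measurable_fun setT g ->
  (forall x, `|f x| <= 1) -> (forall x, `|g x| <= 1) ->
  (P1 \x P2)%E.-integrable setT (fun z => (f z.1 * g z.2)%:E) /\
  \int[(P1 \x P2)%E]_z (f z.1 * g z.2) = (\int[P1]_x f x) * (\int[P2]_x g x).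
Proof.
move=> mf mg f1 g1.
have mfg : measurable_fun setT (fun z : T1 * T2 => f z.1 * g z.2).
  apply: measurable_funM; [exact: (measurableT_comp mf measurable_fst)|].
  exact: (measurableT_comp mg measurable_snd).
have ifg : (P1 \x P2)%E.-integrable setT (fun z => (f z.1 * g z.2)%:E).
  apply: (@bounded_integrable_prob _ _ _ (P1 \x P2)%E (fun z => f z.1 * g z.2) 1) => // z.
  by rewrite normrM -(mulr1 1) ler_pM.
have iF : P1.-integrable setT (EFin \o f) by exact: (@bounded_integrable_prob _ _ _ P1 f 1).
have iG : P2.-integrable setT (EFin \o g) by exact: (@bounded_integrable_prob _ _ _ P2 g 1).
split => //; rewrite /Rintegral -(integral12_prod_meas1 ifg) /fubini_F/=.
transitivity (fine (\int[P1]_x ((\int[P2]_y g y)%R * f x)%:E)%E).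
  congr fine; apply: eq_integral => x _; rewrite mulrC EFinM.
  rewrite /Rintegral fineK ?(integrable_fin_num measurableT iG)//.
  by rewrite -(integralZl measurableT iG).
rewrite -/(Rintegral P1 setT (fun x => (\int[P2]_y g y)%R * f x)).
by rewrite (RintegralZl _ measurableT iF) mulrC.
Qed.
End product_bounded.

Section iid.
Context (R : realType) (B : normedModType R) (ip : B -> B -> R).
Hypothesis hB : euclidean ip.
Variable K : set B.
Hypothesis K0 : K 0.
Variable mu : probability (borel B) R.
Hypothesis muK : carried_by K mu.
Variables rho th : B -> R.
Hypothesis mucos : forall z, \int[mu]_x cos (ip z x) = rho z * cos (th z).
Hypothesis musin : forall z, \int[mu]_x sin (ip z x) = rho z * sin (th z).

Let mcos : measurable_fun setT (@cos R).
Proof. by apply: continuous_measurable_fun; exact: continuous_cos. Qed.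
Let msin : measurable_fun setT (@sin R).
Proof. by apply: continuous_measurable_fun; exact: continuous_sin. Qed.

(** [K] need not be Borel, while the variables in the definition of infinite divisibility must take
    values in [K] everywhere: the identity is replaced by 0 on a Borel null set covering the
    complement of [K]. *)
Lemma carried_version : exists xi : borel B -> borel B,
  [/\ measurable_fun setT xi, forall x, K (xi x) & {ae mu, forall x, xi x = x}].
Proof.
have [A [mA A0 KA]] := muK.
exists (fun x => (\1_(~` A) x : R) *: (x : B)); split.
- apply: (measurable_scaleb hB); last exact: measurable_id.
  by apply/measurable_indicP; exact: measurableC.
- move=> x; rewrite indicE; case: (pselect (A x)) => Ax.
    by rewrite memNset ?scale0r//= => /(_ Ax).
  by rewrite mem_set// scale1r; apply: contrapT => /KA.
exists A; split => // x /= hx; apply: contrapT => Ax; apply: hx.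
by rewrite indicE mem_set// scale1r.
Qed.

(** Iterated products, adding one factor at each step. The variables are indexed by [nat], so that
    their type is the same at every step; only the first [p] matter. The last two clauses are de
    Moivre's formula for the sum. *)
Lemma iid_exists (p : nat) :
  exists (d : measure_display) (Omega : measurableType d) (P : probability Omega R)
    (X : nat -> Omega -> borel B),
  [/\ forall i, measurable_fun setT (X i), forall i w, K (X i w),
      forall E : nat -> set (borel B), (forall i, measurable (E i)) ->
        P [set w | forall i, (i < p)%N -> E i (X i w)] = (\prod_(i < p) mu (E i))%E,
      forall z, \int[P]_w cos (ip z (\sum_(i < p) (X i w : B))) = rho z ^+ p * cos (p%:R * th z) &
      forall z, \int[P]_w sin (ip z (\sum_(i < p) (X i w : B))) = rho z ^+ p * sin (p%:R * th z)].
Proof.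
have [xi [mxi xiK xiE]] := carried_version.
elim: p => [|p [d [W [P [X [mX XK XE Xcos Xsin]]]]]].
  exists _, (borel B), mu, (fun _ _ => 0); split.
  - by move=> i; exact: measurable_cst.
  - by [].
  - move=> E _; rewrite big_ord0 (_ : [set _ | _] = setT) ?probability_setT//.
    by apply/seteqP; split.
  - move=> z; under eq_Rintegral do rewrite big_ord0 (ip0r hB) cos0.
    rewrite Rintegral_cst//= mul0r cos0 expr0 !mul1r.
    by have -> : mu setT = 1%E by exact: probability_setT.
  - move=> z; under eq_Rintegral do rewrite big_ord0 (ip0r hB) sin0.
    by rewrite Rintegral_cst//= !mul0r sin0 mulr0.
pose X' i (z : W * borel B) : borel B := if (i < p)%N then X i z.1 else xi z.2.
have mX' i : measurable_fun setT (X' i).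
  rewrite /X'; case: (i < p)%N; first exact: (measurableT_comp (mX i) measurable_fst).
  exact: (measurableT_comp mxi measurable_snd).
have lawxi (phi : R -> R) z : measurable_fun setT phi ->
    \int[mu]_x phi (ip z (xi x)) = \int[mu]_x phi (ip z x).
  move=> _; rewrite /Rintegral; congr fine; apply: ae_eq_integral_nonmeas.
  by apply: (ae_imply xiE) => x ->.
have sumE z : \sum_(i < p.+1) (X' i z : B) = \sum_(i < p) (X i z.1 : B) + (xi z.2 : B).
  rewrite big_ord_recr/= /X' ltnn; congr (_ + _); apply: eq_bigr => i _.
  by rewrite ltn_ord.
have mS z : measurable_fun setT (fun w => ip z (\sum_(i < p) (X i w : B))).
  have mS0 : measurable_fun setT (fun w => (\sum_(i < p) (X i w : B)) : borel B).
    exact: (measurable_sumb hB).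
  exact: (measurable_ipf hB z mS0).
have mxi' z : measurable_fun setT (fun x => ip z (xi x)) by exact: (measurable_ipf hB).
have c1 (x : R) : `|cos x| <= 1 by exact: cos_max.
have s1 (x : R) : `|sin x| <= 1 by exact: sin_max.
have prodE (f g : R -> R) z : measurable_fun setT f -> measurable_fun setT g ->
    (forall x, `|f x| <= 1) -> (forall x, `|g x| <= 1) ->
    (P \x mu)%E.-integrable setT (fun u => (f (ip z (\sum_(i < p) (X i u.1 : B))) * g (ip z (xi u.2)))%:E) /\
    \int[(P \x mu)%E]_u (f (ip z (\sum_(i < p) (X i u.1 : B))) * g (ip z (xi u.2))) =
      (\int[P]_w f (ip z (\sum_(i < p) (X i w : B)))) * (\int[mu]_x g (ip z x)).
  move=> mf mg f1 g1; rewrite -(lawxi g)//.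
  apply: (@Rintegral_prod_bounded _ _ _ _ R P mu (fun w => f (ip z (\sum_(i < p) (X i w : B)))) (fun x => g (ip z (xi x)))) => //.
  - exact: (measurableT_comp mf (mS z)).
  - exact: (measurableT_comp mg (mxi' z)).
exists _, _, (P \x mu)%E, X'; split => //.
- by move=> i w; rewrite /X'; case: ifP => _; [exact: XK|exact: xiK].
- move=> E mE.
  have mY : measurable [set w | forall i, (i < p)%N -> E i (X i w)].
    rewrite (_ : [set w | _] = \bigcap_(i in `I_p) (setT `&` X i @^-1` E i)).
      by apply: fin_bigcap_measurable => [|i _]; [exact: finite_II|exact: mX].
    apply/seteqP; split => w h i /= ip'; first by split => //; exact: h.
    by have [] := h i ip'.
  have mZ : measurable (xi @^-1` E p) by rewrite -[X in measurable X]setTI; exact: mxi.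
  rewrite (_ : [set w | _] = [set w | forall i, (i < p)%N -> E i (X i w)] `*` (xi @^-1` E p)).
    apply: (etrans (product_measure1E P mu mY mZ)).
    rewrite [RHS]big_ord_recr/=; congr (_ * _)%E; first exact: XE.
    rewrite -(setIT (xi @^-1` _)) -(setIT (E p)) -!integral_indic ?setIT//.
    apply: ae_eq_integral_nonmeas; apply: (ae_imply xiE) => x hx; rewrite !indicE.
    congr ((nat_of_bool _)%:R)%:E.
    by apply/idP/idP => /set_mem h; apply/mem_set; move: h; rewrite /preimage/= hx.
  apply/seteqP; split => [[w x] /= h|[w x] [/= h1 h2] i].
    split => /=; last by have := h p (ltnSn p); rewrite /X' ltnn.
    by move=> i ip'; have := h i (ltnW ip'); rewrite /X' ip'.
  rewrite ltnS leq_eqVlt /X' => /predU1P[->|ip']; first by rewrite ltnn.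
  by rewrite ip'; exact: h1.
- move=> z; have [i1 e1] := prodE _ _ z mcos mcos c1 c1; have [i2 e2] := prodE _ _ z msin msin s1 s1.
  under eq_Rintegral do rewrite sumE (ipDr hB) cosD.
  rewrite RintegralB// e1 e2 Xcos Xsin mucos musin exprS -natr1 mulrDl mul1r cosD; ring.
- move=> z; have [i1 e1] := prodE _ _ z msin mcos s1 c1; have [i2 e2] := prodE _ _ z mcos msin c1 s1.
  under eq_Rintegral do rewrite sumE (ipDr hB) sinD.
  rewrite RintegralD// e1 e2 Xcos Xsin mucos musin exprS -natr1 mulrDl mul1r sinD; ring.
Qed.
End iid.

(** [rho] and [th] are modulus and argument of the characteristic function of the [p]-th root.
    Giving the argument explicitly turns the power into [p * th] and avoids choosing a complex
    root. *)
Lemma infinitely_divisible_criterion (R : realType) (B : normedModType R) (ip : B -> B -> R)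
    (hB : euclidean ip) (K : set B) (mu : probability (borel B) R) : K 0 -> carried_by K mu ->
  (forall p : nat, (0 < p)%N -> exists (mup : probability (borel B) R) (rho th : B -> R),
    [/\ carried_by K mup,
        forall z, \int[mup]_x cos (ip z x) = rho z * cos (th z) /\
                  \int[mup]_x sin (ip z x) = rho z * sin (th z) &
        forall z, \int[mu]_x cos (ip z x) = rho z ^+ p * cos (p%:R * th z) /\
                  \int[mu]_x sin (ip z x) = rho z ^+ p * sin (p%:R * th z)]) ->
  infinitely_divisible_on K mu.
Proof.
move=> K0 muK hp; split => // p p0; have [mup [rho [th [mupK hmup hmu]]]] := hp p p0.
have [d [W [P [X [mX XK XE Xcos Xsin]]]]] :=
  iid_exists hB K0 mupK (fun z => (hmup z).1) (fun z => (hmup z).2) p.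
have mup1 : mup setT = 1%E by exact: probability_setT.
exists d, W, P, mup, (fun i => X i); split => //.
- move=> i; split => // E mE.
  (* Marginal laws, and below the independence of subfamilies, are read off the full product formula
     by putting [setT] in the remaining places. *)
  have := XE (fun j => if j == i then E else setT).
  rewrite (_ : [set w | _] = X i @^-1` E); last first.
    apply/seteqP; split => w /= h; first by have := h i (ltn_ord i); rewrite eqxx.
    by move=> j _; case: eqP => // ->.
  move=> ->; last by move=> j; case: ifP.
  rewrite (bigD1 i)//= eqxx big1 ?mule1// => j ji.
  by rewrite (_ : (j == i :> nat) = false)//; apply: negbTE; rewrite -val_eqE in ji.
- move=> s E us mE.
  have := XE (fun j => if insub j is Some i then (if i \in s then E i else setT) else setT).
  rewrite (_ : [set w | _] = \bigcap_(i in [set` s]) (X i @^-1` E i)); last first.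
    apply/seteqP; split => w h.
      by move=> i /= is'; have := h i (ltn_ord i); rewrite valK is'.
    by move=> j jp; rewrite insubT/=; case: ifP => // is'; exact: (h (Sub j jp)).
  move=> ->; last by move=> j; case: insubP => // i _ _; case: ifP.
  rewrite (eq_bigr (fun i : 'I_p => if i \in s then mup (E i) else 1%E)); last first.
    by move=> i _; rewrite valK; case: ifP.
  rewrite -big_mkcond/= -(big_uniq _ us)/=; apply: eq_bigr => i _.
  have := XE (fun j => if j == i then E i else setT).
  rewrite (_ : [set w | _] = X i @^-1` E i); last first.
    apply/seteqP; split => w /= h; first by have := h i (ltn_ord i); rewrite eqxx.
    by move=> j _; case: eqP => // ->.
  move=> ->; last by move=> j; case: ifP.
  rewrite (bigD1 i)//= eqxx big1 ?mule1// => j ji.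
  by rewrite (_ : (j == i :> nat) = false)//; apply: negbTE; rewrite -val_eqE in ji.
have mS : measurable_fun setT (fun w => (\sum_(i < p) (X i w : B)) : borel B).
  exact: (measurable_sumb hB).
have [nu lawnu] := law_exists P mS.
split => // E mE; have [_ ->//] := lawnu; apply: (characteristic_function_unique hB) => //.
- move=> z; rewrite (hmu z).1 -Xcos; apply: (Rintegral_has_law lawnu (phi := fun x => cos (ip z x))).
  apply: measurableT_comp; last exact: measurable_ip.
  by apply: continuous_measurable_fun; exact: continuous_cos.
- move=> z; rewrite (hmu z).2 -Xsin; apply: (Rintegral_has_law lawnu (phi := fun x => sin (ip z x))).
  apply: measurableT_comp; last exact: measurable_ip.
  by apply: continuous_measurable_fun; exact: continuous_sin.
Qed.

(** * Bernstein's theorem *)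

Section moment_functional.
Variable R : realType.
Implicit Types (a : nat -> R) (p q : {poly R}).

(** The linear functional on polynomials that sends ['X^i] to [a i], as in the Hausdorff moment
    problem. *)
Definition moment a p : R := \sum_(i < size p) p`_i * a i.

Lemma momentE a p n : (size p <= n)%N -> moment a p = \sum_(i < n) p`_i * a i.
Proof.
move=> pn; rewrite /moment (big_ord_widen n (fun i => p`_i * a i) pn) big_mkcond/=.
apply: eq_bigr => i _; case: ltnP => // h; by rewrite nth_default// mul0r.
Qed.

Lemma momentD a p q : moment a (p + q) = moment a p + moment a q.
Proof.
pose n := maxn (size p) (size q).
rewrite (@momentE a (p + q) n) ?size_polyD// (@momentE a p n) ?leq_maxl// (@momentE a q n) ?leq_maxr//.
by rewrite -big_split; apply: eq_bigr => i _; rewrite coefD mulrDl.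
Qed.

Lemma momentZ a c p : moment a (c *: p) = c * moment a p.
Proof.
rewrite (@momentE a (c *: p) (size p)) ?size_scale_leq// mulr_sumr.
by apply: eq_bigr => i _; rewrite coefZ mulrA.
Qed.

Lemma moment0 a : moment a 0 = 0.
Proof. by rewrite /moment size_poly0 big_ord0. Qed.

Lemma moment_sum a (I : finType) (F : I -> {poly R}) :
  moment a (\sum_i F i) = \sum_i moment a (F i).
Proof. by apply: (big_morph (moment a)); [exact: momentD|exact: moment0]. Qed.

Lemma momentX a p : moment a ('X * p) = moment (fun i => a i.+1) p.
Proof.
rewrite (@momentE a ('X * p) (size p).+1); last first.
  by have [->|p0] := eqVneq p 0; rewrite ?mulr0 ?size_poly0// mulrC size_mulX.
rewrite big_ord_recl/= coefXM/= mul0r add0r; apply: eq_bigr => i _.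
by rewrite coefXM.
Qed.

Lemma momentXn a j : moment a 'X^j = a j.
Proof.
elim: j a => [|j IH] a; last by rewrite exprS momentX IH.
by rewrite expr0 /moment size_poly1 big_ord1 coef1 eqxx mul1r.
Qed.

Lemma moment1BX a p : moment a ((1 - 'X) * p) = moment (fun i => a i - a i.+1) p.
Proof.
rewrite mulrBl mul1r momentD -scaleN1r momentZ momentX mulN1r /moment -sumrB.
by apply: eq_bigr => i _; rewrite mulrBr.
Qed.

(** The mass at [i / d] of the discrete approximation of degree [d] to the measure with moments
    [a]. *)
Definition bernstein_weight a d i : R := 'C(d, i)%:R * moment a ('X^i * (1 - 'X) ^+ (d - i)).

Lemma bin_ratio d i j : (j <= d)%N -> (i <= d)%N ->
  (if (j <= i)%N then 'C(d - j, i - j) else 0)%:R =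
  'C(d, i)%:R * \prod_(k < j) ((i - k)%:R / (d - k)%:R) :> R.
Proof.
move=> jd id; elim: j jd => [|j IH] jd; first by rewrite big_ord0 !subn0 mulr1.
rewrite big_ord_recr/= mulrA -IH; last exact: ltnW.
have dj0 : (d - j)%:R != 0 :> R by rewrite pnatr_eq0 -lt0n subn_gt0.
have [ji|ij] := leqP j i; last first.
  by rewrite mul0r ifF//; apply/negbTE; rewrite -ltnNge ltnS ltnW.
have [ji'|ij] := ltnP j i; last first.
  by rewrite (_ : (i - j)%N = 0%N) ?mul0r ?mulr0//; apply/eqP; rewrite subn_eq0.
have := mul_bin_diag (d - j) (i - j).-1.
rewrite prednK ?subn_gt0// -!subnS => /(congr1 (fun n => n%:R : R)).
rewrite !natrM => h; apply: (mulfI dj0); rewrite h; field.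
exact: dj0.
Qed.

(** Multiply ['X^j] by [(1 - 'X + 'X) ^+ (d - j)], which is 1, and expand. The ratio of binomials is
    the product that replaces the [j]-th power of [i / d]. *)
Lemma bernstein_expansion a d j : (j <= d)%N ->
  a j = \sum_(i < d.+1) bernstein_weight a d i * \prod_(k < j) ((i - k)%:R / (d - k)%:R).
Proof.
move=> jd; rewrite -{1}(momentXn a j).
have -> : 'X^j = \sum_(i < (d - j).+1) 'C(d - j, i)%:R *: ('X^(j + i) * (1 - 'X) ^+ (d - j - i)) :> {poly R}.
  have e : (1 : {poly R}) = ((1 - 'X) + 'X) ^+ (d - j) by rewrite subrK expr1n.
  transitivity ('X^j * ((1 - 'X) + 'X) ^+ (d - j) : {poly R}); first by rewrite -e mulr1.
  rewrite exprDn mulr_sumr; apply: eq_bigr => i _.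
  rewrite scaler_nat exprD mulrnAr; congr (_ *+ _).
  by rewrite -!mulrA; congr (_ * _); rewrite mulrC.
rewrite moment_sum.
transitivity (\sum_(i < d.+1) (if (j <= i)%N then 'C(d - j, i - j) else 0)%:R *
    moment a ('X^i * (1 - 'X) ^+ (d - i))); last first.
  apply: eq_bigr => i _; rewrite bin_ratio//; last by rewrite -ltnS.
  by rewrite /bernstein_weight mulrAC.
rewrite -(big_mkord xpredT (fun i => (if (j <= i)%N then 'C(d - j, i - j) else 0)%:R *
    moment a ('X^i * (1 - 'X) ^+ (d - i)))).
rewrite (big_cat_nat (n := j))//=; last exact: leqW.
rewrite [X in _ = X + _]big1_seq ?add0r; last first.
  by move=> i /andP[_]; rewrite mem_index_iota => /andP[_ ij]; rewrite leqNgt ij mul0r.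
have shift (F : nat -> R) : \sum_(j <= i < d.+1) F i = \sum_(i < d.+1 - j) F (i + j)%N.
  by rewrite -{1}(add0n j) big_addn big_mkord.
rewrite shift subSn//; apply: eq_bigr => i _.
by rewrite momentZ leq_addl addnK (addnC i j) subnDA.
Qed.

Lemma prod_diff n (x y : nat -> R) (e : R) :
  (forall k, (k < n)%N -> 0 <= x k <= 1) -> (forall k, (k < n)%N -> 0 <= y k <= 1) ->
  (forall k, (k < n)%N -> `|x k - y k| <= e) ->
  `|\prod_(k < n) x k - \prod_(k < n) y k| <= n%:R * e.
Proof.
move=> hx hy hxy.
suff [h _] : `|\prod_(k < n) x k - \prod_(k < n) y k| <= n%:R * e /\
   (0 <= \prod_(k < n) x k <= 1 /\ 0 <= \prod_(k < n) y k <= 1) by [].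
elim: n hx hy hxy => [|n IH] hx hy hxy.
  by rewrite !big_ord0 subrr normr0 mul0r; do ?split; rewrite ?ler01 ?lexx.
have [||| h [/andP[x0 x1] /andP[y0 y1]]] := IH.
- by move=> k kn; apply: hx; exact: ltnW.
- by move=> k kn; apply: hy; exact: ltnW.
- by move=> k kn; apply: hxy; exact: ltnW.
have /andP[xn0 xn1] := hx n (ltnSn n); have /andP[yn0 yn1] := hy n (ltnSn n).
have en := hxy n (ltnSn n).
rewrite !big_ord_recr/=; set X := \prod_(k < n) x k in h x0 x1 *; set Y := \prod_(k < n) y k in h y0 y1 *.
split; last by split; apply/andP; split; nra.
rewrite (_ : _ - _ = (X - Y) * x n + Y * (x n - y n)); last by ring.
apply: le_trans (ler_normD _ _) _; rewrite !normrM -natr1 mulrDl mul1r.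
apply: lerD.
  by rewrite (ger0_norm xn0); apply: le_trans h; rewrite ler_piMr.
by rewrite (ger0_norm y0); apply: le_trans en; rewrite ler_piMl.
Qed.

(** The exact expansion has factors [(i - k) / (d - k)], each within [j / d] of [i / d]; the [j]
    factors together err by at most [j ^ 2 / d], and the weights sum to [a 0]. *)
Lemma bernstein_moment a d j : (0 < d)%N -> (j <= d)%N ->
  (forall i, (i <= d)%N -> 0 <= bernstein_weight a d i) ->
  `|\sum_(i < d.+1) bernstein_weight a d i * (i%:R / d%:R) ^+ j - a j| <=
    a 0%N * (j ^ 2)%:R / d%:R.
Proof.
move=> d0 jd w0; rewrite (bernstein_expansion a jd) -sumrB.
have a0E : a 0%N = \sum_(i < d.+1) bernstein_weight a d i.
  by rewrite (bernstein_expansion a (leq0n d)); apply: eq_bigr => i _; rewrite big_ord0 mulr1.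
have dR : 0 < d%:R :> R by rewrite ltr0n.
apply: le_trans (ler_norm_sum _ _ _) _; rewrite a0E -mulrA mulr_suml; apply: ler_sum => i _.
have id : (i <= d)%N by rewrite -ltnS.
rewrite -mulrBr normrM ger0_norm ?w0// ler_wpM2l ?w0//.
rewrite -[X in _ ^+ X](card_ord j) -prodr_const.
apply: le_trans (@prod_diff j (fun=> i%:R / d%:R) (fun k => (i - k)%:R / (d - k)%:R) (j%:R / d%:R) _ _ _) _.
- by move=> k _; rewrite divr_ge0//= ler_pdivrMr// mul1r ler_nat.
- move=> k kj; have dk : (0 < d - k)%N by rewrite subn_gt0; exact: leq_trans kj jd.
  by rewrite divr_ge0//= ler_pdivrMr ?ltr0n// mul1r ler_nat leq_sub2r.
- move=> k kj; have kd : (k < d)%N by exact: leq_trans kj jd.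
  have dk : 0 < (d - k)%:R :> R by rewrite ltr0n subn_gt0.
  apply: (@le_trans _ _ (k%:R / d%:R)); last by rewrite ler_pM2r ?invr_gt0// ler_nat ltnW.
  have [ki|ik] := leqP k i; last first.
    rewrite (_ : (i - k)%N = 0%N) ?mul0r ?subr0; last by apply/eqP; rewrite subn_eq0 ltnW.
    by rewrite ger0_norm ?divr_ge0// ler_pM2r ?invr_gt0// ler_nat ltnW.
  have e : i%:R / d%:R - (i - k)%:R / (d - k)%:R = k%:R / d%:R * ((d - i)%:R / (d - k)%:R) :> R.
    have dkn : d%:R - k%:R != 0 :> R by rewrite -natrB ?(ltnW kd)// gt_eqF.
    rewrite !natrB//; last exact: ltnW.
    by field; rewrite dkn gt_eqF.
  rewrite e ger0_norm ?mulr_ge0 ?divr_ge0// ler_piMr ?divr_ge0//.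
  by rewrite ler_pdivrMr// mul1r ler_nat leq_sub2l.
by rewrite mulrA -natrM mulnn.
Qed.
End moment_functional.

Section completely_monotone_sequences.
Variable R : realType.
Implicit Types g : nat -> R -> R.

(** Carrying the successive derivatives as data makes the class visibly stable under differences of
    translates, with no iterated derivative to compute. *)
Definition cm_seq g := forall n (r : R), 0 < r ->
  is_derive r (1:R) (g n) (g n.+1 r) /\ 0 <= (-1) ^+ n * g n r.

Lemma completely_monotone_cm_seq (f : R -> R) : completely_monotone f -> cm_seq (fun n => derive1n n f).
Proof.
move=> cf n r r0; have [d s] := cf n r r0; split => //.
by split => //; rewrite derive1nS derive1E.
Qed.

Lemma cm_seq_decr g n (x y : R) : cm_seq g -> 0 < x -> x <= y ->
  (-1) ^+ n * g n y <= (-1) ^+ n * g n x.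
Proof.
move=> cg x0; rewrite le_eqVlt => /predU1P[->//|xy].
have dg (z : R) : 0 < z -> is_derive z (1:R) (g n) (g n.+1 z) by move=> /(cg n)[].
have [z /[!in_itv]/= /andP[xz zy] e] : exists2 z, z \in `]x, y[ & g n y - g n x = g n.+1 z * (y - x).
  apply: MVT => //.
    by move=> z; rewrite in_itv/= => /andP[xz _]; apply: dg; exact: lt_trans xz.
  apply: continuous_in_subspaceT => z; rewrite inE/= in_itv/= => /andP[xz _].
  apply/differentiable_continuous/derivable1_diffP.
  by case: (dg z (lt_le_trans x0 xz)).
have [_ h] := cg n.+1 z (lt_trans x0 xz).
rewrite -subr_ge0 -mulrBr -opprB e mulrN -mulNr mulrA mulr_ge0//; last by rewrite subr_ge0 ltW.
by move: h; rewrite exprS mulN1r mulNr.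
Qed.

Lemma cm_seq_diff g (delta : R) : 0 < delta -> cm_seq g -> cm_seq (fun n x => g n x - g n (x + delta)).
Proof.
move=> d0 cg n r r0; split; last first.
  by rewrite mulrBr subr_ge0; apply: cm_seq_decr => //; rewrite lerDl ltW.
have h1 := (cg n r r0).1; have h2 := (cg n (r + delta) (addr_gt0 r0 d0)).1.
apply: is_deriveB; have d3 : is_derive r (1:R) (fun x : R => x + delta) 1.
  by apply: is_derive_eq; rewrite addr0.
by have := @is_derive1_comp R (g n) (fun x => x + delta) r _ _ h2 d3; rewrite mulr1.
Qed.

(** A factor [1 - 'X] replaces the sequence of samples by its differences, which sample the
    completely monotone function [f x - f (x + delta)]; induct on [k]. Samples start at [delta], as
    [f] may blow up at 0. *)
Lemma cm_seq_moment_ge0 (delta : R) i k g : 0 < delta -> cm_seq g ->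
  0 <= moment (fun j => g 0%N (delta * j.+1%:R)) ('X^i * (1 - 'X) ^+ k).
Proof.
move=> d0; elim: k g => [|k IH] g cg.
  rewrite expr0 mulr1 momentXn; have [_] := cg 0%N (delta * i.+1%:R) (mulr_gt0 d0 (ltr0Sn _ _)).
  by rewrite expr0 mul1r.
rewrite exprS mulrCA moment1BX; have := IH _ (cm_seq_diff d0 cg).
congr (_ <= moment _ _); apply/funext => j /=; congr (_ - g _ _).
by rewrite -[in RHS]natr1 mulrDr mulr1.
Qed.
End completely_monotone_sequences.

Section discrete_quantile.
Context {R : realType}.
Local Notation leb := (@lebesgue_measure R).

Definition unit_decr (u : R -> R) := (forall s, 0 <= u s <= 1) /\ (forall s t, s <= t -> u t <= u s).

Lemma unit_decr_powR u r : 0 < r -> unit_decr u -> unit_decr (fun s => u s `^ r).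
Proof.
move=> r0 [u01 ud]; split=> [s|s t st].
  have /andP[u0 u1] := u01 s; rewrite powR_ge0/=.
  apply: le_trans (_ : 1 `^ r <= 1); last by rewrite powR1.
  by rewrite ge0_ler_powR ?nnegrE ?ler01// ltW.
have /andP[us _] := u01 s; have /andP[ut _] := u01 t.
by rewrite ge0_ler_powR ?nnegrE ?ud//; exact: ltW.
Qed.

Lemma unit_decr_measurable u : unit_decr u -> measurable_fun setT u.
Proof. by move=> [_ ud]; apply: nonincreasing_measurable => // s t; exact: ud. Qed.

(** The atoms [v i], in decreasing order, are laid on consecutive time intervals of lengths
    [W i]. *)
Lemma discrete_quantile (n : nat) (W v : nat -> R) : (forall i, 0 <= W i) ->
  (forall i, 0 <= v i <= 1) -> (forall i j, (i <= j)%N -> v j <= v i) ->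
  exists u, unit_decr u /\ forall r, 0 < r ->
    (\int[leb]_(s in `]0%R, +oo[) (u s `^ r)%:E = (\sum_(i < n) W i * v i `^ r)%:E)%E.
Proof.
move=> W0 v01 vd; pose S m := \sum_(i < m) W i.
have S0 m : 0 <= S m by exact: sumr_ge0.
suff [u [ud _ _ ui]] : exists u, [/\ unit_decr u, (forall s, S n <= s -> u s = 0),
   (forall s i, s < S n -> (n <= i)%N -> v i <= u s) & forall r, 0 < r ->
    (\int[leb]_(s in `]0%R, +oo[) (u s `^ r)%:E = (\sum_(i < n) W i * v i `^ r)%:E)%E].
  by exists u.
elim: n => [|n [u [[u01 ud] uS uv ui]]].
  (* The value 1 at negative times keeps the invariant that before time [S n] the function dominates
     all remaining atoms. *)
  exists (fun s => if s < 0 then 1 else 0); split.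
  - split=> [s|s t st]; first by case: ifP => _; rewrite ?lexx ler01.
    case: ifP => t0; last by case: ifP; rewrite ?ler01.
    by rewrite (le_lt_trans st t0).
  - by move=> s; rewrite /S big_ord0 ltNge => ->.
  - move=> s i; rewrite /S big_ord0 => -> _; by have /andP[] := v01 i.
  - move=> r r0; rewrite big_ord0; apply: integral0_eq => s; rewrite /= in_itv/= andbT => s0.
    by rewrite ltNge (ltW s0)/= powR0// gt_eqF.
have SS : S n <= S n.+1 by rewrite /S big_ord_recr/= lerDl.
pose u' s := if s < S n then u s else if s < S n.+1 then v n else 0.
exists u'; split.
- split=> [s|s t st]; rewrite /u'.
    by do 2 case: ifP => _ //; rewrite lexx ler01.
  have /andP[vn0 _] := v01 n; have /andP[us0 _] := u01 s.
  case: ltP => tn.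
    by rewrite (le_lt_trans st tn) ud.
  case: ltP => tn1; case: ltP => sn.
  - exact: uv.
  - by rewrite (le_lt_trans st tn1).
  - by [].
  - by case: ifP.
- move=> s sn; rewrite /u' !ifF//; apply/negbTE; rewrite -leNgt//; exact: le_trans sn.
- move=> s i sn ni; rewrite /u'; case: ltP => h; first by apply: uv => //; exact: ltnW.
  by rewrite sn; apply: vd; exact: ltnW.
move=> r r0; rewrite big_ord_recr/= EFinD -ui//.
pose D : set R := `[S n, S n.+1[%classic.
have mu : measurable_fun setT (fun s => u s `^ r).
  exact: (unit_decr_measurable (unit_decr_powR r0 (conj u01 ud))).
transitivity (\int[leb]_(s in `]0%R, +oo[) ((u s `^ r)%:E + (v n `^ r)%:E * (\1_D s)%:E))%E.
  apply: eq_integral => s _; rewrite -EFinM -EFinD; congr EFin; rewrite /u' /D indicE mem_setE in_itv/=.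
  case: ltP => sn /=; first by rewrite mulr0 addr0.
  rewrite uS// powR0 ?gt_eqF// add0r.
  by case: ltP; rewrite ?mulr1 ?mulr0// powR0// gt_eqF.
have m1 : measurable_fun (`]0%R, +oo[%classic : set R) (fun s => (u s `^ r)%:E).
  by apply/measurable_EFinP/measurable_funTS.
have m2 : measurable_fun (`]0%R, +oo[%classic : set R) (fun s => (\1_D s : R)%:E).
  by apply/measurable_EFinP/measurable_funTS/measurable_indicP; exact: measurable_itv.
rewrite ge0_integralD//; first last.
- exact: measurable_funeM.
- by move=> s _; rewrite mule_ge0// lee_fin powR_ge0.
- by move=> s _; rewrite lee_fin powR_ge0.
congr (_ + _)%E; rewrite ge0_integralZl//; last by rewrite lee_fin powR_ge0.
rewrite mulrC EFinM; congr (_ * _)%E.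
rewrite integral_itv_obnd_cbnd; last first.
  exact: m2.
rewrite integral_indic//; last exact: measurable_itv.
rewrite (_ : D `&` _ = D); last first.
  apply/seteqP; split => s; first by case.
  rewrite /D/= !in_itv/= andbT => /andP[h1 h2]; split; first by rewrite h1.
  exact: le_trans (S0 n) h1.
suff lD : leb D = (W n)%:E by rewrite -lD.
have SE : S n.+1 - S n = W n by rewrite /S big_ord_recr/= addrAC subrr add0r.
rewrite /D lebesgue_measure_itv/= lte_fin; case: ltP => h; first by rewrite -EFinB SE.
by congr EFin; apply/eqP; rewrite eq_le W0/= -SE subr_le0 h.
Qed.

Lemma riemann_bound (u : R -> R) (M K : nat) : (0 < M)%N -> unit_decr u ->
  ((\sum_(k < K) u (k.+1%:R / M%:R) / M%:R)%:E <=
     \int[leb]_(s in `]0%R, (K%:R / M%:R)%R]) (u s)%:E <=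
   (\sum_(k < K) u (k%:R / M%:R) / M%:R)%:E)%E.
Proof.
move=> M0 [u01 ud]; have mu := unit_decr_measurable (conj u01 ud).
have MR : 0 < M%:R :> R by rewrite ltr0n.
elim: K => [|K /andP[IH1 IH2]].
  by rewrite !big_ord0 mul0r set_itvoc0 integral_set0 lexx.
have ab : K%:R / M%:R < K.+1%:R / M%:R :> R by rewrite ltr_pM2r ?invr_gt0// ltr_nat.
have len : (K.+1%:R / M%:R - K%:R / M%:R = M%:R^-1 :> R)%R.
  by rewrite -mulrBl -natrB// subSnn mul1r.
have cst_int (c : R) : (\int[leb]_(s in `](K%:R / M%:R)%R, (K.+1%:R / M%:R)%R]) c%:E = (c / M%:R)%:E)%E.
  by rewrite integral_cst//= lebesgue_measure_itv/= lte_fin ab -EFinB len EFinM.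
have -> : `]0%R, (K.+1%:R / M%:R)%R]%classic =
   `]0%R, (K%:R / M%:R)%R] `|` `](K%:R / M%:R)%R, (K.+1%:R / M%:R)%R]%classic :> set R.
  by rewrite -itv_bndbnd_setU// bnd_simp ?divr_ge0// ltW.
rewrite ge0_integral_setU//=; last 3 first.
- by apply: measurable_funTS; exact/measurable_EFinP.
- by move=> s _; rewrite lee_fin; have /andP[] := u01 s.
- apply/disj_setPRL => s /=; rewrite !in_itv/= => /andP[h1 _]; apply/negP; rewrite negb_and -ltNge h1 orbT//.
rewrite !big_ord_recr/= !EFinD; apply/andP; split; apply: leeD => //.
- rewrite -cst_int; apply: ge0_le_integral => //.
  + by move=> s _; rewrite lee_fin; have /andP[] := u01 (K.+1%:R / M%:R).
  + by apply: measurable_funTS; exact/measurable_EFinP.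
  + by move=> s; rewrite /= in_itv/= => /andP[_ h]; rewrite lee_fin ud.
- rewrite -cst_int; apply: ge0_le_integral => //.
  + by move=> s _; rewrite lee_fin; have /andP[] := u01 s.
  + by apply: measurable_funTS; exact/measurable_EFinP.
  + by move=> s; rewrite /= in_itv/= => /andP[h _]; rewrite lee_fin ud// ltW.
Qed.

Definition step_sum (u : R -> R) (M S : nat) : R := \sum_(k < S * M) u (k.+1%:R / M%:R) / M%:R.

(** Upper and lower sums of a decreasing function telescope. The error is independent of [u] and
    [S]: this is what lets limits along an ultrafilter pass under the integral, where dominated
    convergence of sequences does not apply. *)
Lemma riemann_sum (u : R -> R) (M S : nat) : (0 < M)%N -> unit_decr u ->
  ((\int[leb]_(s in `]0%R, S%:R]) (u s))%:E = \int[leb]_(s in `]0%R, S%:R]) (u s)%:E)%E /\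
  `|\int[leb]_(s in `]0%R, S%:R]) u s - step_sum u M S| <= M%:R^-1.
Proof.
move=> M0 uu; have [u01 ud] := uu.
have MR : M%:R != 0 :> R by rewrite pnatr_eq0 -lt0n.
have := riemann_bound (S * M) M0 uu; rewrite natrM mulfK// => /andP[h1 h2].
have ioo : (\int[leb]_(s in `]0%R, S%:R]) (u s)%:E)%E \is a fin_num.
  rewrite ge0_fin_numE; first by apply: le_lt_trans h2 _; exact: ltry.
  by apply: integral_ge0 => s _; rewrite lee_fin; have /andP[] := u01 s.
have IE : ((\int[leb]_(s in `]0%R, S%:R]) (u s))%:E = \int[leb]_(s in `]0%R, S%:R]) (u s)%:E)%E.
  by rewrite /Rintegral fineK.
split => //; move: h1 h2; rewrite -IE !lee_fin -/(step_sum u M S) => h1 h2.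
rewrite ger0_norm ?subr_ge0// lerBlDr; apply: le_trans h2 _.
suff : \sum_(k < S * M) u (k%:R / M%:R) / M%:R - step_sum u M S <= M%:R^-1.
  by rewrite lerBlDr.
rewrite /step_sum -sumrB; under eq_bigr do rewrite -mulrBl.
rewrite -mulr_suml -[leRHS]mul1r ler_wpM2r ?invr_ge0//.
under eq_bigr do rewrite -opprB; rewrite sumrN.
rewrite -(big_mkord xpredT (fun k => u (k.+1%:R / M%:R) - u (k%:R / M%:R))) telescope_sumr//.
have /andP[a0 a1] := u01 ((S * M)%:R / M%:R); have /andP[b0_ b1] := u01 (0%:R / M%:R).
by rewrite opprB; lra.
Qed.
End discrete_quantile.

Section bernstein.
Context {R : realType}.
Local Notation leb := (@lebesgue_measure R).

Lemma ultra_cvg_segment (U : set_system nat) (x : nat -> R) (a b : R) : UltraFilter U ->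
  (forall n, a <= x n <= b) -> exists2 l, a <= l <= b & x n @[n --> U] --> l.
Proof.
move=> UU xab; have := @segment_compact R a b; rewrite compact_ultra.
have UX : UltraFilter (x @ U).
  split; first exact: fmap_proper_filter.
  move=> G PG UG; apply/seteqP; split => A; last exact: UG.
  move=> GA; have [//|UA] := in_ultra_setVsetC (x @^-1` A) UU.
  exfalso; have GnA : G (~` A) by exact: UG.
  by have [y [Ay]] := filter_ex (filterI GA GnA).
move=> /(_ (x @ U) UX)[].
  suff : U (x @^-1` `[a, b]%classic) by [].
  by apply: filterE => n; rewrite /preimage/= in_itv/= xab.
by move=> l [/=]; rewrite in_itv/= => lab xl; exists l.
Qed.

Lemma cvg_powR (U : set_system nat) (x : nat -> R) (l r : R) : ProperFilter U -> 0 < r ->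
  (forall n, 0 <= x n) -> 0 <= l -> x n @[n --> U] --> l -> x n `^ r @[n --> U] --> l `^ r.
Proof.
move=> PU r0 x0; rewrite le_eqVlt => /predU1P[<-|l0] xl.
  rewrite powR0 ?gt_eqF//; apply/cvgrPdist_le => /= e e0.
  have er : 0 < e `^ r^-1 by rewrite powR_gt0.
  move/cvgrPdist_le : xl => /(_ _ er); apply: filterS => n.
  rewrite !sub0r !normrN !ger0_norm ?powR_ge0// => h.
  have e1 : (e `^ r^-1) `^ r = e by rewrite -powRrM mulVf ?gt_eqF// powRr1// ltW.
  rewrite -[leRHS]e1.
  by rewrite ge0_ler_powR ?nnegrE ?powR_ge0//; exact: ltW.
have cl : {for l, continuous (fun y : R => y `^ r)}.
  apply/differentiable_continuous/derivable1_diffP.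
  by apply: derivable_powR; rewrite in_itv/= l0.
exact: (cvg_comp _ _ xl cl).
Qed.

Section limit.
Variables (u_ : nat -> R -> R) (F_ : nat -> R -> R) (f : R -> R) (Dy : set R).
Hypothesis u_01 : forall n, unit_decr (u_ n).
Hypothesis u_F : forall n r, 0 < r -> (\int[leb]_(s in `]0%R, +oo[) (u_ n s `^ r)%:E = (F_ n r)%:E)%E.
Hypothesis Dy0 : forall r, Dy r -> 0 < r.
Hypothesis Dyhalf : forall r, Dy r -> Dy (r / 2).
Hypothesis F_f : forall r, Dy r -> F_ n r @[n --> \oo] --> f r.

(** Since [u_ n] decreases, [u_ n (S) ^ (r / 2) * S] is at most the integral of the power [r / 2].
    Beyond [S], one half of the power [r] is bounded by its value at [S] and the other half is
    integrated: the tail is uniformly small in [n]. *)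
Let tail n (r : R) (S : nat) : 0 < r -> (0 < S)%N ->
  \int[leb]_(s in `]0%R, S%:R]) (u_ n s `^ r) <= F_ n r <=
    \int[leb]_(s in `]0%R, S%:R]) (u_ n s `^ r) + F_ n (r / 2) ^+ 2 / S%:R.
Proof.
move=> r0 S0; pose J := \int[leb]_(s in `]0%R, S%:R]) (u_ n s `^ r); rewrite -/J.
have r20 : 0 < r / 2 by rewrite divr_gt0.
have SR : 0 < S%:R :> R by rewrite ltr0n.
have m q : 0 < q -> measurable_fun setT (fun s => u_ n s `^ q).
  by move=> q0; exact: (unit_decr_measurable (unit_decr_powR q0 (u_01 n))).
have [JE _] := riemann_sum S (ltn0Sn 0) (unit_decr_powR r0 (u_01 n)).
have [JE2 _] := riemann_sum S (ltn0Sn 0) (unit_decr_powR r20 (u_01 n)).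
have setE : `]0%R, +oo[%classic = `]0%R, S%:R] `|` `]S%:R, +oo[%classic :> set R.
  by rewrite -itv_bndbnd_setU// bnd_simp ltW.
have split q : 0 < q -> ((F_ n q)%:E = \int[leb]_(s in `]0%R, S%:R]) (u_ n s `^ q)%:E +
    \int[leb]_(s in `]S%:R, +oo[) (u_ n s `^ q)%:E)%E.
  move=> q0; rewrite -u_F// setE ge0_integral_setU//=.
  - by apply/measurable_EFinP/measurable_funTS; exact: m.
  - by move=> s _; rewrite lee_fin powR_ge0.
  - apply/disj_setPRL => s /=; rewrite !in_itv/= andbT => h1; apply/negP; rewrite negb_and -!ltNge h1 orbT//.
have i0 q A : (0 <= \int[leb]_(s in A) (u_ n s `^ q)%:E)%E.
  by apply: integral_ge0 => s _; rewrite lee_fin powR_ge0.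
pose J2 := \int[leb]_(s in `]0%R, S%:R]) (u_ n s `^ (r / 2)).
have J2F : J2 <= F_ n (r / 2) by rewrite -lee_fin JE2 (split _ r20) leeDl.
have uS : u_ n S%:R `^ (r / 2) * S%:R <= J2.
  rewrite -lee_fin JE2; apply: (@le_trans _ _ (\int[leb]_(s in `]0%R, S%:R]) (u_ n S%:R `^ (r / 2))%:E)%E).
    by rewrite integral_cst//= lebesgue_measure_itv/= lte_fin SR sube0 EFinM.
  apply: ge0_le_integral => //.
  - by move=> s _; rewrite lee_fin powR_ge0.
  - by apply/measurable_EFinP/measurable_funTS; exact: m.
  - move=> s; rewrite /= in_itv/= => /andP[_ sS]; rewrite lee_fin.
    by have [_] := unit_decr_powR r20 (u_01 n); apply.
have F20 : 0 <= F_ n (r / 2) by rewrite -lee_fin -u_F// i0.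
apply/andP; split; first by rewrite -lee_fin JE split// leeDl.
rewrite -lee_fin split// EFinD JE leeD2l//.
apply: (@le_trans _ _ ((u_ n S%:R `^ (r / 2))%:E * (F_ n (r / 2))%:E)%E).
  rewrite -u_F// setE; apply: (@le_trans _ _ ((u_ n S%:R `^ (r / 2))%:E *
     \int[leb]_(s in `]S%:R, +oo[) (u_ n s `^ (r / 2))%:E)%E); last first.
    rewrite lee_wpmul2l ?lee_fin ?powR_ge0// -setE u_F// split// leeDr//.
  rewrite -ge0_integralZl//; last 3 first.
  - by apply/measurable_EFinP/measurable_funTS; exact: m.
  - by move=> s _; rewrite lee_fin powR_ge0.
  - by rewrite lee_fin powR_ge0.
  apply: ge0_le_integral => //.
  - by move=> s _; rewrite lee_fin powR_ge0.
  - by apply/measurable_EFinP/measurable_funTS; exact: m.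
  - by apply/measurable_EFinP/measurable_funTS; apply: measurable_funM => //; exact: m.
  - move=> s; rewrite /= in_itv/= andbT => Ss; rewrite -EFinM lee_fin.
    have := u_01 n; move=> [h01 hd]; have /andP[us0 _] := h01 s; have /andP[uS0 _] := h01 S%:R.
    have -> : u_ n s `^ r = u_ n s `^ (r / 2) * u_ n s `^ (r / 2).
      have [->|un0] := eqVneq (u_ n s) 0; first by rewrite !powR0 ?mulr0 ?gt_eqF.
      by rewrite -powRD ?un0 ?implybT//; congr (_ `^ _); field.
    rewrite ler_wpM2r ?powR_ge0// ge0_ler_powR ?nnegrE ?(ltW r20)//.
    by apply: hd; exact: ltW.
rewrite -EFinM lee_fin ler_pdivlMr// mulrAC expr2 ler_wpM2r//.
exact: le_trans uS J2F.
Qed.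

(** Helly's selection theorem: a limit along an ultrafilter exists at every time at once and is
    again decreasing. The tail estimate prevents mass from escaping to infinity. *)
Lemma unit_decr_limit : exists u, unit_decr u /\ forall r, Dy r ->
  (\int[leb]_(s in `]0%R, +oo[) (u s `^ r)%:E = (f r)%:E)%E.
Proof.
have [U [UU oU]] := ultraFilterLemma (@eventually_filter).
have PU : ProperFilter U by exact: ultra_proper.
have exl s : exists l : R, 0 <= l <= 1 /\ u_ n s @[n --> U] --> l.
  have [l l01 ul] := ultra_cvg_segment UU (fun n => (u_01 n).1 s).
  by exists l.
have [u hu] := choice exl.
have uu : unit_decr u.
  split=> [s|s t st]; first by have [] := hu s.
  have [_ us] := hu s; have [_ ut] := hu t.
  apply: (ler_cvg_to ut us); apply: filterE => n; exact: (u_01 n).2.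
exists u; split => // r Dr; have r0 := Dy0 Dr.
have upow s : u_ n s `^ r @[n --> U] --> u s `^ r.
  have [/andP[us0 _] us] := hu s; apply: cvg_powR => // n.
  by have /andP[] := (u_01 n).1 s.
have ur := unit_decr_powR r0 uu.
pose J (S : nat) := \int[leb]_(s in `]0%R, S%:R]) (u s `^ r).
have JE S : (J S)%:E = (\int[leb]_(s in `]0%R, S%:R]) (u s `^ r)%:E)%E.
  by have [] := riemann_sum S (ltn0Sn 0) ur.
have near_J (S : nat) e : 0 < e -> \forall n \near U,
    `|J S - \int[leb]_(s in `]0%R, S%:R]) (u_ n s `^ r)| <= e.
  move=> e0; pose M := (Num.bound (3 / e)).+1.
  have M3 : M%:R^-1 <= e / 3.
    rewrite -[leRHS]invrK lef_pV2 ?posrE ?invr_gt0 ?divr_gt0// invf_div.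
    apply: le_trans (ltW (archi_boundP _)) _; first by rewrite divr_ge0// ltW.
    by rewrite ler_nat.
  have [_ h1] := riemann_sum S (ltn0Sn (Num.bound (3 / e))) ur.
  have sc : step_sum (fun s => u_ n s `^ r) M S @[n --> U] --> step_sum (fun s => u s `^ r) M S.
    rewrite /step_sum; elim: (S * M)%N => [|k IH].
      by under eq_fun do rewrite big_ord0; rewrite big_ord0; exact: cvg_cst.
    under eq_fun do rewrite big_ord_recr/=; rewrite big_ord_recr/=.
    by apply: cvgD => //; apply: cvgMl; exact: upow.
  have e3 : 0 < e / 3 by rewrite divr_gt0.
  move/cvgrPdist_le : sc => /(_ _ e3); apply: filterS => n h2.
  have [_ h3] := riemann_sum S (ltn0Sn (Num.bound (3 / e))) (unit_decr_powR r0 (u_01 n)).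
  move: h1 h2 h3; rewrite -/M -/(J S) !ler_norml => /andP[a1 a2] /andP[b1 b2] /andP[c1 c2].
  apply/andP; split; lra.
have toU (g : nat -> R) (l : R) : g n @[n --> \oo] --> l -> g n @[n --> U] --> l.
  by move=> gl A /gl; exact: oU.
have key (S : nat) : (0 < S)%N -> J S <= f r <= J S + f (r / 2) ^+ 2 / S%:R.
  move=> S0; have f1 := toU _ _ (F_f Dr); have f2 := toU _ _ (F_f (Dyhalf Dr)).
  have f3 : F_ n (r / 2) ^+ 2 / S%:R @[n --> U] --> f (r / 2) ^+ 2 / S%:R.
    by apply: cvgMl; exact: (cvgM f2 f2).
  apply/andP; split; apply/ler_addgt0Pr => e e0; have e2 : 0 < e / 2 by rewrite divr_gt0.
  - move/cvgrPdist_le : f1 => /(_ _ e2) h1; have h2 := near_J S _ e2.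
    have [n [/ler_normlP[a1 a2] /ler_normlP[b1 b2]]] := filter_ex (filterI h1 h2).
    by have /andP[c1 _] := tail n r0 S0; lra.
  - have e3 : 0 < e / 3 by rewrite divr_gt0.
    move/cvgrPdist_le : f1 => /(_ _ e3) h1; have h2 := near_J S _ e3.
    move/cvgrPdist_le : f3 => /(_ _ e3) h3.
    have [n [[/ler_normlP[a1 a2] /ler_normlP[b1 b2]] /ler_normlP[d1 d2]]] := filter_ex (filterI (filterI h1 h2) h3).
    by have /andP[_ c1] := tail n r0 S0; lra.
have mr : measurable_fun setT (fun s => u s `^ r) by exact: unit_decr_measurable.
have bigc : `]0%R, +oo[%classic = \bigcup_(S : nat) `]0%R, S%:R]%classic :> set R.
  apply/seteqP; split => s; last by move=> [S _]; rewrite /= !in_itv/= andbT => /andP[].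
  rewrite /= in_itv/= andbT => s0; exists (Num.bound s) => //=.
  by rewrite in_itv/= s0/= ltW// archi_boundP// ltW.
have c1 : (\int[leb]_(s in `]0%R, S%:R]) (u s `^ r)%:E @[S --> \oo] -->
    \int[leb]_(s in `]0%R, +oo[) (u s `^ r)%:E)%E.
  rewrite bigc; apply: ge0_nondecreasing_set_cvg_integral.
  - move=> S S' SS; apply/subsetPset => s /=; rewrite !in_itv/= => /andP[-> /le_trans]; apply.
    by rewrite ler_nat.
  - by move=> S; exact: measurable_itv.
  - by move=> S; apply/measurable_EFinP/measurable_funTS.
  - by move=> S s _; rewrite lee_fin powR_ge0.
have c2 : J S @[S --> \oo] --> f r.
  apply/cvgrPdist_le => /= e e0; near=> S.
  have S0 : (0 < S)%N by near: S; exact: nbhs_infty_gt.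
  have /andP[k1 k2] := key S S0.
  have SR : 0 < S%:R :> R by rewrite ltr0n.
  have : f (r / 2) ^+ 2 / S%:R <= e.
    rewrite ler_pdivrMr// -ler_pdivrMl// mulrC.
    by near: S; exact: nbhs_infty_ger.
  by rewrite ger0_norm ?subr_ge0//; lra.
move: c1; under eq_fun do rewrite -JE; move=> c1.
apply: (cvg_unique _ c1); first exact: ereal_hausdorff.
by apply: cvg_EFin => //; exact: nearW.
Unshelve. all: by end_near. Qed.
End limit.

(** Bernstein's theorem through Hausdorff's: samples of [f] on finer and finer meshes have discrete
    representing measures, whose quantile functions have a limit. Convergence is first obtained at
    rational exponents. *)
Theorem completely_monotone_quantile (f : R -> R) : completely_monotone f ->
  exists u, unit_decr u /\ forall r, 0 < r ->
    (\int[leb]_(s in `]0%R, +oo[) (u s `^ r)%:E = (f r)%:E)%E.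
Proof.
move=> cf; have cg := completely_monotone_cm_seq cf.
(* With mesh [1 / n!], every positive rational is eventually a sample point [delta n * (j + 1)] with
   [j > 0]. *)
pose delta n : R := (n`!%:R)^-1.
have f0 n : 0 < n`!%:R :> R by rewrite ltr0n fact_gt0.
have d0 n : 0 < delta n by rewrite invr_gt0.
pose a n j := f (delta n * j.+1%:R).
have a0 n : 0 <= a n 0%N.
  have [_] := cg 0%N (delta n * 1%:R) (mulr_gt0 (d0 n) ltr01).
  by rewrite expr0 mul1r.
have w0 n d i : 0 <= bernstein_weight (a n) d i.
  by rewrite mulr_ge0// (cm_seq_moment_ge0 i (d - i) (d0 n) cg).
(* The degree makes the error in [bernstein_moment] at most [1 / (n + 1)] for all [j <= n * n!]; the
   other summands give [j <= d n] and [0 < d n]. *)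
pose d n := (Num.bound (a n 0%N * ((n * n`!) ^ 2)%:R * n.+1%:R) + n * n`! + 1)%N.
have dn0 n : (0 < d n)%N by rewrite /d addn1.
have dR n : 0 < (d n)%:R :> R by rewrite ltr0n.
have dn n j : (j <= n * n`!)%N -> (j <= d n)%N.
  by move=> h; rewrite /d; apply: leq_trans h _; rewrite -addnA addnCA leq_addr.
(* The sample of index [j] is at [delta n * (j + 1)], so one power of the atom is divided out of its
   weight, and the power [n!] in [v] cancels [delta n]. The reversed index makes the atoms decrease
   and drops the atom at 0, which does not contribute for [j > 0]. *)
pose W n k := if (k < d n)%N then bernstein_weight (a n) (d n) (d n - k) / ((d n - k)%:R / (d n)%:R) else 0.
pose v n k : R := ((d n - k)%:R / (d n)%:R) ^+ n`!.
have W0 n k : 0 <= W n k by rewrite /W; case: ifP => // _; rewrite !divr_ge0.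
have x01 n k : 0 <= ((d n - k)%:R / (d n)%:R : R) <= 1.
  by rewrite divr_ge0//= ler_pdivrMr// mul1r ler_nat leq_subr.
have v01 n k : 0 <= v n k <= 1.
  have /andP[h1 h2] := x01 n k; by rewrite exprn_ge0//= exprn_ile1.
have vd n i j : (i <= j)%N -> v n j <= v n i.
  move=> ij; rewrite /v; have /andP[h1 h2] := x01 n j; apply: lerXn2r; rewrite ?nnegrE ?divr_ge0//.
  by rewrite ler_pM2r ?invr_gt0// ler_nat leq_sub2l.
have exu n := discrete_quantile (d n) (W0 n) (v01 n) (vd n).
have [u_ hu] := choice exu.
pose Dy : set R := [set r | exists p q : nat, r = p.+1%:R / q.+1%:R].
pose F_ n r := \sum_(i < d n) W n i * v n i `^ r.
have FE n j : (0 < j)%N -> F_ n (delta n * j.+1%:R) =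
    \sum_(i < (d n).+1) bernstein_weight (a n) (d n) i * (i%:R / (d n)%:R) ^+ j.
  move=> j0; rewrite big_ord_recl/= mul0r expr0n gtn_eqF// mulr0 add0r.
  rewrite (reindex_inj rev_ord_inj)/=; apply: eq_bigr => i _.
  rewrite /W ltn_ord /v /bump/= add1n subnSK//.
  set x : R := (d n - i)%:R / (d n)%:R.
  have xn0 : x != 0 by rewrite mulf_neq0 ?invr_eq0 ?gt_eqF// ltr0n subn_gt0.
  have x0 : 0 <= x by rewrite divr_ge0.
  have -> : (x ^+ n`!) `^ (delta n * j.+1%:R) = x ^+ j.+1.
    by rewrite -powR_mulrn// -powRrM mulrA mulfV ?gt_eqF// mul1r powR_mulrn.
  by rewrite exprS -mulrA mulKf.
have Fcvg r : Dy r -> F_ n r @[n --> \oo] --> f r.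
  move=> [p [q ->]]; apply/cvgrPdist_le => /= e e0; near=> n.
  have qn : (q.+1 <= n)%N by near: n; exact: nbhs_infty_ge.
  have pn : (p.+1 <= n)%N by near: n; exact: nbhs_infty_ge.
  have n2 : (q.+2 <= n)%N by near: n; exact: nbhs_infty_ge.
  have qdvd : (q.+1 %| n`!)%N by apply: dvdn_fact.
  pose m := (n`! %/ q.+1)%N; have mE : (m * q.+1 = n`!)%N by exact: divnK.
  have m1 : (1 < m)%N.
    rewrite /m ltn_divRL// mul1n; apply: (@leq_trans n) => //.
    have n0 : (0 < n)%N by exact: leq_trans n2.
    by rewrite -(prednK n0) factS leq_pmulr// fact_gt0.
  pose j := (p.+1 * m).-1.
  have jE : j.+1 = (p.+1 * m)%N by rewrite prednK// muln_gt0/= ltnW.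
  have j0 : (0 < j)%N by rewrite -ltnS jE (leq_trans m1)// leq_pmull.
  have rE : p.+1%:R / q.+1%:R = delta n * j.+1%:R :> R.
    rewrite jE /delta -mE !natrM; have m0 : m%:R != 0 :> R by rewrite pnatr_eq0 -lt0n ltnW.
    have q0 : q.+1%:R != 0 :> R by rewrite pnatr_eq0.
    move: q0 m0; set y := (q.+1)%:R; set z := m%:R; set t := (p.+1)%:R => y0 z0.
    by rewrite invfM [t * z]mulrC [RHS]mulrACA (mulVf z0) mul1r [RHS]mulrC.
  have jle : (j <= n * n`!)%N.
    apply: (@leq_trans j.+1) => //; rewrite jE leq_mul//.
    by rewrite -mE leq_pmulr.
  rewrite rE (FE _ _ j0) distrC.
  have := bernstein_moment (dn0 n) (dn _ _ jle) (fun i _ => w0 n (d n) i).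
  rewrite -/(a n j) => h; apply: le_trans h _.
  have hn : n.+1%:R^-1 <= e by apply/ltW; near: n; exact: (near_infty_natSinv_lt (PosNum e0)).
  apply: le_trans hn; rewrite ler_pdivrMr// ler_pdivlMl//.
  rewrite mulrC; apply: le_trans (_ : a n 0%N * ((n * n`!) ^ 2)%:R * n.+1%:R <= _).
    by rewrite ler_wpM2r// ler_wpM2l// ler_nat leq_exp2r.
  apply: le_trans (ltW (archi_boundP _)) _; first by rewrite !mulr_ge0.
  by rewrite ler_nat /d -addnA leq_addr.
have Dy0 r : Dy r -> 0 < r by move=> [p [q ->]]; rewrite divr_gt0.
have Dyh r : Dy r -> Dy (r / 2).
  by move=> [p [q ->]]; exists p, (q.+1 * 2).-1; rewrite prednK// natrM invfM mulrA.
have [u [uu hu']] := unit_decr_limit (fun n => (hu n).1) (fun n => (hu n).2) Dy0 Dyh Fcvg.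
exists u; split => // r r0.
have u01 := uu.1.
(* From rational to real exponents: the integral decreases in the exponent, [f] is continuous, and
   rationals approach [r] from both sides. *)
have anti (x y : R) : 0 < x -> x <= y ->
    (\int[leb]_(s in `]0%R, +oo[) (u s `^ y)%:E <= \int[leb]_(s in `]0%R, +oo[) (u s `^ x)%:E)%E.
  move=> x0 xy; have y0 := lt_le_trans x0 xy.
  have mp z : 0 < z -> measurable_fun (`]0%R, +oo[%classic : set R) (fun s => (u s `^ z)%:E).
    by move=> z0; apply/measurable_EFinP/measurable_funTS; exact: (unit_decr_measurable (unit_decr_powR z0 uu)).
  apply: ge0_le_integral => //; [|exact: mp|exact: mp|].
    by move=> s _; rewrite lee_fin powR_ge0.
  move=> s _; rewrite lee_fin; have /andP[us0 us1] := u01 s.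
  have [->|un0] := eqVneq (u s) 0; first by rewrite !powR0 ?gt_eqF.
  by apply: ger_powR => //; rewrite lt_def un0 us0.
have dense (x y : R) : 0 < x -> x < y -> exists z, Dy z /\ x < z < y.
  move=> x0 /rat_in_itvoo[q]; rewrite in_itv/= => /andP[xq qy]; exists (ratr q).
  have q0 : 0 < q by rewrite -(ltr0q R); exact: lt_trans xq.
  split; last by rewrite xq.
  have n0 : 0 < numq q by rewrite numq_gt0.
  exists `|numq q|%N.-1, `|denq q|%N.-1; rewrite !prednK ?absz_gt0 ?denq_eq0 ?gt_eqF//.
  have e1 : (numq q)%:~R = `|numq q|%N%:R :> R by rewrite -{1}(gtz0_abs n0).
  have e2 : (denq q)%:~R = `|denq q|%N%:R :> R by rewrite -{1}(gtz0_abs (denq_gt0 q)).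
  by rewrite /ratr e1 e2.
have fc : f z @[z --> r] --> f r.
  have := (cg 0%N r r0).1; move=> [h _].
  exact/differentiable_continuous/derivable1_diffP.
have fin : (\int[leb]_(s in `]0%R, +oo[) (u s `^ r)%:E)%E \is a fin_num.
  have r20 : 0 < r / 2 by rewrite divr_gt0.
  have [z [Dz /andP[z1 z2]]] := dense (r / 2) r r20 (ltac:(lra)).
  rewrite ge0_fin_numE; last by apply: integral_ge0 => s _; rewrite lee_fin powR_ge0.
  apply: le_lt_trans (anti z r (Dy0 _ Dz) (ltW z2)) _.
  by rewrite (hu' _ Dz) ltry.
rewrite -(fineK fin); congr EFin; apply/eqP; rewrite eq_le.
have near_r e : 0 < e -> exists2 eta, 0 < eta & forall z, `|r - z| < eta -> `|f r - f z| <= e.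
  move=> e0; move/cvgrPdist_le : fc => /(_ _ e0) /nbhs_ballP[eta /= eta0 h].
  by exists eta => // z hz; apply: h.
apply/andP; split; apply/ler_addgt0Pr => e e0; have [eta eta0 h] := near_r e e0.
- have x0 : 0 < Num.max (r / 2) (r - eta) by rewrite lt_max divr_gt0.
  have xr : Num.max (r / 2) (r - eta) < r by rewrite gt_max; apply/andP; split; lra.
  have [z [Dz /andP[]]] := dense _ _ x0 xr; rewrite gt_max => /andP[z1 z2] z3.
  have : `|f r - f z| <= e by apply: h; rewrite ger0_norm; lra.
  have : fine (\int[leb]_(s in `]0%R, +oo[) (u s `^ r)%:E)%E <= f z.
    by rewrite -lee_fin fineK// -hu'// anti ?Dy0// ltW.
  by rewrite ler_norml => ? /andP[? ?]; lra.
- have xr : r < r + eta by rewrite ltrDl.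
  have [z [Dz /andP[z1 z2]]] := dense _ _ r0 xr.
  have : `|f r - f z| <= e by apply: h; rewrite ler0_norm; lra.
  have : f z <= fine (\int[leb]_(s in `]0%R, +oo[) (u s `^ r)%:E)%E.
    by rewrite -lee_fin fineK// -hu'// anti// ltW.
  by rewrite ler_norml => ? /andP[? ?]; lra.
Unshelve. all: by end_near. Qed.
End bernstein.

(** * Level sets of the quantile and their measurability *)

Section level_sets.
Context {R : realType}.
Local Notation leb := (@lebesgue_measure R).

(** The binomial expansion of [step_poly] at [u ^ delta], integrated term by term: the powers of [u]
    become values of [f]. There is no constant term, whose integral would diverge; the shift to
    [m.+1] keeps all exponents positive. *)
Definition level_moment (f : R -> R) (delta : R) (m : nat) : R :=
  \sum_(l < m.+1 * 2 ^ m.+1)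
    - ((-1) ^+ l.+1 *+ 'C(m.+1 * 2 ^ m.+1, l.+1)) * f (delta * m.+1%:R * l.+1%:R).

Lemma step_poly_powR (delta w : R) (m : nat) : 0 <= w ->
  step_poly m.+1 (w `^ delta) = level_moment (fun r => w `^ r) delta m.
Proof.
move=> w0; rewrite /step_poly /level_moment; set M := (_ * _)%N; set x := _ ^+ m.+1.
rewrite exprDn big_ord_recl/= subn0 expr1n expr0 mulr1 bin0 mulr1n opprD addrA subrr add0r.
rewrite -sumrN; apply: eq_bigr => l _; rewrite expr1n mul1r /bump/= add1n.
have -> : w `^ (delta * m.+1%:R * l.+1%:R) = x ^+ l.+1.
  by rewrite powRrM powR_mulrn ?powR_ge0// powRrM powR_mulrn ?powR_ge0.
by rewrite (exprNn x) mulNr mulrnAl.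
Qed.

Variables (u f : R -> R).
Hypothesis uu : unit_decr u.
Hypothesis uf : forall r, 0 < r -> (\int[leb]_(s in `]0%R, +oo[) (u s `^ r)%:E = (f r)%:E)%E.

Let mpow r : 0 < r -> measurable_fun setT (fun s => u s `^ r).
Proof. by move=> r0; exact: (unit_decr_measurable (unit_decr_powR r0 uu)). Qed.

Let ipow r : 0 < r -> leb.-integrable `]0%R, +oo[ (EFin \o (fun s => u s `^ r)).
Proof.
move=> r0; apply/integrableP; split.
  by apply/measurable_EFinP/measurable_funTS; exact: mpow.
have -> : (\int[leb]_(s in `]0%R, +oo[) `|(EFin \o (fun s => (u s `^ r)%R)) s| = (f r)%:E)%E.
  by rewrite -uf//; apply: eq_integral => s _ /=; rewrite ger0_norm// powR_ge0.
exact: ltry.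
Qed.

Lemma integral_level_moment delta m : 0 < delta ->
  \int[leb]_(s in `]0%R, +oo[) level_moment (fun r => u s `^ r) delta m = level_moment f delta m.
Proof.
move=> d0; rewrite /level_moment /Rintegral.
under eq_integral do rewrite -sumEFin; rewrite integral_sum//=; last first.
  move=> l; apply: (@eq_integrable _ _ _ leb _ (measurable_itv _) (fun s => (- ((-1) ^+ l.+1 *+ 'C(m.+1 * 2 ^ m.+1, l.+1)))%:E *
    (EFin \o (fun s => (u s `^ (delta * m.+1%:R * l.+1%:R))%R)) s)%E).
    by move=> s _ /=; rewrite EFinM.
  by apply: integrableZl => //; apply: ipow; rewrite !mulr_gt0 ?ltr0n.
rewrite -[RHS]/(fine (_%:E)) -sumEFin; congr fine; apply: eq_bigr => l _.
under eq_integral do rewrite EFinM; rewrite integralZl//; last first.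
  by apply: ipow; rewrite !mulr_gt0 ?ltr0n.
by rewrite uf// !mulr_gt0 ?ltr0n.
Qed.

Lemma level_moment_cvg delta : 0 < delta ->
  leb.-integrable `]0%R, +oo[ (EFin \o (fun s => (2^-1 <= u s `^ delta)%R%:R)) /\
  level_moment f delta m @[m --> \oo] -->
    \int[leb]_(s in `]0%R, +oo[) ((2^-1 <= u s `^ delta)%R%:R : R).
Proof.
move=> d0; have [u01 ud] := uu; have [p01 _] := unit_decr_powR d0 uu.
have mS m : measurable_fun setT (fun s => step_poly m (u s `^ delta)).
  rewrite /step_poly; apply: measurable_funB => //; apply: measurable_funX.
  by apply: measurable_funB => //; apply: measurable_funX; exact: mpow.
have [||||||i c] := @dominated_cvgR _ _ R leb `]0%R, +oo[
  (fun m s => step_poly m.+1 (u s `^ delta)) (fun s => (2^-1 <= u s `^ delta)%R%:R : R)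
  (fun s => 4 * u s `^ delta).
- by [].
- by move=> m; apply: measurable_funTS; exact: mS.
- apply: measurable_funTS; rewrite (_ : (fun _ => _) = \1_[set s | 2^-1 <= u s `^ delta]).
    apply/measurable_indicP; rewrite -[X in measurable X]setTI.
    apply: measurable_fun_le => //; exact: (mpow d0).
  by apply/funext => s; rewrite indicE; congr (nat_of_bool _)%:R; apply/idP/idP; rewrite inE.
- apply: aeW => s _; by have := step_poly_cvg (p01 s); rewrite -cvg_shiftS.
- have -> : EFin \o (fun s => 4 * u s `^ delta) = (fun s => 4%:E * (EFin \o (fun s => (u s `^ delta)%R)) s)%E.
    by apply/funext => s /=; rewrite EFinM.
  by apply: integrableZl => //; exact: ipow.
- move=> m s _; have /andP[h1 _] := step_poly_itv m.+1 (p01 s).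
  by rewrite ger0_norm// step_poly_le4.
split=> //.
rewrite (_ : level_moment f delta = fun m =>
  \int[leb]_(s in `]0%R, +oo[) step_poly m.+1 (u s `^ delta))//.
apply/funext => m; rewrite -integral_level_moment//.
by apply: eq_Rintegral => s _; rewrite step_poly_powR//; have /andP[] := u01 s.
Qed.

(** The exponent [ln 2 / - ln t] sends [t] to 1/2, so the threshold of [step_poly] detects any
    level. *)
Lemma half_le_powR (t w : R) : 0 < t < 1 -> 0 <= w ->
  (2^-1 <= w `^ (ln 2 / - ln t)) = (t <= w).
Proof.
move=> /andP[t0 t1] w0.
have lt0 : 0 < - ln t by rewrite oppr_gt0 ln_lt0// t0.
have l2 : 0 < ln 2 :> R by rewrite ln_gt0// ltr1n.
have d0 : 0 < ln 2 / - ln t by rewrite divr_gt0.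
have -> : 2^-1 = t `^ (ln 2 / - ln t).
  rewrite /powR gt_eqF// invrN mulrN mulNr -mulrA mulVf ?mulr1 ?expRN ?lnK ?posrE//.
  by rewrite -oppr_eq0 gt_eqF.
apply/idP/idP; last by move=> tw; rewrite ge0_ler_powR ?nnegrE// ltW.
by apply: contraTT; rewrite -!ltNge => wt; rewrite gt0_ltr_powR ?nnegrE// ltW.
Qed.

(** The limit [a] is the length of the set where [u >= t]. As [u] decreases, that set is an initial
    interval, so [a] decides [t <= u s] for every [s > 0] other than [a]. *)
Lemma level_measure t : 0 < t < 1 -> exists a : R,
  [/\ level_moment f (ln 2 / - ln t) m @[m --> \oo] --> a,
   (forall s, 0 < s -> s < a -> t <= u s) & (forall s, 0 < s -> t <= u s -> s <= a)].
Proof.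
move=> t01; have /andP[t0 t1] := t01; have [u01 ud] := uu.
have d0 : 0 < ln 2 / - ln t by rewrite divr_gt0 ?oppr_gt0 ?ln_lt0 ?t0// ln_gt0// ltr1n.
have [i c] := level_moment_cvg d0.
have hE s : (2^-1 <= u s `^ (ln 2 / - ln t)) = (t <= u s).
  by apply: half_le_powR => //; have /andP[] := u01 s.
set a := Rintegral _ _ _ in c.
have aE : (a%:E = \int[leb]_(s in `]0%R, +oo[) (t <= u s)%R%:R%:E)%E.
  rewrite /a /Rintegral fineK; last exact: (integrable_fin_num _ i).
  by apply: eq_integral => s _; rewrite hE.
have mI : measurable_fun setT (fun s => (t <= u s)%R%:R%:E : \bar R).
  apply/measurable_EFinP; rewrite (_ : (fun _ => _) = \1_[set s | t <= u s]).
    apply/measurable_indicP; rewrite -[X in measurable X]setTI.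
    apply: measurable_fun_le => //; exact: (unit_decr_measurable uu).
  by apply/funext => s; rewrite indicE; congr (nat_of_bool _)%:R; apply/idP/idP; rewrite inE.
have segm (s : R) : 0 < s -> (\int[leb]_(x in `]0%R, +oo[) (\1_(`]0%R, s]%classic) x)%:E = s%:E)%E.
  move=> s0; rewrite integral_indic// setIidl; last first.
    by move=> x /=; rewrite !in_itv/= => /andP[-> _].
  by apply: etrans (lebesgue_measure_itv `]0%R, s]) _; rewrite /= lte_fin s0 sube0.
exists a; split=> // s s0.
- move=> sa; rewrite leNgt; apply/negP => ust.
  suff : a <= s by rewrite leNgt sa.
  rewrite -lee_fin aE -segm//; apply: ge0_le_integral => //.
  + by apply: measurable_funTS.
  + by apply/measurable_EFinP/measurable_funTS/measurable_indicP.
  + move=> x; rewrite /= in_itv/= andbT => x0; rewrite lee_fin indicE mem_setE in_itv/= x0/=.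
    have [xs|sx] := leP x s; first by case: (t <= u x).
    have h := ud _ _ (ltW sx); have [h2|//] := boolP (t <= u x).
    by move: (le_trans h2 h); rewrite leNgt ust.
- move=> tu; rewrite -lee_fin aE -segm//; apply: ge0_le_integral => //.
  + by apply/measurable_EFinP/measurable_funTS/measurable_indicP.
  + by apply: measurable_funTS.
  + move=> x; rewrite /= in_itv/= andbT => x0; rewrite lee_fin indicE mem_setE in_itv/= x0/=.
    by have [xs|sx] := leP x s; last case: (t <= u x); rewrite ?(le_trans tu (ud _ _ xs)).
Qed.

(** [v] may differ from [u] at jumps of [u]. For [c > 1], [u (c s) <= v s <= u s], and dilation by
    [c] changes the integral only by the factor [c], which tends to 1. *)
Lemma quantile_sandwich (v : R -> R) : measurable_fun setT v -> (forall s, 0 <= v s) ->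
  (forall s, 0 < s -> v s <= u s) -> (forall s s', 0 < s -> s < s' -> u s' <= v s) ->
  forall r, 0 < r -> (\int[leb]_(s in `]0%R, +oo[) (v s `^ r)%:E = (f r)%:E)%E.
Proof.
move=> mv v0 vu uv r r0; have [u01 ud] := uu.
have mvr : measurable_fun setT (fun s => v s `^ r).
  exact: (measurableT_comp (measurable_powR r) mv).
have le1 : (\int[leb]_(s in `]0%R, +oo[) (v s `^ r)%:E <= (f r)%:E)%E.
  rewrite -uf//; apply: ge0_le_integral => //.
  - by move=> s _; rewrite lee_fin powR_ge0.
  - by apply/measurable_EFinP/measurable_funTS.
  - by apply/measurable_EFinP/measurable_funTS; exact: mpow.
  - move=> s; rewrite /= in_itv/= andbT => s0; rewrite lee_fin ge0_ler_powR ?nnegrE ?(ltW r0)//.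
      by have /andP[] := u01 s.
    exact: vu.
apply/eqP; rewrite eq_le le1/=.
have ge c : 1 < c -> ((f r)%:E <= c%:E * \int[leb]_(s in `]0%R, +oo[) (v s `^ r)%:E)%E.
  move=> c1; have c0 : 0 < c by exact: lt_trans c1.
  rewrite -uf// (ge0_integral_scale c0); last 2 first.
  - by apply/measurable_EFinP; exact: mpow.
  - by move=> s; rewrite lee_fin powR_ge0.
  rewrite lee_pmul2l ?fin_numE ?lte_fin//; apply: ge0_le_integral => //.
  - by move=> s _; rewrite lee_fin powR_ge0.
  - apply/measurable_EFinP/measurable_funTS; apply: measurableT_comp (mpow r0) _.
    by apply: measurable_funM => //; exact: measurable_cst.
  - by apply/measurable_EFinP/measurable_funTS.
  - move=> s; rewrite /= in_itv/= andbT => s0; rewrite lee_fin ge0_ler_powR ?nnegrE ?(ltW r0)//.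
      by have /andP[] := u01 (c * s).
    by apply: uv => //; rewrite ltr_pMl.
have i0 : (0 <= \int[leb]_(s in `]0%R, +oo[) (v s `^ r)%:E)%E.
  by apply: integral_ge0 => s _; rewrite lee_fin powR_ge0.
move: le1 ge i0; case: (integral _ _ _) => [x| |]; [| by [] | by []].
rewrite !lee_fin => le1 ge x0; apply/ler_addgt0Pr => e e0.
have c1 : 1 < 1 + e / (1 + x) by rewrite ltrDl divr_gt0// ltr_wpDr.
have := ge _ c1; rewrite -EFinM lee_fin => /le_trans; apply.
rewrite mulrDl mul1r lerD2l -mulrA ger_pMr// mulrC ler_pdivrMr ?ltr_wpDr// mul1r lerDr//.
Qed.

End level_sets.

Section measurable_quantile.
Context {R : realType} d (T : measurableType d).
Local Notation leb := (@lebesgue_measure R).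

Lemma measurable_completely_monotone_quantile
    (alpha : {measure set T -> \bar R}) (k : T -> R -> R) :
  (forall r, 0 < r -> measurable_fun setT (k ^~ r)) ->
  {ae alpha, forall U, completely_monotone (k U)} ->
  exists v : (measurableTypeR R * T)%type -> R,
    [/\ measurable_fun setT v, (forall z, 0 <= v z <= 1) &
     {ae alpha, forall U, forall r, 0 < r ->
       (\int[leb]_(s in `]0%R, +oo[) (v (s, U) `^ r)%:E = (k U r)%:E)%E}].
Proof.
move=> mk cmk.
(* An enumeration of the rational levels in ]0, 1[; indices that code no such level give 1/2. *)
pose t (i : nat) : R := if (unpickle i : option rat) is Some q then
  (if 0 < (ratr q : R) < 1 then ratr q else 2^-1) else 2^-1.
have t01 i : 0 < t i < 1.
  have h2 : 0 < (2^-1 : R) < 1 by rewrite invr_gt0 ltr0n invf_lt1 ?ltr1n ?ltr0n.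
  by rewrite /t; case: (unpickle i) => //= q; case: ifP.
pose delta i := ln 2 / - ln (t i).
have d0 i : 0 < delta i.
  by rewrite /delta divr_gt0 ?oppr_gt0 ?ln_lt0 ?t01// ln_gt0// ltr1n.
(* The upper limit is measurable in [U] without any convergence; for almost every [U] it is the
   length of the level set. *)
pose G i U : \bar R := limn_esup (fun m => (level_moment (k U) (delta i) m)%:E).
have mG i : measurable_fun setT (G i).
  apply: measurable_fun_limn_esup => m; apply/measurable_EFinP.
  rewrite /level_moment; apply: measurable_sum => l.
  apply: measurable_funM; first exact: measurable_cst.
 by apply: mk; rewrite mulr_gt0 ?ltr0n// mulr_gt0 ?ltr0n//; exact: d0.
(* The supremum of the levels whose length exceeds [s] lies between the later values of [u] and
   [u s], as [quantile_sandwich] requires, and is jointly measurable as a countable supremum. *)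
pose h i (z : (measurableTypeR R * T)%type) : R := t i * \1_[set z | (z.1%:E < G i z.2)%E] z.
have h01 i z : 0 <= h i z <= 1.
  have /andP[ti0 ti1] := t01 i.
  by rewrite /h indicE; case: (_ \in _); rewrite ?mulr1 ?mulr0 ?lexx ?ler01// !ltW.
have mh i : measurable_fun setT (h i).
  apply: measurable_funM => //; apply/measurable_indicP.
  have m1 : measurable_fun setT (fun z : (measurableTypeR R * T)%type => z.1%:E : \bar R).
    by apply/measurable_EFinP; exact: measurable_fst.
  have m2 : measurable_fun setT (fun z : (measurableTypeR R * T)%type => G i z.2).
    by apply: measurableT_comp (mG i) _; exact: measurable_snd.
  by rewrite -[X in measurable X]setTI; exact: emeasurable_fun_lt.
have bh z : has_ubound (range (h ^~ z)).
  by exists 1 => _ [i _ <-]; have /andP[] := h01 i z.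
pose v (z : (measurableTypeR R * T)%type) := sups (h ^~ z) 0.
have hv i z : h i z <= v z.
  by apply: ub_le_sup; [case: (bh z) => M hM; exists M => _ [j _ <-]; apply: hM; exists j
    | exists i].
have vle z M : (forall i, h i z <= M) -> v z <= M.
  by move=> hM; apply: ge_sup; [exists (h 0%N z), 0%N | move=> _ [i _ <-]; exact: hM].
exists v; split.
- by apply: measurable_fun_sups => // z _; exact: bh.
- move=> z; apply/andP; split; last by apply: vle => i; have /andP[] := h01 i z.
  by apply: le_trans (hv 0%N z); have /andP[] := h01 0%N z.
apply: (ae_imply cmk) => U /completely_monotone_quantile[u [uu uf]].
have [u01 ud] := uu.
have lev i : exists a : R, [/\ G i U = a%:E, (forall s, 0 < s -> s < a -> t i <= u s) &
    (forall s, 0 < s -> t i <= u s -> s <= a)].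
  have [a [ca h1 h2]] := level_measure uu uf (t01 i); exists a; split=> //.
  have ca' : (level_moment (k U) (delta i) m)%:E @[m --> \oo] --> a%:E by apply/fine_cvgP; split; first exact: nearW.
  by rewrite /G is_cvg_limn_esupE; [exact: cvg_lim ca' | apply/cvg_ex; exists a%:E].
apply: (quantile_sandwich uu uf).
- apply: measurableT_comp (_ : measurable_fun setT v) _; last exact: measurable_pair2.
  by apply: measurable_fun_sups => // z _; exact: bh.
- by move=> s; apply: le_trans (hv 0%N _); have /andP[] := h01 0%N (s, U).
- move=> s s0; apply: vle => i; have [a [Ga h1 _]] := lev i.
  rewrite /h indicE; have [|_] := boolP (_ \in _); last by rewrite mulr0; have /andP[] := u01 s.
  rewrite inE/= Ga lte_fin mulr1; exact: h1.
- move=> s s' s0 ss'; rewrite leNgt; apply/negP => vu.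
  have v0 : 0 <= v (s, U) by apply: le_trans (hv 0%N _); have /andP[] := h01 0%N (s, U).
  have /rat_in_itvoo[q] := vu; rewrite in_itv/= => /andP[q1 q2].
  have q01 : 0 < (ratr q : R) < 1.
    rewrite (le_lt_trans v0 q1)/= (lt_le_trans q2)//; by have /andP[] := u01 s'.
  have tq : t (pickle q) = ratr q by rewrite /t pickleK q01.
  have [a [Ga _ h2]] := lev (pickle q).
  have sa : s < a by rewrite (lt_le_trans ss')// h2 ?(lt_trans s0)// tq ltW.
  have := hv (pickle q) (s, U); rewrite /h indicE mem_set/= ?Ga ?lte_fin// mulr1 tq.
  by rewrite leNgt q1.
Qed.

End measurable_quantile.

(** * Generalised Gamma convolutions *)

Section scaled_measures.
Context d (T : measurableType d) (R : realType).
Variables (m : {measure set T -> \bar R}) (k : {nonneg R}).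
Local Open Scope ereal_scope.
Import HBNNSimple.

Let mscale_le (m' : {measure set T -> \bar R}) (l : {nonneg R}) (f : T -> \bar R) :
  (forall x, 0 <= f x) -> \int[mscale l m']_x f x <= l%:num%:E * \int[m']_x f x.
Proof.
move=> f0; rewrite [leLHS]ge0_integralTE//; apply: ge_ereal_sup => _ [h hf <-].
rewrite -integralT_nnsfun ge0_integral_mscale//; last 2 first.
- by apply/measurable_EFinP.
- by move=> x _; rewrite lee_fin.
rewrite lee_wpmul2l ?lee_fin//.
apply: ge0_ae_le_integral_nonmeas => //; first by move=> x; rewrite lee_fin.
by apply: aeW => x; exact: hf.
Qed.

(** One inequality comes from simple functions below [f]; the other is the same inequality for the
    inverse factor. It applies to polar integrals, whose inner integral need not be measurable in
    the direction. *)
Lemma ge0_integral_mscale_nonmeas (f : T -> \bar R) : (0 < k%:num)%R ->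
  (forall x, 0 <= f x) -> \int[mscale k m]_x f x = k%:num%:E * \int[m]_x f x.
Proof.
move=> k0 f0; apply/eqP; rewrite eq_le mscale_le//=.
have kV0 : (0 <= k%:num^-1)%R by rewrite invr_ge0.
pose l : {nonneg R} := NngNum kV0.
have lk : (l%:num * k%:num = 1)%R by rewrite /l/= mulVf ?gt_eqF.
have -> : \int[m]_x f x = \int[mscale l (mscale k m)]_x f x.
  apply: eq_measure_integral => A _ _; rewrite /= /mscale /= /mscale. by rewrite muleA -EFinM lk mul1e.
apply: le_trans (lee_wpmul2l _ (mscale_le _ _ f0)) _; first by rewrite lee_fin.
by rewrite muleA -EFinM mulrC lk mul1e.
Qed.

Lemma Rintegral_mscale (g : T -> R) : (0 < k%:num)%R ->
  (\int[mscale k m]_x g x = k%:num * \int[m]_x g x)%R.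
Proof.
move=> k0; rewrite /Rintegral integralE [in RHS]integralE.
have h1 := ge0_integral_mscale_nonmeas k0 (funepos_ge0 (EFin \o g)).
have h2 := ge0_integral_mscale_nonmeas k0 (funeneg_ge0 (EFin \o g)).
rewrite (_ : (fun x => (g x)%:E) = EFin \o g)// h1 h2.
set a := integral _ _ _; set b := integral _ _ _.
case: a b => [a| |] [b| |] /=; rewrite ?gt0_muley ?gt0_muleNy ?lte_fin//= ?mulr0//.
by rewrite -mulrBr.
Qed.

End scaled_measures.

Lemma poisson_random_measure_ext d (Omega : measurableType d) (R : realType)
    (P : probability Omega R) d' (T : measurableType d') (N : R.-ker Omega ~> T)
    (l1 l2 : set T -> \bar R) : (forall E, measurable E -> l1 E = l2 E) ->
  poisson_random_measure P N l1 -> poisson_random_measure P N l2.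
Proof.
move=> l12 [h1 h2 h3]; split => // E mE; rewrite -l12//; [exact: h1|exact: h2].
Qed.

Section stochastic_integral_law.
Context (R : realType) (B : normedModType R) (ip : B -> B -> R).
Hypothesis hB : euclidean ip.
Variables (dim : nat) (e : 'I_dim -> B).
Hypothesis oe : orthonormal ip e.
Hypothesis he : forall x, x = \sum_i ip (e i) x *: e i.
Variable K : set B.
Hypothesis coneK : is_cone K.
Variable beta : borel B -> R.
Hypothesis mbeta : measurable_fun setT beta.
Variable c : R.
Hypothesis c0 : 0 < c.
Hypothesis cbeta : forall U, unit_sphere K U -> c <= beta U.
Local Notation leb := (@lebesgue_measure R).
Local Notation T := (timespace R B).
Implicit Types (alpha : {finite_measure set (borel B) -> \bar R})
  (lam : {measure set T -> \bar R}).

(** The sphere of [K] need not be Borel; [S0] is a Borel part of it of full [alpha]-measure, on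
    which pointwise arguments are made. *)
Definition gamma_frame alpha lam (S0 : set (borel B)) :=
  [/\ forall phi : T -> \bar R, measurable_fun setT phi -> (forall z, (0 <= phi z)%E) ->
  (\int[lam]_z phi z = \int[leb \x alpha]_z
    ((\1_(`[0%R, +oo[%classic : set R) z.1)%:E * \int[leb]_(r in `]0%R, +oo[)
      (phi (z.1, (r *: (z.2 : B))%R : borel B) * (gamma_density beta z.2 r)%:E)))%E,
    forall phi : T -> \bar R, measurable_fun setT phi -> (forall z, (0 <= phi z)%E) ->
  (\int[lam]_z phi z = \int[alpha]_U \int[leb]_(s in `[0%R, +oo[)
    \int[leb]_(r in `]0%R, +oo[)
      (phi (s, (r *: (U : B))%R : borel B) * (gamma_density beta U r)%:E))%E,
    measurable S0, alpha (~` S0) = 0%E & S0 `<=` unit_sphere K].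

Lemma gamma_frame_exists alpha : carried_by (unit_sphere K) alpha ->
  exists lam S0, gamma_frame alpha lam S0 /\
    forall E, measurable E -> lam E = gamma_intensity beta alpha E.
Proof.
move=> [A [mA A0 KA]]; have [lam [h1 h2 h3]] := gamma_intensity_measure hB alpha mbeta.
exists lam, (~` A); split => //; split => //; first exact: measurableC.
  by rewrite setCK.
by move=> x Ax; apply: contrapT => Kx; apply: Ax; exact: KA.
Qed.

Lemma sint_law alpha lam S0 (H : T -> R) d (Omega : measurableType d)
    (P : probability Omega R) (N : R.-ker Omega ~> T) (mu : probability (borel B) R) :
  carried_by (unit_sphere K) alpha -> gamma_frame alpha lam S0 ->
  measurable_fun setT H -> (forall z, 0 <= H z) -> (forall z, H z != 0 -> S0 z.2) ->
  (jump_mass lam H < +oo)%E -> poisson_random_measure P N lam ->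
  has_law P (sint ip e N H) mu ->
  carried_by K mu /\ exists nu, [/\ regular_LK ip K mu 0 nu, GGC_levy_measure K nu &
    forall E, measurable E -> nu E = polar alpha (thinningR beta H) E].
Proof.
move=> alphaK [lamE1 lamE2 mS0 S0a S0K] mH H0 HD Hoo prm law; split.
  have [C [mC CK PC]] := sint_carried hB coneK lamE2 mS0 S0a c0 S0K cbeta mH H0 HD Hoo oe he prm.
  exists (~` C); split; [exact: measurableC| |exact: subsetC].
  have [mX hX] := law; rewrite -hX; last exact: measurableC.
  apply: measure_negligible; last exact: PC.
  by rewrite -[X in measurable X]setTI; apply: mX => //; exact: measurableC.
have [nu [nuE lev pol ggc]] :=
  directional_levy hB coneK mbeta alphaK lamE2 mS0 S0a c0 S0K cbeta mH H0 Hoo.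
exists nu; split=> //.
exact: (sint_LK hB coneK S0K mH H0 HD Hoo oe he prm law nuE lev).
Qed.

(** The thinning does not involve [alpha], so with the same [H] and a Poisson measure for
    [alpha / p], possibly on another space, the Levy measure is exactly divided by [p]. *)
Lemma sint_infinitely_divisible alpha lam S0 (H : T -> R) d (Omega : measurableType d)
    (P : probability Omega R) (N : R.-ker Omega ~> T) (mu : probability (borel B) R) :
  (forall alpha', carried_by (unit_sphere K) alpha' -> exists d' (Omega' : measurableType d')
     (P' : probability Omega' R) (N' : R.-ker Omega' ~> T),
     poisson_random_measure P' N' (gamma_intensity beta alpha')) ->
  carried_by (unit_sphere K) alpha -> gamma_frame alpha lam S0 ->
  measurable_fun setT H -> (forall z, 0 <= H z) -> (forall z, H z != 0 -> S0 z.2) ->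
  (jump_mass lam H < +oo)%E -> poisson_random_measure P N lam ->
  has_law P (sint ip e N H) mu -> infinitely_divisible_on K mu.
Proof.
move=> hp alphaK fr mH H0 HD Hoo prm law.
have [muK [nu [[_ _ muc mus] _ nupol]]] := sint_law alphaK fr mH H0 HD Hoo prm law.
apply: (infinitely_divisible_criterion hB (cone0 coneK) muK) => p p0.
have kV0 : 0 <= p%:R^-1 :> R by rewrite invr_ge0.
pose k : {nonneg R} := NngNum kV0.
have k0 : 0 < k%:num by rewrite /k/= invr_gt0 ltr0n.
pose alphap : {finite_measure set (borel B) -> \bar R} := mscale k alpha.
have alphapK : carried_by (unit_sphere K) alphap.
  have [A [mA A0 KA]] := alphaK; exists A; split => //.
  by apply: (etrans (_ : _ = k%:num%:E * alpha A)%E) => //; rewrite A0 mule0.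
have [d' [W' [P' [N' prm']]]] := hp _ alphapK.
have [lamE1 lamE2 mS0 S0a S0K] := fr.
have [lamp [_ [[lampE1 lampE2 _ _ _] lampE]]] := gamma_frame_exists alphapK.
have frp : gamma_frame alphap lamp S0.
  by split => //; apply: (etrans (_ : _ = k%:num%:E * alpha (~` S0))%E) => //; rewrite S0a mule0.
have Hoop : (jump_mass lamp H < +oo)%E.
  have mj : measurable_fun setT (fun z => (Num.min `|directional H z : B| 1)%:E).
    apply/measurable_EFinP; apply: measurable_minr => //.
    exact: (measurable_normf (measurable_directional hB mH)).
  have j0 z : (0 <= (Num.min `|directional H z : B| 1)%:E)%E by rewrite lee_fin le_min normr_ge0 ler01.
  rewrite /jump_mass lampE2// ge0_integral_mscale_nonmeas//.
    by rewrite -(lamE2 _ mj j0) lte_mul_pinfty// lee_fin ltW.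
  move=> U; apply: integral_ge0 => s _; apply: integral_ge0 => r; rewrite /= in_itv/= andbT => r0.
  by rewrite mule_ge0// lee_fin divr_ge0 ?expR_ge0// ltW.
have prmp : poisson_random_measure P' N' lamp.
  by apply: poisson_random_measure_ext prm' => E mE; rewrite lampE.
have [mup lawp] := law_exists P' (measurable_sint hB e N' mH).
have [mupK [nup [[_ _ mupc mups] _ nuppol]]] := sint_law alphapK frp mH H0 HD Hoop prmp lawp.
have nupE (g : borel B -> R) : p%:R * \int[nup]_x g x = \int[nu]_x g x.
  have -> : \int[nup]_x g x = \int[mscale k nu]_x g x.
    rewrite /Rintegral; congr fine; apply: eq_measure_integral => E mE _.
    rewrite nuppol//= /mscale nupol// /polar ge0_integral_mscale_nonmeas// => U.
    apply: integral_ge0 => r; rewrite /= in_itv/= andbT => r0.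
    rewrite lee_fin mulr_ge0// divr_ge0 ?(ltW r0)// fine_ge0//.
    by apply: integral_ge0 => s _; rewrite lee_fin; case: ifP => // _; exact: expR_ge0.
  by rewrite Rintegral_mscale// mulrA mulfV ?mul1r// pnatr_eq0 -lt0n.
exists mup, (fun z => expR (\int[nup]_x (cos (ip z x) - 1))), (fun z => \int[nup]_x sin (ip z x)).
split=> // z.
  by rewrite mupc mups (ip0r hB) add0r.
by rewrite muc mus (ip0r hB) add0r -expRM_natl !nupE.
Qed.

End stochastic_integral_law.

(** Dilation by 2 preserves [dr / r] but moves the lower end from 1 to 1/2, which adds at least 1/2;
    the value then satisfies [a + 1/2 <= a], so it is infinite. *)
Lemma integral_inv_ge1 (R : realType) :
  (\int[@lebesgue_measure R]_(r in `]0%R, +oo[) (\1_(`[1, +oo[%classic) r / r)%:E = +oo)%E.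
Proof.
pose f (r : R) : \bar R := (\1_(`[1, +oo[%classic) r * `|r|^-1)%:E.
have mI (A : set R) : measurable A -> measurable_fun setT (\1_A : R -> R).
  by move=> mA; exact/measurable_indicP.
have mf : measurable_fun setT f.
  apply/measurable_EFinP; apply: measurable_funM; first exact: mI.
  by apply: measurable_funVr; apply: measurableT_comp => //; exact: normr_measurable.
have f0 r : (0 <= f r)%E by rewrite lee_fin mulr_ge0// invr_ge0.
rewrite (_ : integral _ _ _ = \int[@lebesgue_measure R]_(r in `]0%R, +oo[) f r)%E; last first.
  by apply: eq_integral => r; rewrite in_itv0y => r0; rewrite /f gtr0_norm.
set a := integral _ _ _.
have a0 : (0 <= a)%E by apply: integral_ge0.
have : (a + 2^-1%:E <= a)%E.
  rewrite [leRHS](ge0_integral_scale (ltr0Sn R 1) mf f0) -ge0_integralZl//; last first.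
    by apply: measurable_funTS; apply: (measurableT_comp mf); apply: measurable_funM.
  have -> : (2^-1%:E = \int[@lebesgue_measure R]_(r in `]0%R, +oo[) (\1_(`[2^-1, 1[%classic) r)%:E :> \bar R)%E.
    rewrite integral_indic// setIidl; last first.
      by move=> r /=; rewrite !in_itv/= andbT => /andP[h _]; lra.
    apply/esym; apply: etrans (lebesgue_measure_itv `[2^-1, 1[) _.
    rewrite /= lte_fin ifT; last by lra.
    by rewrite -EFinB; congr EFin; lra.
  rewrite -ge0_integralD//; last 2 first.
  - by apply: measurable_funTS.
  - by apply/measurable_EFinP/measurable_funTS; exact: mI.
  apply: ge0_le_integral => //.
  - by move=> r _; rewrite adde_ge0// lee_fin.
  - apply: emeasurable_funD; first exact: measurable_funTS.
    by apply/measurable_EFinP/measurable_funTS; exact: mI.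
  - apply: measurable_funTS; apply: emeasurable_funM => //.
    by apply: measurableT_comp mf _; exact: measurable_funM.
  - move=> r; rewrite /= in_itv/= andbT => r0; rewrite /f -EFinD -EFinM lee_fin.
    rewrite !gtr0_norm ?mulr_gt0// !indicE !mem_setE !in_itv/= !andbT.
    have e2 (x : R) : 2 * (x * (2 * r)^-1) = x * r^-1 by field; rewrite gt_eqF.
    rewrite e2.
    have [h1|h1] := leP 1 r.
      by rewrite andbF addr0 (_ : 1 <= 2 * r)//; lra.
    rewrite andbT mul0r add0r (_ : (1 <= 2 * r) = (2^-1 <= r)); last first.
      by rewrite -ler_pdivrMl// mulr1.
    case: (_ <= r); last by rewrite mul0r.
    by rewrite mul1r -invf_le1 ?invr_gt0// invrK ltW.
have : a != -oo%E by rewrite gt_eqF// (lt_le_trans _ a0).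
case: a a0 => // a _ _; rewrite -EFinD lee_fin => h; exfalso; lra.
Qed.

(** * Realizing a given generalised Gamma convolution *)

Section realization.
Context (R : realType) (B : normedModType R) (ip : B -> B -> R).
Hypothesis hB : euclidean ip.
Variables (dim : nat) (e : 'I_dim -> B).
Hypothesis oe : orthonormal ip e.
Hypothesis he : forall x, x = \sum_i ip (e i) x *: e i.
Variable K : set B.
Hypothesis coneK : is_cone K.
Variable beta : borel B -> R.
Hypothesis mbeta : measurable_fun setT beta.
Variable c : R.
Hypothesis c0 : 0 < c.
Hypothesis cbeta : forall U, unit_sphere K U -> c <= beta U.
Local Notation leb := (@lebesgue_measure R).
Local Notation T := (timespace R B).

Section inverse_thinning.
Variables (alpha : {finite_measure set (borel B) -> \bar R}) (k : borel B -> R -> R).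
Variables (v : T -> R) (S0 : set (borel B)).
Hypothesis mv : measurable_fun setT v.
Hypothesis v01 : forall z, 0 <= v z <= 1.
Hypothesis vk : {ae alpha, forall U, forall r, 0 < r ->
  (\int[leb]_(s in `]0%R, +oo[) (v (s, U) `^ r)%:E = (k U r)%:E)%E}.
Hypothesis mS0 : measurable S0.
Hypothesis S0a : alpha (~` S0) = 0%E.
Hypothesis S0K : S0 `<=` unit_sphere K.

Definition inverse_support : set T :=
  [set z | [/\ 0 < z.1, S0 z.2, 0 < v z & v z < 1]].

(* On the time set where [0 < v < 1], [beta * (r / h) = - r * ln v]: the
   thinning at [r] is the integral of [v `^ r]. *)
Definition inverse_thinning (z : T) : R :=
  \1_inverse_support z * (beta z.2 / - ln (v z)).

Lemma measurable_inverse_thinning : measurable_fun setT inverse_thinning.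
Proof.
have mlt (f g : T -> R) : measurable_fun setT f -> measurable_fun setT g ->
    measurable [set z | f z < g z].
  move=> mf mg; rewrite (_ : [set z | f z < g z] = ~` (setT `&` [set z | g z <= f z])).
    by apply: measurableC; exact: measurable_fun_le.
  by rewrite setTI; apply/seteqP; split => z /=; rewrite ltNge => /negP.
apply: measurable_funM.
  apply/measurable_indicP.
  rewrite (_ : inverse_support = [set z | 0 < z.1] `&` (snd @^-1` S0) `&`
      [set z | 0 < v z] `&` [set z | v z < 1]); last first.
    by apply/seteqP; split => z /=; [case|move=> [[[]]]].
  apply: measurableI; last by apply: mlt => //; exact: measurable_cst.
  apply: measurableI; last by apply: mlt => //; exact: measurable_cst.
  apply: measurableI; first by apply: (mlt (cst 0) fst) => //; exact: measurable_fst.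
  by rewrite -[X in measurable X]setTI; exact: (@measurable_snd _ _ (measurableTypeR R) (borel B)).
apply: measurable_funM; first exact: (measurableT_comp mbeta measurable_snd).
apply: measurable_funVr; apply: measurable_funN; exact: (measurableT_comp (@measurable_ln R)).
Qed.

Lemma inverse_thinning_gt0 z : inverse_support z -> 0 < beta z.2 / - ln (v z).
Proof.
move=> [_ Sz v0 v1]; rewrite divr_gt0 ?oppr_gt0 ?ln_lt0 ?v0//.
by apply: lt_le_trans c0 _; apply: cbeta; exact: S0K.
Qed.

Lemma inverse_thinning_ge0 z : 0 <= inverse_thinning z.
Proof.
rewrite /inverse_thinning indicE; have [|_] := boolP (z \in _); last by rewrite mul0r.
by rewrite inE mul1r => /inverse_thinning_gt0 /ltW.
Qed.

Lemma inverse_thinning_support z : inverse_thinning z != 0 -> S0 z.2.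
Proof.
rewrite /inverse_thinning indicE; have [|_] := boolP (z \in _); last by rewrite mul0r eqxx.
by rewrite inE => -[].
Qed.

(** The times at which [beta / - ln v] would divide by 0; [W U] is their total length in the
    direction [U]. *)
Let top : set T := [set z | 0 < z.1 /\ v z = 1].

Let mtop : measurable top.
Proof.
rewrite (_ : top = (fst @^-1` `]0, +oo[%classic) `&` (v @^-1` [set 1])); last first.
  by apply/seteqP; split => z /=; rewrite in_itv/= andbT.
apply: measurableI; rewrite -[X in measurable X]setTI.
  exact: (@measurable_fst _ _ (measurableTypeR R) (borel B)).
by apply: mv => //; exact: measurable_set1.
Qed.

Let W U : \bar R := (\int[leb]_s (\1_top (s, U))%:E)%E.

Let W0 U : (0 <= W U)%E.
Proof. by apply: integral_ge0 => s _; rewrite lee_fin. Qed.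

Let mW : measurable_fun setT W.
Proof.
apply: (@measurable_fun_fubini_tonelli_G _ _ _ _ _ leb (EFin \o \1_top)).
  exact/measurable_EFinP/measurable_indicP.
by move=> z; rewrite lee_fin.
Qed.

Let mvU U : measurable_fun setT (fun s : measurableTypeR R => v (s, U)).
Proof. by apply: (measurableT_comp mv); exact: measurable_pair2. Qed.

Let W_le_k : {ae alpha, forall U, forall r, 0 < r -> (W U <= (k U r)%:E)%E}.
Proof.
apply: (ae_imply vk) => U hU r r0; rewrite -hU// /W [leRHS]integral_mkcond.
apply: ge0_ae_le_integral_nonmeas.
- by move=> s; rewrite lee_fin.
- by move=> s; rewrite patchE; case: ifP => // _; rewrite lee_fin powR_ge0.
apply: aeW => s; rewrite indicE; have [|_] := boolP (_ \in top).
  rewrite inE => -[/= s0 vs]; rewrite patchE mem_set/= ?in_itv/= ?s0//.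
  by rewrite vs powR1.
by rewrite patchE; case: ifP => // _; rewrite lee_fin powR_ge0.
Qed.

(* If [v = 1] on a set of positive length then [k U] is bounded below, and the
   measure [polar alpha k] has infinite mass outside the unit ball. *)
Lemma quantile_lt1 : (polar alpha k [set x : borel B | (1 <= `|x : B|)%R] < +oo)%E ->
  {ae alpha, forall U, W U = 0%E}.
Proof.
move=> fin.
have h1 : (\int[alpha]_U (W U * +oo) < +oo)%E.
  (* The absolute value keeps the comparison integrand nonnegative on the null set of directions
     where [k U] is not controlled. The convention [0 * +oo = 0] then lets finiteness say that [W]
     vanishes almost everywhere. *)
  apply: le_lt_trans fin; apply: (@le_trans _ _ (\int[alpha]_U
    `|\int[leb]_(r in `]0%R, +oo[)
       (\1_[set x : borel B | (1 <= `|x : B|)%R] ((r *: (U : B))%R : borel B) * (k U r / r))%:E|)%E).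
    apply: ge0_ae_le_integral_nonmeas => //; first by move=> U; rewrite mule_ge0// leey.
    apply: filterS2 (S0_ae mS0 S0a) W_le_k => U SU WU; rewrite gee0_abs; last first.
      apply: integral_ge0 => r; rewrite /= in_itv/= andbT => r0; rewrite lee_fin mulr_ge0//.
      by rewrite divr_ge0 ?(ltW r0)// -lee_fin (le_trans (W0 U))// WU.
    have [U0|] := eqVneq (W U) 0%E; first rewrite U0 mul0e.
      apply: integral_ge0 => r; rewrite /= in_itv/= andbT => r0; rewrite lee_fin mulr_ge0//.
      by rewrite divr_ge0 ?(ltW r0)// -lee_fin (le_trans (W0 U))// WU.
    have Wr : W U \is a fin_num by rewrite ge0_fin_numE// (le_lt_trans (WU 1 ltr01))// ltry.
    move=> Un0; rewrite -(integral_inv_ge1 R) -ge0_integralZl//; last 2 first.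
    - apply/measurable_EFinP/measurable_funTS; apply: measurable_funM.
        exact/measurable_indicP.
      exact: measurable_funVr.
    - by move=> r; rewrite /= in_itv/= andbT => r0; rewrite lee_fin divr_ge0// ltW.
    rewrite [leLHS]integral_mkcond [leRHS]integral_mkcond.
    have p0 r : 0 < r -> (0 <= W U * (\1_(`[1%R, +oo[%classic) r / r)%:E)%E.
      by move=> r0; rewrite mule_ge0// lee_fin divr_ge0// ltW.
    have key r : 0 < r -> (W U * (\1_(`[1%R, +oo[%classic) r / r)%:E <=
       (\1_[set x : borel B | (1 <= `|x : B|)%R] ((r *: (U : B))%R : borel B) * (k U r / r))%:E)%E.
      move=> r0; have [_ U1] := S0K SU.
      rewrite !indicE (_ : (_ \in [set x : borel B | _]) = (r \in `[1, +oo[%classic)); last first.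
        by apply/idP/idP; rewrite !inE/= normrZ U1 mulr1 gtr0_norm// in_itv/= andbT.
      case: (_ \in _); rewrite ?mul0r ?mule0// !mul1r [leRHS]EFinM.
      by rewrite lee_wpmul2r ?WU// lee_fin invr_ge0 ltW.
    apply: ge0_ae_le_integral_nonmeas.
    - by move=> r; rewrite patchE; case: ifP => //; rewrite in_itv0y; exact: p0.
    - move=> r; rewrite patchE; case: ifP => //; rewrite in_itv0y => r0.
      by apply: le_trans (key r r0); exact: p0.
    - by apply: aeW => r; rewrite !patchE; case: ifP => //; rewrite in_itv0y; exact: key.
  rewrite /polar le_eqVlt; apply/orP; left; apply/eqP; apply: ae_eq_integral_nonmeas.
  apply: (ae_imply W_le_k) => U WU; rewrite gee0_abs//.
  apply: integral_ge0 => r; rewrite /= in_itv/= andbT => r0; rewrite lee_fin mulr_ge0//.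
  by rewrite divr_ge0 ?(ltW r0)// -lee_fin (le_trans (W0 U))// WU.
have mWy : measurable_fun setT (fun U => W U * +oo)%E by exact: emeasurable_funM.
have := @ge0_integral_ae_lty _ _ R alpha _ mWy.
move=> /(_ (fun U => mule_ge0 (W0 U) (leey 0)) h1); apply: filterS => U.
have := W0 U; rewrite le_eqVlt => /predU1P[<-//|WU]; by rewrite gt0_muley// ltxx.
Qed.

(** Off [top] the integrands agree: both are 0 where [v = 0], and where [0 < v < 1] the exponential
    is [exp (r ln v)]. The time 0, in one of the two intervals only, is excluded by
    [inverse_support]. *)
Lemma thinning_inverse : {ae alpha, forall U, W U = 0%E} ->
  {ae alpha, forall U, forall r, 0 < r ->
    thinning beta inverse_thinning U r = (k U r)%:E}.
Proof.
move=> hW; apply: filterS3 (S0_ae mS0 S0a) vk hW => U SU hU WU r r0; rewrite -hU// /thinning.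
rewrite [LHS]integral_mkcond [RHS]integral_mkcond; apply: ae_eq_integral_nonmeas.
have mA : measurable [set s : measurableTypeR R | top (s, U)].
  by rewrite -[X in measurable X]setTI; apply: (@measurable_pair2 _ _ (measurableTypeR R) (borel B) U).
exists [set s | top (s, U)]; split => //.
  by rewrite -WU /W (eq_integral (fun s => (\1_[set s | top (s, U)] s)%:E)) ?integral_indic ?setIT.
move=> s /= hs; apply: contrapT => ntop; apply: hs; rewrite !patchE !mem_setE !in_itv/= !andbT.
have bU : 0 < beta U by apply: lt_le_trans c0 _; apply: cbeta; exact: S0K.
have [s0|s0|s0] := ltgtP 0 s; last first.
- rewrite /inverse_thinning indicE memNset ?mul0r ?ltxx//.
  by move=> [/=]; rewrite s0 ltxx.
- by [].
have /andP[vs0 vs1] := v01 (s, U).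
have [v0|v0] := eqVneq (v (s, U)) 0.
  rewrite v0 powR0 ?gt_eqF// /inverse_thinning indicE memNset ?mul0r ?ltxx//.
  by move=> [_ _ /=]; rewrite v0 ltxx.
have vp : 0 < v (s, U) by rewrite lt0r v0.
have v1 : v (s, U) < 1.
  by rewrite lt_neqAle vs1 andbT; apply/eqP => v1; apply: ntop; split.
have sup : inverse_support (s, U) by split.
rewrite /inverse_thinning indicE mem_set// mul1r inverse_thinning_gt0//=.
rewrite /powR (negbTE v0); congr (expR _)%:E.
have lv : ln (v (s, U)) < 0 by rewrite ln_lt0// vp.
by field; rewrite lt_eqF// gt_eqF.
Qed.

End inverse_thinning.

Lemma GGC0_stochastic_integral (mu : probability (borel B) R) : GGC0 ip K mu ->
  exists (alpha : {finite_measure set (borel B) -> \bar R}) (h : T -> R)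
    (lam : {measure set T -> \bar R}) S0,
  [/\ carried_by (unit_sphere K) alpha, gamma_integrand K beta alpha h,
    gamma_frame K beta alpha lam S0,
    (forall E, measurable E -> lam E = gamma_intensity beta alpha E) &
    forall d (Omega : measurableType d) (P : probability Omega R) (N : R.-ker Omega ~> T)
      (mu' : probability (borel B) R),
      poisson_random_measure P N lam -> has_law P (sint ip e N (sphere_restr S0 h)) mu' ->
      forall E, measurable E -> mu' E = mu E].
Proof.
move=> [_ [nu [[_ [_ nufin]] _ muc mus] [alpha [k [alphaK mk cmk nuE]]]]].
have [v [mv v01 vk]] := measurable_completely_monotone_quantile mk cmk.
have [lam [S0 [fr lamE]]] := gamma_frame_exists hB mbeta alphaK.
have [lamE1 lamE2 mS0 S0a S0K] := fr.
have S0P U : S0 U -> (`|U : B| = 1) /\ (c <= beta U).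
  by move=> /S0K SU; split; [case: SU|exact: cbeta].
pose h := inverse_thinning v S0.
have mh : measurable_fun setT h := measurable_inverse_thinning mv mS0.
have h0 z : 0 <= h z := inverse_thinning_ge0 v S0K z.
have mmin : measurable_fun setT (fun x : borel B => (Num.min `|x : B| 1)%:E).
  by apply/measurable_EFinP; apply: measurable_minr => //; exact: measurable_normb.
have fin1 : (polar alpha k [set x : borel B | (1 <= `|x : B|)%R] < +oo)%E.
  have mE : measurable [set x : borel B | 1 <= `|x : B|].
    rewrite -[X in measurable X]setTI; apply: measurable_fun_le => //; exact: measurable_normb.
  rewrite -nuE// -[X in nu X]setIT -integral_indic//; apply: le_lt_trans nufin.
  apply: ge0_ae_le_integral_nonmeas.
  - by move=> x; rewrite lee_fin.
  - by move=> x; rewrite lee_fin le_min normr_ge0/=.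
  apply: aeW => x; rewrite lee_fin indicE; have [|_] := boolP (_ \in _).
    by rewrite inE/= => x1; rewrite le_min x1 lexx.
  by rewrite le_min normr_ge0/=.
have hk := thinning_inverse mv v01 vk mS0 S0a S0K (quantile_lt1 mv vk mS0 S0a S0K fin1).
(* The image measure has the polar form of the given [nu], so the finiteness of the jump mass of
   [h], hence the logarithmic condition, is inherited from [nu]. *)
have [nu2 [nu2E nu2pol]] := directional_measure hB lamE2 mS0 S0a c0 S0K cbeta mh h0.
have hoo : (jump_mass lam h < +oo)%E.
  rewrite /jump_mass -(nu2E (fun x => (Num.min `|x : B| 1)%:E))//; last first.
    by rewrite normr0 minEle ler01.
  rewrite (eq_measure_integral nu)// => E mE _; by rewrite nuE// (nu2pol k).
have hint : gamma_integrand K beta alpha h.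
  split; [exact: measurable_funTS|by []|].
  by apply: le_lt_trans hoo; exact: (ln_le_jump_mass hB lamE2 mS0 S0a c0 S0P).
exists alpha, h, lam, S0; split => // d Omega P N mu' prm law.
have rE : sphere_restr S0 h = h.
  apply/funext => -[s U]; rewrite /sphere_restr patchE; case: ifPn => //.
  move=> hz; apply/esym/eqP; apply: contraNT hz => hn0; rewrite inE; split => /=.
    move: hn0; rewrite /h /inverse_thinning indicE; have [|_] := boolP (_ \in _).
      by rewrite inE => -[/= s0 _ _ _ _]; rewrite in_itv/= ltW.
    by rewrite mul0r eqxx.
  exact: (inverse_thinning_support hn0).
rewrite rE in law.
have [_ [nu' [[_ _ muc' mus'] _ nupol]]] :=
  sint_law hB oe he coneK mbeta c0 cbeta alphaK fr mh h0 (@inverse_thinning_support v S0) hoo prm law.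
have RnuE (g : borel B -> R) : \int[nu']_x g x = \int[nu]_x g x.
  rewrite /Rintegral; congr fine; apply: eq_measure_integral => E mE _.
  rewrite nupol// nuE//; apply: ae_eq_integral_nonmeas; apply: (ae_imply hk) => U hU.
  by apply: eq_integral => r; rewrite in_itv0y => r0; rewrite /thinningR hU.
by apply: (characteristic_function_unique hB) => z; rewrite ?muc' ?mus' ?muc ?mus !RnuE.
Qed.

End realization.

Theorem theorem4p5 (R : realType) (B : normedModType R) (ip : B -> B -> R)
  (hB : euclidean ip) (K : set B) (hK : proper_cone K)
  (beta : borel B -> R) (beta_meas : measurable_fun setT beta)
  (beta_lb : exists2 c : R, 0 < c & forall U, unit_sphere K U -> c <= beta U)
  (d : {finite_measure set (borel B) -> \bar R} -> measure_display)
  (Omega : forall alpha, measurableType (d alpha))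
  (P : forall alpha, probability (Omega alpha) R)
  (N : forall alpha, R.-ker (Omega alpha) ~> timespace R B)
  (hN : forall alpha : {finite_measure set (borel B) -> \bar R}, carried_by (unit_sphere K) alpha ->
     gamma_jump_measure ip K beta alpha (P alpha) (N alpha)) :
  (forall (alpha : {finite_measure set (borel B) -> \bar R})
          (h : timespace R B -> R),
     carried_by (unit_sphere K) alpha ->
     gamma_integrand K beta alpha h ->
     exists Y, stochastic_integral ip K (P alpha) (N alpha) alpha h Y) /\
  [set mu : probability (borel B) R | 
     exists (alpha : {finite_measure set (borel B) -> \bar R})
            (h : timespace R B -> R) (Y : Omega alpha -> borel B),
     [/\ carried_by (unit_sphere K) alpha,
         gamma_integrand K beta alpha h,
         stochastic_integral ip K (P alpha) (N alpha) alpha h Y &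
         has_law (P alpha) Y mu]] = GGC0 ip K.
Proof.
have [m [e [oe he]]] := orthonormal_basis hB; have [coneK _] := hK.
have [c c0 cbeta] := beta_lb.
have prm_of (alpha : {finite_measure set (borel B) -> \bar R}) : carried_by (unit_sphere K) alpha ->
    poisson_random_measure (P alpha) (N alpha) (gamma_intensity beta alpha).
  by move=> /hN[].
have prm_lam (alpha : {finite_measure set (borel B) -> \bar R}) (lam : {measure set (timespace R B) -> \bar R}) :
    carried_by (unit_sphere K) alpha ->
    (forall E, measurable E -> lam E = gamma_intensity beta alpha E) ->
    poisson_random_measure (P alpha) (N alpha) lam.
  by move=> /prm_of h lamE; apply: poisson_random_measure_ext h => E mE; rewrite lamE.
split=> [alpha h alphaK hint|].
  have [lam [S0 [[lamE1 lamE2 mS0 S0a S0K] lamE]]] := gamma_frame_exists hB beta_meas alphaK.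
  have prm := prm_lam _ _ alphaK lamE.
  by exists (sint ip e (N alpha) (sphere_restr S0 h));
    exact: (stochastic_integral_exists hB oe he lamE1 lamE2 mS0 S0a c0 S0K cbeta prm hint).
apply/seteqP; split => mu.
- move=> [alpha [h [Y [alphaK hint sY lawY]]]].
  have [lam [S0 [fr lamE]]] := gamma_frame_exists hB beta_meas alphaK.
  have [lamE1 lamE2 mS0 S0a S0K] := fr.
  have prm := prm_lam _ _ alphaK lamE.
  have YE := stochastic_integral_unique hB oe he lamE1 lamE2 mS0 S0a c0 S0K cbeta prm hint sY.
  set H := sphere_restr S0 h in YE.
  have mH : measurable_fun setT H := measurable_sphere_restr mS0 hint.
  have H0 z : 0 <= H z := sphere_restr_ge0 S0K hint z.
  have HD z : H z != 0 -> S0 z.2.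
    rewrite /H /sphere_restr patchE; case: ifPn => [|_]; last by rewrite eqxx.
    by rewrite inE => -[].
  have Hoo : (jump_mass lam H < +oo)%E :=
    sphere_restr_jump_mass hB lamE2 mS0 S0a c0 S0K cbeta hint.
  (* [Y] is only a version of the Poisson integral; almost sure equality carries its law over. *)
  have law : has_law (P alpha) (sint ip e (N alpha) H) mu.
    have msint := measurable_sint hB e (N alpha) mH; split => // E mE.
    have [mY hY] := lawY; rewrite -hY//.
    have mX (X : Omega alpha -> borel B) : measurable_fun setT X -> measurable (X @^-1` E).
      by move=> mX; rewrite -[X in measurable X]setTI; exact: mX.
    rewrite -[in LHS](setIT (_ @^-1` E)) -[in RHS](setIT (_ @^-1` E)) -!integral_indic//; try exact: mX.
    apply: ae_eq_integral_nonmeas; apply: (ae_imply YE) => w Yw.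
    by rewrite !indicE; congr (nat_of_bool _)%:R%:E; apply/idP/idP; rewrite !inE /= Yw.
  have [_ [nu [LK ggc _]]] :=
    sint_law hB oe he coneK beta_meas c0 cbeta alphaK fr mH H0 HD Hoo prm law.
  split; last by exists nu.
  apply: (sint_infinitely_divisible hB oe he coneK beta_meas c0 cbeta _ alphaK fr mH H0 HD Hoo prm law).
  (* The Gamma processes are given for all finite measures at once, so the one for [alpha / p] is
     among them. *)
  move=> alpha' alphaK'; exists (d alpha'), (Omega alpha'), (P alpha'), (N alpha').
  exact: prm_of.
- move=> /(GGC0_stochastic_integral hB oe he coneK beta_meas c0 cbeta).
  move=> [alpha [h [lam [S0 [alphaK hint [lamE1 lamE2 mS0 S0a S0K] lamE hmu]]]]].
  have prm := prm_lam _ _ alphaK lamE.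
  exists alpha, h, (sint ip e (N alpha) (sphere_restr S0 h)); split => //.
    exact: (stochastic_integral_exists hB oe he lamE1 lamE2 mS0 S0a c0 S0K cbeta prm hint).
  have ms := measurable_sint hB e (N alpha) (measurable_sphere_restr mS0 hint).
  have [mu' law] := law_exists (P alpha) ms.
  split => // E mE; rewrite -(hmu _ _ _ _ _ prm law)//.
  by have [_ ->] := law.
Qed.
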